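(* Let $q_n$ denote the $n$-th positive integer that is a product of exactly two distinct primes. Then \[ \liminf_{n\to\infty}\,(q_{n+1}-q_n)\le 26 . \] *)

(* Defs.v *)
From HB Require Import structures.
From mathcomp Require Import all_boot all_order all_algebra.
From mathcomp Require Import all_classical all_reals all_analysis.
Set Implicit Arguments. Unset Strict Implicit. Unset Printing Implicit Defensive.

Definition two_distinct_primes (m : nat) : Prop :=
  exists p q : nat, [/\ prime p, prime q, (p < q)%N & m = (p * q)%N].

(* q enumerates, in strictly increasing order, exactly the numbers that are
   products of two distinct primes; q n is then the n-th such number
   (0-indexed, irrelevant for a liminf). *)
Definition enumerates_two_distinct_primes (q : nat -> nat) : Prop :=
  (forall n, (q n < q n.+1)%N) /\
  (forall m, two_distinct_primes m <-> exists n, q n = m).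

(* Main.v *)
(* A Maynard-Tao type sieve for the admissible octuple h = (0,2,6,8,12,18,20,26).
   Put the weight (1/n) Lambda(n)^2 on n = nu (mod W), where Lambda is a
   multidimensional Selberg sieve diagonalised prime by prime: each prime p
   contributes a factor indexed by the unique j (if any) with p | n + h_j.  If
   two numbers n + h_i, n + h_j were never simultaneously semiprime, the sets
   {n : n + h_i = q q'} would be disjoint, and summing the weight over them
   could not exceed the total mass.  The products q q' are equidistributed on
   average by a bilinear large sieve inequality (W is fixed, so only Mertens'
   theorem in progressions mod W is needed; no Siegel-Walfisz theorem).  All
   the variables are cut dyadically at powers of Z = 2^t, which turns the two
   main terms into lattice-point counts; the resulting numerical inequality is
   verified by computation, and contradicts the disjointness as t tends to
   infinity. *)

From HB Require Import structures.
From mathcomp Require Import all_boot all_order all_algebra.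
From mathcomp Require Import boolp reals topology normedtype derive realfun exp trigo.
From mathcomp Require Import ring lra zify.
Import Order.TTheory GRing.Theory Num.Theory.
Set Implicit Arguments. Unset Strict Implicit. Unset Printing Implicit Defensive.
Local Open Scope ring_scope.

(** * Bilinear sums attached to a set of primes *)

(** The centred variables [1/p - [p | n + h_j]] make the second moment over all [n] nearly diagonal
    in eight coordinates. When [n + h_i] is a product of two large primes, colour [i] is frozen at
    [1/p]: its sum is no longer orthogonal, and its square brings in a ninth coordinate, which
    offsets the logarithmic sparsity of semiprimes. The obstacle is equidistribution of [q q']
    modulo products of few primes, where the large sieve saves no power of [Z] and Siegel-Walfisz
    would normally enter. Here all prime factors of the moduli exceed a fixed [w], which saves a
    constant factor [1134 / w], provided that the large sieve loses no logarithm; that logarithm is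
    recovered by sieving, since [q] has no prime factor in the sieve range. A huge constant [w] then
    suffices. For moduli beyond [Z^2] a power of [Z] is saved because they stay below [Z^554], less
    than the square root of [q q' >= Z^1115]. In units of [log Z] the weight lives on a simplex of
    size 270 truncated at 60 in each coordinate; the numerical inequality has a margin of 21 to 20,
    which pays for all errors. *)

Section Tensor.
Variables (R : realType) (K : finType).
Implicit Types (P : seq nat) (b : (K -> nat) -> R) (p : nat) (j : K).

Lemma big_option (T : finType) (F : option T -> R) :
  \sum_x F x = F None + \sum_j F (Some j).
Proof.
rewrite (bigD1 None) //=; congr (_ + _).
rewrite (reindex_omap Some id) /=; last by case.
by apply: eq_bigl => j; rewrite eqxx.
Qed.

Definition mulp (K' : eqType) (p : nat) (j : K') (f : K' -> nat) : K' -> nat :=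
  fun i => if i == j then (p * f i)%N else f i.

(** A centred indicator: its mean vanishes when [x] is [Some j] with probability [1/p]. This
    centring is what makes the quadratic form nearly diagonal, one prime at a time. *)
Definition xi (p : nat) (j : K) (x : option K) : R :=
  p%:R^-1 - (x == Some j)%:R.

(** One prime of the sieve sum: [p] is given to no colour, or to exactly one colour [j] with
    coefficient [xi p j x]. Two coordinates of [f] therefore never share a prime. *)
Definition twist (p : nat) (x : option K) b : (K -> nat) -> R :=
  fun f => b f + \sum_j xi p j x * b (mulp p j f).

Fixpoint Lam P b (col : nat -> option K) : R :=
  if P is p :: P' then Lam P' (twist p (col p) b) col else b (fun=> 1%N).

(** The expectation of [Lam P b * Lam P b'] when the colours at the primes of [P] are independent,
    the one at [p] with law [mu p]. Laws of total mass other than 1 also occur, in [mu_flag]. *)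
Fixpoint Bil (mu : nat -> option K -> R) P b b' : R :=
  if P is p :: P' then \sum_x mu p x * Bil mu P' (twist p x b) (twist p x b')
  else b (fun=> 1%N) * b' (fun=> 1%N).

Definition lincomb (A : finType) (c : A -> R) (B : A -> (K -> nat) -> R) :=
  fun f => \sum_a c a * B a f.

Lemma twist_lincomb (A : finType) (c : A -> R) B p x :
  twist p x (lincomb c B) = lincomb c (fun a => twist p x (B a)).
Proof.
apply/funext => f; rewrite /twist /lincomb.
under [RHS]eq_bigr do rewrite mulrDr mulr_sumr.
rewrite big_split /=; congr (_ + _).
rewrite exchange_big /=; apply: eq_bigr => j _; rewrite mulr_sumr.
by apply: eq_bigr => a _; rewrite mulrCA.
Qed.

(** Tensor principle: an inequality between quadratic forms in scalars [u a] survives when the [u a]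
    become vectors of a positive semidefinite space. Here the vectors are the weights [B a] and the
    form is [Bil], a nonnegative combination of squares of linear functionals, which the induction
    peels off. Every prime can thus be handled by a scalar computation. *)
Lemma Bil_lift (A X Y : finType) (m1 : X -> R) (c1 : X -> A -> R)
    (m2 : Y -> R) (c2 : Y -> A -> R) mu P (B : A -> (K -> nat) -> R) :
  (forall u : A -> R, \sum_x m1 x * (\sum_a c1 x a * u a) ^+ 2 <=
     \sum_y m2 y * (\sum_a c2 y a * u a) ^+ 2) ->
  (forall p x, p \in P -> 0 <= mu p x) ->
  \sum_x m1 x * Bil mu P (lincomb (c1 x) B) (lincomb (c1 x) B) <=
  \sum_y m2 y * Bil mu P (lincomb (c2 y) B) (lincomb (c2 y) B).
Proof.
move=> H; elim: P B => [|p P IH] B mu0 /=.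
  exact: H (fun a => B a (fun=> 1%N)).
under eq_bigr do rewrite mulr_sumr; under [X in _ <= X]eq_bigr do rewrite mulr_sumr.
rewrite exchange_big /= [X in _ <= X]exchange_big /=.
apply: ler_sum => x _.
under eq_bigr do rewrite twist_lincomb mulrCA.
under [X in _ <= X]eq_bigr do rewrite twist_lincomb mulrCA.
rewrite -!mulr_sumr; apply: ler_wpM2l; first by apply: mu0; rewrite mem_head.
by apply: IH => q y qP; apply: mu0; rewrite inE qP orbT.
Qed.

Definition optb p b : option K -> (K -> nat) -> R :=
  fun a => if a is Some j then fun f => b (mulp p j f) else b.
Definition optc p (x a : option K) : R := if a is Some j then xi p j x else 1.

Lemma twistE p x b : twist p x b = lincomb (optc p x) (optb p b).
Proof. by apply/funext => f; rewrite /lincomb big_option /= mul1r. Qed.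

Lemma lincomb_delta (A : finType) (a : A) (B : A -> (K -> nat) -> R) :
  lincomb (fun a' => (a' == a)%:R) B = B a.
Proof.
apply/funext => f; rewrite /lincomb (bigD1 a) //= eqxx mul1r big1 ?addr0 // => i /negbTE ->.
by rewrite mul0r.
Qed.

End Tensor.

(** * Sums over coprime and over independent coordinates *)

Section Coprime.
Variables (R : realType).
Implicit Types (K : finType).

(** For distinct primes [P]: the sum of [G f] divided by the product of the [f j], over squarefree
    and pairwise coprime [f j] built from [P]. *)
Fixpoint Cs K (P : seq nat) (G : (K -> nat) -> R) : R :=
  if P is p :: P' then
    Cs P' G + p%:R^-1 * \sum_j Cs P' (fun f => G (mulp p j f))
  else G (fun=> 1%N).

(** The analogue of [Cs] in which a prime may enter several coordinates at once; without coprimality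
    the sum of a product function factors over the coordinates. *)
Fixpoint Isum K (P : seq nat) (G : (K -> nat) -> R) : R :=
  if P is p :: P' then
    \sum_(S : {set K}) p%:R^-1 ^+ #|S| *
      Isum P' (fun f => G (fun i => if i \in S then (p * f i)%N else f i))
  else G (fun=> 1%N).

Definition anti K (G : (K -> nat) -> R) :=
  (forall f, 0 <= G f) /\
  (forall f f', (forall i, f i <= f' i)%N -> G f' <= G f).

Lemma anti_mulp K p (j : K) G : anti G -> anti (fun f => G (mulp p j f)).
Proof.
move=> [G0 Ga]; split=> [f|f f' ff']; first exact: G0.
apply: Ga => i; rewrite /mulp; case: eqP => // _.
by rewrite leq_mul2l ff' orbT.
Qed.

Lemma le_mulp K p (j : K) f i : (0 < p)%N -> (f i <= mulp p j f i)%N.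
Proof. by move=> p0; rewrite /mulp; case: eqP => // _; rewrite leq_pmull. Qed.

Lemma ler_Cs K P (G G' : (K -> nat) -> R) :
  (forall f, G f <= G' f) -> Cs P G <= Cs P G'.
Proof.
elim: P G G' => [|p P IH] G G' GG' //=; rewrite lerD ?IH // ler_wpM2l ?invr_ge0 //.
by apply: ler_sum => j _; apply: IH.
Qed.

Lemma Cs_ge0 K P (G : (K -> nat) -> R) : (forall f, 0 <= G f) -> 0 <= Cs P G.
Proof.
elim: P G => [|p P IH] G G0 //=; rewrite addr_ge0 ?IH // mulr_ge0 ?invr_ge0 //.
by apply: sumr_ge0 => j _; apply: IH.
Qed.

Lemma CsD K P (G G' : (K -> nat) -> R) :
  Cs P (fun f => G f + G' f) = Cs P G + Cs P G'.
Proof.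
elim: P G G' => [|p P IH] G G' //=; rewrite IH.
under eq_bigr do rewrite IH.
by rewrite big_split /= mulrDr addrACA.
Qed.

Lemma CsZ K P c (G : (K -> nat) -> R) :
  Cs P (fun f => c * G f) = c * Cs P G.
Proof.
elim: P G => [|p P IH] G //=; rewrite IH.
under eq_bigr do rewrite IH.
by rewrite -mulr_sumr mulrDr mulrCA.
Qed.

Lemma Cs_mulp_le K P p (j : K) G : (0 < p)%N -> anti G ->
  Cs P (fun f => G (mulp p j f)) <= Cs P G.
Proof. by move=> p0 [_ Ga]; apply: ler_Cs => f; apply: Ga => i; exact: le_mulp. Qed.

Lemma ler_Isum K P (G G' : (K -> nat) -> R) :
  (forall f, G f <= G' f) -> Isum P G <= Isum P G'.
Proof.
elim: P G G' => [|p P IH] G G' GG' //=; apply: ler_sum => S _.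
by rewrite ler_wpM2l ?exprn_ge0 ?invr_ge0 // IH.
Qed.

Lemma Isum_ge0 K P (G : (K -> nat) -> R) : (forall f, 0 <= G f) -> 0 <= Isum P G.
Proof.
elim: P G => [|p P IH] G G0 //=; apply: sumr_ge0 => S _.
by rewrite mulr_ge0 ?exprn_ge0 ?invr_ge0 ?IH.
Qed.

Definition mulS K p (S : {set K}) (f : K -> nat) : K -> nat :=
  fun i => if i \in S then (p * f i)%N else f i.

Lemma mulS1 K p (j : K) f : mulS p [set j]%SET f = mulp p j f.
Proof. by apply/funext => i; rewrite /mulS /mulp finset.in_set1. Qed.

Lemma mulS0 K p (f : K -> nat) : mulS p finset.set0 f = f.
Proof. by apply/funext => i; rewrite /mulS finset.in_set0. Qed.

Lemma sum_set1 K (F : {set K} -> R) :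
  \sum_(S : {set K} | #|S| == 1%N) F S = \sum_j F [set j]%SET.
Proof.
have -> : \sum_j F [set j]%SET = \sum_(S <- [seq [set j]%SET | j <- enum K]) F S.
  by rewrite big_map big_enum.
rewrite [RHS]big_uniq /=; last by rewrite map_inj_uniq ?enum_uniq //; exact: set1_inj.
apply: eq_bigl => S; apply/cards1P/mapP => [[x ->]|[x _ ->]]; last by exists x.
by exists x => //; rewrite mem_enum.
Qed.

Lemma sum_set_split K (F : {set K} -> R) :
  \sum_(S : {set K}) F S = F finset.set0 + \sum_j F [set j]%SET + \sum_(S : {set K} | (1 < #|S|)%N) F S.
Proof.
rewrite (bigD1 finset.set0) //= -addrA; congr (_ + _).
rewrite (bigID (fun S : {set K} => #|S| == 1%N)) /=; congr (_ + _).
  rewrite -sum_set1; apply: eq_bigl => S; case: eqP => [|_]; rewrite ?andbF // => S1.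
  by rewrite S1 cards0.
by apply: eq_bigl => S; rewrite -card_gt0; case: #|S| => [|[|n]].
Qed.

Lemma Cs_le_Isum K P (G : (K -> nat) -> R) : (forall f, 0 <= G f) -> Cs P G <= Isum P G.
Proof.
elim: P G => [|p P IH] G G0 //=; rewrite sum_set_split.
rewrite ler_wpDr //.
  apply: sumr_ge0 => S _; rewrite mulr_ge0 ?exprn_ge0 ?invr_ge0 //.
  by apply: Isum_ge0.
rewrite cards0 expr0 mul1r; apply: lerD.
  have -> : (fun f => G (fun i => if i \in (finset.set0 : {set K}) then (p * f i)%N else f i)) = G.
    by apply/funext => f; have := mulS0 p f; rewrite /mulS => ->.
  exact: IH.
rewrite mulr_sumr; apply: ler_sum => j _; rewrite cards1 expr1 ler_wpM2l ?invr_ge0 //.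
have -> : (fun f => G (fun i => if i \in [set j]%SET then (p * f i)%N else f i)) =
          (fun f => G (mulp p j f)).
  by apply/funext => f; rewrite -mulS1.
exact: IH.
Qed.

(** A prime shared by at least two coordinates carries a weight at most [1/p^2], there are at most
    [2^#|K|] such choices, and enlarging the arguments only lowers [G]. Dropping coprimality
    therefore costs a convergent Euler product. *)
Lemma Isum_le_Cs K P (G : (K -> nat) -> R) : anti G -> all (leq 1) P ->
  Isum P G <= \prod_(p <- P) (1 + 2 ^+ #|K| / p%:R ^+ 2) * Cs P G.
Proof.
elim: P G => [|p P IH] G aG; first by rewrite big_nil mul1r.
move=> /= /andP[p1 P1]; rewrite big_cons sum_set_split cards0 expr0 mul1r.
have p0 : 0 < p%:R :> R by rewrite ltr0n.
set Q := \prod_(j <- P) _.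
have Q1 : 1 <= Q.
  rewrite /Q; elim: (P) => [|q P' IHP]; first by rewrite big_nil.
  by rewrite big_cons mulr_ege1 // lerDl divr_ge0 ?exprn_ge0.
have H0 : forall S, anti (fun f => G (mulS p S f)).
  move=> S; case: aG => G0 Ga; split=> [f|f f' ff']; first exact: G0.
  by apply: Ga => i; rewrite /mulS; case: ifP => // _; rewrite leq_mul2l ff' orbT.
have HS : forall S, Isum P (fun f => G (mulS p S f)) <= Isum P G.
  move=> S; apply: ler_Isum => f; case: aG => _; apply => i.
  by rewrite /mulS; case: ifP => // _; rewrite leq_pmull.
have E0 : (fun f => G (fun i => if i \in (finset.set0 : {set K}) then (p * f i)%N else f i)) = G.
  by apply/funext => f; have := mulS0 p f; rewrite /mulS => ->.
rewrite E0.
have T2 : \sum_(S : {set K} | (1 < #|S|)%N) p%:R^-1 ^+ #|S| *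
     Isum P (fun f => G (fun i => if i \in S then (p * f i)%N else f i))
     <= 2 ^+ #|K| / p%:R ^+ 2 * Isum P G.
  apply: (@le_trans _ _ (\sum_(S : {set K}) p%:R^-1 ^+ 2 * Isum P G)).
    rewrite [leRHS](bigID (fun S : {set K} => (1 < #|S|)%N)) /= ler_wpDr //.
      by apply: sumr_ge0 => S _; rewrite mulr_ge0 ?exprn_ge0 ?invr_ge0 // Isum_ge0 //; case: aG.
    apply: ler_sum => S S2; rewrite ler_pM ?exprn_ge0 ?invr_ge0 //.
    - by apply: Isum_ge0 => f; case: aG.
    - rewrite ler_wiXn2l ?invr_ge0 // invf_le1 // ler1n //.
    - exact: HS.
  have -> : \sum_(S : {set K}) p%:R^-1 ^+ 2 * Isum P G =
            (p%:R^-1 ^+ 2 * Isum P G) *+ (2 ^ #|K|).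
    rewrite sumr_const; congr (_ *+ _); rewrite -cardsT -card_powerset.
    by apply: eq_card => S; rewrite powersetT !inE.
  rewrite -mulr_natl natrX exprVn; lra.
have T1 : \sum_j p%:R^-1 ^+ #|[set j]%SET| *
     Isum P (fun f => G (fun i => if i \in [set j]%SET then (p * f i)%N else f i))
     <= Q * (p%:R^-1 * \sum_j Cs P (fun f => G (mulp p j f))).
  rewrite mulrCA mulr_sumr mulr_sumr; apply: ler_sum => j _.
  rewrite cards1 expr1 ler_wpM2l ?invr_ge0 //.
  have -> : (fun f => G (fun i => if i \in [set j]%SET then (p * f i)%N else f i)) =
          (fun f => G (mulp p j f)).
    by apply/funext => f; rewrite -mulS1.
  by apply: IH => //; exact: anti_mulp.
have I0 := IH G aG P1; rewrite -/Q in I0.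
have C0 : 0 <= p%:R^-1 * \sum_j Cs P (fun f => G (mulp p j f)).
  rewrite mulr_ge0 ?invr_ge0 // sumr_ge0 // => j _; apply: Cs_ge0 => f; by case: aG.
apply: le_trans (lerD (lerD I0 T1) T2) _.
have e0 : 0 <= 2 ^+ #|K| / p%:R ^+ 2 :> R by rewrite divr_ge0 ?exprn_ge0.
have := ler_wpM2l e0 I0.
have Q0 : 0 <= Q by exact: le_trans Q1.
have := mulr_ge0 (mulr_ge0 e0 Q0) C0.
set c := Cs P G; set d := p%:R^-1 * _; set e := 2 ^+ _ / _; lra.
Qed.

End Coprime.

(** * The quadratic form at a single prime *)

Section Local.
Variables (R : realType) (K : finType).
Implicit Types (P : seq nat) (b : (K -> nat) -> R) (p : nat) (i j : K).

(** Law of the colour of a uniform residue modulo [p] when the shifts are distinct modulo [p];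
    [mu_unit] is the same law conditioned on colour [i] not occurring. *)
Definition mu_all p (x : option K) : R :=
  if x is Some _ then p%:R^-1 else 1 - #|K|%:R / p%:R.

Definition mu_unit i p (x : option K) : R :=
  if x is Some j then (j != i)%:R / p.-1%:R else 1 - #|K|.-1%:R / p.-1%:R.

Lemma optc_sum p x (u : option K -> R) :
  \sum_a optc R p x a * u a =
  u None + (\sum_j u (Some j)) / p%:R - (if x is Some j then u (Some j) else 0).
Proof.
rewrite big_option /= mul1r -addrA; congr (_ + _); rewrite mulr_suml.
under eq_bigr do rewrite /xi mulrBl [_^-1 * _]mulrC.
rewrite sumrB; congr (_ - _); case: x => [j|]; last first.
  by rewrite big1 // => j _; rewrite mul0r.
rewrite (bigD1 j) //= eqxx mul1r big1 ?addr0 // => l.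
by rewrite eq_sym (inj_eq Some_inj) => /negbTE ->; rewrite mul0r.
Qed.

Lemma sum_sqrB (Q : pred K) (A : R) (u : K -> R) :
  \sum_(j | Q j) (A - u j) ^+ 2 =
  #|Q|%:R * A ^+ 2 - 2 * A * (\sum_(j | Q j) u j) + \sum_(j | Q j) u j ^+ 2.
Proof.
under eq_bigr do rewrite sqrrB.
rewrite big_split /= sumrB sumr_const; congr (_ - _ + _); first by rewrite mulr_natl.
by rewrite mulr_sumr; apply: eq_bigr => j _; rewrite -mulr_natl mulrA.
Qed.

Lemma sum_sqr_le (Q : pred K) (u : K -> R) :
  (\sum_(j | Q j) u j) ^+ 2 <= #|Q|%:R * \sum_(j | Q j) u j ^+ 2.
Proof.
set s := \sum_(j | Q j) u j; set q := \sum_(j | Q j) _.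
have [Q0|Qn0] := eqVneq #|Q| 0%N.
  rewrite /s /q !big_pred0 ?mulr0 ?expr0n //= => j;
    by have := card0_eq Q0 j; rewrite unfold_in.
have c0 : 0 < #|Q|%:R :> R by rewrite ltr0n lt0n.
have : 0 <= \sum_(j | Q j) (s / #|Q|%:R - u j) ^+ 2.
  by apply: sumr_ge0 => j _; rewrite sqr_ge0.
rewrite sum_sqrB -/s -/q.
have -> : #|Q|%:R * (s / #|Q|%:R) ^+ 2 - 2 * (s / #|Q|%:R) * s + q =
          q - s ^+ 2 / #|Q|%:R by field; lra.
by rewrite subr_ge0 ler_pdivrMr // mulrC.
Qed.

Lemma mu_all_ge0 p x : (#|K| <= p)%N -> 0 <= mu_all p x.
Proof.
case: x => [j|] /= H; first by rewrite invr_ge0.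
rewrite subr_ge0; have [->|p0] := posnP p; first by rewrite invr0 mulr0.
by rewrite ler_pdivrMr ?ltr0n // mul1r ler_nat.
Qed.

Lemma mu_unit_ge0 i p x : (#|K| <= p)%N -> 0 <= mu_unit i p x.
Proof.
case: x => [j|] /= H; first by rewrite divr_ge0.
rewrite subr_ge0; have [->|p0] := posnP p.-1; first by rewrite invr0 mulr0.
by rewrite ler_pdivrMr ?ltr0n // mul1r ler_nat; lia.
Qed.

(** Expanding the squares, the left side is the right side minus [(s / p)^2], with [s] the sum of
    the [u (Some j)]. No term linear in [u None] remains because the [xi] are centred. *)
Lemma scalar_all p (u : option K -> R) : (0 < p)%N ->
  \sum_x mu_all p x * (\sum_a optc R p x a * u a) ^+ 2 <=
  u None ^+ 2 + p%:R^-1 * \sum_j u (Some j) ^+ 2.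
Proof.
move=> p0; have p0' : 0 < p%:R :> R by rewrite ltr0n.
rewrite big_option /= !optc_sum subr0.
under eq_bigr do rewrite optc_sum.
rewrite -mulr_sumr; have := sum_sqrB predT (u None + (\sum_j u (Some j)) / p%:R) (u \o Some).
rewrite /= => ->.
set s := \sum_j u (Some j); set q := \sum_j u (Some j) ^+ 2.
set k : R := #|_|%:R; set x := u None; set P := p%:R.
have -> : (1 - k / P) * (x + s / P) ^+ 2 +
  P^-1 * (k * (x + s / P) ^+ 2 - 2 * (x + s / P) * s + q) =
  x ^+ 2 + P^-1 * q - (s / P) ^+ 2 by field; rewrite /P; lra.
by rewrite lerBlDr lerDl sqr_ge0.
Qed.

Lemma Bil_all_le P b : all (fun p => 0 < p)%N P -> all (fun p => #|K| <= p)%N P ->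
  Bil mu_all P b b <= Cs P (fun f => b f ^+ 2).
Proof.
elim: P b => [|p P IH] b //=; case/andP => p0 P0 /andP[pK PK].
under eq_bigr do rewrite twistE.
have mu0 : forall q x, q \in P -> 0 <= mu_all q x.
  by move=> q x qP; apply: mu_all_ge0; exact: (allP PK).
pose m2 (y : option K) : R := if y is Some _ then p%:R^-1 else 1.
apply: le_trans (Bil_lift (m2 := m2) (c2 := fun y a => (a == y)%:R) (optb p b) _ mu0) _.
  move=> u; apply: le_trans (scalar_all u p0) _.
  have E y : \sum_a (a == y)%:R * u a = u y.
    by rewrite (bigD1 y) //= eqxx mul1r big1 ?addr0 // => a /negbTE ->; rewrite mul0r.
  by under [leRHS]eq_bigr do rewrite E; rewrite big_option /= mul1r mulr_sumr.
rewrite (eq_bigr (fun y => m2 y * Bil mu_all P (optb p b y) (optb p b y))); last first.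
  by move=> y _; have := lincomb_delta (y : option K) (optb p b) => /= ->.
rewrite big_option /= mul1r mulr_sumr; apply: lerD; first exact: IH.
by apply: ler_sum => j _; rewrite ler_wpM2l ?invr_ge0 // IH.
Qed.

(* The value of the quadratic form at one prime, when the residue class of
   colour [i] is excluded and each other class has probability 1/(p-1). *)
Lemma scalar_unit i p (u : option K -> R) : (1 < p)%N ->
  let A := u None + u (Some i) / p%:R in
  let s := \sum_(j | j != i) u (Some j) in
  let q := \sum_(j | j != i) u (Some j) ^+ 2 in
  let r := p.-1%:R^-1 in
  \sum_x mu_unit i p x * (\sum_a optc R p x a * u a) ^+ 2 =
  A ^+ 2 + 2 * A * s * (p%:R^-1 - r) + s ^+ 2 * (p%:R^-1 ^+ 2 - 2 * r / p%:R) + r * q.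
Proof.
move=> p1 A s q r.
have E x : \sum_a optc R p x a * u a = A + s / p%:R - (if x is Some j then u (Some j) else 0).
  by rewrite optc_sum (bigD1 i) //= -/s mulrDl addrA.
under eq_bigr do rewrite E.
rewrite big_option /= subr0.
have -> : \sum_j (j != i)%:R / p.-1%:R * (A + s / p%:R - u (Some j)) ^+ 2 =
   r * \sum_(j | j != i) (A + s / p%:R - u (Some j)) ^+ 2.
  rewrite mulr_sumr [RHS]big_mkcond /=; apply: eq_bigr => j _.
  by case: eqP => _ /=; rewrite ?mul0r // mul1r.
have := sum_sqrB (fun j => j != i) (A + s / p%:R) (u \o Some) => /= ->.
rewrite -/s -/q.
have -> : #|fun j : K => j != i| = #|K|.-1 by rewrite -(cardC1 i).
have p0 : p%:R != 0 :> R by rewrite pnatr_eq0; lia.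
by rewrite -/r; field.
Qed.

(** Colour [i] never occurs, so [u None] and [u (Some i)] enter only through [A]. The rest is a
    perturbation of relative size [O(1/p)] or smaller: AM-GM treats the cross term of [A] and [s],
    Cauchy-Schwarz over the seven other colours treats [s^2]. *)
Lemma scalar_unit_ub i p (u : option K -> R) : (#|K| = 8)%N -> (1 < p)%N ->
  \sum_x mu_unit i p x * (\sum_a optc R p x a * u a) ^+ 2 <=
  (1 + p%:R^-1 ^+ 2) * (u None + u (Some i) / p%:R) ^+ 2 +
  p%:R^-1 * (1 + 60 / p%:R) * \sum_(j | j != i) u (Some j) ^+ 2.
Proof.
move=> K8 p1; rewrite scalar_unit //.
set A := u None + _; set s := \sum_(j | _) _; set q := \sum_(j | _) _.
have q0 : 0 <= q by apply: sumr_ge0 => j _; rewrite sqr_ge0.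
have sq : s ^+ 2 <= 7 * q.
  have := sum_sqr_le (fun j => j != i) (u \o Some).
  have -> : #|fun j : K => j != i| = 7%N by rewrite -[RHS]/(8.-1)%N -K8 -(cardC1 i).
  by [].
have p0 : 0 < p%:R :> R by rewrite ltr0n; lia.
clear K8.
have pm : p.-1%:R = p%:R - 1 :> R by rewrite -subn1 natrB //; lia.
have p2 : 2 <= p%:R :> R by rewrite ler_nat.
rewrite pm; set P := p%:R in p0 p2 *.
set e := P^-1; set r := (P - 1)^-1.
have e0 : 0 < e by rewrite invr_gt0.
have r0 : 0 < r by rewrite invr_gt0; lra.
have re : r - e = e * r by rewrite /r /e; field; lra.
have r2 : r <= 2 * e.
  by rewrite /r /e -[2 * _]mulrC -ler_pdivrMr ?ltr0n // -invfM lef_pV2 ?posrE; lra.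
have H1 : 2 * A * s * (e - r) <= e ^+ 2 * A ^+ 2 + r ^+ 2 * s ^+ 2.
  have -> : e - r = - (e * r) by lra.
  have := sqr_ge0 (e * A + r * s); lra.
have H2 : s ^+ 2 * (e ^+ 2 - 2 * r / P + r ^+ 2) <= 7 * q * (e * r) ^+ 2.
  have -> : e ^+ 2 - 2 * r / P + r ^+ 2 = (e * r) ^+ 2 by rewrite -re /e; field; lra.
  by rewrite ler_wpM2r // sqr_ge0.
have H3 : r + 7 * (e * r) ^+ 2 <= e * (1 + 60 / P).
  have er : e * r <= 2 * e ^+ 2 by rewrite expr2 mulrCA ler_wpM2l // ltW.
  have e1 : e <= 1 / 2 by rewrite /e mul1r lef_pV2 ?posrE; lra.
  have er1 : e * r <= 1 by nra.
  have : (e * r) ^+ 2 <= e * r by rewrite expr2 ger_pMl ?er1 // mulr_gt0.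
  have -> : e * (1 + 60 / P) = e + 60 * e ^+ 2 by rewrite /e; field; lra.
  have := sqr_ge0 e; lra.
rewrite -/e in H2 H3; have := ler_wpM2r q0 H3; lra.
Qed.

Lemma scalar_unit_lb i p (u : option K -> R) : (#|K| = 8)%N -> (1 < p)%N ->
  (1 - p%:R^-1 ^+ 2) * (u None + u (Some i) / p%:R) ^+ 2 +
  p%:R^-1 * (1 - 60 / p%:R) * \sum_(j | j != i) u (Some j) ^+ 2 <=
  \sum_x mu_unit i p x * (\sum_a optc R p x a * u a) ^+ 2.
Proof.
move=> K8 p1; rewrite scalar_unit //.
set A := u None + _; set q := \sum_(j | _) _ ^+ 2; set s := \sum_(j | _) _.
have q0 : 0 <= q by apply: sumr_ge0 => j _; rewrite sqr_ge0.
have sq : s ^+ 2 <= 7 * q.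
  have := sum_sqr_le (fun j => j != i) (u \o Some).
  have -> : #|fun j : K => j != i| = 7%N by rewrite -[RHS]/(8.-1)%N -K8 -(cardC1 i).
  by [].
have p0 : 0 < p%:R :> R by rewrite ltr0n; lia.
clear K8.
have pm : p.-1%:R = p%:R - 1 :> R by rewrite -subn1 natrB //; lia.
have p2 : 2 <= p%:R :> R by rewrite ler_nat.
rewrite pm; set P := p%:R in p0 p2 *.
set e := P^-1; set r := (P - 1)^-1.
have e0 : 0 < e by rewrite invr_gt0.
have r0 : 0 < r by rewrite invr_gt0; lra.
have re : r - e = e * r by rewrite /r /e; field; lra.
have r2 : r <= 2 * e.
  by rewrite /r /e -[2 * _]mulrC -ler_pdivrMr ?ltr0n // -invfM lef_pV2 ?posrE; lra.
have er : e * r <= 2 * e ^+ 2 by rewrite expr2 mulrCA ler_wpM2l // ltW.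
have er0 : 0 < e * r by rewrite mulr_gt0.
have H1 : - (e ^+ 2 * A ^+ 2 + r ^+ 2 * s ^+ 2) <= 2 * A * s * (e - r).
  have -> : e - r = - (e * r) by lra.
  have := sqr_ge0 (e * A - r * s); lra.
have rr : r ^+ 2 <= 4 * e ^+ 2 by nra.
have H2 : s ^+ 2 * (2 * (e * r) + r ^+ 2) <= 7 * q * (8 * e ^+ 2).
  by apply: ler_pM; rewrite ?sqr_ge0 //; [nra|lra].
have H3 : s ^+ 2 * (e ^+ 2 - 2 * r / P) = s ^+ 2 * e ^+ 2 - s ^+ 2 * (2 * (e * r)).
  by rewrite /e; field; lra.
have H4 : 0 <= s ^+ 2 * e ^+ 2 by rewrite mulr_ge0 ?sqr_ge0.
have H5 : e * (1 - 60 / P) = e - 60 * e ^+ 2 by rewrite /e; field; lra.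
rewrite -/e in H3 H5; rewrite H3 H5.
have H6 : 0 <= (r - e) * q by rewrite mulr_ge0 // re ltW.
have H7 : 0 <= e ^+ 2 * q by rewrite mulr_ge0 ?sqr_ge0.
lra.
Qed.

End Local.

(** * Bounds for the whole form when colour [i] is excluded *)

Section UnitBounds.
Variables (R : realType) (K : finType) (i : K).
Hypothesis K8 : #|K| == 8%N.
Implicit Types (P : seq nat) (b : (K -> nat) -> R) (p : nat) (j : K).

(* [None] is the second copy of colour [i] in the square of a sum over it. *)
Definition dup b (F : option K -> nat) : R :=
  b (fun j => F (Some j)) * b (fun j => if j == i then F None else F (Some j)).

Lemma anti_dup b : anti b -> anti (dup b).
Proof.
case=> b0 ba; split=> [f|f f' ff']; first by rewrite mulr_ge0.
by apply: ler_pM => //; apply: ba => j //; case: eqP.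
Qed.

Lemma dup_mulp p j b F : j != i ->
  dup (fun f => b (mulp p j f)) F = dup b (mulp p (Some j) F).
Proof.
move=> ji; rewrite /dup; congr (b _ * b _); apply/funext => l.
rewrite /mulp; case: eqP => [->|].
  by rewrite (negbTE ji) /= eqxx.
by move=> /eqP/negbTE lj; rewrite /= (inj_eq Some_inj) lj; case: (l == i).
Qed.

Definition madd p b : (K -> nat) -> R := fun f => b f + p%:R^-1 * b (mulp p i f).

Lemma dup_madd p b F :
  dup (madd p b) F = dup b F + p%:R^-1 * (dup b (mulp p (Some i) F) + dup b (mulp p None F))
   + p%:R^-1 ^+ 2 * (b (mulp p i (fun j => F (Some j))) *
                     b (mulp p i (fun j => if j == i then F None else F (Some j)))).
Proof.
rewrite /dup /madd.
have -> : (fun j => mulp p (Some i) F (Some j)) = mulp p i (fun j => F (Some j)) by [].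
have -> : (fun j => if j == i then mulp p (Some i) F None else mulp p (Some i) F (Some j))
  = (fun j => if j == i then F None else F (Some j)).
  apply/funext => j; rewrite /mulp /=; case: (eqVneq j i) => // ji.
  by rewrite (inj_eq Some_inj) (negbTE ji).
have -> : (fun j => mulp p None F (Some j)) = (fun j => F (Some j)) by [].
have -> : (fun j => if j == i then mulp p None F None else mulp p None F (Some j))
  = mulp p i (fun j => if j == i then F None else F (Some j)).
  by apply/funext => j; rewrite /mulp /=; case: eqP.
ring.
Qed.

Lemma anti_madd p b : anti b -> anti (madd p b).
Proof.
move=> ab; have [b0 ba] := ab; have [c0 ca] := anti_mulp p i ab.
split=> [f|f f' ff'].
  by rewrite addr_ge0 // mulr_ge0 ?invr_ge0.
by rewrite lerD ?ba // ler_wpM2l ?invr_ge0 // ca.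
Qed.

Definition optm p (y a : option K) : R :=
  if y is Some j then (a == Some j)%:R
  else (a == None)%:R + (a == Some i)%:R / p%:R.

Lemma optm_sum p y (u : option K -> R) : \sum_a optm p y a * u a =
  if y is Some j then u (Some j) else u None + u (Some i) / p%:R.
Proof.
have E z : \sum_a (a == z)%:R * u a = u z.
  by rewrite (bigD1 z) //= eqxx mul1r big1 ?addr0 // => a /negbTE ->; rewrite mul0r.
case: y => [j|] /=; first exact: E.
under eq_bigr do rewrite mulrDl mulrAC.
by rewrite big_split /= -mulr_suml !E.
Qed.

Lemma lincomb_optm p b y : lincomb (optm p y) (optb p b) =
  if y is Some j then fun f => b (mulp p j f) else madd p b.
Proof.
apply/funext => f; rewrite /lincomb (optm_sum p y (fun a => optb p b a f)).
by case: y => [j|] //=; rewrite /madd mulrC.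
Qed.

Definition mwt (c1 c2 : R) (y : option K) : R :=
  if y is Some j then (j != i)%:R * c2 else c1.

Lemma mwt_sum c1 c2 (F : option K -> R) :
  \sum_y mwt c1 c2 y * F y = c1 * F None + c2 * \sum_(j | j != i) F (Some j).
Proof.
rewrite big_option /=; congr (_ + _); rewrite mulr_sumr [RHS]big_mkcond /=.
by apply: eq_bigr => j _; case: eqP => _ /=; rewrite ?mul0r // mul1r.
Qed.

(** At a flagged prime the law is replaced by two unit point masses, at the flagged colour and at
    [None]. Their sum dominates the difference of the two evaluations that occurs in [Mz]. *)
Definition mu_flag (fl : nat -> option K) p (x : option K) : R :=
  if fl p is Some j then (x == Some j)%:R + (x == None)%:R else mu_unit R i p x.

Lemma mu_flag_ge0 fl p x : (#|K| <= p)%N -> 0 <= mu_flag fl p x.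
Proof.
by rewrite /mu_flag; case: (fl p) => [j|] H; [rewrite addr_ge0|exact: mu_unit_ge0].
Qed.

(** [162 = 2 * 9 * 9]: Cauchy-Schwarz over the nine options costs 9 for each of the two point
    masses, and the nine resulting terms all have the same bound. The 500 rounds up [60 * 7 + 3],
    from the loss [60 / p] summed over seven colours. *)
Definition flag_cst (fl : nat -> option K) p : R :=
  if fl p is Some _ then 162 else 1 + 500 / p%:R ^+ 2.

Lemma optc_sqr_le p x (u : option K -> R) : (0 < p)%N ->
  (\sum_a optc R p x a * u a) ^+ 2 <= 9 * \sum_a u a ^+ 2.
Proof.
move=> p0; apply: le_trans (sum_sqr_le predT _) _.
have -> : #|[pred _ : option K | true]| = 9%N by rewrite card_option (eqP K8).
rewrite ler_wpM2l //; apply: ler_sum => a _; rewrite exprMn.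
rewrite ler_piMl ?sqr_ge0 //; case: a => [j|] /=; last by rewrite expr1n.
have e0 : 0 <= p%:R^-1 :> R by rewrite invr_ge0.
have e1 : p%:R^-1 <= 1 :> R by rewrite invf_le1 ?ler1n ?ltr0n.
by rewrite /xi; case: eqP => _ /=; nra.
Qed.

Lemma dup_mulp_sum P p b : (0 < p)%N -> anti b ->
  \sum_(j | j != i) Cs P (dup (fun f => b (mulp p j f))) <= 7 * Cs P (dup b).
Proof.
move=> p0 ab.
have -> : (7 : R) * Cs P (dup b) = \sum_(j | j != i) Cs P (dup b).
  rewrite sumr_const (_ : #|_| = 7%N) ?mulr_natl //.
  by rewrite -[RHS]/(8.-1)%N -(eqP K8) -(cardC1 i).
apply: ler_sum => j ji; apply: le_trans (Cs_mulp_le P (Some j) p0 (anti_dup ab)).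
by apply: ler_Cs => F; rewrite dup_mulp.
Qed.

Lemma Cs_option P p b :
  Cs (p :: P) (dup b) = Cs P (dup b) + p%:R^-1 *
   (Cs P (fun F => dup b (mulp p None F)) + Cs P (fun F => dup b (mulp p (Some i) F)) +
    \sum_(j | j != i) Cs P (dup (fun f => b (mulp p j f)))).
Proof.
rewrite /= big_option (bigD1 i) //= addrA; congr (_ + _ * (_ + _)).
apply: eq_bigr => j ji; congr Cs; apply/funext => F; by rewrite dup_mulp.
Qed.

(** At an ordinary prime [Bil_lift] passes to the diagonal form of [scalar_unit_ub]. Its entry
    [None] is the sum [madd p b] over colour [i], and squaring this sum produces the two independent
    copies of colour [i] that [dup] counts. *)
Lemma Bil_flag_le fl P b : anti b -> all (fun p => 8 <= p)%N P ->
  Bil (mu_flag fl) P b b <= \prod_(p <- P) flag_cst fl p * Cs P (dup b).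
Proof.
elim: P b => [|p P IH] b ab; first by rewrite big_nil mul1r /= /dup; case: ab => [b0 ba] _;
  rewrite (_ : (fun j : K => if j == i then 1%N else 1%N) = fun=> 1%N) //; apply/funext => j; case: eqP.
case/andP => p8 P8; rewrite big_cons.
have mu0 : forall q x, q \in P -> 0 <= mu_flag fl q x.
  by move=> q x qP; apply: mu_flag_ge0; rewrite (eqP K8); exact: (allP P8).
set Q := \prod_(q <- P) _.
have Q0 : 0 <= Q.
  apply: prodr_ge0 => q _; rewrite /flag_cst; case: (fl q) => [l|]; first by [].
  by rewrite addr_ge0 // divr_ge0 ?exprn_ge0.
have p0 : (0 < p)%N by apply: leq_trans p8.
have e0 : 0 < p%:R^-1 :> R by rewrite invr_gt0 ltr0n.
have c0 : 0 <= Cs P (dup b) by apply: Cs_ge0; case: (anti_dup ab).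
have cN0 : 0 <= Cs P (fun F => dup b (mulp p None F)) by apply: Cs_ge0 => F; case: (anti_dup ab).
have ci0 : 0 <= Cs P (fun F => dup b (mulp p (Some i) F)) by apply: Cs_ge0 => F; case: (anti_dup ab).
have s0 : 0 <= \sum_(j | j != i) Cs P (dup (fun f => b (mulp p j f))).
  by apply: sumr_ge0 => j _; apply: Cs_ge0 => F; case: (anti_dup (anti_mulp p j ab)).
rewrite Cs_option [Bil _ _ _ _]/=.
under eq_bigr do rewrite twistE.
rewrite {1}/mu_flag {1}/flag_cst; case: (fl p) => [l|].
  pose m2 (y : option K) : R := 18.
  apply: le_trans (Bil_lift (m2 := m2) (c2 := fun y a => (a == y)%:R) (optb p b) _ mu0) _.
    move=> u.
    have E y : \sum_a (a == y)%:R * u a = u y.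
      by rewrite (bigD1 y) //= eqxx mul1r big1 ?addr0 // => a /negbTE ->; rewrite mul0r.
    under [leRHS]eq_bigr do rewrite E.
    rewrite -mulr_sumr; under eq_bigr do rewrite mulrDl.
    have E' (y : option K) (F : option K -> R) : \sum_a (a == y)%:R * F a = F y.
      by rewrite (bigD1 y) //= eqxx mul1r big1 ?addr0 // => a /negbTE ->; rewrite mul0r.
    rewrite big_split /= !(E' _ (fun x => (\sum_a optc R p x a * u a) ^+ 2)).
    have := optc_sqr_le None u p0; have := optc_sqr_le (Some l) u p0; lra.
  rewrite (eq_bigr (fun y => m2 y * Bil (mu_flag fl) P (optb p b y) (optb p b y))); last first.
    by move=> y _; have := lincomb_delta (y : option K) (optb p b) => /= ->.
  have H y : Bil (mu_flag fl) P (optb p b y) (optb p b y) <= Q * Cs P (dup b).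
    have ay : anti (optb p b y) by case: y => [j|] //=; exact: anti_mulp.
    apply: le_trans (IH _ ay P8) _; rewrite ler_wpM2l // ler_Cs // => F.
    case: y {ay} => [j|] //=; rewrite /dup; case: ab => b0 ba.
    by apply: ler_pM => //; apply: ba => l'; exact: le_mulp.
  rewrite -mulr_sumr; apply: (@le_trans _ _ (18 * \sum_(y : option K) (Q * Cs P (dup b)))).
    by rewrite ler_wpM2l // ler_sum.
  rewrite sumr_const card_option (eqP K8) -[_ *+ 9]mulr_natl.
  set c := Cs P (dup b); set d := _ + \sum_(j | _) _.
  have d0 : 0 <= d by rewrite !addr_ge0.
  have := mulr_ge0 Q0 (mulr_ge0 (ltW e0) d0); lra.
apply: le_trans (Bil_lift (m2 := mwt (1 + p%:R^-1 ^+ 2) (p%:R^-1 * (1 + 60 / p%:R)))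
  (c2 := optm p) (optb p b) _ mu0) _.
  move=> u; apply: le_trans (scalar_unit_ub i u (eqP K8) _) _; first exact: leq_trans p8.
  have := mwt_sum (1 + p%:R^-1 ^+ 2) (p%:R^-1 * (1 + 60 / p%:R)) (fun y => (if y is Some j
    then u (Some j) else u None + u (Some i) / p%:R) ^+ 2) => /= <-.
  by apply: ler_sum => y _; rewrite optm_sum.
under eq_bigr do rewrite lincomb_optm.
rewrite mwt_sum.
have H1 : Bil (mu_flag fl) P (madd p b) (madd p b) <= Q * Cs P (dup (madd p b)).
  by apply: IH => //; exact: anti_madd.
have H2 : \sum_(j | j != i) Bil (mu_flag fl) P (fun f => b (mulp p j f)) (fun f => b (mulp p j f))
   <= Q * \sum_(j | j != i) Cs P (dup (fun f => b (mulp p j f))).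
  by rewrite mulr_sumr; apply: ler_sum => j ji; apply: IH => //; exact: anti_mulp.
have H3 : Cs P (dup (madd p b)) <= (1 + p%:R^-1 ^+ 2) * Cs P (dup b) + p%:R^-1 *
   (Cs P (fun F => dup b (mulp p None F)) + Cs P (fun F => dup b (mulp p (Some i) F))).
  rewrite [_ + Cs P (fun F => dup b (mulp p (Some i) F))]addrC -!CsD -!CsZ -CsD.
  apply: ler_Cs => F; rewrite dup_madd.
  (* When [p] divides both copies of colour [i] the weight is [1/p^2]; monotonicity bounds the term
     by the one without [p]. *)
  have key : b (mulp p i (fun j => F (Some j))) *
      b (mulp p i (fun j => if j == i then F None else F (Some j))) <= dup b F.
    by rewrite /dup; case: ab => b0 ba; apply: ler_pM => //; apply: ba => l'; exact: le_mulp.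
  have := ler_wpM2l (sqr_ge0 (p%:R^-1 : R)) key; lra.
have H4 := dup_mulp_sum P p0 ab.
have e1 : p%:R^-1 <= 8^-1 :> R by rewrite lef_pV2 ?posrE ?ltr0n // ler_nat.
move: H1 H2 H3 H4 c0 cN0 ci0 s0; rewrite -exprVn.
set B := Bil _ _ _ _; set BS := \sum_(j | _) Bil _ _ _ _.
set cm := Cs P (dup (madd p b)); set c := Cs P (dup b); set cN := Cs P _; set ci := Cs P _.
set s := \sum_(j | _) _; set e := p%:R^-1 in e0 e1 * => H1 H2 H3 H4 c0 cN0 ci0 s0.
have F1 : B <= Q * ((1 + e ^+ 2) * c + e * (cN + ci)).
  by apply: le_trans H1 _; rewrite ler_wpM2l.
apply: (@le_trans _ _ ((1 + e ^+ 2) * (Q * ((1 + e ^+ 2) * c + e * (cN + ci))) +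
   e * (1 + 60 * e) * (Q * s))).
  apply: lerD; apply: ler_wpM2l => //; [have := sqr_ge0 e; lra|].
  by rewrite mulr_ge0 ?(ltW e0) //; lra.
have -> : (1 + e ^+ 2) * (Q * ((1 + e ^+ 2) * c + e * (cN + ci))) +
   e * (1 + 60 * e) * (Q * s) = Q * ((1 + e ^+ 2) * ((1 + e ^+ 2) * c + e * (cN + ci)) +
   e * (1 + 60 * e) * s) by ring.
have -> : (1 + 500 * e ^+ 2) * Q * (c + e * (cN + ci + s)) =
  Q * ((1 + 500 * e ^+ 2) * (c + e * (cN + ci + s))) by ring.
rewrite ler_wpM2l //.
have g0 : 0 <= e * (cN + ci) by rewrite mulr_ge0 ?addr_ge0 ?(ltW e0).
have g1 : 0 <= e * s by rewrite mulr_ge0 ?(ltW e0).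
have g2 : e ^+ 2 * s <= e ^+ 2 * (7 * c) by rewrite ler_wpM2l ?sqr_ge0.
have g3 : 0 <= e ^+ 2 * c by rewrite mulr_ge0 ?sqr_ge0.
have g4 : e ^+ 2 * (e ^+ 2 * c) <= e ^+ 2 * c.
  by rewrite ler_piMl // expr2; nra.
have g5 : 0 <= e ^+ 2 * (e * (cN + ci)) by rewrite mulr_ge0 ?sqr_ge0.
have g6 : 0 <= e ^+ 2 * (e * s) by rewrite mulr_ge0 ?sqr_ge0.
lra.
Qed.

(** The same induction from below, starting from [scalar_unit_lb]; [60 <= p] keeps its weight
    [1 - 60 / p] nonnegative. *)
Lemma Bil_unit_ge P b : anti b -> all (fun p => 60 <= p)%N P ->
  \prod_(p <- P) (1 - 500 / p%:R ^+ 2) * Cs P (dup b) <= Bil (mu_unit R i) P b b.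
Proof.
elim: P b => [|p P IH] b ab; first by rewrite big_nil mul1r /= /dup; case: ab => [b0 ba] _;
  rewrite (_ : (fun j : K => if j == i then 1%N else 1%N) = fun=> 1%N) //; apply/funext => j; case: eqP.
case/andP => p8 P8; rewrite big_cons.
have mu0 : forall q x, q \in P -> 0 <= mu_unit R i q x.
  by move=> q x qP; apply: mu_unit_ge0; rewrite (eqP K8); apply: leq_trans (allP P8 q qP).
set Q := \prod_(q <- P) _.
have Q0 : 0 <= Q.
  rewrite /Q big_seq; apply: prodr_ge0 => q /(allP P8) q60.
  have q0 : (0 < q)%N by exact: leq_trans q60.
  rewrite subr_ge0 ler_pdivrMr ?exprn_gt0 ?ltr0n //.
  by rewrite mul1r -natrX ler_nat -mulnn; nia.
have p0 : (0 < p)%N by apply: leq_trans p8.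
have e0 : 0 < p%:R^-1 :> R by rewrite invr_gt0 ltr0n.
have c0 : 0 <= Cs P (dup b) by apply: Cs_ge0; case: (anti_dup ab).
have cN0 : 0 <= Cs P (fun F => dup b (mulp p None F)) by apply: Cs_ge0 => F; case: (anti_dup ab).
have ci0 : 0 <= Cs P (fun F => dup b (mulp p (Some i) F)) by apply: Cs_ge0 => F; case: (anti_dup ab).
have s0 : 0 <= \sum_(j | j != i) Cs P (dup (fun f => b (mulp p j f))).
  by apply: sumr_ge0 => j _; apply: Cs_ge0 => F; case: (anti_dup (anti_mulp p j ab)).
rewrite Cs_option [Bil _ _ _ _]/=.
under eq_bigr do rewrite twistE.
apply: le_trans; last first.
  apply: (Bil_lift (m1 := mwt (1 - p%:R^-1 ^+ 2) (p%:R^-1 * (1 - 60 / p%:R)))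
  (c1 := optm p) (optb p b) _ mu0).
  move=> u; apply: le_trans (scalar_unit_lb i u (eqP K8) _); last exact: leq_trans p8.
  have := mwt_sum (1 - p%:R^-1 ^+ 2) (p%:R^-1 * (1 - 60 / p%:R)) (fun y => (if y is Some j
    then u (Some j) else u None + u (Some i) / p%:R) ^+ 2) => /= <-.
  by apply: ler_sum => y _; rewrite optm_sum.
under [leRHS]eq_bigr do rewrite lincomb_optm.
rewrite mwt_sum.
have H1 : Q * Cs P (dup (madd p b)) <= Bil (mu_unit R i) P (madd p b) (madd p b).
  by apply: IH => //; exact: anti_madd.
have H2 : Q * \sum_(j | j != i) Cs P (dup (fun f => b (mulp p j f))) <=
  \sum_(j | j != i) Bil (mu_unit R i) P (fun f => b (mulp p j f)) (fun f => b (mulp p j f)).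
  by rewrite mulr_sumr; apply: ler_sum => j ji; apply: IH => //; exact: anti_mulp.
have H3 : Cs P (dup b) + p%:R^-1 *
   (Cs P (fun F => dup b (mulp p None F)) + Cs P (fun F => dup b (mulp p (Some i) F)))
    <= Cs P (dup (madd p b)).
  rewrite [_ + Cs P (fun F => dup b (mulp p (Some i) F))]addrC -!CsD -!CsZ -CsD.
  apply: ler_Cs => F; rewrite dup_madd lerDl mulr_ge0 ?sqr_ge0 //.
  by rewrite mulr_ge0 //; case: ab.
have H4 := dup_mulp_sum P p0 ab.
have e1 : p%:R^-1 <= 60^-1 :> R by rewrite lef_pV2 ?posrE ?ltr0n // ler_nat.
move: H1 H2 H3 H4 c0 cN0 ci0 s0; rewrite -exprVn.
set B := Bil _ _ _ _; set BS := \sum_(j | _) Bil _ _ _ _.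
set cm := Cs P (dup (madd p b)); set c := Cs P (dup b); set cN := Cs P _; set ci := Cs P _.
set s := \sum_(j | _) _; set e := p%:R^-1 in e0 e1 * => H1 H2 H3 H4 c0 cN0 ci0 s0.
have F1 : Q * (c + e * (cN + ci)) <= B.
  by apply: le_trans H1; rewrite ler_wpM2l.
apply: (@le_trans _ _ ((1 - e ^+ 2) * (Q * (c + e * (cN + ci))) +
   e * (1 - 60 * e) * (Q * s))); last first.
  apply: lerD; apply: ler_wpM2l => //; [nra|].
  by rewrite mulr_ge0 ?(ltW e0) //; lra.
have -> : (1 - e ^+ 2) * (Q * (c + e * (cN + ci))) +
   e * (1 - 60 * e) * (Q * s) = Q * ((1 - e ^+ 2) * (c + e * (cN + ci)) +
   e * (1 - 60 * e) * s) by ring.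
have -> : (1 - 500 * e ^+ 2) * Q * (c + e * (cN + ci + s)) =
  Q * ((1 - 500 * e ^+ 2) * (c + e * (cN + ci + s))) by ring.
rewrite ler_wpM2l //.
have g0 : 0 <= e * (cN + ci) by rewrite mulr_ge0 ?addr_ge0 ?(ltW e0).
have g2 : e ^+ 2 * s <= e ^+ 2 * (7 * c) by rewrite ler_wpM2l ?sqr_ge0.
have g3 : 0 <= e ^+ 2 * c by rewrite mulr_ge0 ?sqr_ge0.
have g5 : 0 <= e ^+ 2 * (e * (cN + ci)) by rewrite mulr_ge0 ?sqr_ge0.
have g6 : 0 <= e ^+ 2 * (e * s) by rewrite mulr_ge0 ?sqr_ge0 // mulr_ge0 ?(ltW e0).
lra.
Qed.

End UnitBounds.

(** * Expansion of the sieve sum into residue classes *)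

Section Linear.
Variables (R : realType) (K : finType).
Implicit Types (P : seq nat) (b : (K -> nat) -> R) (p : nat) (j : K).

Lemma Lam_lincomb (A : finType) (c : A -> R) (B : A -> (K -> nat) -> R) P col :
  Lam P (lincomb c B) col = \sum_a c a * Lam P (B a) col.
Proof.
elim: P B => [|p P IH] B //=.
by rewrite twist_lincomb IH.
Qed.

Lemma Bil_lincombl (A : finType) (c : A -> R) (B : A -> (K -> nat) -> R) mu P b :
  Bil mu P (lincomb c B) b = \sum_a c a * Bil mu P (B a) b.
Proof.
elim: P B b => [|p P IH] B b /=; first by rewrite mulr_suml; apply: eq_bigr => a _; rewrite mulrA.
under eq_bigr do rewrite twist_lincomb IH mulr_sumr.
rewrite exchange_big /=; apply: eq_bigr => a _; rewrite mulr_sumr.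
by apply: eq_bigr => x _; rewrite mulrCA.
Qed.

Lemma BilC mu P b b' : Bil mu P b b' = Bil mu P b' b.
Proof.
elim: P b b' => [|p P IH] b b' /=; first by rewrite mulrC.
by apply: eq_bigr => x _; rewrite IH.
Qed.

Lemma Bil_lincombr (A : finType) (c : A -> R) (B : A -> (K -> nat) -> R) mu P b :
  Bil mu P b (lincomb c B) = \sum_a c a * Bil mu P b (B a).
Proof. by rewrite BilC Bil_lincombl; apply: eq_bigr => a _; rewrite BilC. Qed.

(** Total size of the coefficients when [Lam P b] is expanded into indicators of residue classes: a
    prime given to a colour brings [1/p] and one indicator, hence at most 2. *)
Fixpoint absum P b : R :=
  if P is p :: P' then absum P' b + 2 * \sum_j absum P' (fun f => b (mulp p j f))
  else `|b (fun=> 1%N)|.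

Lemma absum_ge0 P b : 0 <= absum P b.
Proof.
elim: P b => [|p P IH] b //=; rewrite addr_ge0 // mulr_ge0 // sumr_ge0 // => j _; exact: IH.
Qed.

Definition optt (a : option K) : R := if a is Some _ then 2 else 1.

Lemma absum_cons p P b : absum (p :: P) b = \sum_a optt a * absum P (optb p b a).
Proof. by rewrite big_option /= mul1r mulr_sumr. Qed.

Lemma optc_diff_le p a a' : (0 < p)%N ->
  `|optc R p None a * optc R p None a'| +
  \sum_j `|optc R p (Some j) a * optc R p (Some j) a' - optc R p None a * optc R p None a'|
  <= optt a * optt a' .
Proof.
move=> p0; set e : R := p%:R^-1.
have e0 : 0 <= e by rewrite invr_ge0.
have e1 : e <= 1 by rewrite invf_le1 ?ler1n ?ltr0n.
have D (l : K) : \sum_j `|((Some j : option K) == Some l)%:R| = 1 :> R.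
  rewrite (bigD1 l) //= eqxx normr1 big1 ?addr0 // => j jl.
  by rewrite (inj_eq Some_inj) (negbTE jl) normr0.
case: a => [l|]; case: a' => [l'|]; rewrite /= /xi /= -/e ?mulr1 ?mul1r.
- apply: (@le_trans _ _ (e * e + \sum_j (e * `|((Some j : option K) == Some l)%:R| +
     e * `|((Some j : option K) == Some l')%:R| + `|((Some j : option K) == Some l)%:R|))).
    rewrite subr0 ger0_norm ?mulr_ge0 // lerD2l; apply: ler_sum => j _.
    case: (Some j == Some l); case: (Some j == Some l'); rewrite /= ?normr1 ?normr0.
    + by rewrite ler_norml; nra.
    + by rewrite ler_norml; nra.
    + by rewrite ler_norml; nra.
    + by rewrite subr0 subrr normr0; nra.
  rewrite !big_split /= -!mulr_sumr !D; nra.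
- rewrite subr0 ger0_norm //.
  under eq_bigr do rewrite mulr1 [X in `|X|]addrAC subrr add0r normrN.
  rewrite D; lra.
- rewrite subr0 ger0_norm //.
  under eq_bigr do rewrite mul1r [X in `|X|]addrAC subrr add0r normrN.
  rewrite D; lra.
- by rewrite normr1 big1 ?addr0 // => j _; rewrite subrr normr0.
Qed.

(** Rankin's trick: a factor 2 per chosen prime is at most [p = p^2 / p], and on the support the
    product of all the [p^2] is at most [(D / A)^2]. The number [A] is the part of the product
    already extracted. *)
Lemma absum_le_Cs P b (A D : nat) : (0 < A)%N -> all (leq 2) P ->
  (forall f, 0 <= b f) ->
  (forall f, b f != 0 -> (A * \prod_j f j <= D)%N) ->
  A%:R ^+ 2 * absum P b <= D%:R ^+ 2 * Cs P b.
Proof.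
elim: P b A => [|p P IH] b A A0 /= H b0 bD.
  have [->|/bD] := eqVneq (b (fun=> 1%N)) 0; first by rewrite normr0 !mulr0.
  rewrite big1 // muln1 => AD; rewrite ger0_norm // ler_wpM2r //.
  by rewrite ler_pXn2r ?nnegrE ?ler_nat.
case/andP: H => p2 P2.
rewrite mulrDr [leRHS]mulrDr; apply: lerD; first exact: IH.
rewrite mulrCA [leRHS]mulrCA !mulr_sumr; apply: ler_sum => j _.
have p0 : 0 < p%:R :> R by rewrite ltr0n; lia.
have := IH (fun f => b (mulp p j f)) (A * p)%N.
have -> : (0 < A * p)%N by rewrite muln_gt0 A0; lia.
move=> /(_ isT P2 (fun f => b0 _)) H.
have {H} H : A%:R ^+ 2 * p%:R ^+ 2 * absum P (fun f => b (mulp p j f)) <=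
   D%:R ^+ 2 * Cs P (fun f => b (mulp p j f)).
  rewrite -exprMn -natrM; apply: H => f /bD.
  rewrite (bigD1 j) //= [X in (_ -> _ * X <= _)%N](bigD1 j) //= /mulp eqxx.
  rewrite (eq_bigr f) => [|l /negbTE ->] //.
  by rewrite !mulnA.
have a0 := absum_ge0 P (fun f => b (mulp p j f)).
set a := absum _ _ in H a0 *; set d := D%:R ^+ 2 * _ in H *.
have E : A%:R ^+ 2 * a <= d / p%:R ^+ 2.
  by rewrite ler_pdivlMr ?exprn_gt0 // mulrAC.
apply: (@le_trans _ _ (2 * (d / p%:R ^+ 2))); first by rewrite ler_wpM2l.
have d0 : 0 <= d by apply: le_trans H; rewrite !mulr_ge0 ?exprn_ge0.
rewrite expr2 invfM mulrA mulrA [leRHS]mulrC ler_wpM2r ?invr_ge0 ?(ltW p0) //.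
by rewrite ler_pdivrMr // mulrC ler_wpM2l // ler_nat.
Qed.

End Linear.

Section Expand.
Variables (R : realType) (K : finType) (h : K -> nat).
Implicit Types (P : seq nat) (b : (K -> nat) -> R) (p n : nat) (j : K).

Definition hcol n p : option K := [pick j | (p %| n + h j)%N].

Definition hsep p := forall j j', (h j = h j' %[mod p])%N -> j = j'.

Lemma hcolE p n j : hsep p -> (hcol n p == Some j) = (p %| n + h j)%N.
Proof.
move=> sp; rewrite /hcol; case: pickP => [l pl|/(_ j) /= ->] //.
apply/eqP/idP => [[<-] //|pj]; congr Some; apply: sp.
by apply/eqP; rewrite -(eqn_modDl n) (eqP pl) (eqP pj).
Qed.

Lemma sum_hcol p n (F : option K -> R) : hsep p ->
  F (hcol n p) = F None + \sum_j (p %| n + h j)%N%:R * (F (Some j) - F None).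
Proof.
move=> sp; case E: (hcol n p) => [j|].
  rewrite (bigD1 j) //= -hcolE // E eqxx mul1r big1 ?addr0 => [|l jl]; first by ring.
  by rewrite -hcolE // E (inj_eq Some_inj) eq_sym (negbTE jl) mul0r.
by rewrite big1 ?addr0 // => j _; rewrite -hcolE // E mul0r.
Qed.

Lemma merge_class s p a j n : coprime s p -> (0 < p)%N ->
  ((n == a %[mod s]) && (p %| n + h j) = (n == chinese s p a (p - h j %% p) %[mod s * p]))%N.
Proof.
move=> sp p0; rewrite chinese_remainder // chinese_modl // chinese_modr //.
congr (_ && _).
have H : (p - h j %% p + h j = 0 %[mod p])%N.
  rewrite {2}(divn_eq (h j) p) addnCA modnMDl subnK ?modnn ?mod0n //.
  by rewrite ltnW // ltn_mod.
rewrite -(eqn_modDr (h j)) H mod0n /dvdn.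
by [].
Qed.

Lemma twist_sum P p b n :
  Lam (p :: P) b (hcol n) = \sum_a optc R p (hcol n p) a * Lam P (optb p b a) (hcol n).
Proof. by rewrite /= twistE Lam_lincomb. Qed.

Lemma Bil_cons mu P p b b' : Bil mu (p :: P) b b' = \sum_a \sum_a'
  (\sum_x mu p x * (optc R p x a * optc R p x a')) * Bil mu P (optb p b a) (optb p b' a').
Proof.
rewrite /=; under eq_bigr do rewrite !twistE Bil_lincombl mulr_sumr.
rewrite exchange_big /=; apply: eq_bigr => a _.
under eq_bigr do rewrite Bil_lincombr !mulr_sumr.
rewrite exchange_big /=; apply: eq_bigr => a' _; rewrite mulr_suml.
by apply: eq_bigr => x _; ring.
Qed.

Variables (ns : seq nat) (wt : nat -> R) (M err : R) (good : nat -> Prop).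
Hypothesis class_sum : forall s a, good s ->
  `|\sum_(n <- ns | (n == a %[mod s])%N) wt n - M / s%:R| <= err.

Lemma Lam_class_sum P b b' s a : uniq P -> all prime P -> all (coprime s) P ->
  (forall p, p \in P -> hsep p) ->
  good s -> (forall p s', p \in P -> good s' -> good (s' * p)%N) ->
  `|\sum_(n <- ns | (n == a %[mod s])%N) wt n * (Lam P b (hcol n) * Lam P b' (hcol n))
     - M / s%:R * Bil (@mu_all R K) P b b'| <= err * (absum P b * absum P b').
Proof.
elim: P b b' s a => [|p P IH] b b' s a.
  move=> _ _ _ _ gs _ /=; rewrite -mulr_suml -mulrBl !normrM ler_wpM2r ?mulr_ge0 //.
  exact: class_sum.
move=> /= /andP[pP uP] /andP[pp aP] /andP[sp sP] H gs gH.
have p0 : (0 < p)%N := prime_gt0 pp.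
have hp : hsep p by apply: H; rewrite mem_head.
have HP q : q \in P -> hsep q by move=> qP; apply: H; rewrite inE qP orbT.
have gHP q s' : q \in P -> good s' -> good (s' * q)%N.
  by move=> qP; apply: gH; rewrite inE qP orbT.
pose F (a1 a2 x : option K) := optc R p x a1 * optc R p x a2.
pose G a1 a2 n := wt n * (Lam P (optb p b a1) (hcol n) * Lam P (optb p b' a2) (hcol n)).
pose B a1 a2 := Bil (@mu_all R K) P (optb p b a1) (optb p b' a2).
pose c j := chinese s p a (p - h j %% p)%N.
have -> : \sum_(n <- ns | (n == a %[mod s])%N) wt n * (Lam (p :: P) b (hcol n) * Lam (p :: P) b' (hcol n))
  = \sum_a1 \sum_a2 (F a1 a2 None * \sum_(n <- ns | (n == a %[mod s])%N) G a1 a2 n +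
      \sum_j (F a1 a2 (Some j) - F a1 a2 None) * \sum_(n <- ns | (n == c j %[mod s * p])%N) G a1 a2 n).
  under eq_bigr => n _.
    rewrite !twist_sum mulr_suml mulr_sumr.
    under eq_bigr do rewrite mulr_sumr mulr_sumr.
    over.
  rewrite exchange_big /=; apply: eq_bigr => a1 _.
  rewrite exchange_big /=; apply: eq_bigr => a2 _.
  under eq_bigr => n _.
    rewrite (_ : _ * _ = F a1 a2 (hcol n p) * G a1 a2 n); last by rewrite /F /G; ring.
    rewrite (sum_hcol n (F a1 a2) hp) mulrDl mulr_suml.
    over.
  rewrite big_split /= -mulr_sumr; congr (_ + _).
  rewrite exchange_big /=; apply: eq_bigr => j _.
  rewrite mulr_sumr big_mkcond [RHS]big_mkcond /=; apply: eq_bigr => n _.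
  rewrite -merge_class //; case: (n == a %[mod s])%N => //=.
  by case: (p %| n + h j)%N; rewrite ?mul0r ?mul1r.
have -> : M / s%:R * Bil (@mu_all R K) (p :: P) b b' =
   \sum_a1 \sum_a2 (F a1 a2 None * (M / s%:R * B a1 a2) +
      \sum_j (F a1 a2 (Some j) - F a1 a2 None) * (M / (s * p)%:R * B a1 a2)).
  rewrite Bil_cons mulr_sumr; apply: eq_bigr => a1 _.
  rewrite mulr_sumr; apply: eq_bigr => a2 _.
  rewrite big_option /= -/(F a1 a2 None) -mulr_sumr -mulr_suml -/(B a1 a2) sumrB sumr_const.
  rewrite (_ : \sum_j optc R p (Some j) a1 * optc R p (Some j) a2 = \sum_j F a1 a2 (Some j)) //.
  rewrite natrM invfM -[F a1 a2 None *+ _]mulr_natl; ring.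
rewrite -sumrB; apply: le_trans (ler_norm_sum _ _ _) _.
rewrite -[absum P b + _]/(absum (p :: P) b) -[absum P b' + _]/(absum (p :: P) b').
rewrite !absum_cons big_distrlr /= mulr_sumr; apply: ler_sum => a1 _.
rewrite -sumrB; apply: le_trans (ler_norm_sum _ _ _) _.
rewrite mulr_sumr; apply: ler_sum => a2 _.
rewrite opprD addrACA -mulrBr -sumrB.
set e := err * (absum P (optb p b a1) * absum P (optb p b' a2)).
apply: (@le_trans _ _ ((`|F a1 a2 None| + \sum_j `|F a1 a2 (Some j) - F a1 a2 None|) * e)).
  rewrite mulrDl; apply: le_trans (ler_normD _ _) _; apply: lerD.
    by rewrite normrM ler_wpM2l //; exact: IH.
  apply: le_trans (ler_norm_sum _ _ _) _; rewrite mulr_suml; apply: ler_sum => j _.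
  rewrite -mulrBr normrM ler_wpM2l //; apply: IH => //.
    apply/allP => q qP; rewrite coprimeMl (allP sP) //=.
    rewrite prime_coprime // dvdn_prime2 ?pp ?(allP aP q qP) //.
    by apply: contraNneq pP => ->.
  by apply: gH => //; rewrite mem_head.
have e0 : 0 <= e.
  by apply: le_trans (IH (optb p b a1) (optb p b' a2) s a uP aP sP HP gs gHP); exact: normr_ge0.
have -> : err * (optt R a1 * absum P (optb p b a1) * (optt R a2 * absum P (optb p b' a2))) =
   optt R a1 * optt R a2 * e by rewrite /e; ring.
by rewrite ler_wpM2r //; exact: optc_diff_le.
Qed.

End Expand.

(** * Expansion into mean and fluctuations over the units *)

Section UnitExpand.
Variables (R : realType) (K : finType) (h : K -> nat) (i : K).
Implicit Types (P : seq nat) (b : (K -> nat) -> R) (p n : nat) (j : K)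
  (z : seq (nat * K)).

Fixpoint zsum P (F : seq (nat * K) -> R) : R :=
  if P is p :: P' then zsum P' F + \sum_(j | j != i) zsum P' (fun z => F ((p, j) :: z))
  else F [::].

Definition zok P z := subseq (unzip1 z) P && all (fun pj => pj.2 != i) z.

Lemma zok_cons P p z : zok P z -> zok (p :: P) z.
Proof. by case/andP => zP zi; rewrite /zok zi andbT (subseq_trans zP) ?subseq_cons. Qed.

Lemma zok_cons2 P p j z : j != i -> zok P z -> zok (p :: P) ((p, j) :: z).
Proof. by move=> ji /andP[zP zi]; rewrite /zok /= eqxx zP ji zi. Qed.

Lemma le_zsum P F G : (forall z, zok P z -> F z <= G z) -> zsum P F <= zsum P G.
Proof.
elim: P F G => [|p P IH] F G FG /=; first by apply: FG.
apply: lerD; first by apply: IH => z zP; apply: FG; exact: zok_cons.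
by apply: ler_sum => j ji; apply: IH => z zP; apply: FG; exact: zok_cons2.
Qed.

Lemma eq_zsum P F G : (forall z, zok P z -> F z = G z) -> zsum P F = zsum P G.
Proof.
move=> FG; apply/eqP; rewrite eq_le.
by apply/andP; split; apply: le_zsum => z /FG ->.
Qed.

Lemma zsum_sum (I : finType) P (F : I -> seq (nat * K) -> R) :
  zsum P (fun z => \sum_x F x z) = \sum_x zsum P (F x).
Proof.
elim: P F => [|p P IH] F //=; rewrite IH.
under [X in _ + X]eq_bigr do rewrite IH.
by rewrite exchange_big /= -big_split.
Qed.

Lemma zsumD P F G : zsum P (fun z => F z + G z) = zsum P F + zsum P G.
Proof.
elim: P F G => [|p P IH] F G //=; rewrite IH.
under eq_bigr do rewrite IH.
by rewrite big_split /= addrACA.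
Qed.

Lemma zsumZ P c F : zsum P (fun z => c * F z) = c * zsum P F.
Proof.
elim: P F => [|p P IH] F //=; rewrite IH mulrDr mulr_sumr; congr (_ + _).
by apply: eq_bigr => j _; exact: IH.
Qed.

Lemma zsumB P F G : zsum P (fun z => F z - G z) = zsum P F - zsum P G.
Proof. by rewrite -mulN1r -zsumZ -zsumD; apply: eq_zsum => z _; rewrite mulN1r. Qed.

Lemma zsum0 P : zsum P (fun=> 0) = 0.
Proof. by elim: P => //= p P ->; rewrite big1 ?addr0. Qed.

Lemma zsum_nil P F :
  zsum P F = F [::] + zsum P (fun z => if z is [::] then 0 else F z).
Proof.
elim: P F => [|p P IH] F /=; first by rewrite addr0.
by rewrite {1}IH -addrA.
Qed.

Lemma zsum_swap (I : Type) (s : seq I) P (F : I -> seq (nat * K) -> R) :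
  \sum_(x <- s) zsum P (F x) = zsum P (fun z => \sum_(x <- s) F x z).
Proof.
elim: s => [|x s IH]; first by rewrite big_nil -[LHS](zsum0 P); apply: eq_zsum => z _; rewrite big_nil.
by rewrite big_cons IH -zsumD; apply: eq_zsum => z _; rewrite big_cons.
Qed.

Definition flz z p : option K := ohead [seq pj.2 | pj <- z & pj.1 == p].

Lemma flzE z p : (flz z p != None) = (p \in unzip1 z).
Proof.
rewrite /flz; elim: z => [|[q j] z IH] //=; rewrite inE [p == q]eq_sym.
by case: (q == p).
Qed.

Lemma flz_cons p j z q : q != p -> flz ((p, j) :: z) q = flz z q.
Proof. by rewrite /flz /= eq_sym => /negbTE ->. Qed.

(** The coefficient of [kap z n] in the expansion of a product of two [Lam]: the difference of two
    values of the colour at a flagged prime, the [mu_unit] mean at the others. *)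
Fixpoint Mz P (fl : nat -> option K) b b' : R :=
  if P is p :: P' then
    if fl p is Some j then Mz P' fl (twist p (Some j) b) (twist p (Some j) b') -
                           Mz P' fl (twist p None b) (twist p None b')
    else \sum_x mu_unit R i p x * Mz P' fl (twist p x b) (twist p x b')
  else b (fun=> 1%N) * b' (fun=> 1%N).

Lemma Mz_ext P fl fl' b b' : {in P, fl =1 fl'} -> Mz P fl b b' = Mz P fl' b b'.
Proof.
elim: P b b' => [|p P IH] b b' H //=; rewrite (H p) ?mem_head //.
have HP : {in P, fl =1 fl'} by move=> q qP; apply: H; rewrite inE qP orbT.
by case: (fl' p) => [j|]; [rewrite !IH|apply: eq_bigr => x _; rewrite IH].
Qed.

Lemma Mz_nil P b b' : Mz P (flz [::]) b b' = Bil (mu_unit R i) P b b'.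
Proof.
elim: P b b' => [|p P IH] b b' //=.
by apply: eq_bigr => x _; rewrite IH.
Qed.

(** Each factor is an indicator centred for the uniform law on the residues [n] with [n + h_i] prime
    to [p]. *)
Definition kap z n : R :=
  \prod_(pj <- z) ((pj.1 %| n + h pj.2)%N%:R - pj.1.-1%:R^-1).

Lemma hcol_unit p n (F : option K -> R) : hsep h p -> ~~ (p %| n + h i)%N ->
  F (hcol h n p) = \sum_x mu_unit R i p x * F x +
    \sum_(j | j != i) ((p %| n + h j)%N%:R - p.-1%:R^-1) * (F (Some j) - F None).
Proof.
move=> sp pi; rewrite (sum_hcol n F sp) big_option /=.
rewrite (bigD1 i) //= (negbTE pi) mul0r add0r [X in _ = _ + X + _](bigD1 i) //= eqxx !mul0r add0r.
under [X in _ = _ + X]eq_bigr do rewrite mulrBl.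
rewrite sumrB -mulr_sumr sumrB sumr_const.
have -> : #|fun j : K => j != i| = #|K|.-1 by rewrite -(cardC1 i).
under [X in _ = _ + X + _]eq_bigr => j ji do rewrite ji mul1r.
rewrite -mulr_sumr -[F None *+ _]mulr_natl; ring.
Qed.

(** By [hcol_unit] a function of the colour at [p] is its [mu_unit] mean plus centred fluctuations,
    one for each colour other than [i]. Multiplying over [P] gives one term per [z]; the empty [z]
    is the main term, and the others are to be shown small on average. *)
Lemma unit_expand P n b b' : uniq P -> (forall p, p \in P -> hsep h p) ->
  (forall p, p \in P -> ~~ (p %| n + h i)%N) ->
  Lam P b (hcol h n) * Lam P b' (hcol h n) = zsum P (fun z => kap z n * Mz P (flz z) b b').
Proof.
elim: P b b' => [|p P IH] b b' /=; first by rewrite /kap big_nil mul1r.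
case/andP => pP uP H1 H2.
have HP1 q : q \in P -> hsep h q by move=> qP; apply: H1; rewrite inE qP orbT.
have HP2 q : q \in P -> ~~ (q %| n + h i)%N by move=> qP; apply: H2; rewrite inE qP orbT.
rewrite (hcol_unit (n := n) (fun x => Lam P (twist p x b) (hcol h n) * Lam P (twist p x b') (hcol h n)));
  [|by apply: H1; rewrite mem_head|by apply: H2; rewrite mem_head].
have EX (x : option K) := IH (twist p x b) (twist p x b') uP HP1 HP2.
rewrite (eq_bigr (fun x => zsum P (fun z => mu_unit R i p x *
    (kap z n * Mz P (flz z) (twist p x b) (twist p x b'))))); last first.
  by move=> x _; rewrite zsumZ -EX.
rewrite -zsum_sum; congr (_ + _).
  apply: eq_zsum => z /andP[zP _].
  have -> : flz z p = None.
    apply/eqP; rewrite -[_ == _]negbK flzE; apply: contra pP => pz.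
    exact: mem_subseq zP _ pz.
  by rewrite mulr_sumr; apply: eq_bigr => x _; rewrite mulrCA.
apply: eq_bigr => j ji; rewrite !EX -zsumB -zsumZ.
apply: eq_zsum => z _; rewrite /kap big_cons /=.
have -> : flz ((p, j) :: z) p = Some j by rewrite /flz /= eqxx.
have E c c' : Mz P (flz ((p, j) :: z)) c c' = Mz P (flz z) c c'.
  by apply: Mz_ext => q qP; apply: flz_cons; apply: contraNneq pP => <-.
rewrite !E; ring.
Qed.

(** A difference at a flagged prime is bounded by the sum of the absolute values, which is what
    [mu_flag] records. Taking both weights equal makes every final term a square. *)
Lemma Mz_le_Bil P fl b : all (fun p => #|K| <= p)%N P ->
  `|Mz P fl b b| <= Bil (mu_flag R i fl) P b b.
Proof.
elim: P b => [|p P IH] b /=; first by rewrite ger0_norm ?sqr_ge0 // -expr2 sqr_ge0.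
case/andP => pK PK; rewrite {2}/mu_flag; case E: (fl p) => [j|].
  rewrite -[X in _ <= X](_ : Bil (mu_flag R i fl) P (twist p (Some j) b) (twist p (Some j) b) +
    Bil (mu_flag R i fl) P (twist p None b) (twist p None b) = _).
    by apply: le_trans (ler_normB _ _) _; rewrite lerD ?IH.
  have D (y : option K) (F : option K -> R) : \sum_a (a == y)%:R * F a = F y.
    by rewrite (bigD1 y) //= eqxx mul1r big1 ?addr0 // => a /negbTE ->; rewrite mul0r.
  under [RHS]eq_bigr do rewrite /mu_flag E mulrDl.
  by rewrite big_split /= !(D _ (fun x => Bil (mu_flag R i fl) P (twist p x b) (twist p x b))).
apply: le_trans (ler_norm_sum _ _ _) _; apply: ler_sum => x _.
rewrite /mu_flag E normrM ger0_norm ?mu_unit_ge0 //.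
by rewrite ler_wpM2l ?mu_unit_ge0 // IH.
Qed.

Lemma filter_zok P z : uniq P -> zok P z -> [seq p <- P | flz z p != None] = unzip1 z.
Proof.
move=> uP /andP[/(subseq_uniqP uP) zP _]; rewrite [RHS]zP.
by apply: eq_filter => p; rewrite flzE.
Qed.

Lemma Mz_bound P z b : #|K| == 8%N -> uniq P -> all (fun p => 8 <= p)%N P -> zok P z -> anti b ->
  `|Mz P (flz z) b b| <= 162 ^+ size z *
     (\prod_(p <- P) (1 + 500 / p%:R ^+ 2) * Cs P (dup i b)).
Proof.
move=> K8 uP P8 zP ab.
apply: le_trans (Mz_le_Bil _ _ _) _; first by rewrite (eqP K8).
apply: le_trans (Bil_flag_le i K8 (flz z) ab P8) _.
rewrite mulrA ler_wpM2r //; first by apply: Cs_ge0 => F; case: (anti_dup i ab).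
have -> : size z = count (fun p => flz z p != None) P.
  by rewrite -size_filter filter_zok // size_map.
elim: (P) => [|p Q IH]; first by rewrite !big_nil mul1r.
rewrite !big_cons /= exprD mulrACA; apply: ler_pM => //.
- by rewrite /flag_cst; case: (flz z p) => // ; rewrite addr_ge0 // divr_ge0 ?exprn_ge0.
- apply: prodr_ge0 => q _.
  by rewrite /flag_cst; case: (flz z q) => // ; rewrite addr_ge0 // divr_ge0 ?exprn_ge0.
- rewrite /flag_cst; case: (flz z p) => [j|] /=; last by rewrite expr0 mul1r.
  by rewrite expr1 ler_peMr // lerDl divr_ge0 ?exprn_ge0.
Qed.

(** [A] is the part of the product already extracted by the recursion. Colour [i] is left out of the
    bound because no flagged prime carries it. *)
Definition supp (D A : nat) b := forall f, b f != 0 -> (A * \prod_(l | l != i) f l < D)%N.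

Lemma supp_mulp D A p j b : j != i -> supp D A b -> supp D (A * p) (fun f => b (mulp p j f)).
Proof.
move=> ji H f /H; rewrite (bigD1 j) //= [X in (_ -> _ * X < _)%N](bigD1 j) //= /mulp eqxx.
rewrite (eq_bigr f) => [|l /andP[_ /negbTE ->]] //.
by rewrite !mulnA.
Qed.

Lemma supp_twist D A p x b : (0 < p)%N -> supp D A b -> supp D A (twist p x b).
Proof.
move=> p0 H f; rewrite /twist.
have [->|b0 _] := eqVneq (b f) 0; last exact: H.
rewrite add0r => s0.
have [j bj] : exists j, b (mulp p j f) != 0.
  apply/existsP; apply: contraNT s0; rewrite negb_exists => /forallP bj.
  by rewrite big1 // => j _; have := bj j; rewrite negbK => /eqP ->; rewrite mulr0.
apply: leq_ltn_trans (H _ bj); rewrite leq_mul2l; apply/orP; right.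
by apply: leq_prod => l _; exact: le_mulp.
Qed.

Lemma Mz_subl P fl b1 b2 b' :
  Mz P fl (fun f => b1 f - b2 f) b' = Mz P fl b1 b' - Mz P fl b2 b'.
Proof.
have T p x (c1 c2 : (K -> nat) -> R) : twist p x (fun f => c1 f - c2 f) =
   (fun f => twist p x c1 f - twist p x c2 f).
  apply/funext => f; rewrite /twist; under eq_bigr do rewrite mulrBr.
  by rewrite sumrB opprD addrACA.
elim: P b1 b2 b' => [|p P IH] b1 b2 b' /=; first by rewrite mulrBl.
case: (fl p) => [j|]; first by rewrite !T !IH; ring.
by rewrite -sumrB; apply: eq_bigr => x _; rewrite T IH mulrBr.
Qed.

Lemma MzC P fl b b' : Mz P fl b b' = Mz P fl b' b.
Proof.
elim: P b b' => [|p P IH] b b' /=; first by rewrite mulrC.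
by case: (fl p) => [j|]; [rewrite !(IH (twist _ _ b))|apply: eq_bigr => x _; rewrite IH].
Qed.

Lemma twist_Some p j b : twist p (Some j) b = fun f => twist p None b f - b (mulp p j f).
Proof.
apply/funext => f; rewrite /twist -addrA; congr (_ + _).
rewrite (bigD1 j) //= [X in _ = X - _](bigD1 j) //= addrAC /xi eqxx /=.
rewrite subr0 mulrBl mul1r; congr (_ + _).
by apply: eq_bigr => l lj; rewrite (inj_eq Some_inj) eq_sym (negbTE lj) subr0.
Qed.

(** Passing from [None] to [Some j] only subtracts [b (mulp p j f)], so in the difference at a
    flagged prime every surviving product has [p] in colour [j] of at least one factor. The flagged
    primes thus fit into the two supports together, whose product is below [D^2]. *)
Lemma Mz_eq0 P fl b b' D A A' : all (leq 1) P -> {in P, forall p, fl p != Some i} ->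
  supp D A b -> supp D A' b' ->
  (D * D <= A * A' * \prod_(p <- P | fl p != None) p)%N -> Mz P fl b b' = 0.
Proof.
elim: P b b' A A' => [|p P IH] b b' A A' /=.
  move=> _ _ sb sb'; rewrite big_nil muln1 => DA.
  have [->|b0] := eqVneq (b (fun=> 1%N)) 0; first by rewrite mul0r.
  have [->|b0'] := eqVneq (b' (fun=> 1%N)) 0; first by rewrite mulr0.
  have := sb _ b0; have := sb' _ b0'; rewrite !big1 // !muln1 => h1 h2.
  have : (A * A' < D * D)%N by apply: ltn_mul.
  by rewrite ltnNge DA.
case/andP => p0 P0 fli sb sb'; rewrite big_cons.
have flP : {in P, forall q, fl q != Some i} by move=> q qP; apply: fli; rewrite inE qP orbT.
have := fli p (mem_head _ _).
case E: (fl p) => [j|] /= ji DA; last first.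
  by rewrite big1 // => x _; rewrite (IH _ _ A A') ?mulr0 //; apply: supp_twist.
have {}ji : j != i by move: ji; rewrite (inj_eq Some_inj).
rewrite !twist_Some Mz_subl [Mz P fl (twist p None b) _]MzC Mz_subl.
rewrite [Mz P fl (fun f => b (mulp p j f)) _]MzC Mz_subl.
rewrite (MzC _ _ (twist p None b')).
have sbN := supp_twist (p := p) (x := None) p0 sb; have sbN' := supp_twist (p := p) (x := None) p0 sb'.
have sj := supp_mulp (p := p) ji sb; have sj' := supp_mulp (p := p) ji sb'.
rewrite (IH (fun f => b' (mulp p j f)) (twist p None b) (A' * p)%N A) //; last first.
  by apply: leq_trans DA _; rewrite mulnA leq_mul2r; apply/orP; right; nia.
rewrite (IH (twist p None b') (fun f => b (mulp p j f)) A' (A * p)%N) //; last first.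
  by apply: leq_trans DA _; rewrite mulnA leq_mul2r; apply/orP; right; nia.
rewrite (IH (fun f => b' (mulp p j f)) (fun f => b (mulp p j f)) (A' * p)%N (A * p)%N) //; last first.
  apply: leq_trans DA _; rewrite mulnA leq_mul2r; apply/orP; right.
  rewrite (_ : A' * p * (A * p) = A * A' * p * p)%N; last by ring.
  by rewrite leq_pmulr.
ring.
Qed.

Lemma Mz_eq0_z P z b D : uniq P -> all (leq 1) P -> zok P z ->
  supp D 1 b -> (D * D <= \prod_(p <- unzip1 z) p)%N -> Mz P (flz z) b b = 0.
Proof.
move=> uP P1 zP sb DD; apply: (Mz_eq0 (D := D) (A := 1) (A' := 1)) => //.
  move=> p _; case/andP: zP => _ zi; rewrite /flz.
  elim: z zi {DD} => [|[q j] z IH] //= /andP[ji zi].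
  by case: (q == p) => /=; [rewrite (inj_eq Some_inj)|exact: IH].
by rewrite mul1n mul1n -big_filter filter_zok.
Qed.

End UnitExpand.

(** * A large sieve inequality along an arithmetic progression *)

Section Kernel.
Variable (R : realType).

Lemma Cauchy_Schwarz_seq (I : Type) (r : seq I) (x y : I -> R) :
  (\sum_(i <- r) x i * y i) ^+ 2 <= (\sum_(i <- r) x i ^+ 2) * (\sum_(i <- r) y i ^+ 2).
Proof.
have : 0 <= \sum_(i <- r) \sum_(j <- r) (x i * y j - x j * y i) ^+ 2.
  by apply: sumr_ge0 => i _; apply: sumr_ge0 => j _; rewrite sqr_ge0.
have -> : \sum_(i <- r) \sum_(j <- r) (x i * y j - x j * y i) ^+ 2 =
   2 * ((\sum_(i <- r) x i ^+ 2) * (\sum_(i <- r) y i ^+ 2) - (\sum_(i <- r) x i * y i) ^+ 2).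
  under eq_bigr => i _.
    under eq_bigr => j _.
      rewrite (_ : _ ^+ 2 = x i ^+ 2 * y j ^+ 2 + y i ^+ 2 * x j ^+ 2 +
         (- 2 * (x i * y i)) * (x j * y j)); last by ring.
      over.
    rewrite !big_split /= -!mulr_sumr.
    over.
  rewrite !big_split /= -!mulr_suml -mulr_sumr; ring.
by rewrite pmulr_rge0 // subr_ge0.
Qed.

(** For [q], [q'] prime to the moduli this is, up to the factor [1 / (l - 1)] per prime, the sum of
    [chi(q)] times the conjugate of [chi(q')] over the characters primitive at every [l] of [rho];
    congruences replace the characters. *)
Definition kapp (rho : seq nat) (q q' : nat) : R :=
  \prod_(l <- rho) ((q == q' %[mod l])%N%:R - l.-1%:R^-1).

Definition Nk rho (S : seq nat) (al : nat -> R) : R :=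
  \sum_(q <- S) \sum_(q' <- S) al q * al q' * kapp rho q q'.

(** Centred point masses on the [l - 1] units are images of an orthonormal basis under a projection,
    so their inner products are again centred indicators. *)
Lemma Fp_delta (l : nat) (x y : 'F_l) : prime l -> x != 0 -> y != 0 ->
  let c : R := l.-1%:R^-1 in
  \sum_(b : 'F_l) ((b != 0)%:R * ((b == x)%:R - c)) * ((b != 0)%:R * ((b == y)%:R - c))
  = (x == y)%:R - c.
Proof.
move=> pl x0 y0 c.
transitivity (\sum_(b : 'F_l | b != 0) ((b == x)%:R - c) * ((b == y)%:R - c)).
  rewrite [RHS]big_mkcond /=; apply: eq_bigr => b _.
  by case: eqP => _ /=; rewrite ?mul0r // !mul1r.
have D (z : 'F_l) (F : 'F_l -> R) : z != 0 -> \sum_(b | b != 0) (b == z)%:R * F b = F z.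
  move=> z0; rewrite (bigD1 z) //= eqxx mul1r big1 ?addr0 // => b /andP[_ /negbTE ->].
  by rewrite mul0r.
under eq_bigr do rewrite mulrBl.
rewrite sumrB D // -mulr_sumr sumrB sumr_const.
have -> : \sum_(b : 'F_l | b != 0) (b == y)%:R = 1 :> R.
  by under eq_bigr do rewrite -[_%:R]mulr1; rewrite (D y (fun=> 1)).
have -> : #|fun b : 'F_l => b != 0| = l.-1 by rewrite -[in RHS](card_Fp pl) -(cardC1 (0 : 'F_l)).
have l0 : l.-1%:R != 0 :> R by rewrite pnatr_eq0; have := prime_gt1 pl; lia.
by rewrite -[c *+ _]mulr_natl /c mulfV // subrr mulr0 subr0.
Qed.

Lemma eqmod_Fp l q q' : prime l -> (q == q' %[mod l])%N = ((q%:R : 'F_l) == q'%:R).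
Proof. by move=> pl; rewrite -val_eqE /= !val_Fp_nat. Qed.

Lemma Fp_neq0 l q : prime l -> ~~ (l %| q)%N -> (q%:R : 'F_l) != 0.
Proof. by move=> pl; apply: contraNneq => /eqP; rewrite -val_eqE /= val_Fp_nat. Qed.

Variables (K : finType) (h : K -> nat) (i : K).

(** The condition [l | q q' - h_i + h_j] says [q = t / q'] modulo [l], with [t = h_i - h_j]
    invertible. So [v q] is the centred mass at [q] and [w q'] the one at [t / q']; as [q -> t / q]
    permutes the units, both families have Gram kernel [kapp]. This is what allows [q] and [q'] to
    be separated by Cauchy-Schwarz. *)
Lemma kernel_factor (z : seq (nat * K)) : all prime (unzip1 z) ->
  all (fun pj => pj.2 != i) z -> (forall l, l \in unzip1 z -> hsep h l) ->
  exists (I : finType) (v w : nat -> I -> R),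
  [/\ forall q q', all (fun l => ~~ (l %| q)%N) (unzip1 z) ->
        all (fun l => ~~ (l %| q')%N) (unzip1 z) -> (h i <= q * q')%N ->
        kap R h z (q * q' - h i) = \sum_x v q x * w q' x,
      forall q q', all (fun l => ~~ (l %| q)%N) (unzip1 z) ->
        all (fun l => ~~ (l %| q')%N) (unzip1 z) -> kapp (unzip1 z) q q' = \sum_x v q x * v q' x
    & forall q q', all (fun l => ~~ (l %| q)%N) (unzip1 z) ->
        all (fun l => ~~ (l %| q')%N) (unzip1 z) -> kapp (unzip1 z) q q' = \sum_x w q x * w q' x].
Proof.
elim: z => [|[l j] z IH].
  move=> _ _ _; exists unit, (fun _ _ => 1), (fun _ _ => 1).
  by split=> q q' _ _ *; rewrite /kap /kapp big_nil (bigD1 tt) //= big1 ?mulr1 ?addr0 // => [[]].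
move=> /= /andP[pl pz] /andP[ji iz] H.
have [|I [v [w [H1 H2 H3]]]] := IH pz iz.
  by move=> l' lz; apply: H; rewrite inE lz orbT.
pose t : 'F_l := (h i)%:R - (h j)%:R.
have t0 : t != 0.
  rewrite subr_eq0 -eqmod_Fp //; apply: contraNneq ji => E; apply/eqP.
  by apply: (H l (mem_head _ _)).
pose c : R := l.-1%:R^-1.
pose v1 (q : nat) (b : 'F_l) : R := (b != 0)%:R * ((b == q%:R)%:R - c).
pose w1 (q : nat) (b : 'F_l) : R := (b != 0)%:R * ((b == t / q%:R)%:R - c).
exists ('F_l * I)%type, (fun q x => v1 q x.1 * v q x.2), (fun q x => w1 q x.1 * w q x.2).
have P (f1 g1 : 'F_l -> R) (f g : I -> R) :
   \sum_x (f1 x.1 * f x.2) * (g1 x.1 * g x.2) = (\sum_x f1 x * g1 x) * (\sum_x f x * g x).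
  rewrite big_distrlr /= pair_big /=; apply: eq_bigr => x _; by rewrite mulrACA.
split=> q q' /= /andP[lq zq] /andP[lq' zq'].
- move=> hq; rewrite P -H1 // /kap big_cons /=; congr (_ * _).
  have q0 := Fp_neq0 pl lq; have q0' := Fp_neq0 pl lq'.
  rewrite Fp_delta //; last by rewrite mulf_neq0 ?invr_eq0.
  congr (_%:R - _).
  have -> : (l %| q * q' - h i + h j)%N = ((q * q' - h i + h j)%:R == 0 :> 'F_l).
    by rewrite -val_eqE /= val_Fp_nat.
  rewrite natrD natrB // natrM.
  congr nat_of_bool; apply/idP/idP => /eqP => [E|->]; last by apply/eqP; rewrite mulfVK // /t; ring.
  by apply/eqP; rewrite -[LHS](mulfK q0') /t; congr (_ / _); apply/eqP; rewrite -subr_eq0; apply/eqP;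
      rewrite -[RHS]E; ring.
- rewrite P -H2 // /kapp big_cons; congr (_ * _).
  by rewrite Fp_delta ?Fp_neq0 // eqmod_Fp.
- rewrite P -H3 // /kapp big_cons; congr (_ * _).
  have q0 := Fp_neq0 pl lq; have q0' := Fp_neq0 pl lq'.
  rewrite Fp_delta ?mulf_neq0 ?invr_eq0 // eqmod_Fp //; congr (_%:R - _).
  by rewrite (inj_eq (mulfI t0)) (inj_eq invr_inj).
Qed.

Lemma sum_swap3 (I : finType) (S1 S2 : seq nat) (al be : nat -> R) (v w : nat -> I -> R) :
  \sum_(q <- S1) \sum_(q' <- S2) al q * be q' * (\sum_x v q x * w q' x) =
  \sum_x (\sum_(q <- S1) al q * v q x) * (\sum_(q <- S2) be q * w q x).
Proof.
under [RHS]eq_bigr do rewrite big_distrlr /=.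
rewrite [RHS]exchange_big /=; apply: eq_bigr => q _.
rewrite [RHS]exchange_big /=; apply: eq_bigr => q' _.
by rewrite mulr_sumr; apply: eq_bigr => x _; rewrite mulrACA.
Qed.

Lemma kap_bilinear z S1 S2 (al be : nat -> R) : all prime (unzip1 z) ->
  all (fun pj => pj.2 != i) z -> (forall l, l \in unzip1 z -> hsep h l) ->
  (forall q, q \in S1 -> all (fun l => ~~ (l %| q)%N) (unzip1 z)) ->
  (forall q, q \in S2 -> all (fun l => ~~ (l %| q)%N) (unzip1 z)) ->
  (forall q q', q \in S1 -> q' \in S2 -> h i <= q * q')%N ->
  [/\ 0 <= Nk (unzip1 z) S1 al, 0 <= Nk (unzip1 z) S2 be &
  (\sum_(q <- S1) \sum_(q' <- S2) al q * be q' * kap R h z (q * q' - h i)) ^+ 2 <=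
  Nk (unzip1 z) S1 al * Nk (unzip1 z) S2 be].
Proof.
move=> pz iz sz c1 c2 hS.
have [I [v [w [H1 H2 H3]]]] := kernel_factor pz iz sz.
have -> : Nk (unzip1 z) S1 al = \sum_x (\sum_(q <- S1) al q * v q x) ^+ 2.
  under [RHS]eq_bigr do rewrite expr2; rewrite -sum_swap3 /Nk.
  rewrite big_seq [RHS]big_seq; apply: eq_bigr => q qS.
  rewrite big_seq [RHS]big_seq; apply: eq_bigr => q' qS'.
  by rewrite H2 ?c1.
have -> : Nk (unzip1 z) S2 be = \sum_x (\sum_(q <- S2) be q * w q x) ^+ 2.
  under [RHS]eq_bigr do rewrite expr2; rewrite -sum_swap3 /Nk.
  rewrite big_seq [RHS]big_seq; apply: eq_bigr => q qS.
  rewrite big_seq [RHS]big_seq; apply: eq_bigr => q' qS'.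
  by rewrite H3 ?c2.
have -> : \sum_(q <- S1) \sum_(q' <- S2) al q * be q' * kap R h z (q * q' - h i) =
  \sum_x (\sum_(q <- S1) al q * v q x) * (\sum_(q <- S2) be q * w q x).
  rewrite -sum_swap3 big_seq [RHS]big_seq; apply: eq_bigr => q qS.
  rewrite big_seq [RHS]big_seq; apply: eq_bigr => q' qS'.
  by rewrite (H1 _ _ (c1 q qS) (c2 q' qS') (hS q q' qS qS')).
split; [by apply: sumr_ge0 => x _; rewrite sqr_ge0|by apply: sumr_ge0 => x _; rewrite sqr_ge0|].
exact: Cauchy_Schwarz_seq.
Qed.

End Kernel.

Import numFieldNormedType.Exports.

(** * The Fejer kernel *)

Section Trig.
Variable R : realType.
Implicit Types (x y : R).

(** A weak Jordan inequality: if [cos y <= 1/4] the sine is close to 1 while [y <= 2]; otherwise the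
    cosine exceeds [1/4] on all of [[0, y]] and the mean value theorem applies. *)
Lemma sin_ge_quarter y : 0 <= y -> y <= pi / 2 -> y / 4 <= sin y.
Proof.
move=> y0 yp; have p2 : pi / 2 <= 2 :> R by rewrite ltW // pihalf_lt2.
have s0 : 0 <= sin y by apply: sin_ge0_pi; rewrite y0 /=; have := pi_gt0 R; lra.
have c0 : 0 <= cos y by apply: cos_ge0_pihalf; rewrite yp andbT; have := pi_gt0 R; lra.
have [cs|cl] := lerP (cos y) (1 / 4).
  have := cos2Dsin2 y.
  have [//|sl] := lerP (y / 4) (sin y); nra.
have [->|yn0] := eqVneq y 0; first by rewrite sin0 mul0r.
have y1 : 0 < y by rewrite lt_neqAle eq_sym yn0.
have [c cy E] : exists2 c, c \in `]0, y[%R & sin y - sin 0 = cos c * (y - 0).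
  apply: (@MVT R sin cos 0 y y1).
  by apply: derivable_within_continuous => z _; exact: derivable_sin.
move: cy; rewrite in_itv /= => /andP[c1 c2].
have : cos y <= cos c.
  rewrite ltW // ltr_cos // in_itv /=.
    by rewrite (ltW c1) /=; have := pi_gt0 R; lra.
  by rewrite y0 /=; have := pi_gt0 R; lra.
move: E; rewrite sin0 !subr0 => -> cc; nra.
Qed.

Definition dsum1 (L : nat) x : R := \sum_(u < L) cos (u%:R * x).
Definition dsum2 (L : nat) x : R := \sum_(u < L) sin (u%:R * x).

Lemma dsum1E L x : 2 * sin (x / 2) * dsum1 L x = sin (L%:R * x - x / 2) + sin (x / 2).
Proof.
elim: L => [|L IH]; first by rewrite /dsum1 big_ord0 mulr0 mul0r add0r sinN addNr.
rewrite /dsum1 big_ord_recr /= mulrDr -/(dsum1 L x) IH.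
have -> : L.+1%:R * x - x / 2 = L%:R * x + x / 2 by rewrite -natr1; field.
rewrite sinB sinD; ring.
Qed.

Lemma dsum2E L x : 2 * sin (x / 2) * dsum2 L x = cos (x / 2) - cos (L%:R * x - x / 2).
Proof.
elim: L => [|L IH]; first by rewrite /dsum2 big_ord0 mulr0 mul0r add0r cosN subrr.
rewrite /dsum2 big_ord_recr /= mulrDr -/(dsum2 L x) IH.
have -> : L.+1%:R * x - x / 2 = L%:R * x + x / 2 by rewrite -natr1; field.
rewrite cosB cosD; ring.
Qed.

(** The squared modulus of the sum of [exp(i u x)] over [u < L], in real form. *)
Definition fejer L x : R := dsum1 L x ^+ 2 + dsum2 L x ^+ 2.

Lemma fejer_ge0 L x : 0 <= fejer L x.
Proof. by rewrite addr_ge0 ?sqr_ge0. Qed.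

Lemma fejer_sin L x : sin (x / 2) ^+ 2 * fejer L x <= 1.
Proof.
have := cos_geN1 (L%:R * x).
have -> : L%:R * x = (L%:R * x - x / 2) + x / 2 by ring.
rewrite cosD; have := cos2Dsin2 (x / 2); have := cos2Dsin2 (L%:R * x - x / 2).
have := dsum1E L x; have := dsum2E L x; rewrite /fejer.
set A := L%:R * x - x / 2; set B := x / 2; set d1 := dsum1 L x; set d2 := dsum2 L x.
move=> e2 e1 ha hb hc.
have -> : sin B ^+ 2 * (d1 ^+ 2 + d2 ^+ 2) =
  ((2 * sin B * d1) ^+ 2 + (2 * sin B * d2) ^+ 2) / 4 by field.
rewrite e1 e2; lra.
Qed.

Lemma fejer_le L x : fejer L x <= L%:R ^+ 2.
Proof.
have Cs (f : R -> R) (c : 'I_L -> R) : (\sum_u c u) ^+ 2 <= L%:R * \sum_u c u ^+ 2.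
  have := @Cauchy_Schwarz_seq R 'I_L (index_enum _) (fun=> 1) c.
  under eq_bigr do rewrite mul1r.
  by under [X in X * _]eq_bigr do rewrite expr1n; rewrite sumr_const card_ord.
apply: (@le_trans _ _ (L%:R * \sum_(u < L) (cos (u%:R * x) ^+ 2 + sin (u%:R * x) ^+ 2))).
  by rewrite big_split /= mulrDr lerD // Cs.
under eq_bigr do rewrite cos2Dsin2.
by rewrite sumr_const card_ord expr2.
Qed.

Lemma cos2pin x (n : nat) : cos (x + n%:R * (2 * pi)) = cos x.
Proof.
have -> : x + n%:R * (2 * pi) = x + (pi *+ 2) *+ n.
  by rewrite -[RHS]/(x + pi *+ 2 *+ n) mulr_natl mulr_natl.
by rewrite (periodicn (@cosD2pi R)).
Qed.

Lemma sin2pin x (n : nat) : sin (x + n%:R * (2 * pi)) = sin x.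
Proof.
have -> : x + n%:R * (2 * pi) = x + (pi *+ 2) *+ n.
  by rewrite -[RHS]/(x + pi *+ 2 *+ n) mulr_natl mulr_natl.
by rewrite (periodicn (@sinD2pi R)).
Qed.

Lemma cos2piz x (k : int) : cos (x + k%:~R * (2 * pi)) = cos x.
Proof.
case: k => n; first by rewrite -pmulrn cos2pin.
have -> : x + (Negz n)%:~R * (2 * pi) = x - n.+1%:R * (2 * pi).
  by rewrite NegzE mulrNz mulNr.
by rewrite -[in RHS](subrK (n.+1%:R * (2 * pi)) x) cos2pin.
Qed.

Lemma sin2piz x (k : int) : sin (x + k%:~R * (2 * pi)) = sin x.
Proof.
case: k => n; first by rewrite -pmulrn sin2pin.
have -> : x + (Negz n)%:~R * (2 * pi) = x - n.+1%:R * (2 * pi).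
  by rewrite NegzE mulrNz mulNr.
by rewrite -[in RHS](subrK (n.+1%:R * (2 * pi)) x) sin2pin.
Qed.

Lemma fejer_per L x (k : int) : fejer L (2 * pi * (x + k%:~R)) = fejer L (2 * pi * x).
Proof.
have E (u : 'I_L) : u%:R * (2 * pi * (x + k%:~R)) =
    u%:R * (2 * pi * x) + ((u : nat)%:Z * k)%:~R * (2 * pi).
  by rewrite intrM -pmulrn; ring.
by rewrite /fejer /dsum1 /dsum2; congr (_ ^+ 2 + _ ^+ 2); apply: eq_bigr => u _;
  rewrite E ?cos2piz ?sin2piz.
Qed.

Lemma fejer_small L (f : R) (d : R) : 0 < d -> d <= f -> d <= 1 - f ->
  fejer L (2 * pi * f) <= 4 / d ^+ 2.
Proof.
move=> d0 df d1; have := fejer_sin L (2 * pi * f).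
have -> : 2 * pi * f / 2 = pi * f by field.
have p0 := pi_gt0 R; have p2 := pi_ge2 R.
have H : d / 2 <= sin (pi * f).
  have [fs|fl] := lerP f (1 / 2).
    apply: le_trans (sin_ge_quarter _ _); [nra|nra|nra].
  have -> : sin (pi * f) = sin (pi * (1 - f)).
    by rewrite mulrBr mulr1 sinB sinpi cospi; ring.
  apply: le_trans (sin_ge_quarter _ _); [nra|nra|nra].
have F0 := fejer_ge0 L (2 * pi * f).
rewrite ler_pdivlMr ?exprn_gt0 // => H1.
have : (d / 2) ^+ 2 * fejer L (2 * pi * f) <= sin (pi * f) ^+ 2 * fejer L (2 * pi * f).
  by rewrite ler_wpM2r // ler_pXn2r // nnegrE; lra.
lra.
Qed.

Lemma sum_inv_sq_le (n : nat) : \sum_(1 <= k < n) (k%:R ^+ 2)^-1 <= 2 :> R.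
Proof.
have H m : \sum_(1 <= k < m.+2) (k%:R ^+ 2)^-1 <= 2 - m.+1%:R^-1 :> R.
  elim: m => [|m IH]; first by rewrite big_nat1 expr1n invr1; lra.
  rewrite big_nat_recr //=; apply: le_trans (lerD IH (lexx _)) _.
  have a0 : 0 < m.+1%:R :> R by rewrite ltr0n.
  have -> : m.+2%:R = m.+1%:R + 1 :> R by rewrite -[m.+2]addn1 natrD.
  set a := m.+1%:R in a0 *.
  rewrite -subr_ge0 (_ : _ - _ = (a * (a + 1) ^+ 2)^-1); last by field; lra.
  by rewrite invr_ge0 mulr_ge0 ?sqr_ge0 // ltW.
case: n => [|[|n]]; [by rewrite big_geq|by rewrite big_geq|].
apply: le_trans (H n) _; by rewrite lerBlDr lerDl invr_ge0.
Qed.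

End Trig.

Lemma sum_shift (V : nmodType) (v H : nat) (G : nat -> V) :
  \sum_(v <= i < v + H) G i = \sum_(n < H) G (n + v)%N.
Proof. by rewrite -{1}[v]add0n big_addn addKn big_mkord. Qed.

(** * The large sieve for separated points *)

Section LargeSievePoints.
Variables (R : realType) (T : finType) (S : pred T) (H N : nat).
Hypotheses (N0 : (0 < N)%N) (NH : (N <= H)%N).

Definition separated (y : T -> R) := forall t t', S t -> S t' -> t != t' ->
  forall k : int, N%:R^-1 <= `|y t - y t' - k%:~R|.

Definition fr (x : R) : R := x - (Num.floor x)%:~R.

Lemma fr_itv x : 0 <= fr x < 1.
Proof.
have /andP[h1 h2] := Num.Theory.floor_itv x.
rewrite /fr subr_ge0 h1 /= ltrBlDl; move: h2; by rewrite intrD.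
Qed.

Let cell (y : T -> R) t : nat := Num.truncn (N%:R * fr (y t)).

Let NR : 0 < N%:R :> R. Proof. by rewrite ltr0n. Qed.

Lemma cell_itv y t : (cell y t)%:R <= N%:R * fr (y t) < (cell y t).+1%:R.
Proof.
by apply: truncn_itv; rewrite mulr_ge0 ?(ltW NR) //; case/andP: (fr_itv (y t)).
Qed.

Lemma cell_lt y t : (cell y t < N)%N.
Proof.
have /andP[h1 _] := cell_itv y t; have /andP[_ h2] := fr_itv (y t).
rewrite -(ltr_nat R); apply: le_lt_trans h1 _.
by rewrite -[X in _ < X]mulr1 ltr_pM2l.
Qed.

Lemma cell_inj y t t' : separated y -> S t -> S t' -> cell y t = cell y t' -> t = t'.
Proof.
move=> sy St St' E; apply/eqP/negPn/negP => tt.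
have /andP[h1 h2] := cell_itv y t; have /andP[h3 h4] := cell_itv y t'.
rewrite E in h1 h2.
have := sy t t' St St' tt (Num.floor (y t) - Num.floor (y t')).
rewrite leNgt => /negP; apply.
have -> : y t - y t' - (Num.floor (y t) - Num.floor (y t'))%:~R = fr (y t) - fr (y t').
  by rewrite /fr intrB; ring.
rewrite -(ltr_pM2l NR) mulfV ?gt_eqF // -[X in X * _]gtr0_norm // -normrM mulrBr.
rewrite -natr1 in h2 h4; rewrite ltr_norml; apply/andP; split; lra.
Qed.

(** A bound for the Fejer kernel of length [2 H] on the cell from [k / N] to [(k + 1) / N] of the
    circle: the trivial [(2 H)^2] on the two cells touching 0, the inverse square of the distance to
    0, from either side, on the others. *)
Definition cellbound (k : nat) : R :=
  if (k == 0)%N || (k == N.-1)%N then 4 * H%:R ^+ 2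
  else 4 * N%:R ^+ 2 * ((k%:R ^+ 2)^-1 + ((N.-1 - k)%:R ^+ 2)^-1).

Lemma cellbound_ge0 k : 0 <= cellbound k.
Proof.
rewrite /cellbound; case: ifP => _; first by rewrite mulr_ge0 ?sqr_ge0.
by rewrite !mulr_ge0 ?sqr_ge0 // addr_ge0 // invr_ge0 sqr_ge0.
Qed.

Lemma fejer_cell y t : fejer H.*2 (2 * pi * y t) <= cellbound (cell y t).
Proof.
rewrite /cellbound; case: ifP => [_|/negbT].
  apply: le_trans (fejer_le _ _) _; rewrite -muln2 natrM; lra.
rewrite negb_or => /andP[k0 kN].
have E : y t = fr (y t) + (Num.floor (y t))%:~R by rewrite /fr subrK.
rewrite {1}E fejer_per.
have /andP[h1 h2] := cell_itv y t; have kl := cell_lt y t.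
set k := cell y t in k0 kN h1 h2 kl *; set f := fr (y t) in h1 h2 *.
have kp : 0 < k%:R :> R by rewrite ltr0n lt0n.
have mE : (N.-1 - k)%:R + k.+1%:R = N%:R :> R.
  rewrite -natrD; congr (_%:R).
  by rewrite addnS subnK ?prednK // -ltnS prednK.
have mp : 0 < (N.-1 - k)%:R :> R.
  by rewrite ltr0n subn_gt0 ltn_neqAle kN -ltnS prednK.
set m := (N.-1 - k)%:R in mE mp *.
have B (d : R) : 0 < d -> d <= f -> d <= 1 - f -> fejer H.*2 (2 * pi * f) <= 4 / d ^+ 2.
  exact: fejer_small.
have q1 : 0 < k%:R ^+ 2 :> R by rewrite exprn_gt0.
have q2 : 0 < m ^+ 2 :> R by rewrite exprn_gt0.
have X (d : R) : 0 < d -> 4 / (d / N%:R) ^+ 2 = 4 * N%:R ^+ 2 * (d ^+ 2)^-1.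
  by move=> d0; field; rewrite !gt_eqF.
have N2 : 0 <= 4 * N%:R ^+ 2 :> R by rewrite mulr_ge0 ?sqr_ge0.
have [km|mk] := lerP k%:R m.
  apply: le_trans (B (k%:R / N%:R) _ _ _) _.
  - by rewrite divr_gt0.
  - by rewrite ler_pdivrMr // mulrC.
  - rewrite ler_pdivrMr // mulrBl mul1r mulrC; lra.
  rewrite X // ler_wpM2l // lerDl invr_ge0; exact: ltW.
apply: le_trans (B (m / N%:R) _ _ _) _.
- by rewrite divr_gt0.
- rewrite ler_pdivrMr // mulrC; lra.
- rewrite ler_pdivrMr // mulrBl mul1r mulrC; lra.
rewrite X // ler_wpM2l // lerDr invr_ge0; exact: ltW.
Qed.

Lemma sum_cellbound : \sum_(k < N) cellbound k <= 24 * H%:R ^+ 2.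
Proof.
have NH' : N%:R ^+ 2 <= H%:R ^+ 2 :> R by rewrite ler_pXn2r ?nnegrE // ler_nat.
pose f (k : nat) : R := (k%:R ^+ 2)^-1.
have f0 k : 0 <= f k by rewrite invr_ge0 sqr_ge0.
have sf : \sum_(k < N) f k <= 2.
  rewrite -(big_mkord xpredT f) big_ltn // /f expr0n invr0 add0r.
  exact: sum_inv_sq_le.
have sf' : \sum_(k < N) f (N.-1 - k)%N <= 2.
  rewrite (reindex_inj rev_ord_inj) /=.
  apply: le_trans sf; apply: ler_sum => k _.
  suff -> : (N.-1 - (N - k.+1) = k)%N by [].
  by rewrite -subn1 subnAC subn1 subKn // .
apply: (@le_trans _ _ (\sum_(k < N) (((k == 0 :> nat)%:R + (k == N.-1 :> nat)%:R) * (4 * H%:R ^+ 2) +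
    4 * N%:R ^+ 2 * (f k + f (N.-1 - k)%N)))).
  apply: ler_sum => k _; rewrite /cellbound -/(f k) -/(f (N.-1 - k)%N).
  have h4 : 0 <= 4 * H%:R ^+ 2 :> R by rewrite mulr_ge0 ?sqr_ge0.
  have n4 : 0 <= 4 * N%:R ^+ 2 :> R by rewrite mulr_ge0 ?sqr_ge0.
  have := mulr_ge0 n4 (addr_ge0 (f0 k) (f0 (N.-1 - k)%N)).
  set X := 4 * N%:R ^+ 2 * _ => X0; set Y := 4 * _ in h4 *.
  by case: (k == 0 :> nat); case: (k == N.-1 :> nat) => /=; lra.
rewrite big_split /= -mulr_sumr -mulr_suml !big_split /=.
have D (j : nat) : \sum_(k < N) (k == j :> nat)%:R <= 1 :> R.
  have [jN|jN] := ltnP j N.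
    rewrite (bigD1 (Ordinal jN)) //= eqxx big1 ?addr0 // => k /eqP kj.
    by case: eqP => // E; case: kj; apply: val_inj.
  by rewrite big1 // => k _; case: eqP => // E; move: (ltn_ord k); rewrite E ltnNge jN.
have := D 0%N; have := D N.-1.
set d0 := \sum_(k < N) _; set d1 := \sum_(k < N) _ => hd1 hd0.
have h4 : 0 <= H%:R ^+ 2 :> R by rewrite sqr_ge0.
have n4 : 0 <= N%:R ^+ 2 :> R by rewrite sqr_ge0.
set X := \sum_(k < N) f k in sf *; set Y := \sum_(k < N) f _ in sf' *.
have : (d1 + d0) * (4 * H%:R ^+ 2) <= 2 * (4 * H%:R ^+ 2).
  by rewrite ler_wpM2r ?mulr_ge0 //; lra.
have : 4 * N%:R ^+ 2 * (X + Y) <= 4 * N%:R ^+ 2 * 4.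
  by rewrite ler_wpM2l ?mulr_ge0 //; lra.
lra.
Qed.

(** Points at mutual distance at least [1/N] modulo 1 fall into distinct cells, so a row sum is at
    most the sum of the cell bounds. *)
Lemma fejer_row y : separated y ->
  \sum_(t | S t) fejer H.*2 (2 * pi * y t) <= 24 * H%:R ^+ 2.
Proof.
move=> sy; apply: le_trans sum_cellbound.
apply: (@le_trans _ _ (\sum_(t | S t) cellbound (cell y t))).
  by apply: ler_sum => t _; exact: fejer_cell.
rewrite (partition_big (fun t => Ordinal (cell_lt y t)) xpredT) //=.
apply: ler_sum => k _.
have [t /andP[St /eqP tk]|H0] := pickP (fun t => S t && (Ordinal (cell_lt y t) == k)); last first.
  by rewrite big_pred0 // cellbound_ge0.
rewrite (bigD1 t) /= ?St ?tk ?eqxx //.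
rewrite big1 ?addr0 => [|t' /andP[/andP[St' /eqP tk'] tt]].
  by rewrite -tk.
by case/eqP: tt; apply: (cell_inj sy) => //; have := congr1 val tk'; rewrite -tk.
Qed.

(** Duality: the left side [V] is the sum of [a n * Z1 n], so Cauchy-Schwarz reduces to bounding the
    sum of [Z1 n ^ 2]. Every [n < H] is a difference [u - v] with [u, v < 2 H] in at least [H] ways;
    summing over all such [u, v] instead yields a quadratic form with Fejer kernel, and Schur's test
    with [fejer_row] bounds it by [24 H^2 V]. *)
Lemma large_sieve_points (x : T -> R) (a : nat -> R) : separated x ->
  \sum_(t | S t) ((\sum_(n < H) a n * cos (n%:R * (2 * pi * x t))) ^+ 2 +
                  (\sum_(n < H) a n * sin (n%:R * (2 * pi * x t))) ^+ 2)
  <= 24 * H%:R * \sum_(n < H) a n ^+ 2.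
Proof.
move=> sx; pose w t := 2 * pi * x t.
pose C t := \sum_(n < H) a n * cos (n%:R * w t).
pose D t := \sum_(n < H) a n * sin (n%:R * w t).
pose E t := C t ^+ 2 + D t ^+ 2.
set V := \sum_(t | S t) _; rewrite -[V]/(\sum_(t | S t) E t).
have E0 t : 0 <= E t by rewrite addr_ge0 ?sqr_ge0.
have V0 : 0 <= \sum_(t | S t) E t by apply: sumr_ge0.
pose Z1 (m : R) := \sum_(t | S t) (C t * cos (m * w t) + D t * sin (m * w t)).
pose Z2 (m : R) := \sum_(t | S t) (C t * sin (m * w t) - D t * cos (m * w t)).
have VE : \sum_(t | S t) E t = \sum_(n < H) a n * Z1 n%:R.
  under [RHS]eq_bigr do rewrite mulr_sumr.
  rewrite exchange_big /=; apply: eq_bigr => t _.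
  have -> : E t = C t * (\sum_(n < H) a n * cos (n%:R * w t)) +
                  D t * (\sum_(n < H) a n * sin (n%:R * w t)) by rewrite /E !expr2.
  rewrite !mulr_sumr -big_split /=; apply: eq_bigr => n _; ring.
pose B := \sum_(u < H.*2) \sum_(v < H.*2) (Z1 (u%:R - v%:R) ^+ 2 + Z2 (u%:R - v%:R) ^+ 2).
have HB : H%:R * \sum_(n < H) Z1 n%:R ^+ 2 <= B.
  rewrite /B exchange_big /= -[H in H%:R]card_ord mulr_natl -sumr_const.
  have lH : (H <= H.*2)%N by rewrite -addnn leq_addr.
  have pos u (v : nat) : 0 <= Z1 (u%:R - v%:R) ^+ 2 + Z2 (u%:R - v%:R) ^+ 2 :> R.
    by rewrite addr_ge0 ?sqr_ge0.
  rewrite -(big_mkord xpredT (fun v => \sum_(u < H.*2) (Z1 (u%:R - v%:R) ^+ 2 + Z2 (u%:R - v%:R) ^+ 2))).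
  rewrite (big_cat_nat (n := H)) //= ler_wpDr //.
    by apply: sumr_ge0 => v _; apply: sumr_ge0 => u _; exact: pos.
  rewrite big_mkord; apply: ler_sum => v _.
  rewrite -(big_mkord xpredT (fun u => Z1 (u%:R - v%:R) ^+ 2 + Z2 (u%:R - v%:R) ^+ 2)).
  have vH : (v <= v + H)%N by rewrite leq_addr.
  have vH2 : (v + H <= H.*2)%N by rewrite -addnn leq_add2r ltnW.
  rewrite (big_cat_nat (n := v)) //=; last exact: leq_trans vH2.
  rewrite (big_cat_nat (n := (v + H)%N) (p := H.*2)) //= ler_wpDl //.
    by apply: sumr_ge0 => u _; exact: pos.
  rewrite ler_wpDr //; first by apply: sumr_ge0 => u _; exact: pos.
  rewrite (sum_shift v H (fun u => Z1 (u%:R - v%:R) ^+ 2 + Z2 (u%:R - v%:R) ^+ 2)).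
  by apply: ler_sum => n _; rewrite natrD addrK lerDl sqr_ge0.
have BE : B = \sum_(t | S t) \sum_(t' | S t') (C t * C t' + D t * D t') * fejer H.*2 (w t - w t').
  have Zm m : Z1 m ^+ 2 + Z2 m ^+ 2 = \sum_(t | S t) \sum_(t' | S t')
     ((C t * C t' + D t * D t') * cos (m * (w t - w t')) -
      (C t * D t' - D t * C t') * sin (m * (w t - w t'))).
    rewrite !expr2 /Z1 /Z2 !big_distrlr /= -big_split /=; apply: eq_bigr => t _.
    rewrite -big_split /=; apply: eq_bigr => t' _.
    rewrite [m * (_ - _)]mulrBr cosB sinB; ring.
  rewrite /B; under eq_bigr do under eq_bigr do rewrite Zm.
  under eq_bigr do rewrite exchange_big /=.
  rewrite exchange_big /=; apply: eq_bigr => t _.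
  under eq_bigr do rewrite exchange_big /=.
  rewrite exchange_big /=; apply: eq_bigr => t' _.
  set th := w t - w t'.
  transitivity (\sum_(u < H.*2) \sum_(v < H.*2)
     ((C t * C t' + D t * D t') * (cos (u%:R * th) * cos (v%:R * th) + sin (u%:R * th) * sin (v%:R * th)) -
      (C t * D t' - D t * C t') * (sin (u%:R * th) * cos (v%:R * th) - cos (u%:R * th) * sin (v%:R * th)))).
    by apply: eq_bigr => u _; apply: eq_bigr => v _; rewrite [(_ - _) * th]mulrBl cosB sinB.
  under eq_bigr do rewrite sumrB -!mulr_sumr big_split sumrB /= -!mulr_sumr -/(dsum1 _ _) -/(dsum2 _ _).
  rewrite sumrB -!mulr_sumr big_split sumrB /= -!mulr_suml -/(dsum1 _ _) -/(dsum2 _ _).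
  rewrite /fejer !expr2; ring.
have rowB : B <= 24 * H%:R ^+ 2 * \sum_(t | S t) E t.
  rewrite BE.
  apply: (@le_trans _ _ (\sum_(t | S t) \sum_(t' | S t') (E t / 2 + E t' / 2) * fejer H.*2 (w t - w t'))).
    apply: ler_sum => t _; apply: ler_sum => t' _; rewrite ler_wpM2r ?fejer_ge0 //.
    rewrite /E; have := sqr_ge0 (C t - C t'); have := sqr_ge0 (D t - D t'); lra.
  under eq_bigr do under eq_bigr do rewrite mulrDl.
  under eq_bigr do rewrite big_split /=.
  rewrite big_split /= [X in _ + X]exchange_big /=.
  have r1 : \sum_(t | S t) \sum_(t' | S t') E t / 2 * fejer H.*2 (w t - w t') <=
      \sum_(t | S t) E t / 2 * (24 * H%:R ^+ 2).
    apply: ler_sum => t St; rewrite -mulr_sumr ler_wpM2l //; first by have := E0 t; lra.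
    under eq_bigr do rewrite /w -mulrBr.
    apply: (fejer_row (y := fun t' => x t - x t')) => t1 t2 s1 s2 n12 k.
    have -> : x t - x t1 - (x t - x t2) - k%:~R = x t2 - x t1 - k%:~R by ring.
    by apply: sx => //; rewrite eq_sym.
  have r2 : \sum_(t' | S t') \sum_(t | S t) E t' / 2 * fejer H.*2 (w t - w t') <=
      \sum_(t' | S t') E t' / 2 * (24 * H%:R ^+ 2).
    apply: ler_sum => t' St; rewrite -mulr_sumr ler_wpM2l //; first by have := E0 t'; lra.
    under eq_bigr do rewrite /w -mulrBr.
    apply: (fejer_row (y := fun t => x t - x t')) => t1 t2 s1 s2 n12 k.
    have -> : x t1 - x t' - (x t2 - x t') - k%:~R = x t1 - x t2 - k%:~R by ring.
    exact: sx.
  apply: le_trans (lerD r1 r2) _; rewrite -!mulr_suml; lra.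
have H0 : 0 < H%:R :> R by rewrite ltr0n (leq_trans N0).
set v := \sum_(t | S t) E t in V0 VE rowB *.
have CS := @Cauchy_Schwarz_seq R 'I_H (index_enum _) a (fun n => Z1 n%:R).
rewrite -VE in CS.
set s := \sum_(n < H) a n ^+ 2 in CS *.
have s0 : 0 <= s by apply: sumr_ge0 => n _; rewrite sqr_ge0.
set z := \sum_(n < H) Z1 n%:R ^+ 2 in CS HB.
have zv : z <= 24 * H%:R * v.
  rewrite -(ler_pM2l H0); apply: le_trans HB _; apply: le_trans rowB _; lra.
have vv : v * v <= (24 * H%:R * s) * v.
  rewrite -expr2; apply: le_trans CS _; apply: le_trans (ler_wpM2l s0 zv) _; lra.
have [v1|v1] := eqVneq v 0; first by rewrite v1 !mulr_ge0.
by rewrite -(ler_pM2r (_ : 0 < v)) // lt_neqAle eq_sym v1.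
Qed.

End LargeSievePoints.

(** * Sums over squarefree moduli *)

Section Sublists.
Variable R : realType.
Implicit Types (P rho : seq nat) (F G : seq nat -> R).

Fixpoint ssum P F : R :=
  if P is p :: P' then ssum P' F + ssum P' (fun rho => F (p :: rho)) else F [::].

Lemma le_ssum P F G : (forall rho, subseq rho P -> F rho <= G rho) -> ssum P F <= ssum P G.
Proof.
elim: P F G => [|p P IH] F G FG /=; first exact: FG.
apply: lerD; apply: IH => rho rP; apply: FG.
  by apply: subseq_trans rP _; exact: subseq_cons.
by rewrite /= eqxx.
Qed.

Lemma eq_ssum P F G : (forall rho, subseq rho P -> F rho = G rho) -> ssum P F = ssum P G.
Proof.
move=> FG; apply/eqP; rewrite eq_le.
by apply/andP; split; apply: le_ssum => z /FG ->.
Qed.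

Lemma ssum0 P : ssum P (fun=> 0) = 0.
Proof. by elim: P => //= p P ->; rewrite addr0. Qed.

Lemma ssumD P F G : ssum P (fun z => F z + G z) = ssum P F + ssum P G.
Proof. by elim: P F G => [|p P IH] F G //=; rewrite !IH addrACA. Qed.

Lemma ssumZ P c F : ssum P (fun z => c * F z) = c * ssum P F.
Proof. by elim: P F => [|p P IH] F //=; rewrite !IH mulrDr. Qed.

Lemma ssum_ge0 P F : (forall rho, subseq rho P -> 0 <= F rho) -> 0 <= ssum P F.
Proof. by move=> F0; rewrite -(ssum0 P); exact: le_ssum. Qed.

Lemma ssum_swap (I : Type) (s : seq I) P (F : I -> seq nat -> R) :
  \sum_(x <- s) ssum P (F x) = ssum P (fun z => \sum_(x <- s) F x z).
Proof.
elim: s => [|x s IH]; first by rewrite big_nil -[LHS](ssum0 P); apply: eq_ssum => z _; rewrite big_nil.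
by rewrite big_cons IH -ssumD; apply: eq_ssum => z _; rewrite big_cons.
Qed.

End Sublists.

(** * Fractions with squarefree denominator *)

Section Frequencies.
Variable R : realType.
Implicit Types (P : seq nat).

Lemma sin_pi_eq0 (y : R) : sin (pi * y) = 0 -> y = (Num.floor y)%:~R.
Proof.
move=> s0; have /andP[f0 f1] := fr_itv y.
have c1 : cos (2 * pi * y) = 1.
  have -> : 2 * pi * y = pi * y *+ 2 by rewrite -mulr_natl; ring.
  by rewrite cos_mulr2n cos2sin2 s0; ring.
have c2 : cos (2 * pi * fr y) = 1.
  have E : 2 * pi * y = 2 * pi * fr y + (Num.floor y)%:~R * (2 * pi) by rewrite /fr; ring.
  by rewrite -[RHS]c1 E cos2piz.
have s2 : sin (pi * fr y) = 0.
  have E : 2 * pi * fr y = pi * fr y *+ 2 by rewrite -mulr_natl; ring.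
  move: c2; rewrite E cos_mulr2n cos2sin2 => c2.
  apply/eqP; rewrite -sqrf_eq0; apply/eqP; lra.
have [f00|fn0] := eqVneq (fr y) 0; first by apply/eqP; rewrite -subr_eq0; apply/eqP.
have p0 := pi_gt0 R; have fp : 0 < fr y by rewrite lt_neqAle eq_sym fn0.
suff : 0 < sin (pi * fr y) by rewrite s2 ltxx.
by apply: sin_gt0_pi; rewrite mulr_gt0 //= -[X in _ < X]mulr1 ltr_pM2l.
Qed.

Lemma modn_int_eq (l n n' : nat) (k : int) : (0 < l)%N ->
  n%:R - n'%:R = l%:R * k%:~R :> R -> (n == n' %[mod l])%N.
Proof.
move=> l0 E.
have {}E : (n%:Z - n'%:Z = l%:Z * k)%R.
  by apply: (@intr_inj R); rewrite rmorphB rmorphM /= -!pmulrn.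
have : (n%:Z == n'%:Z %[mod l%:Z])%Z by rewrite eqz_mod_dvd E dvdz_mulr.
by rewrite !modz_nat.
Qed.

Lemma sum_roots (l n n' : nat) : (0 < l)%N ->
  \sum_(a < l) cos (2 * pi * (a%:R / l%:R) * (n%:R - n'%:R)) = l%:R * (n == n' %[mod l])%N%:R :> R
  /\ \sum_(a < l) sin (2 * pi * (a%:R / l%:R) * (n%:R - n'%:R)) = 0 :> R.
Proof.
move=> l0; have lr : l%:R != 0 :> R by rewrite pnatr_eq0 -lt0n.
set d : R := n%:R - n'%:R; set x := 2 * pi * d / l%:R.
have -> : \sum_(a < l) cos (2 * pi * (a%:R / l%:R) * d) = dsum1 l x.
  by apply: eq_bigr => a _; congr cos; rewrite /x; field.
have -> : \sum_(a < l) sin (2 * pi * (a%:R / l%:R) * d) = dsum2 l x.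
  by apply: eq_bigr => a _; congr sin; rewrite /x; field.
have dE : d = (n%:Z - n'%:Z)%:~R by rewrite /d intrB -!pmulrn.
case: eqP => [nn|/eqP nn]; rewrite ?mulr1 ?mulr0.
  pose k : int := (n %/ l)%N%:Z - (n' %/ l)%N%:Z.
  have xE : x = k%:~R * (2 * pi).
    have -> : x = 2 * pi * (d / l%:R) by rewrite /x; field.
    suff -> : d / l%:R = k%:~R by ring.
    apply: (mulIf lr); rewrite divfK // /d /k {1}(divn_eq n l) {1}(divn_eq n' l) nn.
    by rewrite !natrD !natrM intrB -!pmulrn; ring.
  have E (a : nat) : a%:R * x = 0 + (a%:Z * k)%:~R * (2 * pi).
    by rewrite xE intrM -pmulrn; ring.
  split.
    rewrite /dsum1; under eq_bigr do rewrite E cos2piz cos0.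
    by rewrite sumr_const card_ord.
  rewrite /dsum2; under eq_bigr do rewrite E sin2piz sin0.
  by rewrite sumr_const card_ord mul0rn.
have s0 : sin (x / 2) != 0.
  have -> : x / 2 = pi * (d / l%:R) by rewrite /x; field.
  apply: contra nn => /eqP/sin_pi_eq0 E; apply: (modn_int_eq (k := Num.floor (d / l%:R))) => //.
  by rewrite -E -/d mulrC divfK.
have lx : l%:R * x - x / 2 = - (x / 2) + (n%:Z - n'%:Z)%:~R * (2 * pi).
  by rewrite -dE /x; field.
have s20 : 2 * sin (x / 2) != 0 by rewrite mulf_neq0 // pnatr_eq0.
split; apply: (mulfI s20); rewrite mulr0.
  by rewrite dsum1E lx sin2piz sinN addNr.
by rewrite dsum2E lx cos2piz cosN subrr.
Qed.

(** A frequency modulo 1 is coded by one numerator per prime, as in partial fractions: [xf] is the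
    fraction itself, and [qf], the product of the primes with nonzero numerator, is its reduced
    denominator. *)
Fixpoint Tf P : finType := if P is l :: P' then ('I_l * Tf P')%type else unit.

Fixpoint xf P : Tf P -> R :=
  if P is l :: P' then fun t => (t.1 : nat)%:R / l%:R + @xf P' t.2 else fun=> 0.

Fixpoint qf P : Tf P -> nat :=
  if P is l :: P' then fun t => if (t.1 == 0 :> nat)%N then @qf P' t.2 else (l * @qf P' t.2)%N
  else fun=> 1%N.

(** The sum factors over primes: numerator 0 contributes 1, the nonzero numerators together a
    Ramanujan sum [l [n = n' mod l] - 1]. The vanishing of the sine sum is part of the induction
    because the addition formulas mix the two. *)
Lemma char_sum P (v : nat -> R) (n n' : nat) : all (leq 1) P ->
  \sum_(t : Tf P) v (@qf P t) * cos (2 * pi * @xf P t * (n%:R - n'%:R)) =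
  ssum P (fun rho => v (\prod_(l <- rho) l)%N *
                     \prod_(l <- rho) (l%:R * (n == n' %[mod l])%N%:R - 1))
  /\ \sum_(t : Tf P) v (@qf P t) * sin (2 * pi * @xf P t * (n%:R - n'%:R)) = 0.
Proof.
set d : R := n%:R - n'%:R.
elim: P v => [|l P IH] v /=.
  have U (F : unit -> R) : \sum_(t : unit) F t = F tt.
    by rewrite (bigD1 tt) //= big1 ?addr0 // => [[]].
  by move=> _; rewrite !U !big_nil mulr0 mul0r cos0 sin0 mulr0.
case/andP => l0 P0.
have [c0 s0] := sum_roots n n' l0.
have [c1 s1] := IH v P0; have [c2 s2] := IH (fun q => v (l * q)%N) P0.
have l0R : l%:R != 0 :> R by rewrite pnatr_eq0 -lt0n.
pose a0 : 'I_l := Ordinal l0.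
have split_sum (F : R -> R) : \sum_(t : 'I_l * Tf P) v (if (t.1 == 0 :> nat)%N then @qf P t.2 else (l * @qf P t.2)%N) *
     F (2 * pi * (t.1%:R / l%:R + @xf P t.2) * d) =
   \sum_(t : Tf P) v (@qf P t) * F (2 * pi * @xf P t * d) +
   \sum_(a : 'I_l | a != a0) \sum_(t : Tf P) v (l * @qf P t)%N *
     F (2 * pi * (a%:R / l%:R) * d + 2 * pi * @xf P t * d).
  rewrite -(pair_big xpredT xpredT (fun a t => v (if (nat_of_ord a == 0)%N then @qf P t else (l * @qf P t)%N) *
     F (2 * pi * (a%:R / l%:R + @xf P t) * d))) /= (bigD1 a0) //=; congr (_ + _).
    by apply: eq_bigr => t _; rewrite mul0r add0r.
  apply: eq_bigr => a aa0; apply: eq_bigr => t _.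
  rewrite ifN; last by apply: contra aa0 => /eqP E; apply/eqP/val_inj.
  by congr (_ * F _); ring.
have c0' : \sum_(a : 'I_l | a != a0) cos (2 * pi * (a%:R / l%:R) * d) =
     l%:R * (n == n' %[mod l])%N%:R - 1.
  by rewrite -c0 [in RHS](bigD1 a0) //= mul0r mulr0 mul0r cos0 addrC addrK.
have s0' : \sum_(a : 'I_l | a != a0) sin (2 * pi * (a%:R / l%:R) * d) = 0.
  by rewrite -[RHS]s0 [in RHS](bigD1 a0) //= mul0r mulr0 mul0r sin0 add0r.
have A : \sum_(a : 'I_l | a != a0) \sum_(t : Tf P) v (l * @qf P t)%N *
     cos (2 * pi * (a%:R / l%:R) * d + 2 * pi * @xf P t * d) =
   (l%:R * (n == n' %[mod l])%N%:R - 1) *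
   \sum_(t : Tf P) v (l * @qf P t)%N * cos (2 * pi * @xf P t * d).
  rewrite -c0' mulr_suml; apply: eq_bigr => a _.
  transitivity (\sum_(t : Tf P) (cos (2 * pi * (a%:R / l%:R) * d) * (v (l * @qf P t)%N * cos (2 * pi * @xf P t * d)) -
     sin (2 * pi * (a%:R / l%:R) * d) * (v (l * @qf P t)%N * sin (2 * pi * @xf P t * d)))).
    by apply: eq_bigr => t _; rewrite cosD; ring.
  by rewrite sumrB -!mulr_sumr s2 mulr0 subr0.
have B : \sum_(a : 'I_l | a != a0) \sum_(t : Tf P) v (l * @qf P t)%N *
     sin (2 * pi * (a%:R / l%:R) * d + 2 * pi * @xf P t * d) = 0.
  transitivity (\sum_(a : 'I_l | a != a0) sin (2 * pi * (a%:R / l%:R) * d) *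
     (\sum_(t : Tf P) (v (l * @qf P t)%N * cos (2 * pi * @xf P t * d)))).
    apply: eq_bigr => a _.
    transitivity (\sum_(t : Tf P) (sin (2 * pi * (a%:R / l%:R) * d) * (v (l * @qf P t)%N * cos (2 * pi * @xf P t * d)) +
       cos (2 * pi * (a%:R / l%:R) * d) * (v (l * @qf P t)%N * sin (2 * pi * @xf P t * d)))).
      by apply: eq_bigr => t _; rewrite sinD; ring.
    by rewrite big_split /= -!mulr_sumr s2 mulr0 addr0.
  by rewrite -mulr_suml s0' mul0r.
split.
  rewrite (split_sum cos) A c1 c2 -ssumZ; congr (_ + _); apply: eq_ssum => rho _.
  by rewrite !big_cons mulrCA.
by rewrite (split_sum sin) B s1 addr0.
Qed.

Lemma qf_gt0 P (t : Tf P) : all (leq 1) P -> (0 < qf t)%N.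
Proof.
elim: P t => [|l P IH] //= [a t] /andP[l0 P0] /=.
by case: ifP => _; rewrite ?muln_gt0 ?l0 IH.
Qed.

Lemma qf_xf_int P (t : Tf P) : all (leq 1) P -> (qf t)%:R * xf t \is a Num.int.
Proof.
elim: P t => [|l P IH] /=; first by move=> t _; rewrite mulr0 rpred0.
move=> [a t] /andP[l0 P0] /=; have l0R : l%:R != 0 :> R by rewrite pnatr_eq0 -lt0n.
case: eqP => [->|_]; first by rewrite mul0r add0r IH.
rewrite natrM mulrDr rpredD //.
  have -> : l%:R * (qf t)%:R * (a%:R / l%:R) = (qf t)%:R * a%:R :> R by field.
  by rewrite rpredM // rpred_nat.
by rewrite -mulrA rpredM ?IH // rpred_nat.
Qed.

Lemma prod_xf_int P (t : Tf P) : all (leq 1) P -> (\prod_(l <- P) l)%N%:R * xf t \is a Num.int.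
Proof.
elim: P t => [|l P IH] /=; first by move=> t _; rewrite mulr0 rpred0.
move=> [a t] /andP[l0 P0] /=; have l0R : l%:R != 0 :> R by rewrite pnatr_eq0 -lt0n.
rewrite big_cons natrM mulrDr rpredD //.
  set M := (\prod_(j <- P) j)%N.
  have -> : l%:R * M%:R * (a%:R / l%:R) = M%:R * a%:R :> R by field.
  by rewrite rpredM // rpred_nat.
by rewrite -mulrA rpredM ?IH // rpred_nat.
Qed.

Lemma xf_inj P (t t' : Tf P) : uniq P -> all prime P -> xf t - xf t' \is a Num.int -> t = t'.
Proof.
elim: P t t' => [|l P IH] /=; first by move=> [] [].
move=> [a t] [a' t'] /= /andP[lP uP] /andP[pl pP] H.
have P0 : all (leq 1) P by apply/allP => q /(allP pP)/prime_gt0.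
have l0 := prime_gt0 pl; have l0R : l%:R != 0 :> R by rewrite pnatr_eq0 -lt0n.
set M := (\prod_(j <- P) j)%N.
have cM : coprime l M.
  rewrite prime_coprime //; apply/negP => lM; have : exists2 q, q \in P & (l %| q)%N.
    move: lM; rewrite /M; elim: (P) => [|q P' IH']; first by rewrite big_nil dvdn1 => /eqP E; rewrite E in pl.
    rewrite big_cons Euclid_dvdM // => /orP[lq|/IH' [q' qP lq]].
      by exists q; rewrite ?mem_head.
    by exists q'; rewrite // inE qP orbT.
  case=> q qP; rewrite dvdn_prime2 ?(allP pP q qP) // => /eqP E.
  by move: lP; rewrite E qP.
have I1 : M%:R * (a%:R - a'%:R) / l%:R \is a @Num.int R.
  have -> : M%:R * (a%:R - a'%:R) / l%:R = M%:R * (a%:R / l%:R + xf t - (a'%:R / l%:R + xf t')) -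
     (M%:R * xf t - M%:R * xf t') :> R by field.
  by rewrite rpredB ?rpredM ?rpred_nat // rpredB // prod_xf_int.
have aa : a = a'.
  have /intrP[k kE] := I1.
  have : (M * a == M * a' %[mod l])%N.
    apply: (modn_int_eq (k := k)) => //.
    by rewrite -kE [RHS]mulrC divfK // !natrM mulrBr.
  move=> E; apply: val_inj => /=.
  rewrite -[LHS](modn_small (ltn_ord a)) -[RHS](modn_small (ltn_ord a')); apply/eqP.
  have G (x y : nat) : (x <= y)%N -> (M * x == M * y %[mod l])%N -> (x == y %[mod l])%N.
    move=> xy; rewrite eq_sym eqn_mod_dvd ?leq_mul2l ?xy ?orbT // -mulnBr Gauss_dvdr // => xl.
    by rewrite eq_sym eqn_mod_dvd.
  by case/orP: (leq_total a a') => le; [apply: G|rewrite eq_sym; apply: G => //; rewrite eq_sym].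
subst a'; have {}H : xf t - xf t' \is a Num.int by move: H; rewrite opprD addrACA subrr add0r.
by rewrite (IH t t').
Qed.

(** Multiplying the difference by both denominators gives a nonzero integer, nonzero by [xf_inj]; so
    the distance is at least [1 / Q^2]. *)
Lemma xf_separated P Q : uniq P -> all prime P -> (0 < Q)%N ->
  separated (fun t : Tf P => (qf t <= Q)%N) (Q * Q)%N (@xf P).
Proof.
move=> uP pP Q0 t t' /= tQ tQ' tt k.
have P0 : all (leq 1) P by apply/allP => q /(allP pP)/prime_gt0.
have q0 : 0 < (qf t)%:R :> R by rewrite ltr0n qf_gt0.
have q0' : 0 < (qf t')%:R :> R by rewrite ltr0n qf_gt0.
set y := xf t - xf t' - k%:~R.
have yI : (qf t)%:R * (qf t')%:R * y \is a Num.int.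
  have -> : (qf t)%:R * (qf t')%:R * y = (qf t')%:R * ((qf t)%:R * xf t) -
    (qf t)%:R * ((qf t')%:R * xf t') - (qf t)%:R * (qf t')%:R * k%:~R by rewrite /y; ring.
  apply: rpredB; last by apply: rpredM; [apply: rpredM; exact: natr_int|exact: intr_int].
  by apply: rpredB; apply: rpredM; rewrite ?qf_xf_int //; exact: natr_int.
have yn0 : y != 0.
  rewrite subr_eq0; apply: contra tt => /eqP E; apply/eqP; apply: xf_inj => //.
  by rewrite E intr_int.
have : 1 <= `|(qf t)%:R * (qf t')%:R * y|.
  by apply: norm_intr_ge1 => //; apply: mulf_neq0 => //; apply: mulf_neq0; rewrite gt_eqF.
rewrite !normrM !normr_nat => H.
have Q0R : 0 < (Q * Q)%:R :> R by rewrite ltr0n muln_gt0 Q0.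
rewrite -[X in X <= _]mul1r ler_pdivrMr //; apply: le_trans H _.
rewrite mulrC ler_wpM2l // natrM; apply: ler_pM; by rewrite ?ler0n ?ler_nat.
Qed.

Lemma large_sieve P Q H (a : nat -> R) : uniq P -> all prime P -> (0 < Q)%N -> (Q * Q <= H)%N ->
  ssum P (fun rho => (\prod_(l <- rho) l <= Q)%N%:R *
    \sum_(n < H) \sum_(n' < H) a n * a n' *
      \prod_(l <- rho) (l%:R * (n == n' %[mod l])%N%:R - 1))
  <= 24 * H%:R * \sum_(n < H) a n ^+ 2.
Proof.
move=> uP pP Q0 QH.
have P0 : all (leq 1) P by apply/allP => q /(allP pP)/prime_gt0.
have QQ0 : (0 < Q * Q)%N by rewrite muln_gt0 Q0.
apply: le_trans (large_sieve_points QQ0 QH a (xf_separated uP pP Q0)).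
rewrite le_eqVlt; apply/orP; left; apply/eqP.
transitivity (\sum_(n < H) \sum_(n' < H) a n * a n' *
   \sum_(t : Tf P) (qf t <= Q)%N%:R * cos (2 * pi * xf t * (n%:R - n'%:R))).
  under [RHS]eq_bigr => n _.
    under eq_bigr => n' _.
      have [-> _] := char_sum (fun q => (q <= Q)%N%:R) n n' P0; rewrite -ssumZ.
      over.
    rewrite ssum_swap.
    over.
  rewrite ssum_swap; apply: eq_ssum => rho _.
  rewrite mulr_sumr; apply: eq_bigr => n _; rewrite mulr_sumr; apply: eq_bigr => n' _; ring.
under eq_bigr do under eq_bigr do rewrite mulr_sumr.
under eq_bigr do rewrite exchange_big /=.
rewrite exchange_big /= [RHS]big_mkcond /=; apply: eq_bigr => t _.
case: (qf t <= Q)%N; last first.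
  by rewrite big1 // => n _; rewrite big1 // => n' _; rewrite mul0r mulr0.
rewrite !expr2 !big_distrlr /= -big_split /=; apply: eq_bigr => n _.
rewrite -big_split /=; apply: eq_bigr => n' _.
have -> : 2 * pi * xf t * (n%:R - n'%:R) = n%:R * (2 * pi * xf t) - n'%:R * (2 * pi * xf t) by ring.
rewrite cosB; ring.
Qed.

End Frequencies.

(** * The large sieve for sifted sequences *)

Section SieveGain.
Variable R : realType.
Implicit Types (P rho : seq nat) (v : nat -> R) (x y : nat -> R).

(** Collects, for fixed [rho], the terms of all larger sublists: the sum of [v (r * m)] times the
    [y]-weight of [m], where [r] is the product of [rho] and [m] runs over products of primes of [P]
    outside [rho]. *)
Fixpoint cofactor y P rho v : R :=
  if P is p :: P' then
    if ohead rho == Some p then cofactor y P' (behead rho) (fun q => v (p * q)%N)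
    else cofactor y P' rho (fun q => v q + y p * v (p * q)%N)
  else v 1%N.

Lemma ssum_prodD x y P v : uniq P ->
  ssum P (fun rho => v (\prod_(l <- rho) l)%N * \prod_(l <- rho) (x l + y l)) =
  ssum P (fun rho => \prod_(l <- rho) x l * cofactor y P rho v).
Proof.
elim: P v => [|p P IH] v /=; first by rewrite !big_nil mul1r mulr1.
case/andP => pP uP.
have -> : ssum P (fun rho => v (\prod_(l <- p :: rho) l)%N * \prod_(l <- p :: rho) (x l + y l)) =
   ssum P (fun rho => x p * (v (p * \prod_(l <- rho) l)%N * \prod_(l <- rho) (x l + y l))) +
   ssum P (fun rho => y p * v (p * \prod_(l <- rho) l)%N * \prod_(l <- rho) (x l + y l)).
  by rewrite -ssumD; apply: eq_ssum => rho _; rewrite !big_cons; ring.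
rewrite addrCA addrC; congr (_ + _).
  rewrite -ssumD.
  rewrite [RHS](_ : _ = ssum P (fun rho => \prod_(l <- rho) x l * cofactor y P rho (fun q => v q + y p * v (p * q)%N))); last first.
    apply: eq_ssum => rho rP; congr (_ * _).
    case: rho rP => [|l rho] //= rP; case: eqP => // -[E].
    by case/negP: pP; rewrite -E (mem_subseq rP) // mem_head.
  rewrite -(IH (fun q => v q + y p * v (p * q)%N)) //; apply: eq_ssum => rho _; ring.
rewrite ssumZ (IH (fun q => v (p * q)%N)) // -ssumZ; apply: eq_ssum => rho _.
by rewrite eqxx big_cons mulrA.
Qed.

Definition antin v := (forall q, 0 <= v q) /\ (forall q q', (q <= q')%N -> v q' <= v q).

Definition ysum y P v : R := ssum P (fun m => v (\prod_(l <- m) l)%N * \prod_(l <- m) y l).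

Lemma ysum_cons y p P v : ysum y (p :: P) v = ysum y P (fun q => v q + y p * v (p * q)%N).
Proof.
rewrite /ysum /= -ssumD; apply: eq_ssum => m _; rewrite !big_cons; ring.
Qed.

Lemma le_ysum y P v v' : (forall l, 0 <= y l) -> (forall q, v q <= v' q) -> ysum y P v <= ysum y P v'.
Proof.
by move=> y0 vv; apply: le_ssum => m _; rewrite ler_wpM2r //; apply: prodr_ge0.
Qed.

Lemma antin_add y p v : (forall l, 0 <= y l) -> antin v -> antin (fun q => v q + y p * v (p * q)%N).
Proof.
move=> y0 [v0 va]; split=> [q|q q' qq]; first by rewrite addr_ge0 // mulr_ge0.
by rewrite lerD ?va // ler_wpM2l // va // leq_mul2l qq orbT.
Qed.

Lemma antin_mul p v : antin v -> antin (fun q => v (p * q)%N).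
Proof. by case=> v0 va; split=> // q q' qq; rewrite va // leq_mul2l qq orbT. Qed.

(** The cofactor omits the primes of [rho]; the factors [1 + y l] put them back. Nothing is lost,
    since [v] decreases and an omitted prime could only make its argument larger. *)
Lemma cofactor_ge y P rho v : (forall l, 0 <= y l) -> all (leq 1) P -> subseq rho P -> antin v ->
  ysum y P (fun q => v (\prod_(l <- rho) l * q)%N) <= \prod_(l <- rho) (1 + y l) * cofactor y P rho v.
Proof.
move=> y0; elim: P rho v => [|p P IH] rho v /=.
  by move=> _ /eqP -> _; rewrite /ysum /= !big_nil mulr1 mul1r muln1.
case/andP => p1 P1 rP av; case: rho rP => [|l rho] /= rP.
  apply: le_trans (IH [::] (fun q => v q + y p * v (p * q)%N) P1 (sub0seq _) (antin_add p y0 av)).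
  by rewrite ysum_cons le_eqVlt; apply/orP; left; apply/eqP; congr ysum; apply/funext => q;
    rewrite big_nil !mul1n.
move: rP; rewrite eq_sym (inj_eq Some_inj).
case: (eqVneq l p) => [->|lp] rP; last first.
  apply: le_trans (IH (l :: rho) (fun q => v q + y p * v (p * q)%N) P1 rP (antin_add p y0 av)).
  by rewrite ysum_cons le_eqVlt; apply/orP; left; apply/eqP; congr ysum; apply/funext => q;
    rewrite mulnCA.
rewrite !big_cons -mulrA ysum_cons.
have H := IH rho (fun q => v (p * q)%N) P1 rP (antin_mul p av).
apply: le_trans (ler_wpM2l (_ : 0 <= 1 + y p) H); last by rewrite addr_ge0.
have -> : (1 + y p) * ysum y P (fun q => v (p * (\prod_(l0 <- rho) l0 * q))%N) =
   ysum y P (fun q => (1 + y p) * v (p * (\prod_(l0 <- rho) l0 * q))%N).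
  by rewrite /ysum -ssumZ; apply: eq_ssum => m _; rewrite mulrA.
apply: le_ysum => // q; rewrite mulrDl mul1r -!mulnA lerD2l ler_wpM2l //.
by case: av => _; apply; rewrite !leq_mul2l leq_pmull ?orbT.
Qed.

Lemma cofactor_ge0 y P rho v : (forall l, 0 <= y l) -> (forall q, 0 <= v q) -> 0 <= cofactor y P rho v.
Proof.
move=> y0; elim: P rho v => [|p P IH] rho v v0 //=.
by case: ifP => _; apply: IH => // q; rewrite addr_ge0 // mulr_ge0.
Qed.

Lemma cofactor_ge_last y P rho v : (forall l, 0 <= y l) -> (forall q, 0 <= v q) -> subseq rho P ->
  v (\prod_(l <- rho) l)%N <= cofactor y P rho v.
Proof.
move=> y0; elim: P rho v => [|p P IH] rho v v0 /=; first by move/eqP => ->; rewrite big_nil.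
case: rho => [|l rho] /= rP.
  apply: le_trans (IH [::] _ _ (sub0seq _)); first by rewrite lerDl mulr_ge0.
  by move=> q; rewrite addr_ge0 // mulr_ge0.
move: rP; rewrite eq_sym (inj_eq Some_inj); case: (eqVneq l p) => [->|lp] rP.
  by rewrite big_cons; apply: (IH rho (fun q => v (p * q)%N)).
apply: le_trans (IH (l :: rho) _ _ rP); first by rewrite lerDl mulr_ge0.
by move=> q; rewrite addr_ge0 // mulr_ge0.
Qed.

Definition unitl P q := all (fun l => ~~ (l %| q)%N) P.

(** A Gram form is a sum of squares. [kernel_factor] is applied to two artificial colours, with
    shifts 0 and 1 on [bool], for the sake of its Gram identity. *)
Lemma Nk_ge0 rho (S : seq nat) (al : nat -> R) : all prime rho -> (forall q, q \in S -> unitl rho q) ->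
  0 <= Nk rho S al.
Proof.
move=> pr uS.
have [z [zr zt]] : exists z : seq (nat * bool), unzip1 z = rho /\ all (fun pj => pj.2 != false) z.
  exists [seq (l, true) | l <- rho]; split; first by rewrite /unzip1 -map_comp map_id.
  by apply/allP => _ /mapP[l _ ->].
pose h (j : bool) : nat := j.
have hs l : l \in unzip1 z -> hsep h l.
  rewrite zr => /(allP pr)/prime_gt1 l1 [] [] //; rewrite /h /= ?modn_small // ltnW //.
rewrite -zr in pr uS *.
have [I [v [w [_ H _]]]] := @kernel_factor R bool h false z pr zt hs.
have -> : Nk (unzip1 z) S al = \sum_x (\sum_(q <- S) al q * v q x) ^+ 2.
  under [RHS]eq_bigr do rewrite expr2; rewrite -sum_swap3 /Nk.
  rewrite big_seq [RHS]big_seq; apply: eq_bigr => q qS.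
  rewrite big_seq [RHS]big_seq; apply: eq_bigr => q' qS'.
  by rewrite (H q q' (uS q qS) (uS q' qS')).
by apply: sumr_ge0 => x _; rewrite sqr_ge0.
Qed.

Section Progression.
Variables (P S : seq nat) (al : nat -> R) (W c H : nat).
Hypotheses (uP : uniq P) (pP : all prime P) (W0 : (0 < W)%N) (cW : all (coprime W) P)
  (uS : uniq S) (SP : forall q, q \in S -> unitl P q)
  (Sc : forall q, q \in S -> exists2 m, (m < H)%N & q = (c + W * m)%N).

(** Writing [q = c + W * m] shortens the range by the factor [W]; congruences modulo [l] agree for
    [q] and [m] because [l] is prime to [W]. *)
Lemma large_sieve_prog Q : (0 < Q)%N -> (Q * Q <= H)%N ->
  ssum P (fun rho => (\prod_(l <- rho) l <= Q)%N%:R *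
    \sum_(n <- S) \sum_(n' <- S) al n * al n' *
      \prod_(l <- rho) (l%:R * (n == n' %[mod l])%N%:R - 1))
  <= 24 * H%:R * \sum_(n <- S) al n ^+ 2.
Proof.
move=> Q0 QH.
pose g m := (c + W * m)%N.
pose a m : R := (g m \in S)%:R * al (g m).
have gi : injective g by move=> m m' /addnI/eqP; rewrite eqn_pmul2l // => /eqP.
have re (F : nat -> R) : \sum_(n <- S) F n = \sum_(m < H) (g m \in S)%:R * F (g m).
  transitivity (\sum_(n <- [seq g m | m <- iota 0 H & g m \in S]) F n).
    apply: perm_big; apply: uniq_perm => //.
      by rewrite map_inj_uniq // filter_uniq // iota_uniq.
    move=> q; apply/idP/mapP => [qS|[m]].
      have [m mH E] := Sc qS; exists m => //.
      by rewrite mem_filter /g -E qS mem_iota.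
    by rewrite mem_filter => /andP[gS _] ->.
  rewrite big_map big_filter -(big_mkord xpredT (fun m => (g m \in S)%:R * F (g m))).
  rewrite /index_iota subn0 big_mkcond /=; apply: eq_bigr => m _.
  by case: (g m \in S); rewrite ?mul1r ?mul0r.
have := large_sieve a uP pP Q0 QH.
have -> : \sum_(n < H) a n ^+ 2 = \sum_(n <- S) al n ^+ 2.
  rewrite re; apply: eq_bigr => m _; rewrite /a exprMn.
  by case: (g m \in S); rewrite ?expr1n ?expr0n.
apply: le_trans; rewrite le_eqVlt; apply/orP; left; apply/eqP.
apply: eq_ssum => rho rP; congr (_ * _).
rewrite re; apply: eq_bigr => m _; rewrite re mulr_sumr; apply: eq_bigr => m' _.
have -> : \prod_(l <- rho) (l%:R * (g m == g m' %[mod l])%N%:R - 1) =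
          \prod_(l <- rho) (l%:R * (m == m' %[mod l])%N%:R - 1) :> R.
  rewrite big_seq [RHS]big_seq; apply: eq_bigr => l lr.
  congr (_ * (nat_of_bool _)%:R - _).
  rewrite /g eqn_modDl.
  have cl : coprime l W by rewrite coprime_sym (allP cW) // (mem_subseq rP).
  have G (x y : nat) : (x <= y)%N -> (W * x == W * y %[mod l])%N = (x == y %[mod l])%N.
    move=> xy; rewrite eq_sym eqn_mod_dvd ?leq_mul2l ?xy ?orbT // -mulnBr Gauss_dvdr //.
    by rewrite [RHS]eq_sym eqn_mod_dvd.
  by case/orP: (leq_total m m') => le; [apply: G|rewrite eq_sym G // eq_sym].
rewrite /a; ring.
Qed.

Let y l : R := l.-1%:R^-1.
Let y0 l : 0 <= y l. Proof. by rewrite invr_ge0. Qed.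

(** The Ramanujan factor [l [q = q'] - 1] splits as [l ([q = q'] - y) + y] with [y = 1 / (l - 1)].
    The second part, which belongs to the principal character, is kept and accumulates in
    [cofactor]. *)
Lemma Nk_sieve v Q : (0 < Q)%N -> (Q * Q <= H)%N -> (forall q, v q = (q <= Q)%N%:R) ->
  ssum P (fun rho => (\prod_(l <- rho) l)%N%:R * Nk rho S al * cofactor y P rho v)
  <= 24 * H%:R * \sum_(n <- S) al n ^+ 2.
Proof.
move=> Q0 QH vE; apply: le_trans (large_sieve_prog Q0 QH).
rewrite le_eqVlt; apply/orP; left; apply/eqP.
transitivity (\sum_(n <- S) \sum_(n' <- S) al n * al n' *
   ssum P (fun rho => v (\prod_(l <- rho) l)%N * \prod_(l <- rho)
     (l%:R * ((n == n' %[mod l])%N%:R - y l) + y l))).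
  transitivity (\sum_(n <- S) \sum_(n' <- S) ssum P (fun rho =>
       al n * al n' * (\prod_(l <- rho) (l%:R * ((n == n' %[mod l])%N%:R - y l)) * cofactor y P rho v))).
    under [RHS]eq_bigr do rewrite ssum_swap; rewrite ssum_swap.
    apply: eq_ssum => rho _; rewrite /Nk natr_prod.
    rewrite mulr_sumr mulr_suml; apply: eq_bigr => n _.
    rewrite mulr_sumr mulr_suml; apply: eq_bigr => n' _.
    rewrite big_split /= -/(kapp R rho n n'); ring.
  apply: eq_bigr => n _; apply: eq_bigr => n' _.
  by rewrite ssum_prodD // ssumZ.
transitivity (\sum_(n <- S) \sum_(n' <- S) ssum P (fun rho =>
    al n * al n' * (v (\prod_(l <- rho) l)%N * \prod_(l <- rho) (l%:R * (n == n' %[mod l])%N%:R - 1)))).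
  apply: eq_bigr => n _; apply: eq_bigr => n' _; rewrite ssumZ; congr (_ * _).
  apply: eq_ssum => rho rP; congr (_ * _).
  rewrite big_seq [RHS]big_seq; apply: eq_bigr => l lr.
  have pl := allP pP l (mem_subseq rP lr).
  have l1 : 1 < l%:R :> R by rewrite ltr1n prime_gt1.
  have lm : l.-1%:R = l%:R - 1 :> R by rewrite -subn1 natrB // prime_gt0.
  by rewrite /y lm; field; lra.
under eq_bigr do rewrite ssum_swap; rewrite ssum_swap.
apply: eq_ssum => rho _; rewrite mulr_sumr; apply: eq_bigr => n _.
rewrite mulr_sumr; apply: eq_bigr => n' _; rewrite vE; ring.
Qed.

Let P1 : all (leq 1) P. Proof. by apply/allP => q /(allP pP)/prime_gt0. Qed.

Let NkP rho : subseq rho P -> 0 <= Nk rho S al.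
Proof.
move=> rP; apply: Nk_ge0 => [|q /SP/allP qS].
  by apply/allP => l lr; apply: (allP pP); exact: (mem_subseq rP).
by apply/allP => l lr; apply: qS; exact: (mem_subseq rP).
Qed.

Lemma Nk_large Q : (0 < Q)%N -> (Q * Q <= H)%N ->
  ssum P (fun rho => (\prod_(l <- rho) l <= Q)%N%:R * ((\prod_(l <- rho) l)%N%:R * Nk rho S al))
  <= 24 * H%:R * \sum_(n <- S) al n ^+ 2.
Proof.
move=> Q0 QH; pose v q : R := (q <= Q)%N%:R.
apply: le_trans (Nk_sieve Q0 QH (v := v) (fun=> erefl)).
apply: le_ssum => rho rP; rewrite mulrC ler_wpM2l //.
  by rewrite mulr_ge0 // NkP.
exact: cofactor_ge_last.
Qed.

(** For small moduli the cofactor is at least a full harmonic sum over [m], of order [log Z] in the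
    application. This gains back the logarithm that the plain large sieve loses on a set as sparse
    as the primes. *)
Lemma Nk_small Q X M : (0 < Q)%N -> (Q * Q <= H)%N -> (X * M <= Q)%N ->
  ssum P (fun rho => (\prod_(l <- rho) l <= X)%N%:R * ((\prod_(l <- rho) l.-1)%N%:R * Nk rho S al)) *
  ssum P (fun m => (\prod_(l <- m) l <= M)%N%:R / (\prod_(l <- m) l)%N%:R)
  <= 24 * H%:R * \sum_(n <- S) al n ^+ 2.
Proof.
move=> Q0 QH XM; pose v q : R := (q <= Q)%N%:R.
apply: le_trans (Nk_sieve Q0 QH (v := v) (fun=> erefl)).
rewrite mulrC -ssumZ; apply: le_ssum => rho rP.
set r := (\prod_(l <- rho) l)%N.
have pr : all prime rho by apply/allP => l lr; apply: (allP pP); exact: (mem_subseq rP).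
have N0 := NkP rP.
case: leqP => rX; last first.
  rewrite mul0r mulr0 !mulr_ge0 //; apply: cofactor_ge0 => // q; exact: ler0n.
rewrite mul1r.
have av : antin v.
  by split=> [q|q q' qq]; rewrite /v ?ler0n // ler_nat; case: (leqP q' Q) => // /(leq_trans qq) ->.
have := cofactor_ge y0 P1 rP av; rewrite -/r => Hc.
have E : \prod_(l <- rho) (1 + y l) * (\prod_(l <- rho) l.-1)%N%:R = r%:R.
  rewrite /r !natr_prod -big_split /= big_seq [RHS]big_seq; apply: eq_bigr => l /(allP pr) pl.
  have l1 : 1 < l%:R :> R by rewrite ltr1n prime_gt1.
  have lm : l.-1%:R = l%:R - 1 :> R by rewrite -subn1 natrB // prime_gt0.
  by rewrite /y lm; field; lra.
have Y : ssum P (fun m => (\prod_(l <- m) l <= M)%N%:R / (\prod_(l <- m) l)%N%:R) <=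
   ysum y P (fun q => v (r * q)%N).
  apply: le_ssum => m mP; case: leqP => mM; last first.
    by rewrite mul0r mulr_ge0 ?ler0n ?prodr_ge0.
  rewrite mul1r /v (leq_trans (leq_mul rX mM)) // mul1r natr_prod -prodfV.
  rewrite big_seq [X in _ <= X]big_seq; apply: ler_prod => l lm.
  have pl := allP pP l (mem_subseq mP lm); rewrite invr_ge0 ler0n /=.
  have l1 : (0 < l.-1)%N by rewrite -subn1 subn_gt0 prime_gt1.
  by rewrite /y lef_pV2 ?posrE ?ltr0n ?ler_nat ?leq_pred // prime_gt0.
rewrite -E; set a := _%:R * Nk rho S al.
have -> : \prod_(l <- rho) (1 + y l) * (\prod_(l <- rho) l.-1)%N%:R * Nk rho S al *
   cofactor y P rho v = \prod_(l <- rho) (1 + y l) * cofactor y P rho v * a by rewrite /a; ring.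
by rewrite ler_wpM2r ?mulr_ge0 ?ler0n //; apply: le_trans Hc.
Qed.

End Progression.
End SieveGain.

(** * Mertens' theorem in arithmetic progressions *)

Section Arithmetic.
Variable R : realType.

Lemma sum_dvdn_pfactor (V : nmodType) (F : nat -> V) p k m : prime p -> (0 < m)%N -> ~~ (p %| m)%N ->
  \sum_(1 <= d < (p ^ k * m).+1 | (d %| p ^ k * m)%N) F d =
  \sum_(j < k.+1) \sum_(1 <= e < m.+1 | (e %| m)%N) F (p ^ j * e)%N.
Proof.
move=> pp m0 pm; have p0 := prime_gt0 pp.
have E (F' : nat -> V) n : (0 < n)%N ->
    \sum_(1 <= d < n.+1 | (d %| n)%N) F' d = \sum_(d <- divisors n) F' d.
  move=> n0; rewrite -[LHS]big_filter; apply: perm_big; apply: uniq_perm.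
  - by rewrite filter_uniq // iota_uniq.
  - exact: divisors_uniq.
  move=> d; rewrite mem_filter mem_index_iota -dvdn_divisors // andb_idr // => dn.
  by rewrite ltnS (dvdn_gt0 n0 dn) dvdn_leq.
have pk0 : (0 < p ^ k)%N by rewrite expn_gt0 p0.
rewrite E ?muln_gt0 ?pk0 //.
under [RHS]eq_bigr do rewrite E //.
have -> : \sum_(j < k.+1) \sum_(e <- divisors m) F (p ^ j * e)%N =
  \sum_(d <- [seq (p ^ j * e)%N | j <- iota 0 k.+1, e <- divisors m]) F d.
  rewrite big_allpairs_dep /= -(big_mkord xpredT (fun j => \sum_(e <- divisors m) F (p ^ j * e)%N)).
  by rewrite /index_iota subn0.
have logE j e : e \in divisors m -> logn p (p ^ j * e) = j.
  rewrite -dvdn_divisors // => em; have e0 := dvdn_gt0 m0 em.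
  rewrite lognM ?expn_gt0 ?p0 // pfactorK // -[RHS]addn0; congr (_ + _)%N.
  apply/eqP; rewrite eqn0Ngt logn_gt0 mem_primes pp e0 /=.
  by apply: contra pm => /dvdn_trans; exact.
apply: perm_big; apply: uniq_perm; first exact: divisors_uniq.
  apply: allpairs_uniq; rewrite ?iota_uniq ?divisors_uniq //.
  move=> [a b] [a' b'] m1 m2 /= H.
  have bm : b \in divisors m by case/allpairsP: m1 => [[? ?]] /= [_ ? [_ ->]].
  have bm' : b' \in divisors m by case/allpairsP: m2 => [[? ?]] /= [_ ? [_ ->]].
  have aa : a = a' by rewrite -(logE a b) // -(logE a' b') // H.
  subst a'; congr pair; apply/eqP; move/eqP: H; rewrite eqn_pmul2l //.
  by rewrite expn_gt0 p0.
move=> d; rewrite -dvdn_divisors ?muln_gt0 ?pk0 //; apply/idP/allpairsP => [dn|].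
  have d0 : (0 < d)%N by apply: dvdn_gt0 dn; rewrite muln_gt0 pk0.
  have [e ce dE] := pfactor_coprime pp d0.
  exists (logn p d, e); split; last by rewrite mulnC.
    rewrite mem_iota /= add0n ltnS.
    have := dvdn_leq_log p _ dn; rewrite muln_gt0 pk0 m0 => /(_ isT).
    rewrite lognM // pfactorK // (_ : logn p m = 0)%N ?addn0 //.
    by apply/eqP; rewrite eqn0Ngt logn_gt0 mem_primes pp m0 /= pm.
  rewrite -dvdn_divisors //.
  have : (e %| p ^ k * m)%N by apply: dvdn_trans dn; rewrite dE dvdn_mulr.
  by rewrite Gauss_dvdr // coprime_sym coprimeXl.
case=> [[j e]] [jk em ->]; rewrite mem_iota add0n ltnS /= in jk em *.
by rewrite dvdn_mul // ?dvdn_exp2l // dvdn_divisors.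
Qed.

Lemma nat_prime_ind (Q : nat -> Prop) : Q 1%N ->
  (forall p k m, prime p -> (0 < m)%N -> ~~ (p %| m)%N -> Q m -> Q (p ^ k.+1 * m)%N) ->
  forall n, (0 < n)%N -> Q n.
Proof.
move=> Q1 QS n; have [N] := ubnP n; elim: N n => // N IH n nN n0.
have [->//|n1] := eqVneq n 1%N.
have n2 : (1 < n)%N by rewrite ltn_neqAle eq_sym n1.
have pp := pdiv_prime n2; set p := pdiv n in pp.
have [m cm nE] := pfactor_coprime pp n0.
have l0 : (0 < logn p n)%N by rewrite logn_gt0 mem_primes pp n0 pdiv_dvd.
have m0 : (0 < m)%N by move: n0; rewrite nE muln_gt0 => /andP[].
rewrite nE mulnC -(prednK l0); apply: QS => //; first by rewrite -prime_coprime.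
apply: IH => //; rewrite -ltnS; apply: leq_trans nN; rewrite ltnS nE.
rewrite -{1}[m]muln1 ltn_pmul2l // -(prednK l0) expnS.
by rewrite (leq_trans (prime_gt1 pp)) // leq_pmulr // expn_gt0 prime_gt0.
Qed.

Lemma sum_nat_trunc (a m N : nat) (F : nat -> R) : (a <= m <= N)%N ->
  (forall d, (m <= d < N)%N -> F d = 0) -> \sum_(a <= d < N) F d = \sum_(a <= d < m) F d.
Proof.
move=> /andP[am mN] F0; rewrite (big_cat_nat am mN) /= [X in _ + X]big_nat_cond.
by rewrite [X in _ + X]big1 ?addr0 // => d /andP[/F0].
Qed.

Lemma sum_hyperbola (N : nat) (G : nat -> nat -> R) :
  \sum_(1 <= n < N.+1) \sum_(1 <= d < n.+1 | (d %| n)%N) G d (n %/ d)%N =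
  \sum_(1 <= d < N.+1) \sum_(1 <= m < (N %/ d).+1) G d m.
Proof.
transitivity (\sum_(1 <= n < N.+1) \sum_(1 <= d < N.+1) \sum_(1 <= m < N.+1 | (d * m == n)%N) G d m).
  apply: eq_big_nat => n /andP[n0 nN].
  rewrite [RHS](sum_nat_trunc (m := n.+1)) //; last first.
    move=> d /andP[nd dN]; rewrite big_nat_cond big_pred0 // => m.
    apply/negbTE; rewrite negb_and -implybE; apply/implyP => /andP[m0 _].
    by rewrite neq_ltn orbC (leq_trans nd) // leq_pmulr.
  rewrite big_mkcond; apply: eq_big_nat => d /andP[d0 dn].
  case: ifP => dn'.
    have mN : (n %/ d < N.+1)%N by rewrite ltnS (leq_trans (leq_div _ _)).
    have m1 : (1 <= n %/ d)%N by rewrite divn_gt0.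
    rewrite big_mkcond (big_rem (n %/ d)%N) /=; last by rewrite mem_index_iota m1.
    rewrite [(d * _)%N]mulnC divnK // eqxx big_seq big1 ?addr0 // => m.
    rewrite rem_filter ?iota_uniq // mem_filter /= => /andP[/negP mn _].
    by case: eqP => // E; case: mn; rewrite -E mulKn.
  rewrite big_pred0 // => m; apply/negbTE; apply: contraFN dn' => /eqP <-.
  exact: dvdn_mulr.
rewrite exchange_big /=; apply: eq_big_nat => d /andP[d0 dN].
under eq_bigr do rewrite big_mkcond /=.
rewrite exchange_big /=.
rewrite [LHS](sum_nat_trunc (m := (N %/ d).+1)) ?ltnS ?leq_div //; last first.
  move=> m /andP[mN _]; rewrite big_nat_cond big1 // => n.
  rewrite andbT => /andP[n0 nN]; case: eqP => // E.
  have : (N < d * m)%N by rewrite mulnC -ltn_divLR.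
  by rewrite E ltnNge -ltnS nN.
apply: eq_big_nat => m /andP[m0 mN].
have dmN : (d * m < N.+1)%N by rewrite ltnS mulnC -leq_divRL.
rewrite (big_rem (d * m)%N) /=; last by rewrite mem_index_iota dmN muln_gt0 d0 m0.
rewrite eqxx big_seq big1 ?addr0 // => n.
by rewrite rem_filter ?iota_uniq // mem_filter /= => /andP[/negbTE nE _]; rewrite eq_sym nE.
Qed.

(** Von Mangoldt's function: the prime powers are the numbers with a single prime divisor. *)
Definition vM (n : nat) : R := if primes n is [:: p] then ln p%:R else 0.

Lemma vM_ge0 n : 0 <= vM n.
Proof.
rewrite /vM; case E: (primes n) => [|p []] //.
have : p \in primes n by rewrite E mem_head.
rewrite mem_primes => /andP[/prime_gt0 p0 _].
by rewrite ln_ge0 // ler1n.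
Qed.

Lemma vM_prime p : prime p -> vM p = ln p%:R.
Proof. by move=> pp; rewrite /vM primes_prime. Qed.

Lemma vM_sum n : (0 < n)%N -> \sum_(1 <= d < n.+1 | (d %| n)%N) vM d = ln n%:R.
Proof.
move: n; apply: nat_prime_ind => [|p k m pp m0 pm IH].
  by rewrite big_mkcond big_nat1 /= /vM ln1.
rewrite sum_dvdn_pfactor // big_ord_recl expn0.
under eq_bigr do rewrite mul1n; rewrite IH.
have p0 := prime_gt0 pp.
have H (j : 'I_k.+1) : \sum_(1 <= e < m.+1 | (e %| m)%N) vM (p ^ lift ord0 j * e) = ln p%:R.
  rewrite big_ltn_cond //= dvd1n muln1 /bump /= add1n.
  rewrite {1}/vM primesX // primes_prime // big_nat_cond big1 ?addr0 // => e.
  case/andP=> /andP[e1 em] de.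
  have e0 : (0 < e)%N by apply: leq_trans e1.
  have pq := pdiv_prime e1; set q := pdiv e in pq.
  have qe : (q %| e)%N by exact: pdiv_dvd.
  have qp : q != p by apply: contra pm => /eqP <-; apply: dvdn_trans de.
  rewrite /vM; case E: (primes _) => [|a [|b s]] //.
  have h1 : p \in primes (p ^ j.+1 * e).
    by rewrite mem_primes pp muln_gt0 expn_gt0 p0 e0 expnS -mulnA dvdn_mulr.
  have h2 : q \in primes (p ^ j.+1 * e).
    by rewrite mem_primes pq muln_gt0 expn_gt0 p0 e0 dvdn_mull.
  rewrite E !inE in h1 h2.
  by case/negP: qp; rewrite (eqP h2) (eqP h1).
rewrite (eq_bigr _ (fun j _ => H j)) sumr_const card_ord natrM lnM ?posrE ?ltr0n ?expn_gt0 ?p0 //.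
by rewrite natrX lnXn ?ltr0n // addrC.
Qed.

Lemma vM_conv (N : nat) (F : nat -> R) :
  \sum_(1 <= n < N.+1) F n * ln n%:R =
  \sum_(1 <= d < N.+1) vM d * \sum_(1 <= m < (N %/ d).+1) F (d * m)%N.
Proof.
transitivity (\sum_(1 <= n < N.+1) \sum_(1 <= d < n.+1 | (d %| n)%N) vM d * F (d * (n %/ d))%N).
  apply: eq_big_nat => n /andP[n0 _]; rewrite -vM_sum // mulr_sumr; apply: eq_bigr => d dn.
  by rewrite [(d * _)%N]mulnC divnK // mulrC.
rewrite (sum_hyperbola N (fun d m => vM d * F (d * m)%N)).
by apply: eq_bigr => d _; rewrite mulr_sumr.
Qed.

Lemma ln_le_sub1 (x : R) : 0 < x -> ln x <= x - 1.
Proof. by move=> x0; have := @le_ln1Dx R (x - 1); rewrite addrCA subrr addr0; apply; lra. Qed.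

Lemma ln_natS_le (n : nat) : (0 < n)%N -> ln n.+1%:R - ln n%:R <= n%:R^-1 :> R.
Proof.
move=> n0; have nr : 0 < n%:R :> R by rewrite ltr0n.
rewrite -ln_div ?posrE ?ltr0n //; apply: le_trans (ln_le_sub1 _) _; first by rewrite divr_gt0.
by rewrite -natr1 mulrDl mul1r mulfV ?gt_eqF // addrC addKr.
Qed.

Lemma ln_natS_ge (n : nat) : (0 < n)%N -> n.+1%:R^-1 <= ln n.+1%:R - ln n%:R :> R.
Proof.
move=> n0; have nr : 0 < n%:R :> R by rewrite ltr0n.
have n1r : 0 < n.+1%:R :> R by rewrite ltr0n.
rewrite -[leRHS]opprB -ln_div ?posrE // -lerN2 opprK.
apply: le_trans (ln_le_sub1 _) _; first by rewrite divr_gt0.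
rewrite -(natr1 n); rewrite le_eqVlt; apply/orP; left; apply/eqP; field; lra.
Qed.

Definition lfact (N : nat) : R := \sum_(1 <= n < N.+1) ln n%:R.

Lemma lfactS N : lfact N.+1 = lfact N + ln N.+1%:R.
Proof. by rewrite /lfact big_nat_recr. Qed.

Lemma lfact_vM N : lfact N = \sum_(1 <= d < N.+1) vM d * (N %/ d)%N%:R.
Proof.
have := vM_conv N (fun=> 1); rewrite /lfact => E.
transitivity (\sum_(1 <= n < N.+1) 1 * ln n%:R : R); first by apply: eq_bigr => n _; rewrite mul1r.
rewrite E; apply: eq_bigr => d _; congr (_ * _).
by rewrite sumr_const_nat subn1.
Qed.

Lemma lfact_le N : lfact N <= N%:R * ln N%:R.
Proof.
have -> : N%:R * ln N%:R = \sum_(1 <= n < N.+1) ln N%:R :> R by rewrite sumr_const_nat subn1 mulr_natl.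
rewrite /lfact.
rewrite big_nat [leRHS]big_nat; apply: ler_sum => n /andP[n0 nN].
by rewrite ler_ln ?posrE ?ltr0n ?ler_nat // (leq_trans n0).
Qed.

Lemma lfact_ge N : (0 < N)%N -> N%:R * ln N%:R - N%:R <= lfact N.
Proof.
case: N => // N _; elim: N => [|N IH]; first by rewrite /lfact big_nat1 ln1; lra.
rewrite lfactS; have := ln_natS_le (isT : 0 < N.+1)%N; have N0 : 0 < N.+1%:R :> R by rewrite ltr0n.
rewrite -(ler_pM2l N0) mulfV ?gt_eqF //.
rewrite -(natr1 N.+1); set x := ln (_ + 1); set y := ln N.+1%:R in IH *.
set n := N.+1%:R in IH N0 *; lra.
Qed.

Definition psi (N : nat) : R := \sum_(1 <= d < N.+1) vM d.

(** Chebyshev's argument: [ln (2n)! - 2 ln n!] is at most [2 n], and it is the sum of [vM d] times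
    [floor(2n/d) - 2 floor(n/d)], which is never negative and at least 1 for [n < d <= 2n]. *)
Lemma psi_double n : psi n.*2 <= psi n + 2 * n%:R.
Proof.
have l2 : lfact n.*2 <= 2 * lfact n + 2 * n%:R.
  elim: n => [|n IH]; first by rewrite /lfact !big_geq //; lra.
  rewrite doubleS !lfactS.
  have E2 : n.*2.+2%:R = 2 * n.+1%:R :> R by rewrite -doubleS -muln2 natrM mulrC.
  have L2 : ln (n.*2.+2%:R : R) = ln 2 + ln n.+1%:R.
    by rewrite E2 lnM ?posrE ?ltr0n.
  have L1 : ln (n.*2.+1%:R : R) <= ln n.*2.+2%:R by rewrite ler_ln ?posrE ?ltr0n // ler_nat.
  have l21 : ln 2 <= 1 :> R by have := @ln_le_sub1 2 (ltr0n _ 2); lra.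
  by have := @natr1 R n; lra.
have : psi n.*2 - psi n <= lfact n.*2 - 2 * lfact n.
  have nn : (n <= n.*2)%N by rewrite -addnn leq_addr.
  have ext (F : nat -> R) : \sum_(1 <= d < n.+1) F d = \sum_(1 <= d < n.*2.+1) (d <= n)%N%:R * F d.
    rewrite [RHS](sum_nat_trunc (m := n.+1)) //.
      by apply: eq_big_nat => d /andP[_]; rewrite ltnS => ->; rewrite mul1r.
    by move=> d; rewrite ltnNge => /andP[/negbTE -> _]; rewrite mul0r.
  rewrite !lfact_vM /psi !ext mulr_sumr -!sumrB.
  rewrite big_nat [leRHS]big_nat; apply: ler_sum => d /andP[d0 d2].
  have := vM_ge0 d; case: leqP => dn.
    rewrite !mul1r subrr => v0.
    have H : (2 * (n %/ d) <= n.*2 %/ d)%N.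
      by rewrite leq_divRL // -mulnA -muln2 [leqRHS]mulnC leq_mul2l leq_trunc_div.
    have := ler_wpM2l v0 (_ : (2 * (n %/ d))%N%:R <= (n.*2 %/ d)%N%:R :> R).
    by rewrite ler_nat H natrM => /(_ isT); lra.
  rewrite !mul0r mulr0 !subr0 => v0.
  have H : (1 <= n.*2 %/ d)%N by rewrite divn_gt0 // -ltnS.
  by rewrite -[leLHS]mulr1 ler_wpM2l // ler1n.
lra.
Qed.

Lemma psi_le N : psi N <= 4 * N%:R.
Proof.
have [m] := ubnP N; elim: m N => // m IH N Nm.
have [->|N0] := posnP N; first by rewrite /psi big_geq // mulr0.
rewrite -(odd_double_half N); case: (odd N) => /=.
  rewrite add1n /psi big_nat_recr //= -/(psi _).
  have h1 : (N./2 < m)%N by rewrite (leq_trans _ (Nm : N <= m)%N) // -divn2 ltn_Pdiv.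
  have := IH _ h1; have := psi_double N./2.
  set n := N./2; have v1 : vM n.*2.+1 <= ln n.*2.+1%:R.
    rewrite -vM_sum // big_mkcond big_nat_recr //= dvdnn lerDr sumr_ge0 // => d _.
    by case: ifP => // _; exact: vM_ge0.
  have := @ln_le_sub1 n.*2.+1%:R (ltr0n _ _).
  have E1 : n.*2.+1%:R = 2 * n%:R + 1 :> R by rewrite -natr1 -muln2 natrM mulrC.
  by have := ler0n R n; move: E1 v1; clear; lra.
have [->|h0] := posnP N./2; first by rewrite /psi big_geq // mulr0.
have h1 : (N./2 < m)%N by rewrite (leq_trans _ (Nm : N <= m)%N) // -divn2 ltn_Pdiv.
have := IH _ h1; have := psi_double N./2; rewrite add0n -muln2 natrM.
by have := ler0n R N./2; lra.
Qed.

Definition mertens (N : nat) : R := \sum_(1 <= d < N.+1) vM d / d%:R.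

Lemma mertens_le N : (0 < N)%N -> mertens N <= ln N%:R + 4.
Proof.
move=> N0; have Nr : 0 < N%:R :> R by rewrite ltr0n.
have : N%:R * mertens N - psi N <= lfact N.
  rewrite lfact_vM /mertens /psi mulr_sumr -sumrB big_nat [leRHS]big_nat.
  apply: ler_sum => d /andP[d0 _]; have dr : 0 < d%:R :> R by rewrite ltr0n.
  have : N%:R / d%:R - 1 <= (N %/ d)%N%:R :> R.
    rewrite lerBlDr natr1 ler_pdivrMr // -natrM ler_nat ltnW //.
    by rewrite ltn_ceil.
  move/(ler_wpM2l (vM_ge0 d)); apply: le_trans; rewrite le_eqVlt; apply/orP; left; apply/eqP; field; lra.
have := lfact_le N; have := psi_le N; move=> h1 h2 h3.
rewrite -(ler_pM2l Nr) mulrDr; lra.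
Qed.

Lemma mertens_ge N : (0 < N)%N -> ln N%:R - 1 <= mertens N.
Proof.
move=> N0; have Nr : 0 < N%:R :> R by rewrite ltr0n.
have : lfact N <= N%:R * mertens N.
  rewrite lfact_vM /mertens mulr_sumr big_nat [leRHS]big_nat.
  apply: ler_sum => d /andP[d0 _]; have dr : 0 < d%:R :> R by rewrite ltr0n.
  rewrite mulrCA ler_wpM2l ?vM_ge0 // ler_pdivlMr // -natrM ler_nat; exact: leq_trunc_div.
have := lfact_ge N0; move=> h1 h2.
rewrite -(ler_pM2l Nr) mulrBr mulr1; lra.
Qed.

End Arithmetic.

(** * Abel summation, limits and the Moebius function *)

Section BoundedSums.
Variable R : realType.

Lemma sum_by_parts (M : nat) (u c : nat -> R) n :
  \sum_(M <= m < M + n) u m * c m =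
  \sum_(M <= m < M + n) (\sum_(M <= k < m.+1) u k) * (c m - c m.+1)
  + (\sum_(M <= k < M + n) u k) * c (M + n)%N.
Proof.
elim: n => [|n IH]; first by rewrite addn0 !big_geq // add0r mul0r.
have e : (M <= M + n)%N by rewrite leq_addr.
by rewrite addnS !(big_nat_recr _ _ _ e) /= IH ?(big_nat_recr _ _ _ e) /=; ring.
Qed.

(** Quantitative Dirichlet test: after summation by parts the differences of [c] are nonnegative and
    telescope. *)
Lemma abel_le (M n : nat) (u c : nat -> R) (B : R) :
  (forall m, (M <= m)%N -> 0 <= c m) -> (forall m, (M <= m)%N -> c m.+1 <= c m) ->
  (forall k, `|\sum_(M <= m < M + k) u m| <= B) ->
  `|\sum_(M <= m < M + n) u m * c m| <= B * c M.
Proof.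
move=> c0 cS uB.
have B0 : 0 <= B by apply: le_trans (uB 0%N).
rewrite sum_by_parts; apply: le_trans (ler_normD _ _) _.
have cn : 0 <= c (M + n)%N by rewrite c0 ?leq_addr.
apply: (@le_trans _ _ (B * (c M - c (M + n)%N) + B * c (M + n)%N)); last by rewrite -mulrDr subrK.
apply: lerD; last by rewrite normrM (ger0_norm cn) ler_wpM2r.
apply: le_trans (ler_norm_sum _ _ _) _.
have -> : c M - c (M + n)%N = \sum_(M <= m < M + n) (c m - c m.+1).
  rewrite (@telescope_sumr_eq _ _ _ (fun m => - c m)) ?leq_addr //; first by rewrite opprK addrC.
  by move=> m _; rewrite opprK addrC.
rewrite mulr_sumr big_nat [leRHS]big_nat; apply: ler_sum => m /andP[Mm _].
rewrite normrM; have d0 : 0 <= c m - c m.+1 by rewrite subr_ge0 cS.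
rewrite (ger0_norm d0) ler_wpM2r //.
by have := uB (m.+1 - M)%N; rewrite subnKC // leqW.
Qed.

(** The limit is the supremum of the lower bounds [u N - e N], each of which lies below every upper
    bound [u M + e M]. *)
Lemma lim_exists (u e : nat -> R) :
  (forall N M, (N <= M)%N -> `|u M - u N| <= e N) ->
  exists l, forall N, `|u N - l| <= e N.
Proof.
move=> ue.
have e0 N : 0 <= e N by apply: le_trans (ue N N _).
have ub N M : u N - e N <= u M + e M.
  have [NM|/ltnW MN] := leqP N M.
    by have := ue _ _ NM; have := e0 M; rewrite ler_norml => ? /andP[]; lra.
  by have := ue _ _ MN; have := e0 N; rewrite ler_norml => ? /andP[]; lra.
set A := (fun x => exists N, x = u N - e N) : classical_sets.set R.
have hs : classical_sets.has_sup A.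
  split; first by exists (u 0%N - e 0%N); exists 0%N.
  by exists (u 0%N + e 0%N) => _ [N ->]; exact: ub.
exists (sup A) => N.
have h1 : u N - e N <= sup A by apply: ub_le_sup; [case: hs | exists N].
have h2 : sup A <= u N + e N by apply: ge_sup; [case: hs | move=> _ [M ->]; exact: ub].
by rewrite ler_norml; apply/andP; split; lra.
Qed.

Lemma le_inv_eq0 (x C : R) : (forall N : nat, `|x| <= C / N.+1%:R) -> x = 0.
Proof.
move=> H; apply/eqP; rewrite -normr_le0 leNgt; apply/negP => x0.
have C0 : 0 <= C by have := H 0%N; rewrite divr1; apply: le_trans.
have [N hN] : exists N : nat, C / `|x| < N%:R.
  by exists (Num.Def.archi_bound (C / `|x|)); apply: archi_boundP; rewrite divr_ge0.
have := H N; rewrite ler_pdivlMr ?ltr0n // leNgt => /negP; apply.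
rewrite ltr_pdivrMr // in hN; apply: lt_le_trans hN _.
by rewrite mulrC ler_wpM2l // ler_nat.
Qed.

Lemma ln_unbounded (C : R) : exists N : nat, (0 < N)%N /\ C < ln N%:R.
Proof.
exists (Num.Def.archi_bound (sequences.expR C)).
have h := archi_boundP (expR_ge0 C); split.
  by rewrite -(ltr0n R) (le_lt_trans _ h) ?expR_ge0.
by rewrite -ltr_expR lnK // posrE (lt_le_trans _ (ltW h)) ?expR_gt0.
Qed.

Definition mob (n : nat) : R := \prod_(p <- primes n) (if logn p n == 1%N then -1 else 0).

Lemma mob_le1 n : `|mob n| <= 1.
Proof.
rewrite /mob; elim: (primes n) => [|p s IH]; first by rewrite big_nil normr1.
by rewrite big_cons normrM -[leRHS]mul1r ler_pM // ; case: ifP; rewrite ?normrN1 ?normr0.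
Qed.

Lemma mob_pfactor p k m : prime p -> (0 < m)%N -> ~~ (p %| m)%N ->
  mob (p ^ k.+1 * m) = if k == 0%N then - mob m else 0.
Proof.
move=> pp m0 pm; have p0 := prime_gt0 pp.
have pk0 : (0 < p ^ k.+1)%N by rewrite expn_gt0 p0.
have lm : logn p m = 0%N by apply/eqP; rewrite eqn0Ngt logn_gt0 mem_primes pp m0 /= pm.
have pe : perm_eq (primes (p ^ k.+1 * m)) (p :: primes m).
  apply: uniq_perm; rewrite ?primes_uniq //= ?primes_uniq ?mem_primes ?pp ?m0 ?pm //.
  move=> q; rewrite primesM // primesX // primes_prime // inE.
  by rewrite in_cons.
rewrite /mob (perm_big _ pe) big_cons lognM // pfactorK // lm addn0 eqSS.
have -> : \prod_(j <- primes m) (if logn j (p ^ k.+1 * m) == 1%N then -1 else 0 : R) = mob m.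
  apply: eq_big_seq => q; rewrite mem_primes => /and3P[pq _ qm].
  rewrite lognM // (_ : logn q _ = 0%N) //.
  apply/eqP; rewrite eqn0Ngt logn_gt0 primesX // primes_prime // inE.
  by apply/negP => /eqP qp; rewrite qp (negbTE pm) in qm.
by rewrite -/(mob m); case: ifP => _ /=; rewrite ?mulN1r ?mul0r.
Qed.

Lemma vM_pfactor p k m : prime p -> (0 < m)%N -> ~~ (p %| m)%N ->
  vM R (p ^ k.+1 * m) = if m == 1%N then ln p%:R else 0.
Proof.
move=> pp m0 pm; have p0 := prime_gt0 pp.
case: eqVneq => [->|m1]; first by rewrite muln1 /vM primesX // primes_prime.
have m2 : (1 < m)%N by rewrite ltn_neqAle eq_sym m1.
have pq := pdiv_prime m2; set q := pdiv m in pq.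
have qm : (q %| m)%N by exact: pdiv_dvd.
have qp : q != p by apply: contra pm => /eqP <-.
rewrite /vM; case E: (primes _) => [|a [|b s]] //.
have h1 : p \in primes (p ^ k.+1 * m).
  by rewrite mem_primes pp muln_gt0 expn_gt0 p0 m0 expnS -mulnA dvdn_mulr.
have h2 : q \in primes (p ^ k.+1 * m).
  by rewrite mem_primes pq muln_gt0 expn_gt0 p0 m0 dvdn_mull.
rewrite E !inE in h1 h2.
by case/negP: qp; rewrite (eqP h2) (eqP h1).
Qed.

(** Taken with [x = ln N], this turns Moebius-weighted partial sums of a series into the value at 1
    times [ln N] plus a sum against von Mangoldt's function; see [isL0_bdd]. *)
Lemma mob_log n : (0 < n)%N -> forall x : R,
  \sum_(1 <= d < n.+1 | (d %| n)%N) mob d * (x - ln d%:R) = x * (n == 1%N)%:R + vM R n.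
Proof.
move: n; apply: nat_prime_ind => [x|p k m pp m0 pm IH x].
  by rewrite big_mkcond big_nat1 /= /mob /vM big_nil ln1 !mul1r subr0 mulr1 addr0.
rewrite sum_dvdn_pfactor // big_ord_recl expn0.
under eq_bigr do rewrite mul1n.
rewrite IH big_ord_recl /= [X in _ + (_ + X)]big1 ?addr0; last first.
  move=> j _; rewrite big1_seq // => e /andP[em]; rewrite mem_index_iota => /andP[e1 _].
  rewrite mob_pfactor ?mul0r //; apply: contra pm => /dvdn_trans; exact.
have p0 := prime_gt0 pp.
have -> : \sum_(1 <= e < m.+1 | (e %| m)%N) mob (p ^ bump 0 0 * e) * (x - ln (p ^ bump 0 0 * e)%N%:R)
  = \sum_(1 <= e < m.+1 | (e %| m)%N) - (mob e * (x - ln p%:R - ln e%:R)).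
  rewrite big_nat_cond [RHS]big_nat_cond; apply: eq_bigr => e /andP[/andP[e1 _] em].
  rewrite mob_pfactor //=; last by apply: contra pm => /dvdn_trans; exact.
  rewrite expn1 natrM lnM ?posrE ?ltr0n // mulNr opprD addrA //.
rewrite sumrN IH vM_pfactor //.
have -> : (p ^ k.+1 * m == 1)%N = false.
  by rewrite expnS -mulnA muln_eq1 gtn_eqF ?prime_gt1.
rewrite mulr0 add0r; case: ifP => _ /=; ring.
Qed.

(** AM-GM applied to the terms of index [i] and [n - i], whose product is always [y^(2n)]. *)
Lemma geom_ge (y : R) n : 0 <= y -> n.+1%:R * y ^+ n <= \sum_(i < n.+1) (y ^+ 2) ^+ i.
Proof.
move=> y0; rewrite -(ler_pM2l (ltr0n R 2 : 0 < 2)).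
have -> : 2 * \sum_(i < n.+1) (y ^+ 2) ^+ i = \sum_(i < n.+1) ((y ^+ 2) ^+ i + (y ^+ 2) ^+ (n - i)).
  rewrite big_split /= [X in _ = _ + X](reindex_inj rev_ord_inj) /=.
  rewrite mulr_natl mulr2n; congr (_ + _); apply: eq_bigr => i _.
  by rewrite subSS subKn // -ltnS.
rewrite mulrCA mulr_natl -[X in _ *+ X]card_ord -sumr_const; apply: ler_sum => i _.
rewrite -!exprM; have ni : (i <= n)%N by rewrite -ltnS.
rewrite -{1}(subnKC ni) exprD mul2n -addnn exprD mul2n -addnn exprD.
have := sqr_ge0 (y ^+ i - y ^+ (n - i)); lra.
Qed.

Lemma bernoulli (y : R) n : 0 <= y <= 1 -> 1 - n%:R * (1 - y) <= y ^+ n.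
Proof.
move=> /andP[y0 y1]; elim: n => [|n IH]; first by rewrite mul0r subr0 expr0.
apply: (@le_trans _ _ (y ^+ n - (1 - y))); first by rewrite -natr1; lra.
have y1' : y ^+ n <= 1 by rewrite exprn_ile1.
rewrite exprS; have := mulr_ge0 (_ : 0 <= 1 - y ^+ n) (_ : 0 <= 1 - y).
by rewrite !subr_ge0 => /(_ y1' y1); lra.
Qed.

Lemma bernoulliD (z : R) n : 0 <= z -> 1 + n%:R * z <= (1 + z) ^+ n.
Proof.
move=> z0; elim: n => [|n IH]; first by rewrite mul0r addr0 expr0.
rewrite exprS; have nz := ler0n R n.
apply: (@le_trans _ _ ((1 + z) * (1 + n%:R * z))); last by rewrite ler_wpM2l // addr_ge0.
by rewrite -natr1; have := mulr_ge0 (mulr_ge0 nz z0) z0; lra.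
Qed.

Lemma sum_squares_le (F : nat -> R) r : (forall k, 0 <= F k) ->
  \sum_(1 <= m < r.+1) F (m ^ 2)%N <= \sum_(1 <= k < (r ^ 2).+1) F k.
Proof.
move=> F0; elim: r => [|r IH]; first by rewrite !big_geq.
rewrite big_nat_recr //= [leRHS](@big_cat_nat _ _ _ (r ^ 2).+1) //=; last first.
  by rewrite ltnS leq_exp2r.
have rr : ((r ^ 2).+1 <= r.+1 ^ 2)%N by rewrite ltn_exp2r.
by apply: lerD => //; rewrite big_nat_recr //= lerDr sumr_ge0.
Qed.

Lemma six_mul_le n : (6 * n <= 4 ^ n + 4)%N.
Proof.
elim: n => // -[|n] // IH; rewrite expnS.
have h : (2 <= 4 ^ n.+1)%N by rewrite (leq_trans (isT : (2 <= 4 ^ 1)%N)) // leq_exp2l.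
rewrite mulnS; move: IH h; set a := (4 ^ n.+1)%N; set b := (6 * n.+1)%N; lia.
Qed.

(** * Nonvanishing at 1 for real characters, by Lambert series *)

Section RealCharacter.
Variables (chi : nat -> R) (B C : R).
Hypothesis chiM : forall m n, chi (m * n) = chi m * chi n.
Hypothesis chi1 : chi 1 = 1.
Hypothesis chi_sign : forall n, [\/ chi n = 0, chi n = 1 | chi n = -1].
Hypothesis chi_sum : forall M k, `|\sum_(M <= m < M + k) chi m| <= B.
Hypothesis chi_L1 : forall N, `|\sum_(1 <= m < N.+1) chi m / m%:R| <= C / N.+1%:R.

Let f n := \sum_(1 <= d < n.+1 | (d %| n)%N) chi d.

Lemma chiX p j : chi (p ^ j) = chi p ^+ j.
Proof. by elim: j => [|j IH]; rewrite ?expn0 ?chi1 // expnS chiM IH exprS. Qed.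

(** [f] is multiplicative, and at [p^k] it is 1, [k + 1], or 1 and 0 according as [k] is even or
    odd. The condition on all exponents says that [n] is a square. *)
Lemma sum_chi_div_ge n : (0 < n)%N ->
  0 <= f n /\ ((forall p, ~~ odd (logn p n)) -> 1 <= f n).
Proof.
move: n; apply: nat_prime_ind => [|p k m pp m0 pm [IH0 IH1]].
  by rewrite /f big_mkcond big_nat1 /= chi1.
have -> : f (p ^ k.+1 * m) = (\sum_(j < k.+2) chi p ^+ j) * f m.
  rewrite /f sum_dvdn_pfactor // mulr_suml; apply: eq_bigr => j _.
  by rewrite mulr_sumr; apply: eq_bigr => e _; rewrite chiM chiX.
have s0 : 0 <= \sum_(j < k.+2) chi p ^+ j /\ (~~ odd k.+1 -> 1 <= \sum_(j < k.+2) chi p ^+ j).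
  case: (chi_sign p) => ->.
  - rewrite big_ord_recl expr0 big1 => [|j _]; last by rewrite /bump /= exprS mul0r.
    by rewrite addr0.
  - under eq_bigr do rewrite expr1n.
    by rewrite sumr_const card_ord; split=> [|_]; rewrite ?ler0n // ler1n.
  have H n : \sum_(j < n) (-1) ^+ j = (odd n)%:R :> R.
    elim: n => [|n IH]; first by rewrite big_ord0.
    by rewrite big_ord_recr /= IH -signr_odd; case: (odd n); rewrite /= ?expr1 ?expr0; lra.
  rewrite H; split=> [|h]; rewrite ?ler0n //.
  by rewrite (_ : odd k.+2 = true) //= -[odd k.+2]/(~~ odd k.+1) h.
case: s0 => s0 s1; split=> [|ev]; first exact: mulr_ge0.
have lm : logn p m = 0%N by apply/eqP; rewrite eqn0Ngt logn_gt0 mem_primes pp m0 /= pm.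
have p0 := prime_gt0 pp.
have pk0 : (0 < p ^ k.+1)%N by rewrite expn_gt0 p0.
rewrite -[1]mulr1 ler_pM //.
  by apply: s1; have := ev p; rewrite lognM // pfactorK // lm addn0.
apply: IH1 => q; have := ev q; rewrite lognM //; have [->|qp] := eqVneq q p; first by rewrite lm.
by rewrite lognX logn_prime // (negbTE qp) muln0.
Qed.

Section Lambert.
Variables (y : R).
Hypothesis y01 : 0 < y < 1.
Let x := y ^+ 2.

Lemma lambert_x01 : 0 < x < 1.
Proof. by case/andP: y01 => y0 y1; rewrite /x exprn_gt0 // exprn_ilt1 // ltW. Qed.

Lemma one_subX_gt0 n : (0 < n)%N -> 0 < 1 - x ^+ n.
Proof.
move=> n0; case/andP: lambert_x01 => x0 x1.
by rewrite subr_gt0 exprn_ilt1 // ?ltW // -lt0n.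
Qed.

Let br n := \sum_(i < n) x ^+ i.

Lemma one_subXE n : 1 - x ^+ n = (1 - x) * br n.
Proof. by rewrite -opprB subrX1 -mulNr opprB. Qed.

Lemma br_ge n : n.+1%:R * y ^+ n <= br n.+1.
Proof. by apply: geom_ge; case/andP: y01 => /ltW. Qed.

Lemma br_gt0 n : 0 < br n.+1.
Proof.
case/andP: y01 => y0 y1; apply: lt_le_trans (br_ge n).
by rewrite mulr_gt0 ?ltr0n ?exprn_gt0.
Qed.

(** The Lambert term [x^n / (1 - x^n)] subtracted from its singular part as [x] tends to 1. Since
    [chi n / n] sums to 0 the singular parts cancel, and the Lambert series is governed by the sum
    of [chi n * c n]. *)
Let c n := (n%:R * (1 - x))^-1 - x ^+ n / (1 - x ^+ n).

(* The arithmetic-geometric mean inequality [br n >= n y^(n-1)] makes [c] nonincreasing. *)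
Lemma lambert_decr n : (1 <= n)%N -> c n.+1 <= c n.
Proof.
case: n => // n _; case/andP: y01 => y0 y1; case/andP: lambert_x01 => x0 x1.
have b1 := br_gt0 n; have b2 := br_gt0 n.+1.
have n1 : 0 < n.+1%:R :> R by rewrite ltr0n.
have n2 : 0 < n.+2%:R :> R by rewrite ltr0n.
have E : c n.+1 - c n.+2 = (1 - x)^-1 *
   ((n.+1%:R * n.+2%:R)^-1 - x ^+ n.+1 / (br n.+1 * br n.+2)).
  rewrite /c (one_subXE n.+1) (one_subXE n.+2).
  have H : br n.+2 = br n.+1 + x ^+ n.+1 by rewrite /br big_ord_recr.
  have H1 : (1 - x) * br n.+1 = 1 - x ^+ n.+1 by rewrite one_subXE.
  have H3 : x ^+ n.+2 = x * x ^+ n.+1 by rewrite exprS.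
  have H4 : n.+2%:R = n.+1%:R + 1 :> R by rewrite natr1.
  have b21 : br n.+2 - x * br n.+1 = 1 by rewrite H; lra.
  have -> : (1 - x)^-1 * ((n.+1%:R * n.+2%:R)^-1 - x ^+ n.+1 / (br n.+1 * br n.+2)) =
    (n.+2%:R - n.+1%:R) / ((1 - x) * (n.+1%:R * n.+2%:R))
    - x ^+ n.+1 * (br n.+2 - x * br n.+1) / ((1 - x) * (br n.+1 * br n.+2)).
    by rewrite b21 H4; field; rewrite -?natr1; apply/and5P; split; lra.
  by rewrite H3; field; apply/and5P; split; lra.
rewrite -subr_ge0 E; apply: mulr_ge0; first by rewrite invr_ge0 subr_ge0 ltW.
rewrite subr_ge0 ler_pdivrMr ?mulr_gt0 // mulrC ler_pdivlMr ?mulr_gt0 //.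
have h1 := br_ge n; have h2 := br_ge n.+1.
have h3 : n.+1%:R * y ^+ n * (n.+2%:R * y ^+ n.+1) <= br n.+1 * br n.+2.
  by apply: ler_pM => //; rewrite mulr_ge0 ?ler0n ?exprn_ge0 ?ltW.
apply: le_trans h3; rewrite /x -exprM mul2n -addnn addSn exprS exprD.
have yn : 0 <= y ^+ n * y ^+ n.+1 by rewrite mulr_ge0 ?exprn_ge0 ?ltW.
have := ler_wpM2r yn (ltW y1); rewrite mul1r => h4.
have := ler_wpM2l (ltW (mulr_gt0 n1 n2)) h4; lra.
Qed.

Lemma lambert_ge0 n : (1 <= n)%N -> 0 <= c n.
Proof.
case: n => // n _; case/andP: y01 => y0 y1; case/andP: lambert_x01 => x0 x1.
have b1 := br_gt0 n; have u0 : 0 < 1 - x by rewrite subr_gt0.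
rewrite subr_ge0 one_subXE ler_pdivrMr ?mulr_gt0 //.
have -> : (n.+1%:R * (1 - x))^-1 * ((1 - x) * br n.+1) = br n.+1 / n.+1%:R.
  by have n0 := ler0n R n; field; apply/andP; split; lra.
rewrite ler_pdivlMr ?ltr0n // mulrC.
apply: le_trans (br_ge n); rewrite ler_wpM2l ?ler0n // /x -exprM.
by rewrite ler_wiXn2l ?ltW // (leq_trans (leqnSn n)) // leq_pmull.
Qed.

Lemma sum_geom1 (z : R) M : z != 1 -> \sum_(1 <= m < M.+1) z ^+ m = (z - z ^+ M.+1) / (1 - z).
Proof.
move=> z1; have z1' : 1 - z != 0 by rewrite subr_eq0 eq_sym.
elim: M => [|M IH]; first by rewrite big_geq // expr1 subrr mul0r.
by rewrite big_nat_recr //= IH [z ^+ M.+2]exprS; field.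
Qed.

(** Grouping by the divisor [d] gives geometric sums cut at [N / d], with tails [e d]. What remains
    splits into the vanishing series over [1 - x] and the sum of [chi d * c d], which Abel summation
    bounds by [B] since [c 1 = 1] and [c] decreases. *)
Lemma lambert_le N : (0 < N)%N ->
  \sum_(1 <= k < N.+1) f k * x ^+ k <=
  B + C / N.+1%:R / (1 - x) + N%:R * (x ^+ N / (1 - x)).
Proof.
move=> N0; case/andP: lambert_x01 => x0 x1; have u0 : 0 < 1 - x by rewrite subr_gt0.
have -> : \sum_(1 <= k < N.+1) f k * x ^+ k =
    \sum_(1 <= d < N.+1) \sum_(1 <= m < (N %/ d).+1) chi d * x ^+ (d * m).
  rewrite -(sum_hyperbola N (fun d m => chi d * x ^+ (d * m))).
  apply: eq_bigr => k _; rewrite mulr_suml; apply: eq_bigr => d dk.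
  by rewrite [(d * _)%N]mulnC divnK.
pose e d := x ^+ (d * (N %/ d).+1) / (1 - x ^+ d).
have -> : \sum_(1 <= d < N.+1) \sum_(1 <= m < (N %/ d).+1) chi d * x ^+ (d * m) =
   (1 - x)^-1 * \sum_(1 <= d < N.+1) chi d / d%:R
   - \sum_(1 <= d < N.+1) chi d * c d - \sum_(1 <= d < N.+1) chi d * e d.
  rewrite mulr_sumr -!sumrB; apply: eq_big_nat => d /andP[d0 dN].
  rewrite -mulr_sumr; under eq_bigr do rewrite exprM.
  have h := one_subX_gt0 d0.
  have xd : x ^+ d != 1 by rewrite -subr_eq0 -oppr_eq0 opprB gt_eqF.
  rewrite sum_geom1 // -exprM /e /c mulnS exprD.
  have dr : d%:R != 0 :> R by rewrite pnatr_eq0 -lt0n.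
  by field; rewrite dr !gt_eqF.
have h1 := chi_L1 N.
have h2 : `|\sum_(1 <= d < N.+1) chi d * c d| <= B.
  have c1 : c 1 = 1 by rewrite /c expr1 mul1r; field; lra.
  rewrite -[leRHS]mulr1 -c1 -add1n.
  apply: abel_le; [exact: lambert_ge0 | exact: lambert_decr | exact: chi_sum].
have h3 : `|\sum_(1 <= d < N.+1) chi d * e d| <= N%:R * (x ^+ N / (1 - x)).
  have -> : N%:R * (x ^+ N / (1 - x)) = \sum_(1 <= d < N.+1) x ^+ N / (1 - x).
    by rewrite sumr_const_nat subn1 mulr_natl.
  apply: le_trans (ler_norm_sum _ _ _) _.
  rewrite big_nat [leRHS]big_nat; apply: ler_sum => d /andP[d0 dN].
  have h := one_subX_gt0 d0.
  have e0 : 0 <= e d by apply: divr_ge0; [apply: exprn_ge0|]; exact: ltW.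
  rewrite normrM (ger0_norm e0) -[leRHS]mul1r ler_pM //.
    by case: (chi_sign d) => ->; rewrite ?normrN1 ?normr1 ?normr0.
  apply: ler_pM; [apply: exprn_ge0; exact: ltW | by rewrite invr_ge0 ltW | |].
    by rewrite ler_wiXn2l ?ltW // mulnC ltnW // ltn_ceil.
  rewrite lef_pV2 ?posrE // lerB // -[leRHS]expr1 ler_wiXn2l // ltW //.
have h4 : `|(1 - x)^-1 * \sum_(1 <= m < N.+1) chi m / m%:R| <= C / N.+1%:R / (1 - x).
  have ui : 0 <= (1 - x)^-1 by rewrite invr_ge0 ltW.
  by rewrite normrM (ger0_norm ui) mulrC ler_wpM2r.
move: h2 h3 h4; rewrite !ler_norml.
move: ((1 - x)^-1 * _) (\sum_(1 <= d < _) chi d * c d) (\sum_(1 <= d < _) chi d * e d).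
move: (N%:R * _) (C / _ / _) => q r a b c' /andP[? ?] /andP[? ?] /andP[? ?].
by lra.
Qed.

End Lambert.

(* With [1 - y = 1/K], [K = 4^(s+1)], [N = K^2], the squares [m^2 <= 4^s] contribute at least
   [2^s/2] to the Lambert sum, which stays bounded. *)
Lemma real_char_absurd : False.
Proof.
have B0 : 0 <= B by apply: le_trans (chi_sum 0 0).
have C0 : 0 <= C by have := chi_L1 0; rewrite divr1; apply: le_trans.
have key s : (2 ^ s)%N%:R <= 2 * (B + C + 16) :> R.
  set K := (4 ^ s.+1)%N; have K0 : (0 < K)%N by rewrite expn_gt0.
  have K1 : (1 < K)%N by rewrite /K expnS; have : (0 < 4 ^ s)%N by [rewrite expn_gt0|]; lia.
  have Kr : 0 < K%:R :> R by rewrite ltr0n.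
  have Kr1 : 1 < K%:R :> R by rewrite ltr1n.
  pose y : R := 1 - K%:R^-1.
  have Ki : (0 < K%:R^-1 :> R) && (K%:R^-1 < 1 :> R) by rewrite invr_gt0 Kr invf_lt1.
  have y01 : 0 < y < 1 by rewrite /y; case/andP: Ki => ? ?; apply/andP; split; lra.
  have yle : 0 <= y <= 1 by case/andP: y01 => /ltW -> /ltW ->.
  set N := (K ^ 2)%N; have N0 : (0 < N)%N by rewrite expn_gt0 K0.
  have := lambert_le y01 N0; set x := y ^+ 2.
  case/andP: (lambert_x01 y01) => x0 x1; rewrite -/x in x0 x1.
  have xk k : 0 <= x ^+ k by apply: exprn_ge0; exact: ltW.
  have ux : (1 - x)^-1 <= K%:R.
    rewrite -[leRHS]invrK lef_pV2 ?posrE ?invr_gt0 ?subr_gt0 //.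
    by rewrite /x /y expr2; case/andP: Ki => ? ?; nra.
  have u0 : 0 <= (1 - x)^-1 by rewrite invr_ge0 subr_ge0 ltW.
  have lo : (2 ^ s)%N%:R / 2 <= \sum_(1 <= k < N.+1) f k * x ^+ k.
    apply: (@le_trans _ _ (\sum_(1 <= k < ((2 ^ s) ^ 2).+1) f k * x ^+ k)); last first.
      have sN : ((2 ^ s) ^ 2 <= N)%N.
        by rewrite leq_exp2r // /K -[4%N]/(2 ^ 2)%N -expnM leq_exp2l // mul2n -addnn leqW // leq_addr.
      rewrite [leRHS](@big_cat_nat _ _ _ ((2 ^ s) ^ 2).+1) //= lerDl big_nat.
      apply: sumr_ge0 => k /andP[k0 _]; rewrite mulr_ge0 //.
      by have [] := sum_chi_div_ge (leq_ltn_trans (leq0n _) k0).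
    pose F k := if k == 0%N then 0 else f k * x ^+ k.
    have F0 k : 0 <= F k.
      rewrite /F; case: k => //= k; rewrite mulr_ge0 //.
      by case: (@sum_chi_div_ge k.+1 isT).
    rewrite [leRHS](_ : _ = \sum_(1 <= k < ((2 ^ s) ^ 2).+1) F k); last first.
      by apply: eq_big_nat => -[].
    apply: le_trans (sum_squares_le _ F0).
    have -> : (2 ^ s)%N%:R / 2 = \sum_(1 <= m < (2 ^ s).+1) 2^-1 :> R.
      by rewrite sumr_const_nat subn1 mulr_natl.
    rewrite big_nat [leRHS]big_nat; apply: ler_sum => m /andP[m0 ms].
    rewrite /F -[(m ^ 2 == 0)%N]negbK -lt0n expn_gt0 m0 /=.
    have f1 : 1 <= f (m ^ 2).
      have [|_] := @sum_chi_div_ge (m ^ 2); first by rewrite expn_gt0 m0.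
      by apply=> p; rewrite lognX mul2n odd_double.
    have xm : 2^-1 <= x ^+ (m ^ 2).
      rewrite /x -exprM; apply: le_trans (bernoulli _ yle).
      have : (2 * m ^ 2 * 2 <= K)%N.
        have KE : K = (4 * (2 ^ s) ^ 2)%N by rewrite /K expnS -expnM (mulnC s) (expnM 2 2 s).
        by rewrite mulnAC KE leq_mul2l leq_exp2r.
      rewrite -(ler_nat R) natrM => h.
      have : (2 * m ^ 2)%N%:R * K%:R^-1 <= 2^-1 :> R.
        by rewrite ler_pdivrMr // mulrC ler_pdivlMr.
      by rewrite /y; lra.
    by apply: (le_trans xm); rewrite -[leLHS]mul1r ler_wpM2r.
  have t1 : C / N.+1%:R / (1 - x) <= C.
    rewrite -mulrA -[leRHS]mulr1 ler_wpM2l // mulrC ler_pdivrMr ?ltr0n // mul1r.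
    apply: (le_trans ux); rewrite ler_nat leqW // /N expnS expn1 leq_pmulr //.
  have t2 : N%:R * (x ^+ N / (1 - x)) <= 16.
    have xN : x ^+ N <= (2 ^ K)%N%:R^-1.
      have h : 2 <= (1 + K%:R^-1) ^+ K :> R.
        by apply: le_trans (bernoulliD _ _); rewrite ?mulfV ?gt_eqF // ltW //; case/andP: Ki.
      (* [(1 - 1/K) (1 + 1/K)] is at most 1, while [(1 + 1/K)^K >= 2]. *)
      have yK : y ^+ K <= 2^-1.
        rewrite -[2^-1]mul1r ler_pdivlMr //; apply: (@le_trans _ _ (y ^+ K * (1 + K%:R^-1) ^+ K)).
          by rewrite ler_wpM2l // exprn_ge0 //; case/andP: yle.
        rewrite -exprMn exprn_ile1 // /y; case/andP: Ki => k0 k1; last by nra.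
        by rewrite mulr_ge0; lra.
      rewrite /N expnS expn1 exprM natrX -exprVn.
      apply: lerXn2r; rewrite ?nnegrE ?invr_ge0 //.
      apply: le_trans yK; apply: lerXn2r; rewrite ?nnegrE ?(ltW x0) //; first by case/andP: yle.
      by rewrite /x expr2; case/andP: yle => ? ?; rewrite -[leRHS]mulr1 ler_wpM2l.
    (* In exponents of 2 this reads [6 (s + 1) <= 4 + 4^(s + 1)]. *)
    have KK : (K ^ 3 <= 16 * 2 ^ K)%N.
      rewrite {1}/K -(expnM 4) -[16%N]/(2 ^ 4)%N -[4%N in X in (X <= _)%N]/(2 ^ 2)%N.
      by rewrite -expnM -expnD leq_exp2l // [leqRHS]addnC (leq_trans _ (six_mul_le s.+1)) // mulnCA mulnC -mulnA.
    apply: (@le_trans _ _ (N%:R * ((2 ^ K)%N%:R^-1 * K%:R))).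
      by rewrite ler_wpM2l // ler_pM.
    rewrite mulrCA mulrC ler_pdivrMr ?ltr0n ?expn_gt0 // -!natrM ler_nat.
    by rewrite /N -expnSr.
  move=> up; have : (2 ^ s)%N%:R / 2 <= B + C + 16.
    by apply: le_trans lo (le_trans up _); rewrite lerD // lerD2l.
  by rewrite ler_pdivrMr // [leRHS]mulrC.
have [N hN] : exists N : nat, 2 * (B + C + 16) < N%:R.
  by eexists; apply: archi_boundP; lra.
have := key N; apply/negP; rewrite -ltNge; apply: lt_le_trans hN _.
by rewrite ler_nat ltnW // ltn_expl.
Qed.

End RealCharacter.
End BoundedSums.

(** * Functions on the units modulo [W] and their values at 1 *)

Section Progressions.
Variable R : realType.
Variable W : nat.
Hypothesis W0 : (0 < W)%N.

Definition bdd (u : nat -> R) := exists C : R, forall N, `|u N| <= C.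

Lemma bddD u v : bdd u -> bdd v -> bdd (fun N => u N + v N).
Proof.
move=> [C hC] [D hD]; exists (C + D) => N.
by apply: le_trans (ler_normD _ _) _; apply: lerD.
Qed.

Lemma bddZ a u : bdd u -> bdd (fun N => a * u N).
Proof. by move=> [C hC]; exists (`|a| * C) => N; rewrite normrM ler_wpM2l. Qed.

Lemma bddB u v : bdd u -> bdd v -> bdd (fun N => u N - v N).
Proof.
move=> hu /(bddZ (-1)) hv; have [C hC] := bddD hu hv.
by exists C => N; have := hC N; rewrite mulN1r.
Qed.

Lemma bdd_eq u v : (forall N, u N = v N) -> bdd u -> bdd v.
Proof. by move=> uv [C hC]; exists C => N; rewrite -uv. Qed.

Lemma bdd_sum (I : Type) (s : seq I) (u : I -> nat -> R) :
  (forall i, bdd (u i)) -> bdd (fun N => \sum_(i <- s) u i N).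
Proof.
move=> hu; elim: s => [|i s IH].
  by exists 0 => N; rewrite big_nil normr0.
by have := bddD (hu i) IH; apply: bdd_eq => N; rewrite big_cons.
Qed.

Lemma bdd_ln_eq0 a : bdd (fun N => a * ln N%:R) -> a = 0.
Proof.
move=> [C hC]; apply/eqP; rewrite -normr_eq0; apply/negPn/negP => a0.
have {}a0 : 0 < `|a| by rewrite lt_def a0 normr_ge0.
have [N [N0 hN]] := ln_unbounded (C / `|a|).
have := hC N; rewrite leNgt normrM; case/negP.
rewrite ltr_pdivrMr // mulrC in hN; apply: lt_le_trans hN _.
by rewrite ler_wpM2l // ler_norm.
Qed.

Definition periodic (F : nat -> R) := forall n, F (n %% W)%N = F n.
Definition unitfun (F : nat -> R) := periodic F /\ (forall n, ~~ coprime n W -> F n = 0).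
Definition mean0 (F : nat -> R) := \sum_(0 <= r < W) F r = 0.

Lemma periodicDr F n : periodic F -> F (n + W)%N = F n.
Proof. by move=> pF; rewrite -pF modnDr pF. Qed.

Lemma periodic_sum F M : periodic F -> \sum_(M <= m < M + W) F m = \sum_(0 <= r < W) F r.
Proof.
move=> pF; elim: M => // M <-.
have H : (M < M + W)%N by rewrite -{1}[M]addn0 ltn_add2l.
by rewrite [RHS]big_ltn // addSn big_nat_recr //= periodicDr // addrC.
Qed.

Lemma periodic_bounded F : periodic F -> exists2 B, 0 <= B & forall n, `|F n| <= B.
Proof.
move=> pF; exists (\sum_(0 <= r < W) `|F r|); first exact: sumr_ge0.
move=> n; rewrite -pF (big_rem (n %% W)%N) /=; last by rewrite mem_index_iota ltn_pmod.
by rewrite lerDl sumr_ge0.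
Qed.

Lemma mean0_partial F B M k : periodic F -> mean0 F -> (forall n, `|F n| <= B) ->
  `|\sum_(M <= m < M + k) F m| <= W%:R * B.
Proof.
move=> pF mF FB; have B0 : 0 <= B by apply: le_trans (FB 0%N).
have [n] := ubnP k; elim: n k M => // n IH k M kn.
have [kW|Wk] := ltnP k W.
  apply: le_trans (ler_norm_sum _ _ _) _.
  apply: (@le_trans _ _ (\sum_(M <= m < M + k) B)); first exact: ler_sum.
  by rewrite sumr_const_nat addKn -[leLHS]mulr_natl ler_wpM2r // ler_nat ltnW.
rewrite (@big_cat_nat _ _ _ (M + W)) ?leq_addr ?leq_add2l //= periodic_sum // mF add0r.
rewrite -(subnKC Wk) addnA; apply: IH.
by rewrite -ltnS (leq_trans _ kn) // ltnS ltn_subrL W0 (leq_trans W0).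
Qed.

Lemma modn_mul_inj a r s : coprime a W -> (r < W)%N -> (s < W)%N ->
  (r * a = s * a %[mod W])%N -> r = s.
Proof.
move=> ca; wlog rs : r s / (r <= s)%N => [H|].
  by case/orP: (leq_total r s) => h ? ? E; [|apply/esym]; apply: H.
move=> rW sW /esym/eqP; rewrite eqn_mod_dvd ?leq_mul2r ?rs ?orbT // -mulnBl.
rewrite Gauss_dvdl; last by rewrite coprime_sym.
move=> d; apply/eqP; rewrite eqn_leq rs -subn_eq0; apply/eqP; apply: contraTeq d => h.
by rewrite gtnNdvd ?lt0n // (leq_ltn_trans (leq_subr _ _)).
Qed.

Lemma sum_unit_mul F a : periodic F -> coprime a W ->
  \sum_(0 <= r < W) F (r * a)%N = \sum_(0 <= r < W) F r.
Proof.
move=> pF ca; rewrite !big_mkord.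
pose h (r : 'I_W) : 'I_W := Ordinal (ltn_pmod (r * a) W0).
have hi : injective h.
  move=> r s /(congr1 val) /= E; apply: val_inj => /=.
  exact: modn_mul_inj E.
rewrite [RHS](reindex_inj hi) /=; apply: eq_bigr => r _; by rewrite pF.
Qed.

Lemma unitfun_shift F g : unitfun F -> unitfun (fun n => F (g * n)%N).
Proof.
move=> [pF uF]; split=> n; first by rewrite -[LHS]pF modnMmr pF.
by move=> cn; apply: uF; rewrite coprimeMl negb_and cn orbT.
Qed.

Lemma mean0_shift F g : unitfun F -> mean0 F -> mean0 (fun n => F (g * n)%N).
Proof.
move=> [pF uF] mF; have [cg|cg] := boolP (coprime g W).
  by rewrite /mean0; under eq_bigr do rewrite mulnC; rewrite sum_unit_mul.
by rewrite /mean0 big1 // => n _; apply: uF; rewrite coprimeMl negb_and cg.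
Qed.

(** [G g] is the sum of the series of [F (g m) / m], with an error [O(1/N)] uniform in [g]. This
    operator on mean-zero functions of units replaces the values of L-functions at 1, and
    multiplication by a unit plays the role of the characters. *)
Definition isL (F G : nat -> R) := exists C : R, forall g N,
  `|\sum_(1 <= m < N.+1) F (g * m)%N / m%:R - G g| <= C / N.+1%:R.

Lemma sum_nat_cat (F : nat -> R) a m n : (a <= m <= n)%N ->
  \sum_(a <= i < n) F i - \sum_(a <= i < m) F i = \sum_(m <= i < n) F i.
Proof. by case/andP=> h1 h2; rewrite (big_cat_nat h1 h2) /= addrAC subrr add0r. Qed.

Lemma isL_exists F : unitfun F -> mean0 F -> exists G, isL F G.
Proof.
move=> uF mF; have [pF _] := uF; have [B B0 FB] := periodic_bounded pF.
suff /boolp.choice[G hG] : forall g, exists l, forall N,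
    `|\sum_(1 <= m < N.+1) F (g * m)%N / m%:R - l| <= W%:R * B / N.+1%:R.
  by exists G; exists (W%:R * B).
move=> g; apply: lim_exists => N M NM.
rewrite sum_nat_cat ?ltnS // -(subnKC (NM : N.+1 <= M.+1)%N).
apply: (@abel_le _ _ _ _ (fun m => m%:R^-1)) => [m _|m Nm|k].
- by rewrite invr_ge0.
- by rewrite lef_pV2 ?posrE ?ltr0n ?ler_nat // (leq_trans _ Nm).
- by apply: mean0_partial (fun n => FB (g * n)%N); [case: (unitfun_shift g uF) | exact: mean0_shift].
Qed.

Lemma isL_unique F F' G G' g g' : isL F G -> isL F' G' ->
  (forall n, F (g * n)%N = F' (g' * n)%N) -> G g = G' g'.
Proof.
move=> [C hC] [D hD] E; apply/eqP; rewrite -subr_eq0; apply/eqP.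
apply: (@le_inv_eq0 _ _ (C + D)) => N.
apply: le_trans (ler_distD (\sum_(1 <= m < N.+1) F (g * m)%N / m%:R) _ _) _.
rewrite mulrDl distrC lerD //; have := hD g' N.
by under eq_bigr do rewrite -E.
Qed.

Lemma isL0 : isL (fun=> 0) (fun=> 0).
Proof. by exists 0 => g N; rewrite big1 ?subrr ?normr0 ?mul0r // => m _; rewrite mul0r. Qed.

Lemma isL_eq F F' G G' : (forall n, F n = F' n) -> (forall n, G n = G' n) -> isL F G -> isL F' G'.
Proof.
move=> FF GG [C hC]; exists C => g N; rewrite -GG.
by under eq_bigr do rewrite -FF; exact: hC.
Qed.

Lemma isLD a F F' G G' : isL F G -> isL F' G' ->
  isL (fun n => a * F n + F' n) (fun n => a * G n + G' n).
Proof.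
move=> [C hC] [D hD]; exists (`|a| * C + D) => g N.
have -> : \sum_(1 <= m < N.+1) (a * F (g * m)%N + F' (g * m)%N) / m%:R - (a * G g + G' g) =
   a * (\sum_(1 <= m < N.+1) F (g * m)%N / m%:R - G g)
   + (\sum_(1 <= m < N.+1) F' (g * m)%N / m%:R - G' g).
  have -> : \sum_(1 <= m < N.+1) (a * F (g * m)%N + F' (g * m)%N) / m%:R =
    a * \sum_(1 <= m < N.+1) F (g * m)%N / m%:R + \sum_(1 <= m < N.+1) F' (g * m)%N / m%:R.
    by rewrite mulr_sumr -big_split /=; apply: eq_bigr => m _; ring.
  ring.
apply: le_trans (ler_normD _ _) _; rewrite mulrDl -mulrA; apply: lerD => //.
by rewrite normrM ler_wpM2l.
Qed.

Lemma isL_sum (I : Type) (s : seq I) (x : I -> R) (F G : I -> nat -> R) :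
  (forall i, isL (F i) (G i)) ->
  isL (fun n => \sum_(i <- s) x i * F i n) (fun n => \sum_(i <- s) x i * G i n).
Proof.
move=> H; elim: s => [|i s IH].
  by apply: isL_eq isL0 => n; rewrite big_nil.
by apply: isL_eq (isLD (x i) (H i) IH) => n; rewrite big_cons.
Qed.

Lemma isL_unitfun F G : unitfun F -> mean0 F -> isL F G -> unitfun G /\ mean0 G.
Proof.
move=> uF mF LG; have [pF zF] := uF; split; first split=> n.
- apply: (isL_unique LG LG) => m; by rewrite -[LHS]pF modnMml pF.
- move=> cn; apply: (isL_unique (g' := 0%N) LG isL0) => m; apply: zF.
  by rewrite coprimeMl negb_and cn.
case: LG => C hC; apply: (@le_inv_eq0 _ _ (\sum_(0 <= r < W) C)) => N.
have E : \sum_(0 <= g < W) \sum_(1 <= m < N.+1) F (g * m)%N / m%:R = 0.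
  rewrite exchange_big /= big1 // => m _; rewrite -mulr_suml.
  under eq_bigr do rewrite mulnC.
  by rewrite (mean0_shift m uF mF) mul0r.
rewrite -normrN -[X in `|X|]add0r -[X in X - _]E -sumrB mulr_suml.
by apply: le_trans (ler_norm_sum _ _ _) _; apply: ler_sum.
Qed.

Definition cproj (F : nat -> R) (n : nat) : R :=
  (coprime n W)%:R * (F n - (\sum_(0 <= r < W) (coprime r W)%:R * F r) / (totient W)%:R).

Lemma coprime_modW n : coprime (n %% W) W = coprime n W.
Proof. exact: coprime_modl. Qed.

Lemma sum_coprime : \sum_(0 <= r < W) (coprime r W)%:R = (totient W)%:R :> R.
Proof.
rewrite totient_count_coprime natr_sum; apply: eq_bigr => r _.
by rewrite coprime_sym.
Qed.

Lemma totW_neq0 : (totient W)%:R != 0 :> R.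
Proof. by rewrite pnatr_eq0 -lt0n totient_gt0. Qed.

Lemma unitfun_cproj F : periodic F -> unitfun (cproj F).
Proof.
move=> pF; split=> n; first by rewrite /cproj coprime_modW pF.
by rewrite /cproj => /negbTE ->; rewrite mul0r.
Qed.

Lemma mean0_cproj F : mean0 (cproj F).
Proof.
rewrite /mean0 /cproj; set m := _ / _.
have -> : \sum_(0 <= r < W) (coprime r W)%:R * (F r - m) =
  \sum_(0 <= r < W) (coprime r W)%:R * F r - (\sum_(0 <= r < W) (coprime r W)%:R) * m.
  by rewrite mulr_suml -sumrB; apply: eq_bigr => r _; rewrite mulrBr.
by rewrite sum_coprime /m mulrC divfK ?totW_neq0 // subrr.
Qed.

(* [L] is a linear endomorphism of a finite-dimensional space: it is onto or has a kernel. *)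
Lemma isL_dichotomy :
  (forall u, unitfun u -> mean0 u -> exists F, [/\ unitfun F, mean0 F & isL F u]) \/
  (exists v, [/\ unitfun v, mean0 v, isL v (fun=> 0) & exists n, v n != 0]).
Proof.
pose dl (j : 'I_W) (n : nat) : R := (n %% W == j)%N%:R.
have pdl j : periodic (dl j) by move=> n; rewrite /dl modn_mod.
have /boolp.choice[G hG] : forall j, exists G, isL (cproj (dl j)) G.
  by move=> j; apply: isL_exists; [exact: unitfun_cproj | exact: mean0_cproj].
pose fn (x : 'rV[R]_W) (n : nat) : R := x 0 (Ordinal (ltn_pmod n W0)).
have pfn x : periodic (fn x).
  by move=> n; rewrite /fn; congr (x 0 _); apply: val_inj; rewrite /= modn_mod.
have fnE x n : fn x n = \sum_j x 0 j * dl j n.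
  rewrite (bigD1 (Ordinal (ltn_pmod n W0))) //= /dl /= eqxx mulr1 big1 ?addr0 // => j nj.
  rewrite (_ : (_ == _) = false) ?mulr0 //; apply/negbTE; apply: contra nj => /eqP E.
  by apply/eqP; apply: val_inj.
have cpE x n : cproj (fn x) n = \sum_j x 0 j * cproj (dl j) n.
  rewrite /cproj.
  have -> : \sum_(0 <= r < W) (coprime r W)%:R * fn x r =
     \sum_j x 0 j * \sum_(0 <= r < W) (coprime r W)%:R * dl j r.
    under eq_bigr do rewrite fnE mulr_sumr.
    rewrite exchange_big /=; apply: eq_bigr => j _; rewrite mulr_sumr.
    by apply: eq_bigr => r _; rewrite mulrCA.
  rewrite fnE mulr_suml -sumrB mulr_sumr; apply: eq_bigr => j _; ring.
(* The operator acts only on mean-zero functions supported on units. Adding the complementary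
   projection extends it to all functions modulo [W], so that one determinant decides between the
   two alternatives. *)
pose A : 'M[R]_W := \matrix_(j, g) (G j g + dl j g - cproj (dl j) g).
pose LG (x : 'rV[R]_W) n := \sum_j x 0 j * G j n.
have hL x : isL (cproj (fn x)) (LG x).
  by apply: isL_eq (isL_sum _ (fun j => x 0 j) hG) => n //; rewrite cpE.
have uL x : unitfun (LG x) /\ mean0 (LG x).
  by apply: isL_unitfun (hL x); [exact: unitfun_cproj | exact: mean0_cproj].
have AE x (g : 'I_W) : (x *m A) 0 g = LG x g + fn x g - cproj (fn x) g.
  rewrite mxE /LG fnE cpE -big_split /= -sumrB; apply: eq_bigr => j _; rewrite mxE; ring.
pose mu x : R := (\sum_(0 <= r < W) (coprime r W)%:R * fn x r) / (totient W)%:R.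
have cE x n : coprime n W -> fn x n - cproj (fn x) n = mu x.
  by move=> cn; rewrite /cproj cn mul1r subKr.
(* On units the complementary part is the constant [mu x]; both [u] and [LG x] have mean zero, so
   this constant vanishes. *)
have key x u : unitfun u -> mean0 u -> (forall g : 'I_W, (x *m A) 0 g = u g) ->
    mu x = 0 /\ forall n, LG x n = u n.
  move=> [pu zu] mu0 xu; have [[pL zL] mL] := uL x.
  have E n : coprime n W -> u n = LG x n + mu x.
    move=> cn; rewrite -pu -[u _](xu (Ordinal (ltn_pmod n W0))) AE /=.
    by rewrite -addrA cE ?coprime_modW // pL.
  have m0 : mu x = 0.
    have : \sum_(0 <= r < W) u r = \sum_(0 <= r < W) (LG x r + (coprime r W)%:R * mu x).
      apply: eq_bigr => r _; case: (boolP (coprime r W)) => cr; first by rewrite E // mul1r.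
      by rewrite zu // zL // mul0r addr0.
    rewrite mu0 big_split /= mL add0r -mulr_suml sum_coprime => /esym/eqP.
    by rewrite mulf_eq0 (negbTE totW_neq0) => /eqP.
  split=> // n; case: (boolP (coprime n W)) => cn; first by rewrite E // m0 addr0.
  by rewrite zu // zL.
have [dA|dA] := eqVneq (\det A) 0.
  right; have /det0P[x x0 xA] : \det A == 0 by rewrite dA.
  have [m0 Lx] : mu x = 0 /\ forall n, LG x n = 0.
    apply: key => [||g]; last by rewrite xA mxE.
      by split.
    by rewrite /mean0 big1.
  exists (cproj (fn x)); split; first exact: unitfun_cproj.
  - exact: mean0_cproj.
  - exact: isL_eq (hL x).
  apply: contrapT => /boolp.forallNP H; case/negP: x0; apply/eqP/rowP => g; rewrite mxE.
  have c0 n : cproj (fn x) n = 0 by apply/eqP/negPn/negP; exact: H.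
  have := AE x g; rewrite xA mxE Lx c0 add0r subr0 /fn => ->.
  by congr (x 0 _); apply: val_inj; rewrite /= modn_small.
left=> u uu mu0.
have Au : A \in unitmx by rewrite unitmxE unitfE.
pose x := (\row_(g < W) u g) *m invmx A.
exists (cproj (fn x)); split; first exact: unitfun_cproj.
  exact: mean0_cproj.
have [_ Lx] : mu x = 0 /\ forall n, LG x n = u n.
  by apply: key => // g; rewrite mulmxKV // mxE.
exact: isL_eq (hL x).
Qed.

Definition Sv (F : nat -> R) g N := \sum_(1 <= n < N.+1) vM R n / n%:R * F (g * n)%N.

Lemma err_le (C : R) d N : 0 <= C -> (0 < d)%N -> (0 < N)%N ->
  d%:R^-1 * (C / (N %/ d).+1%:R) <= C / N%:R.
Proof.
move=> C0 d0 N0; rewrite mulrCA -invfM ler_wpM2l // lef_pV2 ?posrE ?mulr_gt0 ?ltr0n //.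
by rewrite -natrM ler_nat mulnC ltnW // ltn_ceil.
Qed.

Lemma isL_C_ge0 F G C : (forall g N, `|\sum_(1 <= m < N.+1) F (g * m)%N / m%:R - G g : R| <= C / N.+1%:R) ->
  0 <= C.
Proof. by move=> /(_ 0%N 0%N); rewrite divr1; apply: le_trans. Qed.

Lemma bdd_log_weight F : unitfun F -> mean0 F -> bdd (fun N => \sum_(1 <= n < N.+1) F n / n%:R * ln n%:R).
Proof.
move=> uF mF; have [pF _] := uF; have [B B0 FB] := periodic_bounded pF.
have part k : `|\sum_(1 <= m < 1 + k) F m| <= W%:R * B by exact: mean0_partial.
have pA (c : nat -> R) : (forall m, (1 <= m)%N -> 0 <= c m) ->
   (forall m, (1 <= m)%N -> c m.+1 <= c m) -> bdd (fun N => \sum_(1 <= n < N.+1) F n * c n).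
  by move=> c0 cd; exists (W%:R * B * c 1%N) => N; rewrite -add1n; exact: abel_le.
(* [(ln n + 2) / n] decreases from [n = 1] on, unlike [ln n / n]; the added [2 / n] is subtracted
   again through [h2]. *)
have h1 : bdd (fun N => \sum_(1 <= n < N.+1) F n * ((ln n%:R + 2) / n%:R)).
  apply: pA => m m1.
    by rewrite divr_ge0 // addr_ge0 // ln_ge0 // ler1n.
  have mr : 0 < m%:R :> R by rewrite ltr0n.
  rewrite ler_pdivrMr ?ltr0n // mulrAC ler_pdivlMr // -natr1.
  have := @ln_natS_le R m m1; rewrite -(ler_pM2r mr) mulVf ?gt_eqF //.
  have l0 : 0 <= ln m%:R :> R by rewrite ln_ge0 // ler1n.
  rewrite -natr1; set x := ln (_ + 1); set y := ln m%:R in l0 *; lra.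
have h2 : bdd (fun N => \sum_(1 <= n < N.+1) F n * n%:R^-1).
  apply: pA => m m1; first by rewrite invr_ge0.
  by rewrite lef_pV2 ?posrE ?ltr0n // ler_nat.
have := bddB h1 (bddZ 2 h2); apply: bdd_eq => N.
by rewrite mulr_sumr -sumrB; apply: eq_bigr => n _; ring.
Qed.

(** Since [ln] is the divisor sum of von Mangoldt's function, [Sv G g N] is the bounded sum of
    [F (g n) ln n / n] up to the tails of the series defining [G]; Chebyshev's bound controls their
    total. *)
Lemma isL_bdd F G g : unitfun F -> mean0 F -> isL F G -> bdd (Sv G g).
Proof.
move=> uF mF [C hC]; have C0 := isL_C_ge0 hC.
have h1 := bdd_log_weight (unitfun_shift g uF) (mean0_shift g uF mF).
suff h2 : bdd (fun N => Sv G g N - \sum_(1 <= n < N.+1) F (g * n)%N / n%:R * ln n%:R).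
  by apply: bdd_eq (bddD h1 h2) => N; rewrite addrC subrK.
exists (4 * C) => N; have [->|N0] := posnP N.
  by rewrite /Sv !big_geq // subrr normr0 mulr_ge0.
have -> : Sv G g N - \sum_(1 <= n < N.+1) F (g * n)%N / n%:R * ln n%:R =
  \sum_(1 <= d < N.+1) vM R d / d%:R *
    (G (g * d)%N - \sum_(1 <= m < (N %/ d).+1) F (g * d * m)%N / m%:R).
  rewrite (vM_conv N (fun n => F (g * n)%N / n%:R)) -sumrB; apply: eq_bigr => d _.
  rewrite mulrBr; congr (_ - _); rewrite -mulrA; congr (_ * _).
  by rewrite mulr_sumr; apply: eq_bigr => m _; rewrite mulnA natrM invfM mulrCA.
apply: le_trans (ler_norm_sum _ _ _) _.
apply: (@le_trans _ _ (\sum_(1 <= d < N.+1) vM R d * (C / N%:R))).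
  rewrite big_nat [leRHS]big_nat; apply: ler_sum => d /andP[d0 _].
  have v0 := vM_ge0 R d; rewrite normrM ger0_norm ?divr_ge0 //.
  rewrite -mulrA ler_wpM2l //; apply: le_trans (err_le C0 d0 N0).
  by rewrite ler_wpM2l ?invr_ge0 // distrC.
rewrite -mulr_suml -/(psi R N) mulrA ler_pdivrMr ?ltr0n // mulrAC ler_wpM2r //.
exact: psi_le.
Qed.

(** By [mob_log] with [x = ln N] the quantity is a Moebius-weighted sum of partial sums of series
    with value 0. Their errors [C / N], weighted by [ln N - ln d], add up to [O(1)] because
    [ln N! >= N ln N - N]. *)
Lemma isL0_bdd F g : unitfun F -> mean0 F -> isL F (fun=> 0) ->
  bdd (fun N => Sv F g N + F g * ln N%:R).
Proof.
move=> uF mF [C hC]; have C0 := isL_C_ge0 hC; exists C => N.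
have [->|N0] := posnP N; first by rewrite /Sv big_geq // ln0 // mulr0 addr0 normr0.
have -> : Sv F g N + F g * ln N%:R =
   \sum_(1 <= k < N.+1) F (g * k)%N / k%:R * (ln N%:R * (k == 1%N)%:R + vM R k).
  rewrite addrC /Sv; under [RHS]eq_bigr do rewrite mulrDr.
  rewrite big_split /=; congr (_ + _); last by apply: eq_bigr => k _; ring.
  rewrite big_ltn // eqxx muln1 divr1 mulr1 big_nat_cond big1 ?addr0 //.
  by move=> k /andP[/andP[k1 _] _]; rewrite gtn_eqF // !mulr0.
have -> : \sum_(1 <= k < N.+1) F (g * k)%N / k%:R * (ln N%:R * (k == 1%N)%:R + vM R k) =
   \sum_(1 <= d < N.+1) mob R d * (ln N%:R - ln d%:R) * (d%:R^-1 *
      \sum_(1 <= m < (N %/ d).+1) F (g * d * m)%N / m%:R).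
  transitivity (\sum_(1 <= d < N.+1) \sum_(1 <= m < (N %/ d).+1)
     mob R d * (ln N%:R - ln d%:R) * (F (g * (d * m))%N / (d * m)%N%:R)); last first.
    apply: eq_bigr => d _; rewrite -mulr_sumr; congr (_ * _); rewrite mulr_sumr.
    by apply: eq_bigr => m _; rewrite mulnA natrM invfM mulrCA.
  rewrite -(sum_hyperbola N (fun d m => mob R d * (ln N%:R - ln d%:R) * (F (g * (d * m))%N / (d * m)%N%:R))).
  apply: eq_big_nat => k /andP[k0 _]; rewrite -mob_log // mulrC mulr_suml.
  by apply: eq_bigr => d dk; rewrite [(d * (k %/ d))%N]mulnC divnK.
apply: le_trans (ler_norm_sum _ _ _) _.
apply: (@le_trans _ _ (\sum_(1 <= d < N.+1) (ln N%:R - ln d%:R) * (C / N%:R))).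
  rewrite big_nat [leRHS]big_nat; apply: ler_sum => d /andP[d0 dN].
  have l0 : 0 <= ln N%:R - ln d%:R :> R.
    by rewrite subr_ge0 ler_ln ?posrE ?ltr0n // ler_nat -ltnS.
  rewrite normrM; apply: ler_pM => //.
    by rewrite normrM (ger0_norm l0) -[leRHS]mul1r ler_wpM2r // mob_le1.
  apply: le_trans (err_le C0 d0 N0); rewrite normrM ger0_norm ?invr_ge0 // ler_wpM2l ?invr_ge0 //.
  by have := hC (g * d)%N (N %/ d)%N; rewrite subr0.
have Nr : 0 < N%:R :> R by rewrite ltr0n.
rewrite -mulr_suml sumrB sumr_const_nat subn1 /= -/(lfact R N) mulrA ler_pdivrMr // mulrC.
by rewrite ler_wpM2l // -[ln _ *+ _]mulr_natl; have := @lfact_ge R N N0; lra.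
Qed.

Lemma geom_tail (p a n : nat) : (1 < p)%N ->
  \sum_(a <= k < a + n) (p ^ k)%N%:R^-1 <= 2 / (p ^ a)%N%:R - 2 / (p ^ (a + n))%N%:R :> R.
Proof.
move=> p1; have p0 : (0 < p)%N by apply: ltnW.
elim: n => [|n IH]; first by rewrite addn0 big_geq // subrr.
rewrite addnS big_nat_recr ?leq_addr //=.
have pr : 2 <= p%:R :> R by rewrite ler_nat.
have -> : 2 / (p ^ (a + n).+1)%N%:R = (p ^ (a + n))%N%:R^-1 * (2 / p%:R) :> R.
  by rewrite expnS natrM invfM; ring.
have h : 2 / p%:R <= 1 :> R by rewrite ler_pdivrMr ?mul1r // ltr0n.
have q0 : 0 <= (p ^ (a + n))%N%:R^-1 :> R by rewrite invr_ge0.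
by have := ler_wpM2l q0 h; lra.
Qed.

Lemma vM_neq0 n : vM R n != 0 -> exists p k, [/\ prime p, (0 < k)%N & n = (p ^ k)%N].
Proof.
rewrite /vM; case E: (primes n) => [|p []]; rewrite ?eqxx // => _.
have : p \in primes n by rewrite E mem_head.
rewrite mem_primes => /and3P[pp n0 pn]; exists p, (logn p n).
have [m cm nE] := pfactor_coprime pp n0.
split=> //; first by rewrite logn_gt0 mem_primes pp n0.
suff m1 : m = 1%N by rewrite {1}nE m1 mul1n.
have m0 : (0 < m)%N by move: n0; rewrite nE muln_gt0 => /andP[].
apply/eqP; rewrite eqn_leq m0 andbT leqNgt; apply/negP => m2.
have pq := pdiv_prime m2; have qm := pdiv_dvd m; set q := pdiv m in pq qm.
have : q \in primes n by rewrite mem_primes pq n0 nE dvdn_mulr.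
rewrite E inE => /eqP qp; move: cm; rewrite prime_coprime // -qp.
by rewrite qm.
Qed.

Lemma vM_powers_le (P : pred nat) N :
  \sum_(1 <= n < N.+1 | P n) vM R n / n%:R <=
  \sum_(1 <= p < N.+1 | prime p) \sum_(1 <= k < N.+1 | P (p ^ k)%N) ln p%:R / (p ^ k)%N%:R.
Proof.
pose T n p k : R := (n == p ^ k)%N%:R * (ln p%:R / (p ^ k)%N%:R).
have T0 n p k : 0 <= T n p k.
  rewrite /T mulr_ge0 // divr_ge0 //; case: p => [|p]; first by rewrite ln0.
  by rewrite ln_ge0 // ler1n.
have h1 n : (1 <= n < N.+1)%N -> P n -> vM R n / n%:R <=
    \sum_(1 <= p < N.+1 | prime p) \sum_(1 <= k < N.+1 | P (p ^ k)%N) T n p k.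
  move=> /andP[n0 nN] Pn; have [->|vn] := eqVneq (vM R n) 0.
    by rewrite mul0r; do 2!apply: sumr_ge0 => ? _.
  have [p [k [pp k0 nE]]] := vM_neq0 vn.
  have pN : (1 <= p < N.+1)%N.
    by rewrite prime_gt0 // (leq_ltn_trans _ nN) // nE -{1}[p]expn1 leq_exp2l // prime_gt1.
  have kN : (1 <= k < N.+1)%N.
    by rewrite k0 (leq_ltn_trans _ nN) // nE ltnW // ltn_expl // prime_gt1.
  rewrite big_mkcond (big_rem p) /=; last by rewrite mem_index_iota.
  rewrite pp -[leLHS]addr0; apply: lerD; last first.
    by apply: sumr_ge0 => q _; case: ifP => // _; apply: sumr_ge0.
  rewrite big_mkcond (big_rem k) /=; last by rewrite mem_index_iota.
  rewrite -nE Pn -[leLHS]addr0; apply: lerD; last first.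
    by apply: sumr_ge0 => q _; case: ifP.
  rewrite /T -nE eqxx mul1r nE /vM; case: (k) k0 => // k' _.
  by rewrite primesX // primes_prime.
apply: (@le_trans _ _ (\sum_(1 <= n < N.+1 | P n)
    \sum_(1 <= p < N.+1 | prime p) \sum_(1 <= k < N.+1 | P (p ^ k)%N) T n p k)).
  rewrite big_nat_cond [leRHS]big_nat_cond; apply: ler_sum => n /andP[]; exact: h1.
rewrite exchange_big /=; apply: ler_sum => p _; rewrite exchange_big /=; apply: ler_sum => k _.
rewrite -mulr_suml -[leRHS]mul1r ler_wpM2r //.
  by have := T0 (p ^ k)%N p k; rewrite /T eqxx mul1r.
rewrite -natr_sum -[leRHS]/(1%:R) ler_nat.
have -> : (\sum_(1 <= i < N.+1 | P i) (i == p ^ k) =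
           count (pred1 (p ^ k)%N) [seq i <- index_iota 1 N.+1 | P i])%N.
  by rewrite -sum1_count big_filter_cond /= big_mkcondr; apply: eq_bigr => i _; case: eqP.
by rewrite count_uniq_mem ?filter_uniq ?iota_uniq // leq_b1.
Qed.

Lemma sum_ln_sq_le N : \sum_(1 <= n < N.+1) ln n%:R / n%:R ^+ 2 <= 2 :> R.
Proof.
have [->|N0] := posnP N; first by rewrite big_geq.
(* The tail integral would be [(ln N + 1) / N]; the extra [1 / N] makes the induction go through,
   with equality at [N = 1]. *)
suff H : \sum_(1 <= n < N.+1) ln n%:R / n%:R ^+ 2 <= 2 - (ln N%:R + 2) / N%:R :> R.
  by apply: (le_trans H); rewrite gerBl divr_ge0 // addr_ge0 // ln_ge0 // ler1n.
elim: N N0 => // -[_|n IH _]; first by rewrite big_nat1 ln1 mul0r add0r divr1 subrr.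
rewrite big_nat_recr //=; have {}IH := IH isT.
have E : n.+2%:R = n.+1%:R + 1 :> R by rewrite natr1.
have x1 : 1 <= n.+1%:R :> R by rewrite ler1n.
have b0 : 0 <= ln n.+2%:R :> R by rewrite ln_ge0 // ler1n.
have := @ln_natS_le R n.+1 isT.
move: IH b0; rewrite E; set x := n.+1%:R in x1 *; set b := ln (x + 1); set a := ln x.
set S := \sum_(1 <= i < _) _ => IH b0 l1.
apply: (le_trans (lerD IH (lexx _))); rewrite -subr_ge0.
have -> : 2 - (b + 2) / (x + 1) - (2 - (a + 2) / x + b / (x + 1) ^+ 2) =
  (x^-1 - (b - a)) / x + b / (x * (x + 1) ^+ 2) + (x - 1) / (x ^+ 2 * (x + 1)).
  by field; apply/andP; split; lra.
have x0 : 0 <= x by lra.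
have xs : 0 <= x + 1 by lra.
by rewrite !addr_ge0 // divr_ge0 ?mulr_ge0 ?exprn_ge0 // subr_ge0.
Qed.

Lemma vM_powers_geom (P Q : pred nat) a N : (0 < a)%N ->
  (forall p k, prime p -> (0 < k)%N -> P (p ^ k)%N -> Q p && (a <= k)%N) ->
  \sum_(1 <= n < N.+1 | P n) vM R n / n%:R <=
  2 * \sum_(1 <= p < N.+1 | Q p) ln p%:R / p%:R ^+ a.
Proof.
move=> a0 PQ; apply: le_trans (vM_powers_le P N) _.
rewrite mulr_sumr big_mkcond [leRHS]big_mkcond /=.
rewrite big_nat [leRHS]big_nat; apply: ler_sum => p /andP[p1 _].
have lp : 0 <= ln p%:R :> R by rewrite ln_ge0 // ler1n.
have r0 : 0 <= 2 * (ln p%:R / p%:R ^+ a) :> R by rewrite mulr_ge0 // divr_ge0 // exprn_ge0.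
case: ifP => pp; last by case: ifP.
have t0 k : 0 <= ln p%:R / (p ^ k)%N%:R :> R by rewrite divr_ge0.
have H : \sum_(1 <= k < N.+1 | P (p ^ k)%N) ln p%:R / (p ^ k)%N%:R <=
    \sum_(1 <= k < N.+1) (if Q p && (a <= k)%N then ln p%:R / (p ^ k)%N%:R else 0) :> R.
  rewrite big_mkcond big_nat [leRHS]big_nat; apply: ler_sum => k /andP[k1 _].
  case: ifP => Pk; first by rewrite PQ.
  by case: ifP.
apply: (le_trans H); case: (Q p) => /=; last by rewrite big1.
have [aN|Na] := ltnP a N.+1; last first.
  rewrite big_nat_cond big1 // => k /andP[/andP[_ kN] _].
  by rewrite leqNgt (leq_trans kN Na).
rewrite (big_cat_nat (a0 : 1 <= a)%N (ltnW aN)) /= big_nat_cond big1 ?add0r; last first.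
  by move=> k /andP[/andP[_ ka] _]; rewrite leqNgt ka.
have -> : \sum_(a <= k < N.+1) (if (a <= k)%N then ln p%:R / (p ^ k)%N%:R else 0) =
   ln p%:R * \sum_(a <= k < a + (N.+1 - a)) (p ^ k)%N%:R^-1 :> R.
  rewrite subnKC ?(ltnW aN) // mulr_sumr; apply: eq_big_nat => k /andP[-> _] //.
rewrite mulrCA ler_wpM2l //; apply: le_trans (geom_tail _ _ (prime_gt1 pp)) _.
by rewrite natrX lerBlDr lerDl divr_ge0.
Qed.

Lemma bdd_le_ge0 (u : nat -> R) C : (forall N, 0 <= u N) -> (forall N, u N <= C) -> bdd u.
Proof. by move=> u0 uC; exists C => N; rewrite ger0_norm. Qed.

Lemma bdd_vM_nonprime (P : pred nat) :
  bdd (fun N => \sum_(1 <= n < N.+1 | ~~ prime n && P n) vM R n / n%:R).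
Proof.
apply: (@bdd_le_ge0 _ 4) => N.
  by apply: sumr_ge0 => n _; rewrite divr_ge0 ?vM_ge0.
apply: le_trans (_ : 2 * \sum_(1 <= p < N.+1 | true) ln p%:R / p%:R ^+ 2 <= _).
  apply: (@vM_powers_geom _ xpredT 2) => // p [|[|k]] // pp _.
  by rewrite expn1 pp.
by rewrite (_ : 4 = 2 * 2 :> R) ?ler_wpM2l ?sum_ln_sq_le // -natrM.
Qed.

Lemma bdd_vM_noncoprime : bdd (fun N => \sum_(1 <= n < N.+1 | ~~ coprime n W) vM R n / n%:R).
Proof.
apply: (@bdd_le_ge0 _ (2 * \sum_(1 <= p < W.+1) ln p%:R / p%:R)) => N.
  by apply: sumr_ge0 => n _; rewrite divr_ge0 ?vM_ge0.
apply: le_trans (_ : 2 * \sum_(1 <= p < N.+1 | (p <= W)%N) ln p%:R / p%:R ^+ 1 <= _).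
  apply: (@vM_powers_geom _ (fun p => p <= W)%N 1) => // p k pp k0.
  by rewrite coprime_pexpl // prime_coprime // negbK k0 => pW; rewrite dvdn_leq.
rewrite ler_wpM2l //.
have t0 p : 0 <= ln p%:R / p%:R :> R.
  by case: p => [|p]; rewrite ?invr0 ?mulr0 // divr_ge0 // ln_ge0 // ler1n.
have [NW|/ltnW WN] := leqP N W.
  rewrite (_ : \sum_(1 <= p < W.+1) _ = \sum_(1 <= p < N.+1) ln p%:R / p%:R +
     \sum_(N.+1 <= p < W.+1) ln p%:R / p%:R); last first.
    by rewrite -(@big_cat_nat _ _ _ N.+1) ?ltnS.
  rewrite -[leLHS]addr0; apply: lerD; last exact: sumr_ge0.
  by rewrite big_mkcond; apply: ler_sum => p _; case: ifP.
rewrite big_mkcond (@big_cat_nat _ _ _ W.+1) //= [X in _ + X]big_nat_cond [X in _ + X]big1 ?addr0.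
  by apply: ler_sum => p _; case: ifP.
by move=> p /andP[/andP[Wp _] _]; rewrite leqNgt Wp.
Qed.

Lemma bdd_vM_coprime :
  bdd (fun N => \sum_(1 <= n < N.+1) vM R n / n%:R * (coprime n W)%:R - ln N%:R).
Proof.
have h1 : bdd (fun N => mertens R N - ln N%:R).
  exists 4 => N; have [->|N0] := posnP N; first by rewrite /mertens big_geq // ln0 // subrr normr0.
  have := @mertens_le R N N0; have := @mertens_ge R N N0.
  by rewrite ler_norml => ? ?; apply/andP; split; lra.
apply: bdd_eq (bddB h1 bdd_vM_noncoprime) => N.
rewrite addrAC; congr (_ - _); rewrite /mertens [X in _ - X]big_mkcond /= -sumrB.
by apply: eq_bigr => n _; case: coprime; rewrite /= ?subr0 ?subrr ?mulr1 ?mulr0.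
Qed.

(** * Triviality of the kernel of the operator *)

Section Vanishing.
Variable v : nat -> R.
Hypotheses (uv : unitfun v) (mv : mean0 v) (Lv : isL v (fun=> 0)).

(** Measures how far multiplication by [n] is from reversing the sign of [v]. A nonzero [v] in the
    kernel forces almost all primes, in the logarithmic sense, to reverse it; this is [D_bdd]. *)
Let D n := \sum_(0 <= g < W) (v g + v (g * n)%N) ^+ 2.

Lemma unitfun_mulr a : periodic (fun g => v (g * a)%N).
Proof. by have [pv _] := uv; move=> n; rewrite -[RHS]pv -modnMml pv. Qed.

Lemma D_eq0 b : D b = 0 -> forall g, v (g * b)%N = - v g.
Proof.
move=> Db g; have [pv _] := uv; apply/eqP; rewrite -addr_eq0 addrC.
rewrite -pv -(unitfun_mulr b g).
suff : (v (g %% W) + v (g %% W * b)%N) ^+ 2 == 0 by rewrite expf_eq0.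
rewrite -[_ == 0]andTb; move: Db => /eqP.
rewrite /D psumr_eq0 => [/allP|n _]; last exact: sqr_ge0.
by apply; rewrite mem_index_iota ltn_pmod.
Qed.

(** Expanding the square, the two diagonal parts contribute [2 V ln N] and the cross terms
    [- 2 V ln N], the latter by [isL0_bdd], up to [O(1)]. *)
Lemma D_bdd : bdd (fun N => \sum_(1 <= n < N.+1) vM R n / n%:R * ((coprime n W)%:R * D n)).
Proof.
have [pv zv] := uv; pose V := \sum_(0 <= g < W) v g ^+ 2.
have E n : (coprime n W)%:R * D n =
    2 * V * (coprime n W)%:R + \sum_(0 <= g < W) 2 * v g * v (g * n)%N.
  case: (boolP (coprime n W)) => cn; last first.
    rewrite mul0r mulr0 add0r big1 // => g _.
    by rewrite [v (_ * _)%N]zv ?mulr0 // coprimeMl negb_and cn orbT.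
  rewrite mul1r mulr1 mulr_natl mulr2n {2}/V.
  rewrite -(@sum_unit_mul (fun g => v g ^+ 2) n) //; last by move=> g /=; rewrite pv.
  by rewrite -!big_split; apply: eq_bigr => g _ /=; ring.
have h1 := bddZ (2 * V) bdd_vM_coprime.
have h2 : bdd (fun N => \sum_(0 <= g < W) 2 * v g * (Sv v g N + v g * ln N%:R)).
  by apply: bdd_sum => g; apply: bddZ; exact: isL0_bdd.
apply: bdd_eq (bddD h1 h2) => N.
under [RHS]eq_bigr do rewrite E mulrDr.
rewrite big_split /=.
have -> : \sum_(1 <= n < N.+1) vM R n / n%:R * (2 * V * (coprime n W)%:R) =
  2 * V * \sum_(1 <= n < N.+1) vM R n / n%:R * (coprime n W)%:R.
  by rewrite mulr_sumr; apply: eq_bigr => n _; rewrite mulrCA.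
have -> : \sum_(1 <= n < N.+1) vM R n / n%:R * (\sum_(0 <= g < W) 2 * v g * v (g * n)%N) =
  \sum_(0 <= g < W) 2 * v g * Sv v g N.
  under eq_bigr do rewrite mulr_sumr.
  rewrite exchange_big /=; apply: eq_bigr => g _; rewrite /Sv mulr_sumr.
  by apply: eq_bigr => n _; rewrite mulrCA.
have -> : \sum_(0 <= g < W) 2 * v g * (Sv v g N + v g * ln N%:R) =
   \sum_(0 <= g < W) 2 * v g * Sv v g N + 2 * V * ln N%:R.
  by rewrite /V mulr_sumr mulr_suml -big_split; apply: eq_bigr => g _ /=; ring.
ring.
Qed.

(** On units [w (g n) - w g] vanishes wherever [D n] does, and there are finitely many classes, so
    it is at most a constant times [D n]; by [D_bdd], [w (g n)] may be replaced by [w g]. *)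
Lemma invariant_bdd w g : unitfun w ->
  (forall b, coprime b W -> D b = 0 -> forall g', w (g' * b)%N = w g') ->
  bdd (fun N => Sv w g N - w g * ln N%:R).
Proof.
move=> [pw zw] hw; have [pv zv] := uv.
pose K := \sum_(0 <= r < W) `|w (g * r)%N - w g| / D r.
have D0 r : 0 <= D r by apply: sumr_ge0 => g' _; exact: sqr_ge0.
have K0 : 0 <= K by apply: sumr_ge0 => r _; rewrite divr_ge0.
have Dper n : D (n %% W)%N = D n.
  by apply: eq_bigr => g' _; rewrite -[v (_ * n)%N]pv -modnMmr pv.
have key n : `|w (g * n)%N - (coprime n W)%:R * w g| <= K * ((coprime n W)%:R * D n).
  case: (boolP (coprime n W)) => cn; last first.
    by rewrite !mul0r subr0 mulr0 [w _]zw ?normr0 // coprimeMl negb_and cn orbT.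
  rewrite !mul1r; have [Dn|Dn] := eqVneq (D n) 0; first by rewrite hw // subrr normr0 Dn mulr0.
  rewrite -ler_pdivrMr ?lt_def ?Dn ?D0 //.
  rewrite /K (big_rem (n %% W)%N) /=; last by rewrite mem_index_iota ltn_pmod.
  rewrite Dper -[w (g * (n %% W))%N]pw modnMmr pw lerDl sumr_ge0 // => r _.
  by rewrite divr_ge0.
have h1 : bdd (fun N => \sum_(1 <= n < N.+1) vM R n / n%:R * (w (g * n)%N - (coprime n W)%:R * w g)).
  have [C hC] := D_bdd; exists (K * C) => N.
  apply: le_trans (ler_norm_sum _ _ _) _.
  apply: (@le_trans _ _ (K * \sum_(1 <= n < N.+1) vM R n / n%:R * ((coprime n W)%:R * D n))).
    rewrite mulr_sumr; apply: ler_sum => n _; have v0 : 0 <= vM R n / n%:R by rewrite divr_ge0 ?vM_ge0.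
    by rewrite normrM (ger0_norm v0) mulrCA ler_wpM2l.
  by rewrite ler_wpM2l // (le_trans (ler_norm _)).
apply: bdd_eq (bddD h1 (bddZ (w g) bdd_vM_coprime)) => N.
rewrite mulrBr addrA mulr_sumr -big_split /=; congr (_ - _).
by apply: eq_bigr => n _; ring.
Qed.

(** The transform [G] of [u] inherits the invariance, so [Sv G g N] is [G g ln N + O(1)]; it is also
    bounded by [isL_bdd], hence [G = 0]. Then [Sv u g N] is [- u g ln N] by [isL0_bdd] and
    [+ u g ln N] by invariance, so [u] vanishes. *)
Lemma invariant_eq0 u : unitfun u -> mean0 u ->
  (forall b, coprime b W -> D b = 0 -> forall g, u (g * b)%N = u g) -> forall g, u g = 0.
Proof.
move=> uu mu hu; have [G LG] := isL_exists uu mu.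
have [uG mG] := isL_unitfun uu mu LG.
have G0 g : G g = 0.
  apply: bdd_ln_eq0; have hG : bdd (fun N => Sv G g N - G g * ln N%:R).
    apply: invariant_bdd => // b cb Db g'; apply: (isL_unique LG LG) => n.
    by rewrite mulnAC hu.
  by apply: bdd_eq (bddB (isL_bdd g uu mu LG) hG) => N; rewrite opprB addrC subrK.
move=> g; have L0 : isL u (fun=> 0) by apply: isL_eq LG.
have := bddB (isL0_bdd g uu mu L0) (invariant_bdd g uu hu).
move=> /(bdd_eq (v := fun N => (2 * u g) * ln N%:R)) H.
have /bdd_ln_eq0/eqP : bdd (fun N => (2 * u g) * ln N%:R) by apply: H => N; ring.
by rewrite mulf_eq0 pnatr_eq0 => /eqP.
Qed.

(** When [D b = 0], multiplying [n] by [b] changes the sign of both factors. The product is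
    therefore invariant, and [invariant_eq0] makes it constant on the units. *)
Lemma quadratic_rel a n : coprime a W -> coprime n W -> v n * v (n * a)%N = v 1%N * v a.
Proof.
move=> ca cn; have [pv zv] := uv.
pose Q n := v n * v (n * a)%N.
have pQ : periodic Q by move=> m; rewrite /Q pv unitfun_mulr.
have c0 : forall g, cproj Q g = 0.
  apply: invariant_eq0; [exact: unitfun_cproj | exact: mean0_cproj | move=> b cb Db g].
  rewrite /cproj coprimeMl cb andbT; congr (_ * (_ - _)).
  by rewrite /Q mulnAC !(D_eq0 Db) mulrNN.
have E m : coprime m W -> Q m = (\sum_(0 <= r < W) (coprime r W)%:R * Q r) / (totient W)%:R.
  by move=> cm; have := c0 m; rewrite /cproj cm mul1r => /eqP; rewrite subr_eq0 => /eqP.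
by have := E n cn; rewrite -(E 1%N) ?coprime1n // /Q mul1n.
Qed.

(** If [v] were nonzero, [quadratic_rel] would make [v / v 1] a real character modulo [W] whose
    series vanishes at 1, contrary to [real_char_absurd]. *)
Lemma vanishing_eq0 n : v n = 0.
Proof.
have [pv zv] := uv; have [C hC] := Lv.
case: (boolP (coprime n W)) => [cn|/zv //]; apply/eqP/negPn/negP => vn.
have sq m : coprime m W -> v m ^+ 2 = v 1%N ^+ 2.
  by move=> cm; have := quadratic_rel (coprime1n W) cm; rewrite muln1 !expr2.
have v1 : v 1%N != 0.
  by have := sq n cn; apply: contra_eq_neq => ->; rewrite expr0n /= sqrf_eq0.
have [B B0 vB] := periodic_bounded pv.
apply: (@real_char_absurd R (fun m => v m / v 1%N) (W%:R * B / `|v 1%N|) (C / `|v 1%N|)).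
- move=> a b; case: (boolP (coprime a W)) => ca; last first.
    by rewrite (zv (a * b)%N) ?(zv a) ?mul0r // coprimeMl negb_and ca.
  case: (boolP (coprime b W)) => cb; last first.
    by rewrite (zv (a * b)%N) ?(zv b) ?mul0r ?mulr0 // coprimeMl negb_and cb orbT.
  have va : v a != 0 by rewrite -sqrf_eq0 sq // sqrf_eq0.
  have := quadratic_rel cb ca; have := sq a ca => h1 h2.
  apply: (mulfI va); rewrite [LHS]mulrA h2.
  have -> : v a * (v a / v 1%N * (v b / v 1%N)) = v a ^+ 2 * v b / v 1%N ^+ 2 by field.
  by rewrite h1; field.
- by rewrite divff.
- move=> m; case: (boolP (coprime m W)) => [cm|/zv ->]; last by constructor 1; rewrite mul0r.
  have /eqP := sq m cm; rewrite eqf_sqr => /orP[]/eqP ->; [constructor 2|constructor 3].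
    by rewrite divff.
  by rewrite mulNr divff.
- move=> M k; rewrite -mulr_suml normrM normfV ler_wpM2r ?invr_ge0 //.
  exact: mean0_partial.
move=> N; have := hC 1%N N; rewrite subr0.
have -> : \sum_(1 <= m < N.+1) v m / v 1%N / m%:R = (\sum_(1 <= m < N.+1) v (1 * m)%N / m%:R) / v 1%N.
  by rewrite mulr_suml; apply: eq_bigr => m _; rewrite mul1n mulrAC.
by rewrite normrM normfV mulrAC; apply: ler_wpM2r; rewrite invr_ge0.
Qed.

End Vanishing.

(** The indicator of the class splits into its mean on the units, which yields [ln N] over the
    totient, and a mean-zero part. As the kernel is trivial, that part is a transform, and [isL_bdd]
    bounds its contribution; higher prime powers are bounded separately. *)
Lemma mertens_progression a : coprime a W ->
  bdd (fun N => \sum_(1 <= p < N.+1 | prime p && (p == a %[mod W])) ln p%:R / p%:R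
                - ln N%:R / (totient W)%:R).
Proof.
move=> ca; pose e n : R := (n == a %[mod W])%:R.
have pe : periodic e by move=> n; rewrite /e modn_mod.
have ce n : ~~ coprime n W -> e n = 0.
  rewrite /e; case: eqP => // E; rewrite -coprime_modW E coprime_modW ca //.
have [F [uF mF LF]] : exists F, [/\ unitfun F, mean0 F & isL F (cproj e)].
  have [H|[v [uv mv Lv [n]]]] := isL_dichotomy; last by rewrite vanishing_eq0 ?eqxx.
  by apply: H; [exact: unitfun_cproj | exact: mean0_cproj].
have h1 := isL_bdd 1 uF mF LF.
have se : \sum_(0 <= r < W) (coprime r W)%:R * e r = 1.
  rewrite (big_rem (a %% W)%N) /=; last by rewrite mem_index_iota ltn_pmod.
  rewrite /e modn_mod eqxx coprime_modW ca mul1r big_seq big1 ?addr0 // => r.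
  rewrite rem_filter ?iota_uniq // mem_filter mem_index_iota => /andP[/negbTE /= ra rW].
  by rewrite modn_small // ra mulr0.
have h2 := bddZ (totient W)%:R^-1 bdd_vM_coprime.
have h3 := bdd_vM_nonprime (fun n => n == a %[mod W]).
apply: bdd_eq (bddB (bddD h1 h2) h3) => N.
have <- : Sv (cproj e) 1 N
    + (totient W)%:R^-1 * (\sum_(1 <= n < N.+1) vM R n / n%:R * (coprime n W)%:R)
    - \sum_(1 <= n < N.+1 | ~~ prime n && (n == a %[mod W])) vM R n / n%:R =
    \sum_(1 <= p < N.+1 | prime p && (p == a %[mod W])) ln p%:R / p%:R; last by ring.
rewrite /Sv mulr_sumr -big_split /= [in X in _ - X]big_mkcond [in RHS]big_mkcond /= -sumrB.
apply: eq_bigr => n _; rewrite mul1n /cproj se mul1r.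
have -> : vM R n / n%:R * ((coprime n W)%:R * (e n - (totient W)%:R^-1)) +
   (totient W)%:R^-1 * (vM R n / n%:R * (coprime n W)%:R) = vM R n / n%:R * e n.
  by case: (boolP (coprime n W)) => [_|/ce ->]; rewrite ?mul1r /=; ring.
rewrite /e; case: (boolP (prime n)) => pn /=; last by case: eqP; rewrite ?mulr1 ?mulr0 subrr.
by rewrite vM_prime // subr0; case: eqP; rewrite ?mulr1 ?mulr0.
Qed.

End Progressions.

(** * Harmonic sums and masses of the sieve weight *)

Section Harmonic.
Variable R : realType.

Lemma ln_ratio_le (x y : R) : 0 < x -> 0 < y -> ln y - ln x <= (y - x) / x.
Proof.
move=> x0 y0; rewrite -ln_div ?posrE //; apply: le_trans (ln_le_sub1 _) _; first by rewrite divr_gt0.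
by rewrite mulrBl divff ?gt_eqF.
Qed.

Lemma window_count s a M : (0 < s)%N ->
  \sum_(M <= n < M + s) (n == a %[mod s])%N%:R = 1 :> R.
Proof.
move=> s0; rewrite (@periodic_sum _ s s0 (fun n => (n == a %[mod s])%N%:R)); last first.
  by move=> n; rewrite modn_mod.
rewrite (big_rem (a %% s)%N) /=; last by rewrite mem_index_iota ltn_pmod.
rewrite modn_mod eqxx big_seq big1 ?addr0 // => r.
rewrite rem_filter ?iota_uniq // mem_filter mem_index_iota => /andP[/negbTE /= ra rW].
by rewrite modn_small // ra.
Qed.

(** Induction by windows of length [s], each containing exactly one term. That term and
    [(ln (A + s) - ln A) / s] both lie between [1 / (A + s)] and [1 / A], so the errors
    telescope. *)
Lemma harmonic_progression (A B s a : nat) : (0 < A)%N -> (A <= B)%N -> (0 < s)%N ->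
  `|\sum_(A <= n < B | (n == a %[mod s])%N) n%:R^-1 - (ln B%:R - ln A%:R) / s%:R| <= A%:R^-1 :> R.
Proof.
move=> A0 AB s0; have sr : 0 < s%:R :> R by rewrite ltr0n.
have [k] := ubnP (B - A)%N; elim: k A A0 AB => // k IH A A0 AB kB.
have Ar : 0 < A%:R :> R by rewrite ltr0n.
have Ai : 0 <= A%:R^-1 :> R by rewrite invr_ge0 ltW.
have Br : 0 < B%:R :> R by rewrite ltr0n (leq_trans A0).
have win M N : (0 < M)%N -> (M <= N)%N -> (N <= M + s)%N ->
    0 <= \sum_(M <= n < N | (n == a %[mod s])%N) (n%:R^-1 : R) <= M%:R^-1.
  move=> M0 MN NM; rewrite sumr_ge0 /= => [|n _]; last by rewrite invr_ge0.
  apply: (@le_trans _ _ (M%:R^-1 * \sum_(M <= n < M + s) (n == a %[mod s])%N%:R)); last first.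
    by rewrite window_count // mulr1.
  rewrite (big_cat_nat MN NM) /= mulrDr -[leLHS]addr0; apply: lerD; last first.
    by rewrite mulr_ge0 ?invr_ge0 // sumr_ge0.
  rewrite mulr_sumr big_mkcond big_nat [leRHS]big_nat; apply: ler_sum => n /andP[Mn _].
  by case: eqP; rewrite ?mulr0 // mulr1 lef_pV2 ?posrE ?ltr0n ?ler_nat // (leq_trans M0).
have [Bs|sB] := leqP B (A + s).
  have /andP[h1 h2] := win A B A0 AB Bs.
  have h3 : 0 <= (ln B%:R - ln A%:R) / s%:R :> R.
    by rewrite divr_ge0 // subr_ge0 ler_ln ?posrE // ler_nat.
  have h4 : (ln B%:R - ln A%:R) / s%:R <= A%:R^-1 :> R.
    rewrite ler_pdivrMr // mulrC; apply: le_trans (ln_ratio_le Ar Br) _.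
    by rewrite ler_wpM2r // lerBlDl -natrD ler_nat.
  by rewrite ler_norml; apply/andP; split; lra.
have As0 : (0 < A + s)%N by rewrite addn_gt0 A0.
have Asr : 0 < (A + s)%N%:R :> R by rewrite ltr0n.
have kAs : (B - (A + s) < k)%N.
  rewrite -ltnS (leq_trans _ kB) // ltnS ltn_sub2l // ?(leq_ltn_trans (leq_addr s A) sB) //.
  by rewrite -[ltnLHS]addn0 ltn_add2l.
have := IH (A + s)%N As0 (ltnW sB) kAs.
rewrite (big_cat_nat (leq_addr s A) (ltnW sB)) /=.
have /andP[_ w2] := win A (A + s)%N A0 (leq_addr _ _) (leqnn _).
have w1 : (A + s)%N%:R^-1 <= \sum_(A <= n < A + s | (n == a %[mod s])%N) n%:R^-1 :> R.
  apply: (@le_trans _ _ ((A + s)%N%:R^-1 * \sum_(A <= n < A + s) (n == a %[mod s])%N%:R)).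
    by rewrite window_count // mulr1.
  rewrite mulr_sumr [leRHS]big_mkcond; apply: ler_sum_nat => n /andP[An nA].
  by case: eqP; rewrite ?mulr0 // mulr1 lef_pV2 ?posrE ?ltr0n ?ler_nat ?(ltnW nA) // (leq_trans A0).
have l1 : (ln (A + s)%N%:R - ln A%:R) / s%:R <= A%:R^-1 :> R.
  rewrite ler_pdivrMr // mulrC; apply: le_trans (ln_ratio_le Ar Asr) _.
  by rewrite natrD addrAC subrr add0r.
have l2 : (A + s)%N%:R^-1 <= (ln (A + s)%N%:R - ln A%:R) / s%:R :> R.
  rewrite ler_pdivlMr // mulrC; have := ln_ratio_le Asr Ar; rewrite natrD.
  rewrite (_ : A%:R - (A%:R + s%:R) = - s%:R :> R); [rewrite mulNr; lra | ring].
have E : (ln B%:R - ln A%:R) / s%:R =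
    (ln (A + s)%N%:R - ln A%:R) / s%:R + (ln B%:R - ln (A + s)%N%:R) / s%:R :> R.
  by rewrite -mulrDl; congr (_ / _); ring.
rewrite E.
move: w1 w2 l1 l2; set I1 := \sum_(A <= n < A + s | _) _; set I2 := \sum_(A + s <= n < B | _) _.
set L1 := (ln (A + s)%N%:R - _) / _; set L2 := (ln B%:R - _) / _.
set x := (A + s)%N%:R^-1; set y := A%:R^-1.
move=> w1 w2 l1 l2; rewrite !ler_norml => /andP[i1 i2]; apply/andP; split; lra.
Qed.

Lemma harmonic_coprime (A B W : nat) : (0 < A)%N -> (A <= B)%N -> (0 < W)%N ->
  `|\sum_(A <= n < B | coprime n W) n%:R^-1
    - (totient W)%:R / W%:R * (ln B%:R - ln A%:R)| <= W%:R :> R.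
Proof.
move=> A0 AB W0.
have -> : \sum_(A <= n < B | coprime n W) n%:R^-1 =
    \sum_(0 <= c < W | coprime c W) \sum_(A <= n < B | (n == c %[mod W])%N) n%:R^-1 :> R.
  under [RHS]eq_bigr do rewrite big_mkcond.
  rewrite exchange_big /= big_mkcond; apply: eq_bigr => n _.
  rewrite (big_rem (n %% W)%N) /=; last by rewrite mem_index_iota ltn_pmod.
  rewrite coprime_modl modn_mod eqxx big_seq_cond big1 ?addr0 // => r.
  rewrite rem_filter ?iota_uniq // mem_filter mem_index_iota => /andP[/andP[/negbTE /= ra rW] _].
  by rewrite (modn_small rW) eq_sym ra.
have -> : (totient W)%:R / W%:R * (ln B%:R - ln A%:R) =
    \sum_(0 <= c < W | coprime c W) (ln B%:R - ln A%:R) / W%:R :> R.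
  rewrite -(sum_coprime R W) mulrAC -mulrA mulr_suml [RHS]big_mkcond; apply: eq_bigr => c _.
  by case: coprime; rewrite ?mul1r ?mul0r.
rewrite -sumrB; apply: le_trans (ler_norm_sum _ _ _) _.
rewrite [leRHS](_ : _ = \sum_(0 <= c < W) 1); last by rewrite sumr_const_nat subn0.
rewrite big_mkcond; apply: ler_sum => c _; case: ifP => // _.
apply: le_trans (harmonic_progression c A0 AB W0) _.
by rewrite invf_le1 ?ltr0n // ler1n.
Qed.

Lemma prod_primes_gt0 P : all prime P -> (0 < \prod_(l <- P) l)%N.
Proof.
elim: P => [|p P IH]; rewrite ?big_nil // big_cons /= => /andP[/prime_gt0 p0 /IH P0].
by rewrite muln_gt0 p0.
Qed.

Lemma prime_dvdn_prod p P : prime p -> all prime P -> (p %| \prod_(l <- P) l)%N -> p \in P.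
Proof.
move=> pp; elim: P => [|q P IH]; first by rewrite big_nil dvdn1 => _ /eqP E; rewrite E in pp.
rewrite big_cons /= => /andP[pq PP]; rewrite Euclid_dvdM // dvdn_prime2 // inE.
by case/orP => [->//|/(IH PP) ->]; rewrite orbT.
Qed.

Lemma squarefree_dvdn_prod P d : (0 < d)%N -> uniq P -> all prime P ->
  (forall p, prime p -> (p %| d)%N -> p \in P) ->
  (forall p, p \in P -> ~~ (p ^ 2 %| d)%N) -> (d %| \prod_(l <- P) l)%N.
Proof.
move=> d0 uP PP; move: d d0; apply: nat_prime_ind => [//|p k m pp m0 pm IH hd hs].
have pd : (p %| p ^ k.+1 * m)%N by rewrite expnS -mulnA dvdn_mulr.
have pP := hd p pp pd.
have k0 : k = 0%N.
  case: k hs {IH hd pd} => // k /(_ p pP) /negP[].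
  by rewrite dvdn_mulr // dvdn_exp2l.
subst k; rewrite expn1 in hd hs *; rewrite Gauss_dvd ?prime_coprime //.
rewrite (big_rem p pP) /= dvdn_mulr //= -(big_rem p pP (P := xpredT) (F := id)).
by apply: IH => [q pq /(dvdn_mull p)/(hd q pq) | q qP]; [|apply: contra (hs q qP) => /(dvdn_mull p)].
Qed.

Lemma ssum_dvdn P (F : nat -> R) : uniq P -> all prime P ->
  ssum P (fun m => F (\prod_(l <- m) l)%N) =
  \sum_(1 <= d < (\prod_(l <- P) l)%N.+1 | (d %| \prod_(l <- P) l)%N) F d.
Proof.
elim: P F => [|p P IH] F.
  by rewrite /= !big_nil [RHS]big_mkcond big_nat1.
rewrite /= => /andP[pP uP] /andP[pp PP].
have P0 := prod_primes_gt0 PP.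
have pn : ~~ (p %| \prod_(l <- P) l)%N.
  by apply: contra pP; exact: prime_dvdn_prod.
have := @sum_dvdn_pfactor R F p 1 _ pp P0 pn; rewrite expn1 big_cons => ->.
rewrite big_ord_recl big_ord1 /= expn0 expn1; congr (_ + _).
  by rewrite IH //; apply: eq_bigr => e _; rewrite mul1n.
rewrite -(IH (fun d => F (p * d)%N)) //; apply: eq_ssum => rho _.
by rewrite big_cons.
Qed.

Definition ibin A B (m : nat) : R := (A <= m < B)%N%:R / m%:R.

Section Bins.
Variables (W N : nat) (P : seq nat).
Hypotheses (W0 : (0 < W)%N) (uP : uniq P)
  (memP : forall p, (p \in P) = [&& prime p, coprime p W & (p < N)%N]).

Let primeP : all prime P. Proof. by apply/allP => p; rewrite memP => /and3P[]. Qed.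
Let coprimeP : all (fun p => coprime p W) P. Proof. by apply/allP => p; rewrite memP => /and3P[]. Qed.

Let dvd_coprime d : (d %| \prod_(l <- P) l)%N -> coprime d W.
Proof.
move=> dP; apply: coprime_dvdl dP _; elim: (P) coprimeP => [|p P' IH]; first by rewrite big_nil coprime1n.
by rewrite big_cons coprimeMl /= => /andP[-> /IH].
Qed.

Lemma ssum_ibin_sum A B : (0 < A)%N -> (A <= B)%N ->
  ssum P (fun m => ibin A B (\prod_(l <- m) l)%N) =
  \sum_(A <= d < B | (d %| \prod_(l <- P) l)%N) d%:R^-1.
Proof.
move=> A0 AB; rewrite (ssum_dvdn (ibin A B)) //; have P0 := prod_primes_gt0 primeP.
set Q := (\prod_(l <- P) l)%N in P0 *.
pose M := maxn Q.+1 B.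
have -> : \sum_(1 <= d < Q.+1 | (d %| Q)%N) ibin A B d =
    \sum_(1 <= d < M) (d %| Q)%N%:R * ibin A B d.
  rewrite [RHS](@sum_nat_trunc _ 1 Q.+1) ?leq_maxl ?andbT //.
    by rewrite big_mkcond; apply: eq_bigr => d _; case: (d %| Q)%N; rewrite ?mul1r ?mul0r.
  move=> d /andP[Qd _]; case: (boolP (d %| Q)%N); rewrite ?mul0r // => /(dvdn_leq P0).
  by rewrite leqNgt Qd.
have BM : (B <= M)%N by rewrite leq_maxr.
rewrite (@sum_nat_trunc _ 1 B) ?BM ?(leq_trans A0) //; last first.
  by move=> d /andP[Bd _]; rewrite /ibin [(d < B)%N]ltnNge Bd andbF mul0r mulr0.
rewrite (big_cat_nat A0 AB) /= big_nat_cond big1 ?add0r; last first.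
  by move=> d /andP[/andP[_ dA] _]; rewrite /ibin leqNgt dA mul0r mulr0.
rewrite [RHS]big_mkcond; apply: eq_big_nat => d AdB; rewrite /ibin AdB mul1r.
by case: (d %| Q)%N; rewrite ?mul1r ?mul0r.
Qed.

Lemma ssum_ibin_le A B : (0 < A)%N -> (A <= B)%N ->
  ssum P (fun m => ibin A B (\prod_(l <- m) l)%N) <=
  (totient W)%:R / W%:R * (ln B%:R - ln A%:R) + W%:R.
Proof.
move=> A0 AB; rewrite ssum_ibin_sum //.
have := @harmonic_coprime A B W A0 AB W0; rewrite ler_norml => /andP[_].
rewrite lerBlDl => H; apply: le_trans H.
rewrite big_mkcond [leRHS]big_mkcond; apply: ler_sum => d _.
case: ifP => [/dvd_coprime ->//|_]; by case: ifP; rewrite ?invr_ge0.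
Qed.

Lemma sum_multiples_le q A Z : (0 < q)%N -> coprime q W -> (0 < A)%N -> (0 < Z)%N ->
  \sum_(A <= n < Z * A | coprime n W && (q %| n)%N) n%:R^-1 <=
  q%:R^-1 * ((totient W)%:R / W%:R * ln Z%:R + W%:R) :> R.
Proof.
move=> q0 cq A0 Z0; pose A' := (A.-1 %/ q).+1.
have AA : (A <= q * A')%N by rewrite -(prednK A0) mulnC ltn_ceil.
apply: (@le_trans _ _ (q%:R^-1 * \sum_(A' <= e < Z * A' | coprime e W) e%:R^-1)); last first.
  rewrite ler_wpM2l ?invr_ge0 //.
  have := @harmonic_coprime A' (Z * A') W isT (leq_pmull _ Z0) W0.
  rewrite natrM lnM ?posrE ?ltr0n // addrK ler_norml => /andP[_].
  by rewrite lerBlDl.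
pose T n e : R := ((n == q * e)%N && coprime e W)%:R * (q%:R^-1 * e%:R^-1).
have T0 n e : 0 <= T n e by rewrite mulr_ge0 // mulr_ge0 ?invr_ge0.
apply: (@le_trans _ _ (\sum_(A <= n < Z * A) \sum_(A' <= e < Z * A') T n e)).
  rewrite big_mkcond; apply: ler_sum_nat => n /andP[An nZ].
  case: ifP => [/andP[cn /dvdnP[e ne]]|_]; last by apply: sumr_ge0.
  have n0 : (0 < n)%N by apply: leq_trans An.
  have er : (A' <= e < Z * A')%N.
    rewrite /A' ltn_divLR // -ne -(prednK A0) in An *; rewrite An /=.
    rewrite -(ltn_pmul2r q0) -ne (leq_trans nZ) // -mulnA leq_mul2l; apply/orP; right.
    by rewrite mulnC.
  rewrite (big_rem e) /=; last by rewrite mem_index_iota.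
  rewrite {1}/T [(q * e)%N]mulnC -ne eqxx.
  have -> : coprime e W by apply: coprime_dvdl cn; rewrite ne dvdn_mulr.
  rewrite mul1r -invfM -natrM mulnC -ne lerDl; exact: sumr_ge0.
rewrite exchange_big /= mulr_sumr [leRHS]big_mkcond; apply: ler_sum_nat => e /andP[Ae _].
rewrite -mulr_suml; have r0 : 0 <= q%:R^-1 * e%:R^-1 :> R by rewrite mulr_ge0 ?invr_ge0.
case: (boolP (coprime e W)) => ce; last by rewrite big1 ?mul0r // => n _; rewrite andbF.
rewrite -[leRHS]mul1r ler_wpM2r // -natr_sum -[leRHS]/(1%:R) ler_nat.
have -> : (\sum_(A <= i < Z * A) ((i == q * e) && true) =
           count (pred1 (q * e)%N) (index_iota A (Z * A)))%N.
  by rewrite -sum1_count [RHS]big_mkcond; apply: eq_bigr => i _ /=; rewrite andbT; case: eqP.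
by rewrite count_uniq_mem ?iota_uniq // leq_b1.
Qed.

(** An [n] below [N] and prime to [W] is a product of distinct primes of [P] unless [p^2] divides it
    for some [p] in [P]. These exceptions are removed by a union bound. *)
Lemma ssum_ibin_ge A Z : (0 < A)%N -> (0 < Z)%N -> (Z * A <= N)%N ->
  (totient W)%:R / W%:R * ln Z%:R - W%:R
   - (\sum_(p <- P) p%:R^-1 ^+ 2) * ((totient W)%:R / W%:R * ln Z%:R + W%:R) <=
  ssum P (fun m => ibin A (Z * A) (\prod_(l <- m) l)%N).
Proof.
move=> A0 Z0 BN; have AB : (A <= Z * A)%N by rewrite leq_pmull.
rewrite ssum_ibin_sum // .
have EL : ln Z%:R = ln (Z * A)%N%:R - ln A%:R :> R.
  by rewrite natrM lnM ?posrE ?ltr0n // addrK.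
have lo : (totient W)%:R / W%:R * ln Z%:R - W%:R <= \sum_(A <= n < Z * A | coprime n W) (n%:R^-1 : R).
  have := @harmonic_coprime A (Z * A) W A0 AB W0; rewrite -EL ler_norml => /andP[].
  by rewrite lerBrDr addrC.
set L := _ / _ * _ in lo *; pose B := (Z * A)%N; rewrite -/B in lo AB BN *.
have sq p : p \in P -> \sum_(A <= n < B | coprime n W && (p ^ 2 %| n)%N) n%:R^-1 <=
    p%:R^-1 ^+ 2 * (L + W%:R) :> R.
  rewrite memP => /and3P[pp cp _]; have p0 := prime_gt0 pp.
  rewrite exprVn -natrX; apply: sum_multiples_le => //; rewrite ?expn_gt0 ?p0 //.
  by rewrite coprimeXl.
have : \sum_(A <= n < B | coprime n W) n%:R^-1 <=
  \sum_(A <= d < B | (d %| \prod_(l <- P) l)%N) d%:R^-1 +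
  \sum_(p <- P) \sum_(A <= n < B | coprime n W && (p ^ 2 %| n)%N) n%:R^-1 :> R.
  under [X in _ <= _ + X]eq_bigr do rewrite big_mkcond.
  rewrite exchange_big /= big_mkcond [X in _ <= X + _]big_mkcond -big_split /=.
  apply: ler_sum_nat => n /andP[An nB].
  have ni : 0 <= n%:R^-1 :> R by rewrite invr_ge0.
  have n0 : (0 < n)%N by apply: leq_trans An.
  case: (boolP (coprime n W)) => cn /=; last by rewrite addr_ge0 ?sumr_ge0 //; case: ifP.
  case: (boolP (has (fun p => p ^ 2 %| n)%N P)) => [/hasP[p pP pn]|].
    rewrite -[leLHS]add0r lerD //; first by case: ifP.
    by rewrite (big_rem p pP) /= pn lerDl sumr_ge0 // => q _; case: ifP.
  rewrite -all_predC => /allP /= sf.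
  rewrite squarefree_dvdn_prod //; first by rewrite lerDl sumr_ge0 // => q _; case: ifP.
  move=> p pp pn; rewrite memP pp (leq_ltn_trans (dvdn_leq n0 pn)) ?andbT ?(leq_trans nB) //.
  exact: coprime_dvdl pn cn.
have : \sum_(p <- P) \sum_(A <= n < B | coprime n W && (p ^ 2 %| n)%N) n%:R^-1 <=
   (\sum_(p <- P) p%:R^-1 ^+ 2) * (L + W%:R) :> R.
  rewrite mulr_suml big_seq [leRHS]big_seq; apply: ler_sum; exact: sq.
lra.
Qed.

End Bins.
End Harmonic.

(** * The sieve weight and its masses *)

Section SieveWeight.
Variable R : realType.

Definition Us P (u : nat -> R) : R := ssum P (fun m => u (\prod_(l <- m) l)%N / (\prod_(l <- m) l)%N%:R).

Lemma Us_cons p P u : Us (p :: P) u = Us P u + p%:R^-1 * Us P (fun m => u (p * m)%N).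
Proof.
rewrite /Us /= -ssumZ; congr (_ + _); apply: eq_ssum => rho _.
by rewrite big_cons natrM invfM; ring.
Qed.

Lemma Us_ge0 P u : (forall m, 0 <= u m) -> 0 <= Us P u.
Proof. by move=> h; apply: ssum_ge0 => rho _; rewrite divr_ge0. Qed.

Lemma Us_sum (I : Type) (s : seq I) P (u : I -> nat -> R) :
  Us P (fun m => \sum_(x <- s) u x m) = \sum_(x <- s) Us P (u x).
Proof. by rewrite /Us ssum_swap; apply: eq_ssum => rho _; rewrite mulr_suml. Qed.

Section Colours.
Variable K : finType.

Lemma Isum_prod P (u : K -> nat -> R) :
  Isum P (fun f => \prod_j u j (f j)) = \prod_j Us P (u j).
Proof.
elim: P u => [|p P IH] u /=.
  by apply: eq_bigr => j _; rewrite /Us /= big_nil divr1.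
transitivity (\prod_j (p%:R^-1 * Us P (fun m => u j (p * m)%N) + Us P (u j))); last first.
  by apply: eq_bigr => j _; rewrite Us_cons addrC.
rewrite bigA_distr; apply: eq_bigr => S _.
rewrite -[X in X * _]prodr_const [X in X * _]big_mkcond /=.
rewrite (IH (fun j m => u j (if j \in S then (p * m)%N else m))) -big_split /=; apply: eq_bigr => j _.
by case: ifP; rewrite ?mul1r.
Qed.

Lemma Isum_sum P (A : finType) (c : A -> R) (G : A -> (K -> nat) -> R) :
  Isum P (fun f => \sum_a c a * G a f) = \sum_a c a * Isum P (G a).
Proof.
elim: P G => [|p P IH] G //=.
under eq_bigr do rewrite IH mulr_sumr.
rewrite exchange_big /=; apply: eq_bigr => a _; rewrite mulr_sumr.
by apply: eq_bigr => S _; rewrite mulrCA.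
Qed.

Lemma eq_Isum P (G G' : (K -> nat) -> R) : (forall f, G f = G' f) -> Isum P G = Isum P G'.
Proof. by move=> GG; congr Isum; apply/boolp.funext. Qed.

End Colours.

Variables (Z g L0 : nat).
Hypotheses (Z1 : (1 < Z)%N) (g0 : (0 < g)%N).
Notation lg := (trunc_log Z).

Lemma lg_lt m : (m < Z ^ g)%N -> (lg m < g)%N.
Proof.
have [->|m0] := posnP m; first by rewrite trunc_log0.
by move=> mg; have := trunc_logP Z1 m0; move/leq_ltn_trans/(_ mg); rewrite ltn_exp2l.
Qed.

Definition bin (l m : nat) : R := ((m < Z ^ g)%N && (lg m == l))%:R.
Definition cap (tau m : nat) : R := ((m < Z ^ g) && (lg m + tau <= L0))%N%:R.

Section Weights.
Variable K : finType.

Lemma prod_bool (Q b : pred K) :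
  \prod_(j | Q j) (b j)%:R = [forall j, Q j ==> b j]%:R :> R.
Proof.
have [/forallP H|] := boolP [forall j, Q j ==> b j].
  by rewrite big1 // => j Qj; have := H j; rewrite Qj /= => ->.
rewrite negb_forall => /existsP[j]; rewrite negb_imply => /andP[Qj /negbTE bj].
by rewrite (bigD1 j Qj) /= bj mul0r.
Qed.

(** A truncated simplex in the integer levels [lg (f j)]. As a 0/1 function it equals its square, it
    is decreasing, and it is a finite sum of products of one-variable bins, which turns its masses
    into lattice-point counts. *)
Definition wt (f : K -> nat) : R :=
  ([forall j, f j < Z ^ g] && (\sum_j lg (f j) <= L0))%N%:R.

Lemma wt_sqr f : wt f ^+ 2 = wt f.
Proof. by rewrite /wt; case: (_ && _); rewrite ?expr1n ?expr0n. Qed.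

Lemma anti_wt : anti wt.
Proof.
split=> [f|f f' ff]; first by rewrite ler0n.
rewrite ler_nat; case: (boolP (_ && (\sum_j lg (f' j) <= L0)%N)) => // /andP[/forallP f'Z f'L].
rewrite (_ : _ && _ = true) //; apply/andP; split.
  by apply/forallP => j; exact: leq_ltn_trans (ff j) (f'Z j).
by apply: leq_trans f'L; apply: leq_sum => j _; exact: leq_trunc_log.
Qed.

Lemma wt_neq0 f : wt f != 0 -> (forall j, f j < Z ^ g)%N /\ (\sum_j lg (f j) <= L0)%N.
Proof. by rewrite /wt pnatr_eq0 eqb0 negbK => /andP[/forallP]. Qed.

(** Rounding sizes down to levels loses at most one power of [Z] per coordinate: hence the exponents
    278 here and 277 in [wt_prod_lt] when [L0 = 270]. *)
Lemma wt_prod_le f : wt f != 0 -> (\prod_j f j <= Z ^ (L0 + #|K|))%N.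
Proof.
move=> /wt_neq0[_ fL]; apply: (@leq_trans (\prod_j Z ^ (lg (f j)).+1)%N).
  by apply: leq_prod => j _; apply: ltnW; exact: trunc_log_ltn.
rewrite -expn_sum leq_exp2l // (eq_bigr (fun j => lg (f j) + 1)%N) => [|j _]; last by rewrite addn1.
by rewrite big_split /= sum1_card leq_add2r.
Qed.

Lemma wt_prod_lt i f : (1 < #|K|)%N -> wt f != 0 ->
  (\prod_(l | l != i) f l < Z ^ (L0 + #|K|.-1))%N.
Proof.
move=> K1 /wt_neq0[_ fL].
have [k ki] : exists k, k != i.
  apply/existsP; rewrite -negb_forall; apply: contraL K1 => /forallP H.
  by rewrite -leqNgt -(card1 i); apply/subset_leq_card/subsetP => x _; rewrite inE H.
apply: (@leq_trans (\prod_(l | l != i) Z ^ (lg (f l)).+1)%N).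
  rewrite (bigD1 k ki) [X in (_ <= X)%N](bigD1 k ki) /=; set X := (\prod_(l | _) f l)%N; set Y := (\prod_(l | _) _)%N.
  have XY : (X <= Y)%N by apply: leq_prod => j _; apply: ltnW; exact: trunc_log_ltn.
  have Y0 : (0 < Y)%N by rewrite prodn_gt0 // => l; rewrite expn_gt0 (ltnW Z1).
  by rewrite (leq_ltn_trans (leq_mul (leqnn _) XY)) // ltn_pmul2r // trunc_log_ltn.
rewrite -expn_sum leq_exp2l // (eq_bigr (fun j => lg (f j) + 1)%N) => [|j _]; last by rewrite addn1.
rewrite big_split /= sum1_card leq_add //.
  by apply: leq_trans fL; rewrite [leqRHS](bigID (fun l => l != i)) /= leq_addr.
by rewrite (cardC1 i).
Qed.

(** Level vectors on the coordinates of [Q]: the others are pinned to 0, so that each choice is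
    counted once and adds nothing to the sum of levels. *)
Definition vok (Q : pred K) (v : {ffun K -> 'I_g}) := [forall j, Q j || (v j == 0 :> nat)%N].

Lemma bins_expand (Q : pred K) (phi : nat -> R) f :
  \prod_(j | Q j) (f j < Z ^ g)%N%:R * phi (\sum_(j | Q j) lg (f j))%N =
  \sum_(v : {ffun K -> 'I_g} | vok Q v) phi (\sum_j v j)%N * \prod_(j | Q j) bin (v j) (f j).
Proof.
have [fQ|] := boolP [forall j, Q j ==> (f j < Z ^ g)%N]; last first.
  rewrite negb_forall => /existsP[j]; rewrite negb_imply => /andP[Qj fj].
  rewrite (bigD1 j) //= (negbTE fj) !mul0r big1 // => v _.
  by rewrite (bigD1 j Qj) /= /bin (negbTE fj) mul0r mulr0.
have fE j : Q j -> (f j < Z ^ g)%N by move/forallP: fQ => /(_ j)/implyP.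
rewrite big1 ?mul1r => [|j Qj]; last by rewrite fE.
pose v0 : {ffun K -> 'I_g} := [ffun j => insubd (Ordinal g0) (if Q j then lg (f j) else 0%N)].
have v0E j : v0 j = (if Q j then lg (f j) else 0%N) :> nat.
  by rewrite ffunE val_insubd; case: (boolP (Q j)) => Qj; rewrite ?g0 ?lg_lt ?fE.
have v0ok : vok Q v0 by apply/forallP => j; rewrite v0E; case: (Q j).
rewrite (bigD1 v0) //= [X in _ + X]big1 ?addr0; last first.
  move=> v /andP[vv nv].
  have [j nj] : exists j, v j != v0 j.
    apply/existsP; rewrite -negb_forall; apply: contra nv => /forallP H.
    by apply/eqP/ffunP => j; apply/eqP.
  have Qj : Q j.
    apply: contraR nj => nQ; apply/eqP/val_inj; rewrite /= v0E (negbTE nQ).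
    by move/forallP: vv => /(_ j); rewrite (negbTE nQ) => /eqP.
  rewrite (bigD1 j Qj) /= /bin (_ : (_ == _) = false) ?andbF ?mul0r ?mulr0 //.
  apply/negbTE; apply: contra nj => /eqP E; apply/eqP/val_inj; by rewrite /= v0E Qj E.
rewrite [X in _ * X]big1 ?mulr1 => [|j Qj]; last by rewrite /bin v0E Qj eqxx andbT fE.
by congr phi; rewrite big_mkcond; apply: eq_bigr => j _; rewrite v0E.
Qed.

Lemma wtE f : wt f = \sum_(v : {ffun K -> 'I_g}) (\sum_j v j <= L0)%N%:R * \prod_j bin (v j) (f j).
Proof.
have E : vok xpredT =1 xpredT by move=> v; apply/forallP.
rewrite -(eq_bigl _ _ E) -(bins_expand xpredT (fun s => (s <= L0)%N%:R) f).
by rewrite (prod_bool xpredT (fun j => f j < Z ^ g)%N) -natrM mulnb.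
Qed.

End Weights.

Section Duplicated.
Variables (K : finType) (i : K).

(** Once the levels [v] of the other colours are fixed, each of the two copies of colour [i]
    independently uses what is left of the budget [L0]. This is the origin of the squared count in
    [Isum_dup_ge]. *)
Definition uv (v : {ffun K -> 'I_g}) (c : option K) : nat -> R :=
  if c is Some j then if j == i then cap (\sum_l v l)%N else bin (v j) else cap (\sum_l v l)%N.

Lemma prod_option (F : option K -> R) :
  \prod_c F c = F None * F (Some i) * \prod_(j | j != i) F (Some j).
Proof.
rewrite (bigD1 None) //= -mulrA; congr (_ * _).
rewrite (reindex_omap Some id) /=; last by case.
rewrite (eq_bigl xpredT) => [|j]; last by rewrite eqxx.
by rewrite (bigD1 i).
Qed.

Lemma wt_split f : wt f =
  \prod_(j | j != i) (f j < Z ^ g)%N%:R * cap (\sum_(j | j != i) lg (f j))%N (f i).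
Proof.
rewrite (prod_bool (fun j => j != i) (fun j => f j < Z ^ g)%N) -natrM mulnb.
rewrite /wt (bigD1 i) //= andbA; congr ((_ && _)%:R).
apply/forallP/andP => [H|[/forallP H1 H2] j]; first by split=> //; apply/forallP => j; rewrite H implybT.
by have [->//|ji] := eqVneq j i; have := H1 j; rewrite ji.
Qed.

Lemma prod_bool_sqr (Q : pred K) (b : K -> bool) :
  \prod_(j | Q j) (b j)%:R * \prod_(j | Q j) (b j)%:R = \prod_(j | Q j) (b j)%:R :> R.
Proof. by rewrite -big_split; apply: eq_bigr => j _; case: (b j); rewrite /= ?mulr1 ?mulr0. Qed.

Lemma dup_wtE F : dup i (@wt K) F =
  \sum_(v : {ffun K -> 'I_g} | vok (fun j => j != i) v) \prod_c uv v c (F c).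
Proof.
have E (v : {ffun K -> 'I_g}) : vok (fun j => j != i) v ->
  \prod_c uv v c (F c) = cap (\sum_l v l)%N (F None) * cap (\sum_l v l)%N (F (Some i)) *
     \prod_(j | j != i) bin (v j) (F (Some j)).
  move=> _; rewrite prod_option /uv eqxx; congr (_ * _).
  by apply: eq_bigr => j /negbTE ->.
rewrite (eq_bigr _ E) -(bins_expand _ (fun s => cap s (F None) * cap s (F (Some i)))).
rewrite /dup !wt_split eqxx.
rewrite (eq_bigr (fun j => (F (Some j) < Z ^ g)%N%:R : R)) //.
have -> : \prod_(j | j != i) ((if j == i then F None else F (Some j)) < Z ^ g)%N%:R =
    \prod_(j | j != i) (F (Some j) < Z ^ g)%N%:R :> R.
  by apply: eq_bigr => j /negbTE ->.
have -> : (\sum_(j | j != i) lg (if j == i then F None else F (Some j)) =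
           \sum_(j | j != i) lg (F (Some j)))%N.
  by apply: eq_bigr => j /negbTE ->.
by rewrite mulrACA prod_bool_sqr [cap _ _ * _]mulrC.
Qed.

Lemma dup_wt_le F : dup i (@wt K) F <= \prod_c (F c < Z ^ g)%N%:R.
Proof.
rewrite prod_option /dup !wt_split eqxx.
have -> : \prod_(j | j != i) ((if j == i then F None else F (Some j)) < Z ^ g)%N%:R =
    \prod_(j | j != i) (F (Some j) < Z ^ g)%N%:R :> R.
  by apply: eq_bigr => j /negbTE ->.
rewrite mulrACA prod_bool_sqr mulrC ler_wpM2r ?prodr_ge0 // mulrC.
have c1 tau m : cap tau m <= (m < Z ^ g)%N%:R.
  by rewrite /cap ler_nat; case: (m < _)%N; rewrite //= leq_b1.
by apply: ler_pM; rewrite ?ler0n.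
Qed.

Section Masses.
Variables (P : seq nat) (lo hi : R).
Hypotheses (lo0 : 0 <= lo)
  (beta_lo : forall l, (l < g)%N -> lo <= Us P (bin l)) (beta_hi : forall l, (l < g)%N -> Us P (bin l) <= hi).

Lemma Isum_wt_le : Isum P (@wt K) <=
  (\sum_(v : {ffun K -> 'I_g}) (\sum_j v j <= L0)%N%:R) * hi ^+ #|K|.
Proof.
rewrite (eq_Isum _ (@wtE K)).
rewrite (Isum_sum P (fun v : {ffun K -> 'I_g} => (\sum_j v j <= L0)%N%:R)
                    (fun v f => \prod_j bin (v j) (f j))) mulr_suml.
apply: ler_sum => v _; rewrite (Isum_prod P (fun j => bin (v j))) ler_wpM2l //.
rewrite -[leRHS]prodr_const; apply: ler_prod => j _.
by rewrite Us_ge0 => [|m]; rewrite ?ler0n // beta_hi.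
Qed.

Lemma Us_cap_ge tau : (\sum_(l < g) (l + tau <= L0)%N)%:R * lo <= Us P (cap tau).
Proof.
have E m : cap tau m = \sum_(l < g) (l + tau <= L0)%N%:R * bin l m.
  rewrite /cap /bin; case: (ltnP m (Z ^ g)) => mZ /=; last first.
    by rewrite big1 // => l _; rewrite mulr0.
  rewrite (bigD1 (Ordinal (lg_lt mZ))) //= eqxx mulr1 big1 ?addr0 // => l nl.
  rewrite (_ : (_ == _) = false) ?mulr0 //; apply: contraNF nl => /eqP E.
  by apply/eqP/val_inj.
have -> : Us P (cap tau) = \sum_(l < g) (l + tau <= L0)%N%:R * Us P (bin l).
  rewrite (_ : cap tau = fun m => \sum_(l < g) (l + tau <= L0)%N%:R * bin l m); last exact/boolp.funext.
  rewrite Us_sum; apply: eq_bigr => l _; rewrite /Us -ssumZ; apply: eq_ssum => rho _.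
  by rewrite mulrA.
by rewrite natr_sum mulr_suml; apply: ler_sum => l _; rewrite ler_wpM2l // beta_lo.
Qed.

Lemma Isum_dup_ge :
  (\sum_(v : {ffun K -> 'I_g} | vok (fun j => j != i) v)
      (\sum_(l < g) (l + \sum_j v j <= L0)%N)%:R ^+ 2) * lo ^+ #|K|.+1 <= Isum P (dup i (@wt K)).
Proof.
rewrite (eq_Isum _ dup_wtE).
have -> : (fun F : option K -> nat => \sum_(v : {ffun K -> 'I_g} | vok (fun j => j != i) v) \prod_c uv v c (F c)) =
   (fun F => \sum_(v : {ffun K -> 'I_g}) (vok (fun j => j != i) v)%:R * \prod_c uv v c (F c)).
  by apply/boolp.funext => F; rewrite big_mkcond; apply: eq_bigr => v _; case: ifP; rewrite ?mul1r ?mul0r.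
rewrite (Isum_sum P (fun v : {ffun K -> 'I_g} => (vok (fun j => j != i) v)%:R)
                    (fun v F => \prod_c uv v c (F c))) mulr_suml big_mkcond /=.
apply: ler_sum => v _; case: ifP => vv; last by rewrite mul0r.
rewrite mul1r (Isum_prod P (uv v)) prod_option /uv eqxx.
set n := (\sum_(l < g) _)%N; have hc := Us_cap_ge (\sum_j v j)%N.
have -> : n%:R ^+ 2 * lo ^+ #|K|.+1 = n%:R * lo * (n%:R * lo) * lo ^+ #|K|.-1 :> R.
  have : (0 < #|K|)%N by apply/card_gt0P; exists i.
  by move=> h; rewrite -{1}(prednK h) !exprS expr0; ring.
have nl : 0 <= n%:R * lo by rewrite mulr_ge0.
apply: ler_pM; rewrite ?mulr_ge0 ?exprn_ge0 //; first exact: ler_pM.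
rewrite -(cardC1 i) -[leLHS]prodr_const; apply: ler_prod => j ji.
by rewrite lo0 (negbTE ji) beta_lo.
Qed.

Lemma Isum_dup_le : Isum P (dup i (@wt K)) <= (g%:R * hi) ^+ #|K|.+1.
Proof.
apply: le_trans (ler_Isum P dup_wt_le) _.
rewrite (Isum_prod P (fun _ m => (m < Z ^ g)%N%:R)) prodr_const card_option.
have E m : (m < Z ^ g)%N%:R = \sum_(l < g) bin l m.
  rewrite /bin; case: (ltnP m (Z ^ g)) => mZ /=; last by rewrite big1.
  rewrite (bigD1 (Ordinal (lg_lt mZ))) //= eqxx big1 ?addr0 // => l nl.
  rewrite (_ : (_ == _) = false) //; apply: contraNF nl => /eqP E.
  by apply/eqP/val_inj.
apply: lerXn2r; rewrite ?nnegrE ?Us_ge0 //.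
  rewrite mulr_ge0 //; apply: le_trans (beta_hi g0); exact: Us_ge0.
rewrite (_ : (fun m => _) = fun m => \sum_(l < g) bin l m); last exact/boolp.funext.
rewrite Us_sum -[X in X%:R * _]card_ord mulr_natl -sumr_const.
by apply: ler_sum => l _; exact: beta_hi.
Qed.

End Masses.
End Duplicated.
End SieveWeight.

(** * Lattice-point counts in binary arithmetic *)

Section Counting.

Lemma nat_of_bin_add a b : nat_of_bin (BinNat.N.add a b) = (a + b)%N.
Proof. by lia. Qed.

Lemma nat_of_bin_mul a b : nat_of_bin (BinNat.N.mul a b) = (a * b)%N.
Proof. by lia. Qed.

Lemma nat_of_bin_leb a b : BinNat.N.leb a b -> (nat_of_bin a <= nat_of_bin b)%N.
Proof. by lia. Qed.

Lemma nat_of_bin_gt0 p : (0 < nat_of_bin (BinNums.Npos p))%N.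
Proof. by lia. Qed.

Definition sumN (s : seq BinNums.N) : BinNums.N := foldr BinNat.N.add BinNums.N0 s.

(** Multiplication by [1 + X + ... + X^(g-1)] on coefficients listed by decreasing index: a new
    coefficient is the sum of the [g] entries from its position on. *)
Fixpoint window (g : nat) (r : seq BinNums.N) : seq BinNums.N :=
  if r is x :: r' then sumN (take g r) :: window g r' else [::].

(* [crow g L n] lists, by decreasing index [s = L, ..., 0], the coefficients of
   [(1 + X + ... + X^(g-1))^n]. *)
Definition crow (g L n : nat) : seq BinNums.N := iter n (window g) (rcons (nseq L BinNums.N0) (BinNums.Npos BinNums.xH)).

Lemma sumN_take g l : nat_of_bin (sumN (take g l)) = (\sum_(x < g) nat_of_bin (nth BinNums.N0 l x))%N.
Proof.
elim: g l => [|g IH] l; first by rewrite take0 big_ord0.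
case: l => [|x l]; first by rewrite big1 // => i _; rewrite nth_nil.
by rewrite big_ord_recl /= nat_of_bin_add IH.
Qed.

Lemma size_window g r : size (window g r) = size r.
Proof. by elim: r => //= x r ->. Qed.

Lemma nth_window g r k : nth BinNums.N0 (window g r) k = sumN (take g (drop k r)).
Proof. by elim: r k => [|x r IH] [|k] //=; rewrite ?IH ?nth_nil. Qed.

Variable R : realType.

Lemma size_crow g L n : size (crow g L n) = L.+1.
Proof. by elim: n => [|n IH]; rewrite /crow /= ?size_window // size_rcons size_nseq. Qed.

Lemma crowE g L n k : (k <= L)%N ->
  ((\sum_(x < g) 'X^x) ^+ n : {poly R})`_(L - k) = (nat_of_bin (nth BinNums.N0 (crow g L n) k))%:R.
Proof.
elim: n k => [|n IH] k kL.
  rewrite expr0 coefC /crow /= nth_rcons size_nseq nth_nseq subn_eq0.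
  by case: (ltngtP k L) kL.
rewrite exprS mulr_suml coef_sum /crow iterS -/(crow g L n) nth_window sumN_take natr_sum.
apply: eq_bigr => x _; rewrite coefXnM nth_drop; case: ltnP => h.
  by rewrite nth_default // size_crow; lia.
by rewrite -subnDA IH //; lia.
Qed.

(** A generating function replaces a sum over as many as [60^8] vectors by one over the coefficients
    of a polynomial, which is small enough to evaluate. *)
Lemma sum_vok (K : finType) (g N : nat) (Q : pred K) (phi : nat -> R) : (0 < g)%N ->
  (forall s, (N <= s)%N -> phi s = 0) ->
  \sum_(v : {ffun K -> 'I_g} | vok Q v) phi (\sum_j v j)%N =
  \sum_(s < N) ((\sum_(x < g) 'X^x) ^+ #|Q| : {poly R})`_s * phi s.
Proof.
move=> g0 phi0.
pose F (j : K) (x : 'I_g) : {poly R} := if Q j || (x == 0 :> nat)%N then 'X^x else 0.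
have E : (\sum_(x < g) 'X^x) ^+ #|Q| = \sum_(v : {ffun K -> 'I_g} | vok Q v) 'X^(\sum_j v j) :> {poly R}.
  transitivity (\prod_j \sum_x F j x).
    rewrite -prodr_const big_mkcond; apply: eq_bigr => j _; rewrite /F unfold_in.
    case: (Q j) => //=; rewrite (bigD1 (Ordinal g0)) //= expr0 big1 ?addr0 // => x nx.
    rewrite ifF //; apply: contraNF nx => /eqP x0; by apply/eqP/val_inj.
  rewrite bigA_distr_bigA [RHS]big_mkcond; apply: eq_bigr => v _.
  case: (boolP (vok Q v)) => [/forallP vv|]; rewrite /F.
    by rewrite (eq_bigr (fun j => 'X^(v j))) => [|j _]; [rewrite expr_sum | rewrite vv].
  rewrite negb_forall => /existsP[j nj].
  by rewrite (bigD1 j) //= (negbTE nj) mul0r.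
under [RHS]eq_bigr do rewrite E coef_sum mulr_suml.
rewrite exchange_big /=; apply: eq_bigr => v _.
have [sN|Ns] := ltnP (\sum_j v j)%N N; last first.
  rewrite phi0 // big1 // => s _; rewrite coefXn (_ : (_ == _) = false) ?mul0r //.
  by apply/negbTE; rewrite neq_ltn (leq_trans (ltn_ord s)).
move: (\sum_j v j)%N sN => s0 sN.
rewrite (bigD1 (Ordinal sN)) //= coefXn eqxx mul1r big1 ?addr0 // => s ns.
rewrite coefXn (_ : (_ == _) = false) ?mul0r //; apply: contraNF ns => /eqP E'.
by apply/eqP/val_inj.
Qed.

Fixpoint wsum (w : nat -> BinNums.N) (k : nat) (r : seq BinNums.N) : BinNums.N :=
  if r is x :: r' then BinNat.N.add (BinNat.N.mul x (w k)) (wsum w k.+1 r') else BinNums.N0.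

Lemma wsumE w k r : nat_of_bin (wsum w k r) =
  (\sum_(i < size r) nat_of_bin (nth BinNums.N0 r i) * nat_of_bin (w (k + i)%N))%N.
Proof.
elim: r k => [|x r IH] k; first by rewrite big_ord0.
rewrite big_ord_recl /= nat_of_bin_add nat_of_bin_mul addn0 IH; congr (_ + _)%N.
by apply: eq_bigr => i _; rewrite /bump /= addSnnS.
Qed.

Lemma sum_vok_crow (K : finType) (g L n : nat) (Q : pred K) (phi : nat -> nat) (w : nat -> BinNums.N) : (0 < g)%N -> #|Q| = n ->
  (forall s, (L < s)%N -> phi s = 0%N) -> (forall k, (k <= L)%N -> nat_of_bin (w k) = phi (L - k)%N) ->
  \sum_(v : {ffun K -> 'I_g} | vok Q v) (phi (\sum_j v j)%N)%:R =
  (nat_of_bin (wsum w 0 (crow g L n)))%:R :> R.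
Proof.
move=> g0 <- phi0 wphi.
rewrite (@sum_vok K g L.+1 Q (fun s => (phi s)%:R)) // => [|s sL]; last by rewrite phi0.
rewrite wsumE size_crow natr_sum (reindex_inj rev_ord_inj) /=; apply: eq_bigr => k _.
have kL : (k <= L)%N by rewrite -ltnS.
by rewrite subSS crowE // natrM add0n wphi.
Qed.

(** The number of vectors in [{0..59}^8] with sum at most 270; it governs the total mass. *)
Definition count8 : BinNums.N := wsum (fun=> BinNums.Npos BinNums.xH) 0 (crow 60 270 8).
(** Seven levels of sum [270 - k] leave [min 60 (k + 1)] levels for colour [i], squared for its two
    copies. *)
Definition count9 : BinNums.N := wsum (fun k => bin_of_nat (minn 60 k.+1 ^ 2)) 0 (crow 60 270 7).

Lemma count8E (K : finType) : #|K| = 8%N ->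
  \sum_(v : {ffun K -> 'I_60}) (\sum_j v j <= 270)%N%:R = (nat_of_bin count8)%:R :> R.
Proof.
move=> K8; have c8 : #|xpredT : pred K| = 8%N by [].
rewrite /count8; apply: etrans (sum_vok_crow (phi := fun s => (s <= 270)%N) _ c8 _ _); last 1 first.
- by move=> k _; rewrite leq_subr.
- by apply: eq_bigl => v; apply/esym/forallP.
- by [].
by move=> s; rewrite ltnNge => /negbTE ->.
Qed.

Lemma count9E (K : finType) (i : K) : #|K| = 8%N ->
  \sum_(v : {ffun K -> 'I_60} | vok (fun j => j != i) v)
     (\sum_(l < 60) (l + \sum_j v j <= 270)%N)%:R ^+ 2 = (nat_of_bin count9)%:R :> R.
Proof.
move=> K8; have c7 : #|(fun j : K => j != i)| = 7%N by rewrite -[RHS]/(8.-1) -K8 -(cardC1 i).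
have cnt s : (\sum_(l < 60) (l + s <= 270) = minn 60 (271 - s))%N.
  rewrite -(big_mkord xpredT (fun l => nat_of_bool (l + s <= 270)%N)).
  rewrite (@big_cat_nat _ _ _ (minn 60 (271 - s))) ?geq_minl //=.
  rewrite [X in (_ + X)%N]big_nat_cond [X in (_ + X)%N]big1 ?addn0; last by move=> l; lia.
  rewrite (eq_big_nat _ _ (F2 := fun=> 1%N)) ?sum_nat_const_nat ?subn0 ?muln1 // => l.
  by move=> h; rewrite (_ : (l + s <= 270)%N = true) //; lia.
rewrite /count9; apply: etrans (sum_vok_crow (phi := fun s => (minn 60 (271 - s) ^ 2)%N) _ c7 _ _);
  last 1 first.
- by move=> k kL; rewrite bin_of_natK; congr ((minn _ _) ^ 2)%N; lia.
- by apply: eq_bigr => v _; rewrite cnt natrX.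
- by [].
move=> s sL; have -> : (271 - s = 0)%N by lia.
by rewrite minn0.
Qed.

(** For [q] at level [a] and [q'] at level [b]: [b > a] ensures [q < q'], and [a + b >= 1115]
    ensures [q q' >= Z^1115]. *)
Definition lowb (a : nat) := maxn a.+1 (1115 - a).

(** At level [a] one has [ln q <= (a + 1) ln Z], so [1 / (q q')] is at least [lnq q * lnq q']
    divided by [(a + 1) (b + 1) (ln Z)^2]. This sum is the resulting lower density of pairs. *)
Definition harm_sum : R :=
  \sum_(60 <= a < 646) \sum_(lowb a <= b < 1293 - a) (a.+1%:R * b.+1%:R)^-1.

(** Pairing a term with its mirror image, [1/u + 1/v >= 4 / (u + v)]. Each row of [harm_sum] is
    thereby bounded by a single fraction. *)
Lemma harmonic_mean_le (b c : nat) : (b <= c)%N ->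
  2 * (c - b)%N%:R / (b + c).+1%:R <= \sum_(b <= x < c) x.+1%:R^-1 :> R.
Proof.
move=> bc.
have E : 2 * \sum_(b <= x < c) x.+1%:R^-1 =
    \sum_(b <= x < c) (x.+1%:R^-1 + (b + c - x)%N%:R^-1) :> R.
  rewrite big_split /= mulr_natl mulr2n; congr (_ + _).
  rewrite big_nat_rev /=; apply: eq_big_nat => x /andP[bx xc]; congr (_%:R^-1); lia.
rewrite -(ler_pM2l (ltr0n R 2 : 0 < 2)) E.
have -> : 2 * (2 * (c - b)%N%:R / (b + c).+1%:R) = \sum_(b <= x < c) 4 / (b + c).+1%:R :> R.
  by rewrite sumr_const_nat -[RHS]mulr_natl; ring.
apply: ler_sum_nat => x /andP[bx xc].
have x0 : 0 < x.+1%:R :> R by rewrite ltr0n.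
have y0 : 0 < (b + c - x)%N%:R :> R by rewrite ltr0n; lia.
have -> : (b + c).+1%:R = x.+1%:R + (b + c - x)%N%:R :> R by rewrite -natrD; congr (_%:R); lia.
move: x.+1%:R x0 (b + c - x)%N%:R y0 => u x0 v y0.
rewrite ler_pdivrMr ?addr_gt0 // -subr_ge0.
have -> : (u^-1 + v^-1) * (u + v) - 4 = (u - v) ^+ 2 / (u * v) by field; apply/andP; split; lra.
by rewrite divr_ge0 ?sqr_ge0 // mulr_ge0 ?ltW.
Qed.

Let num (M : BinNums.N) a : BinNums.N := BinNat.N.mul M (bin_of_nat (2 * (1293 - a - lowb a))).
Let den a : BinNums.N := BinNat.N.mul (bin_of_nat a.+1) (bin_of_nat (lowb a + (1293 - a)).+1).

(** Fixed-point arithmetic: [quo a / M] is a lower bound for row [a], verified by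
    cross-multiplication of binary integers. *)
Lemma harm_sum_ge M (quo : nat -> BinNums.N) :
  all (fun a => BinNat.N.leb (BinNat.N.mul (quo a) (den a)) (num M a) && (lowb a <= 1293 - a)%N)
    (index_iota 60 646) ->
  (nat_of_bin (sumN [seq quo a | a <- index_iota 60 646]))%:R <= (nat_of_bin M)%:R * harm_sum.
Proof.
move=> chk.
have -> : (nat_of_bin (sumN [seq quo a | a <- index_iota 60 646]))%:R =
    \sum_(60 <= a < 646) (nat_of_bin (quo a))%:R :> R.
  elim: (index_iota 60 646) => [|a s IH]; first by rewrite big_nil.
  by rewrite big_cons -IH -natrD -nat_of_bin_add.
rewrite mulr_sumr big_seq [leRHS]big_seq; apply: ler_sum => a ha.
have /andP[h1 h2] := allP chk _ ha.
have {}h1 := nat_of_bin_leb h1; rewrite /num /den !nat_of_bin_mul !bin_of_natK in h1.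
have -> : \sum_(lowb a <= b < 1293 - a) (a.+1%:R * b.+1%:R)^-1 =
   a.+1%:R^-1 * \sum_(lowb a <= b < 1293 - a) b.+1%:R^-1 :> R.
  by rewrite mulr_sumr; apply: eq_bigr => b _; rewrite invfM.
have a0 : 0 < a.+1%:R :> R by rewrite ltr0n.
have := harmonic_mean_le h2; set X := \sum_(lowb a <= b < _) _ => h3.
have s0 : 0 <= (nat_of_bin M)%:R / a.+1%:R :> R by rewrite divr_ge0.
apply: le_trans (_ : (nat_of_bin M)%:R / a.+1%:R * X <= _); last by rewrite mulrA.
apply: le_trans (ler_wpM2l s0 h3).
rewrite -(ler_nat R) !natrM in h1.
have d0 : 0 < (lowb a + (1293 - a)).+1%:R :> R by rewrite ltr0n.
by rewrite mulrACA -invfM ler_pdivlMr ?mulr_gt0.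
Qed.

Lemma ratio_of_check (c8 c9 e M : BinNums.N) : (0 < nat_of_bin M)%N ->
  BinNat.N.leb (BinNat.N.mul (BinNat.N.mul (bin_of_nat (21 * 180)) c8) M)
               (BinNat.N.mul (BinNat.N.mul (bin_of_nat 160) e) c9) ->
  (nat_of_bin e)%:R <= (nat_of_bin M)%:R * harm_sum ->
  21 * 180 * (nat_of_bin c8)%:R <= 160 * harm_sum * (nat_of_bin c9)%:R.
Proof.
move=> M0 /nat_of_bin_leb chk eM.
rewrite !nat_of_bin_mul !bin_of_natK -(ler_nat R) !natrM in chk.
have s0 : 0 < (nat_of_bin M)%:R :> R by rewrite ltr0n.
rewrite -(ler_pM2r s0); apply: le_trans chk _.
rewrite [leRHS]mulrAC; apply: ler_wpM2r => //; rewrite -mulrA ler_wpM2l //.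
by rewrite [leRHS]mulrC.
Qed.

(** Disjointness of the eight colours would give [180 * count8 >= 8 * harm_sum * count9] up to the
    error terms; since [160 = 20 * 8], the factor 21 contradicts it with five percent to spare. *)
Lemma numeric_ratio :
  21 * 180 * (nat_of_bin count8)%:R <= 160 * harm_sum * (nat_of_bin count9)%:R.
Proof.
(* The scale is [10^9], in binary constructors. *)
pose scale : BinNums.N := BinNums.Npos (BinPos.Pos.pow (BinNums.xO (BinNums.xI (BinNums.xO BinNums.xH)))
   (BinNums.xI (BinNums.xO (BinNums.xO BinNums.xH)))).
pose quo a := BinNat.N.div (num scale a) (den a).
apply: (@ratio_of_check count8 count9 (sumN [seq quo a | a <- index_iota 60 646]) scale).
- exact: nat_of_bin_gt0.
- by vm_compute.
by apply: harm_sum_ge; vm_compute.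
Qed.

End Counting.

(** * Equidistribution of products of two primes *)

Section PieceEstimate.
Variable R : realType.

Lemma sqrt_CauchySchwarz (a b c d : R) : 0 <= a -> 0 <= b -> 0 <= c -> 0 <= d ->
  Num.sqrt (a * b) + Num.sqrt (c * d) <= Num.sqrt ((a + c) * (b + d)).
Proof.
move=> a0 b0 c0 d0.
rewrite -(sqr_sqrtr a0) -(sqr_sqrtr b0) -(sqr_sqrtr c0) -(sqr_sqrtr d0).
move: (sqrtr_ge0 a) (sqrtr_ge0 b) (sqrtr_ge0 c) (sqrtr_ge0 d).
move: (Num.sqrt a) (Num.sqrt b) (Num.sqrt c) (Num.sqrt d) => x y z t x0 y0 z0 t0.
rewrite -!exprMn !sqrtr_sqr !ger0_norm ?mulr_ge0 //.
rewrite -[leLHS]ger0_norm; last by rewrite addr_ge0 ?mulr_ge0.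
rewrite -sqrtr_sqr; apply: ler_wsqrtr; rewrite -subr_ge0.
have -> : (x ^+ 2 + z ^+ 2) * (y ^+ 2 + t ^+ 2) - (x * y + z * t) ^+ 2 = (x * t - z * y) ^+ 2 by ring.
exact: sqr_ge0.
Qed.

Lemma ssum_sqrt_le P (g x y : seq nat -> R) :
  (forall rho, subseq rho P -> [/\ 0 <= g rho, 0 <= x rho & 0 <= y rho]) ->
  ssum P (fun rho => g rho * Num.sqrt (x rho * y rho)) <=
  Num.sqrt (ssum P (fun rho => g rho * x rho) * ssum P (fun rho => g rho * y rho)).
Proof.
elim: P g x y => [|p P IH] g x y H /=.
  have [g0 x0 y0] := H [::] isT.
  by rewrite [X in _ <= Num.sqrt X]mulrACA -expr2 [leRHS]sqrtrM ?sqr_ge0 // sqrtr_sqr ger0_norm.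
have H1 rho : subseq rho P -> [/\ 0 <= g rho, 0 <= x rho & 0 <= y rho].
  by move=> s; apply: H; apply: subseq_trans s (subseq_cons _ _).
have H2 rho : subseq rho P -> [/\ 0 <= g (p :: rho), 0 <= x (p :: rho) & 0 <= y (p :: rho)].
  by move=> s; apply: H; rewrite /= eqxx.
have pos (f k : seq nat -> R) : (forall rho, subseq rho P -> 0 <= f rho /\ 0 <= k rho) ->
    0 <= ssum P (fun rho => f rho * k rho).
  by move=> fk; apply: ssum_ge0 => rho /fk[? ?]; rewrite mulr_ge0.
apply: le_trans (lerD (IH _ _ _ H1) (IH _ _ _ H2)) (sqrt_CauchySchwarz _ _ _ _).
- by apply: pos => rho /H1[].
- by apply: pos => rho /H1[].
- by apply: (pos (fun r => g (p :: r)) (fun r => x (p :: r))) => rho /H2[].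
- by apply: (pos (fun r => g (p :: r)) (fun r => y (p :: r))) => rho /H2[].
Qed.

Variables (K : finType) (h : K -> nat) (i : K).
Hypothesis K8 : #|K| == 8%N.

Lemma zsum_ssum P (F : seq nat -> R) :
  zsum i P (fun z => F (unzip1 z)) = ssum P (fun rho => 7 ^+ size rho * F rho).
Proof.
elim: P F => [|p P IH] F /=; first by rewrite mul1r.
rewrite IH; congr (_ + _).
rewrite (eq_bigr (fun=> ssum P (fun rho => 7 ^+ size rho * F (p :: rho)))) => [|j _]; last first.
  exact: (IH (fun rho => F (p :: rho))).
rewrite sumr_const (cardC1 i) (eqP K8) /= -[LHS]mulr_natl -ssumZ.
by apply: eq_ssum => rho _; rewrite exprS mulrA.
Qed.

Lemma ler_norm_zsum P F (G : seq (nat * K) -> R) : (forall z, zok i P z -> `|F z| <= G z) ->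
  `|zsum i P F| <= zsum i P G.
Proof.
move=> FG; rewrite ler_norml; apply/andP; split.
  rewrite -[leLHS]mulN1r -zsumZ; apply: le_zsum => z /FG.
  by rewrite ler_norml mulN1r => /andP[].
by apply: le_zsum => z /FG; rewrite ler_norml => /andP[].
Qed.

Variables (P : seq nat) (b : (K -> nat) -> R) (D : nat).
Hypotheses (uP : uniq P) (pP : all prime P) (P60 : all (leq 60) P)
  (sepP : forall p, p \in P -> hsep h p) (ab : anti b) (sb : supp i D 1 b).
Variables (S1 S2 : seq nat) (al be : nat -> R).
Hypotheses (US1 : forall q, q \in S1 -> unitl P q) (US2 : forall q, q \in S2 -> unitl P q)
  (hS : forall q q', q \in S1 -> q' \in S2 -> (h i <= q * q')%N).

Let MB := \prod_(p <- P) (1 + 500 / p%:R ^+ 2) * Cs P (dup i b).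

Let P8 : all (fun p => 8 <= p)%N P.
Proof. by apply/allP => p /(allP P60); apply: leq_trans. Qed.

Let P1 : all (leq 1) P.
Proof. by apply/allP => p /(allP P60); apply: leq_trans. Qed.

Let MB0 : 0 <= MB.
Proof.
rewrite mulr_ge0 //; last first.
  by apply: Cs_ge0 => f; rewrite /dup; case: ab => b0 _; rewrite mulr_ge0.
by apply: prodr_ge0 => p _; rewrite addr_ge0 // divr_ge0 // exprn_ge0.
Qed.

(** The empty [z] gives the main term. For the others [Mz_bound] costs 162 per flagged prime, and
    the seven possible colours make it [1134 = 7 * 162]; [Mz_eq0_z] discards moduli from [D^2] on,
    and [kap_bilinear] bounds the fluctuation. *)
Lemma piece_expand :
  `|\sum_(q <- S1) \sum_(q' <- S2) al q * be q' * Lam P b (hcol h (q * q' - h i)) ^+ 2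
    - (\sum_(q <- S1) al q) * (\sum_(q <- S2) be q) * Bil (mu_unit R i) P b b| <=
  MB * ssum P (fun rho => (rho != [::])%:R * (\prod_(l <- rho) l < D * D)%N%:R * 1134 ^+ size rho
                          * Num.sqrt (Nk rho S1 al * Nk rho S2 be)).
Proof.
pose B z := \sum_(q <- S1) \sum_(q' <- S2) al q * be q' * kap R h z (q * q' - h i).
have -> : \sum_(q <- S1) \sum_(q' <- S2) al q * be q' * Lam P b (hcol h (q * q' - h i)) ^+ 2 =
    zsum i P (fun z => B z * Mz i P (flz z) b b).
  transitivity (\sum_(q <- S1) \sum_(q' <- S2)
      zsum i P (fun z => al q * be q' * kap R h z (q * q' - h i) * Mz i P (flz z) b b)).
    rewrite big_seq [RHS]big_seq; apply: eq_bigr => q q1.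
    rewrite big_seq [RHS]big_seq; apply: eq_bigr => q' q2.
    rewrite expr2 (@unit_expand R K h i) // => [|p pin]; last first.
      rewrite subnK ?hS // Euclid_dvdM ?(allP pP) // negb_or.
      by rewrite (allP (US1 q1)) // (allP (US2 q2)).
    by rewrite -zsumZ; apply: eq_zsum => z _; rewrite mulrA.
  under eq_bigr do rewrite zsum_swap.
  rewrite zsum_swap; apply: eq_zsum => z _; rewrite /B mulr_suml; apply: eq_bigr => q _.
  by rewrite mulr_suml.
rewrite zsum_nil Mz_nil.
have -> : B [::] = (\sum_(q <- S1) al q) * (\sum_(q <- S2) be q).
  rewrite /B mulr_suml; apply: eq_bigr => q _; rewrite mulr_sumr; apply: eq_bigr => q' _.
  by rewrite /kap big_nil mulr1.
rewrite addrAC subrr add0r.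
pose G rho := MB * ((rho != [::])%:R * (\prod_(l <- rho) l < D * D)%N%:R * 162 ^+ size rho
                          * Num.sqrt (Nk rho S1 al * Nk rho S2 be)).
apply: le_trans (ler_norm_zsum (G := fun z => G (unzip1 z)) _) _; last first.
  rewrite zsum_ssum /G -ssumZ; apply: le_ssum => rho _.
  rewrite le_eqVlt; apply/orP; left; apply/eqP.
  rewrite (_ : 1134 = 7 * 162 :> R); last by rewrite -natrM.
  by rewrite exprMn; ring.
move=> z zz; have [sz iz] : subseq (unzip1 z) P /\ all (fun pj => pj.2 != i) z by apply/andP.
have zP l : l \in unzip1 z -> l \in P by move/(mem_subseq sz).
have pz : all prime (unzip1 z) by apply/allP => l /zP /(allP pP).
have Uz (S : seq nat) : (forall q, q \in S -> unitl P q) -> forall q, q \in S -> all (fun l => ~~ (l %| q)%N) (unzip1 z).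
  by move=> US q /US/allP H; apply/allP => l /zP/H.
have [N1 N2 BN] := @kap_bilinear R K h i z S1 S2 al be pz iz (fun l lz => sepP (zP l lz))
  (Uz S1 US1) (Uz S2 US2) hS.
rewrite /G; case: z zz sz iz zP pz {Uz} N1 N2 BN => [|pj z] zz sz iz zP pz N1 N2 BN.
  by rewrite normr0 !mul0r mulr0.
set zz' := pj :: z in zz sz iz zP pz N1 N2 BN *.
have -> : (unzip1 zz' != [::]) = true by [].
rewrite mul1r normrM; have [small|big] := ltnP (\prod_(l <- unzip1 zz') l) (D * D); last first.
  by rewrite (Mz_eq0_z uP P1 zz sb big) normr0 mulr0 !mul0r mulr0.
have := Mz_bound K8 uP P8 zz ab; rewrite -/MB => Mb.
have Bb : `|B zz'| <= Num.sqrt (Nk (unzip1 zz') S1 al * Nk (unzip1 zz') S2 be).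
  by rewrite -sqrtr_sqr; apply: ler_wsqrtr.
rewrite mul1r mulrC (_ : MB * _ = (162 ^+ size zz' * MB) *
    Num.sqrt (Nk (unzip1 zz') S1 al * Nk (unzip1 zz') S2 be)); last by rewrite size_map; ring.
exact: ler_pM.
Qed.

(** Moduli up to [Z^2] only gain the small constant [dl]. The larger ones are grouped by their level
    [e]: there [1134^size] is at most [Z], and inserting the modulus as a weight for the large sieve
    brings in [1 / Z^e]. *)
Lemma piece_bound (Z E : nat) (dl V1 V2 : R) (U1 U2 : nat -> R) : (1 < Z)%N -> (D * D <= Z ^ E)%N -> 0 <= dl ->
  (forall rho, subseq rho P -> rho != [::] -> 1134 ^+ size rho <= dl * (\prod_(l <- rho) l.-1)%N%:R) ->
  (forall rho, subseq rho P -> (\prod_(l <- rho) l < D * D)%N -> 1134 ^+ size rho <= Z%:R :> R) ->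
  ssum P (fun rho => (\prod_(l <- rho) l <= Z ^ 2)%N%:R * ((\prod_(l <- rho) l.-1)%N%:R * Nk rho S1 al)) <= V1 ->
  ssum P (fun rho => (\prod_(l <- rho) l <= Z ^ 2)%N%:R * ((\prod_(l <- rho) l.-1)%N%:R * Nk rho S2 be)) <= V2 ->
  (forall e, (2 <= e < E)%N -> ssum P (fun rho => (\prod_(l <- rho) l <= Z ^ e.+1)%N%:R *
    ((\prod_(l <- rho) l)%N%:R * Nk rho S1 al)) <= U1 e) ->
  (forall e, (2 <= e < E)%N -> ssum P (fun rho => (\prod_(l <- rho) l <= Z ^ e.+1)%N%:R *
    ((\prod_(l <- rho) l)%N%:R * Nk rho S2 be)) <= U2 e) ->
  `|\sum_(q <- S1) \sum_(q' <- S2) al q * be q' * Lam P b (hcol h (q * q' - h i)) ^+ 2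
    - (\sum_(q <- S1) al q) * (\sum_(q <- S2) be q) * Bil (mu_unit R i) P b b| <=
  MB * (dl * Num.sqrt (V1 * V2) + \sum_(2 <= e < E) Z%:R / (Z ^ e)%N%:R * Num.sqrt (U1 e * U2 e)).
Proof.
move=> Z1 DZ dl0 H1 H2 hV1 hV2 hU1 hU2; apply: le_trans piece_expand _; apply: ler_wpM2l => //.
have NkP (S : seq nat) (ga : nat -> R) rho : (forall q, q \in S -> unitl P q) -> subseq rho P -> 0 <= Nk rho S ga.
  move=> US sr; apply: Nk_ge0 => [|q /US /allP H].
    by apply/allP => l /(mem_subseq sr)/(allP pP).
  by apply/allP => l /(mem_subseq sr)/H.
set SQ := fun rho => Num.sqrt (Nk rho S1 al * Nk rho S2 be).
pose g1 (rho : seq nat) : R := (\prod_(l <- rho) l <= Z ^ 2)%N%:R * (\prod_(l <- rho) l.-1)%N%:R.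
pose ge e (rho : seq nat) : R := (\prod_(l <- rho) l <= Z ^ e.+1)%N%:R * (\prod_(l <- rho) l)%N%:R.
have key g V V' : (forall rho, 0 <= g rho) ->
    ssum P (fun rho => g rho * Nk rho S1 al) <= V -> ssum P (fun rho => g rho * Nk rho S2 be) <= V' ->
    ssum P (fun rho => g rho * SQ rho) <= Num.sqrt (V * V').
  move=> g0 hV hV'; apply: le_trans (ssum_sqrt_le _) _.
    by move=> rho sr; split=> //; apply: NkP.
  apply: ler_wsqrtr; apply: ler_pM => //; apply: ssum_ge0 => rho sr; rewrite mulr_ge0 //; exact: NkP.
have Z0 : 0 < Z%:R :> R by rewrite ltr0n (ltn_trans _ Z1).
have Ze e : 0 < (Z ^ e)%N%:R :> R by rewrite natrX exprn_gt0.
apply: (@le_trans _ _ (ssum P (fun rho => dl * (g1 rho * SQ rho) +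
    \sum_(2 <= e < E) Z%:R / (Z ^ e)%N%:R * (ge e rho * SQ rho)))).
  apply: le_ssum => rho sr; rewrite -/(SQ rho).
  have -> : dl * (g1 rho * SQ rho) + \sum_(2 <= e < E) Z%:R / (Z ^ e)%N%:R * (ge e rho * SQ rho) =
     (dl * g1 rho + \sum_(2 <= e < E) Z%:R / (Z ^ e)%N%:R * ge e rho) * SQ rho.
    by rewrite mulrDl mulr_suml mulrA; congr (_ + _); apply: eq_bigr => e _; rewrite mulrA.
  rewrite ler_wpM2r ?sqrtr_ge0 //.
  have s0 : 0 <= \sum_(2 <= e < E) Z%:R / (Z ^ e)%N%:R * ge e rho.
    by apply: sumr_ge0 => e _; rewrite mulr_ge0 ?divr_ge0 ?mulr_ge0.
  have d0 : 0 <= dl * g1 rho by rewrite mulr_ge0 // mulr_ge0.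
  case: (eqVneq rho [::]) => [_|rn] /=; first by rewrite !mul0r addr_ge0.
  case: ltnP => rD; last by rewrite mulr0 mul0r addr_ge0.
  rewrite mulr1 mul1r; have [rZ|Zr] := leqP (\prod_(l <- rho) l) (Z ^ 2).
    by rewrite -[leLHS]addr0 lerD // /g1 rZ mul1r H1.
  rewrite -[leLHS]add0r lerD //; apply: le_trans (H2 _ sr rD) _.
  have r0 : (0 < \prod_(l <- rho) l)%N by apply: leq_trans Zr.
  have /andP[lo hi] := trunc_log_bounds Z1 r0; set e := trunc_log Z _ in lo hi.
  have e2 : (2 <= e)%N by apply: trunc_log_max => //; apply: ltnW.
  have eE : (e < E)%N.
    by have := leq_ltn_trans lo (leq_trans rD DZ); rewrite ltn_exp2l.
  rewrite (big_rem e) /=; last by rewrite mem_index_iota e2.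
  rewrite -[leLHS]addr0 lerD //; last first.
    by apply: sumr_ge0 => e' _; rewrite mulr_ge0 ?divr_ge0 ?mulr_ge0.
  rewrite /ge (ltnW hi) mul1r mulrAC ler_pdivlMr // ler_pM2l // ler_nat //.
rewrite ssumD lerD //.
  rewrite ssumZ ler_wpM2l //; apply: key => //.
    by move=> rho; rewrite mulr_ge0.
    by apply: le_trans hV1; apply: le_ssum => rho _; rewrite mulrA.
  by apply: le_trans hV2; apply: le_ssum => rho _; rewrite mulrA.
rewrite -ssum_swap; apply: ler_sum_nat => e eE; rewrite ssumZ ler_wpM2l ?divr_ge0 //.
apply: key => //; first by move=> rho; rewrite mulr_ge0.
  by apply: le_trans (hU1 e eE); apply: le_ssum => rho _; rewrite mulrA.
by apply: le_trans (hU2 e eE); apply: le_ssum => rho _; rewrite mulrA.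
Qed.

End PieceEstimate.

(** * The primes of the sieve and their products *)

Section Preparation.
Variable R : realType.

Lemma sum_inv_sqr_tail (w N : nat) : (0 < w)%N -> \sum_(w.+1 <= n < N) n%:R^-1 ^+ 2 <= w%:R^-1 :> R.
Proof.
move=> w0; have [Nw|wN] := leqP N w.+1; first by rewrite big_geq // invr_ge0.
rewrite -(subnKC (ltnW wN)).
suff H k : \sum_(w.+1 <= n < w.+1 + k) n%:R^-1 ^+ 2 <= w%:R^-1 - (w + k)%N%:R^-1 :> R.
  by apply: le_trans (H _) _; rewrite gerBl invr_ge0.
elim: k => [|k IH]; first by rewrite !addn0 big_geq // subrr.
rewrite addnS big_nat_recr ?leq_addr //=; apply: le_trans (lerD IH (lexx _)) _.
rewrite addSn addnS; have x0 : 0 < (w + k)%N%:R :> R by rewrite ltr0n addn_gt0 w0.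
rewrite -natr1; move: (w + k)%N%:R x0 => x x0.
rewrite -subr_ge0.
have -> : w%:R^-1 - (x + 1)^-1 - (w%:R^-1 - x^-1 + (x + 1)^-1 ^+ 2) = (x * (x + 1) ^+ 2)^-1.
  by field; rewrite pnatr_eq0 -lt0n w0; apply/andP; split; lra.
by rewrite invr_ge0 mulr_ge0 ?exprn_ge0 //; lra.
Qed.

Lemma prod_one_sub_ge (s : seq nat) (x : nat -> R) : (forall p, p \in s -> 0 <= x p <= 1) ->
  1 - \sum_(p <- s) x p <= \prod_(p <- s) (1 - x p) <= 1.
Proof.
elim: s => [|p s IH] H; first by rewrite !big_nil subr0 lexx.
have /andP[x0 x1] := H p (mem_head _ _).
have /andP[i1 i2] : 1 - \sum_(p <- s) x p <= \prod_(p <- s) (1 - x p) <= 1.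
  by apply: IH => q qs; apply: H; rewrite inE qs orbT.
have s0 : 0 <= \sum_(p <- s) x p.
  by rewrite big_seq sumr_ge0 // => q qs; case/andP: (H q (mem_behead (s := p :: s) qs)).
have q0 : 0 <= \prod_(p <- s) (1 - x p).
  by rewrite big_seq prodr_ge0 // => q qs; rewrite subr_ge0; case/andP: (H q (mem_behead (s := p :: s) qs)).
rewrite !big_cons; move: (\sum_(p <- s) _) (\prod_(p <- s) _) i1 i2 s0 q0 => S Q i1 i2 s0 q0.
apply/andP; split; nra.
Qed.

Lemma prod_one_add_le (s : seq nat) (x : nat -> R) : (forall p, p \in s -> 0 <= x p <= 1) ->
  \prod_(p <- s) (1 + x p) * (1 - \sum_(p <- s) x p) <= 1 /\ 1 <= \prod_(p <- s) (1 + x p).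
Proof.
move=> H; have /andP[h1 _] := prod_one_sub_ge H.
have g1 : 1 <= \prod_(p <- s) (1 + x p).
  elim: s H {h1} => [|p s IH] H; first by rewrite big_nil.
  rewrite big_cons -[leLHS]mulr1 ler_pM //.
    by rewrite lerDl; case/andP: (H p (mem_head _ _)).
  by apply: IH => q qs; apply: H; rewrite inE qs orbT.
split=> //; apply: le_trans (ler_wpM2l (le_trans ler01 g1) h1) _.
rewrite -big_split /= big_seq.
rewrite [leRHS](_ : _ = \prod_(p <- s | p \in s) 1); last by rewrite big1.
apply: ler_prod => p /H/andP[x0 x1]; apply/andP; split; first by rewrite mulr_ge0 //; lra.
by rewrite mulrC -subr_sqr expr1n gerBl sqr_ge0.
Qed.

Lemma sum_dyadic (F : nat -> R) (a n : nat) :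
  \sum_(2 ^ a <= q < 2 ^ (a + n)) F q = \sum_(a <= s < a + n) \sum_(2 ^ s <= q < 2 ^ s.+1) F q.
Proof.
elim: n => [|n IH]; first by rewrite addn0 !big_geq.
rewrite addnS big_nat_recr ?leq_addr //= -IH -big_cat_nat //= leq_exp2l // ?leq_addr //.
Qed.

Section Sieving.
Variables (w W N : nat).
Hypotheses (w0 : (0 < w)%N) (W0 : (0 < W)%N) (Hw : forall p, prime p -> coprime p W -> (w < p)%N).

Definition sprimes := [seq p <- iota 0 N | prime p && coprime p W].

Lemma mem_sprimes p : (p \in sprimes) = [&& prime p, coprime p W & (p < N)%N].
Proof. by rewrite mem_filter mem_iota add0n leq0n -andbA. Qed.

Lemma uniq_sprimes : uniq sprimes.
Proof. by rewrite filter_uniq // iota_uniq. Qed.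

Lemma sprimes_gt p : p \in sprimes -> (w < p)%N.
Proof. by rewrite mem_sprimes => /and3P[pp cp _]; exact: Hw. Qed.

Lemma prime_sprimes : all prime sprimes.
Proof. by apply/allP => p; rewrite mem_sprimes => /and3P[]. Qed.

Lemma sum_sprimes_le : \sum_(p <- sprimes) p%:R^-1 ^+ 2 <= w%:R^-1 :> R.
Proof.
apply: le_trans (sum_inv_sqr_tail N w0).
rewrite big_filter big_mkcond /= -[X in iota 0 X]subn0 -/(index_iota 0 N).
have z p : (p < w.+1)%N -> (if prime p && coprime p W then p%:R^-1 ^+ 2 else 0) = 0 :> R.
  move=> pw; case: ifP => // /andP[pp cp].
  by have := Hw pp cp; rewrite ltnNge -ltnS pw.
have [wN|Nw] := leqP w.+1 N; last first.
  rewrite big_nat_cond big1 ?sumr_ge0 // => [n _|p /andP[/andP[_ pN] _]]; first exact: sqr_ge0.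
  by rewrite z // (leq_trans pN) // ltnW.
rewrite (big_cat_nat (leq0n _) wN) /= [X in X + _]big_nat_cond [X in X + _]big1 ?add0r.
  by apply: ler_sum => p _; case: ifP => // _; exact: sqr_ge0.
by move=> p /andP[/andP[_ pw] _]; rewrite z.
Qed.

Lemma prod_sprimes_bounds (c : R) : 0 <= c -> c <= w%:R ->
  1 - c / w%:R <= \prod_(p <- sprimes) (1 - c / p%:R ^+ 2) /\
  (\prod_(p <- sprimes) (1 + c / p%:R ^+ 2) * (1 - c / w%:R) <= 1 /\
   1 <= \prod_(p <- sprimes) (1 + c / p%:R ^+ 2)).
Proof.
move=> c0 cw; have w1 : 0 < w%:R :> R by rewrite ltr0n.
have H p : p \in sprimes -> 0 <= c / p%:R ^+ 2 <= 1.
  move=> /sprimes_gt wp; have p0 : 0 < p%:R :> R by rewrite ltr0n (leq_trans _ wp).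
  rewrite divr_ge0 ?exprn_ge0 //= ler_pdivrMr ?exprn_gt0 // mul1r (le_trans cw) //.
  by rewrite -natrX ler_nat expnS expn1 (leq_trans (ltnW wp)) // leq_pmulr // (leq_trans _ wp).
have S : \sum_(p <- sprimes) c / p%:R ^+ 2 <= c / w%:R.
  rewrite -mulr_sumr ler_wpM2l //; apply: le_trans sum_sprimes_le.
  by rewrite le_eqVlt; apply/orP; left; apply/eqP/eq_bigr => p _; rewrite exprVn.
have /andP[h1 _] := prod_one_sub_ge H; have [h2 h3] := prod_one_add_le H.
split; first by lra.
split=> //; apply: le_trans h2; rewrite ler_wpM2l ?(le_trans ler01) //; lra.
Qed.

(** Every prime satisfies [l - 1 >= w >= c], so each factor [c] is absorbed; one prime of the
    nonempty [rho] moreover yields the gain [c / w]. *)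
Lemma factor_small (c : R) rho : 0 <= c -> c <= w%:R -> subseq rho sprimes -> rho != [::] ->
  c ^+ size rho <= c / w%:R * (\prod_(l <- rho) l.-1)%N%:R.
Proof.
move=> c0 cw; have w1 : 0 < w%:R :> R by rewrite ltr0n.
have gt l : l \in sprimes -> w%:R <= l.-1%:R :> R.
  by move=> /sprimes_gt; case: l => // l; rewrite ltnS ler_nat.
have base rho' : {subset rho' <= sprimes} -> c ^+ size rho' <= (\prod_(l <- rho') l.-1)%N%:R.
  elim: rho' => [|l r IH] sr; first by rewrite big_nil.
  rewrite big_cons exprS natrM ler_pM ?exprn_ge0 //.
    by apply: le_trans cw (gt _ _); apply: sr; exact: mem_head.
  by apply: IH => q qr; apply: sr; rewrite inE qr orbT.
case: rho => // l r /mem_subseq sr _; rewrite big_cons exprS natrM mulrA ler_pM ?exprn_ge0 //.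
  rewrite mulrAC ler_pdivlMr // ler_wpM2l // gt //; apply: sr; exact: mem_head.
by apply: base => q qr; apply: sr; rewrite inE qr orbT.
Qed.

(** All primes exceed [c^n], so [c^(n * size rho)] is at most the product, which is below [Z^n];
    take [n]-th roots. This is why [w] must reach [1134^554]. *)
Lemma factor_pow (c n : nat) (Z : nat) rho : (0 < n)%N -> (1 < Z)%N -> (c ^ n <= w)%N -> subseq rho sprimes ->
  (\prod_(l <- rho) l < Z ^ n)%N -> (c ^ size rho <= Z)%N.
Proof.
move=> n0 Z1 cw /mem_subseq sr rZ; rewrite -(leq_exp2r _ _ n0) -expnM mulnC expnM.
apply: leq_trans (ltnW rZ); elim: rho sr {rZ} => [|l r IH] sr; first by rewrite big_nil expn0.
rewrite big_cons expnS leq_mul //; last by apply: IH => q qr; apply: sr; rewrite inE qr orbT.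
by apply: leq_trans cw (ltnW (sprimes_gt _)); apply: sr; exact: mem_head.
Qed.

End Sieving.

Lemma Us_bin_ibin P (Z g l : nat) : (1 < Z)%N -> (l < g)%N -> all prime P ->
  Us P (@bin R Z g l) = ssum P (fun m => ibin R (Z ^ l) (Z ^ l.+1) (\prod_(q <- m) q)%N).
Proof.
move=> Z1 lg pP; apply: eq_ssum => rho sr.
have : (0 < \prod_(q <- rho) q)%N.
  by apply: prod_primes_gt0; apply/allP => q /(mem_subseq sr)/(allP pP).
move: (\prod_(q <- rho) q)%N => m m0; rewrite /bin /ibin; congr (_%:R / _).
congr nat_of_bool; apply/andP/andP => [[mZ /eqP <-]|[lo hi]].
  by have /andP[] := trunc_log_bounds Z1 m0.
rewrite (leq_trans hi) ?leq_exp2l //; split=> //; apply/eqP/trunc_log_eq => //.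
by rewrite lo hi.
Qed.

Lemma Us_bin_bounds (w W Z g l : nat) (b : R) : b = (totient W)%:R / W%:R * ln Z%:R -> (0 < w)%N -> (0 < W)%N ->
  (forall p, prime p -> coprime p W -> (w < p)%N) -> (1 < Z)%N -> (l < g)%N ->
  b - W%:R - (b + W%:R) / w%:R <= Us (sprimes W (Z ^ g)) (@bin R Z g l) <= b + W%:R.
Proof.
move=> bE w0 W0 Hw Z1 lg; set P := sprimes _ _; rewrite Us_bin_ibin ?prime_sprimes //.
have Z0 : (0 < Z)%N by apply: ltnW.
have lnE : ln (Z ^ l.+1)%N%:R - ln (Z ^ l)%N%:R = ln Z%:R :> R.
  by rewrite expnS natrM lnM ?posrE ?ltr0n ?expn_gt0 ?Z0 // addrK.
have mP := mem_sprimes W (Z ^ g); have uP := uniq_sprimes W (Z ^ g).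
apply/andP; split; last first.
  rewrite bE -lnE; apply: (ssum_ibin_le R W0 uP mP); rewrite ?expn_gt0 ?Z0 //.
  by rewrite leq_exp2l.
have b0 : 0 <= b by rewrite bE mulr_ge0 ?divr_ge0 // ln_ge0 // ler1n.
have Zl : (0 < Z ^ l)%N by rewrite expn_gt0 Z0.
have ZZ : (Z * Z ^ l <= Z ^ g)%N by rewrite -expnS leq_exp2l.
have := @ssum_ibin_ge R W (Z ^ g) P W0 uP mP (Z ^ l) Z Zl Z0 ZZ.
rewrite -expnS; apply: le_trans; rewrite -bE lerB // mulrC ler_wpM2l ?addr_ge0 //.
exact: sum_sprimes_le.
Qed.

End Preparation.

(** * Error terms for one pair of binary ranges *)

Section Pieces.
Variable R : realType.
Variables (w W N : nat).
Hypotheses (w0 : (0 < w)%N) (W0 : (0 < W)%N) (Hw : forall p, prime p -> coprime p W -> (w < p)%N).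
Let P := sprimes W N.

Definition lnq (q : nat) : R := ln q%:R / q%:R.
(** A level from [Z^a] to [Z^(a+1)] is too long for the large sieve, which compares the length of
    the range with the size of [q]; levels are therefore cut into binary blocks. *)
Definition cls c s := [seq q <- index_iota (2 ^ s) (2 ^ s.+1) | prime q && (q == c %[mod W])].
Definition Tp c s : R := \sum_(q <- cls c s) lnq q.

Lemma mem_cls c s q : (q \in cls c s) = [&& prime q, (q == c %[mod W])%N & (2 ^ s <= q < 2 ^ s.+1)%N].
Proof. by rewrite mem_filter mem_index_iota -andbA. Qed.

Lemma lnq_bounds c s q : q \in cls c s -> 0 <= lnq q <= s.+1%:R / (2 ^ s)%N%:R.
Proof.
rewrite mem_cls => /and3P[pq _ /andP[lo hi]]; have q0 := prime_gt0 pq.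
have qr : 0 < q%:R :> R by rewrite ltr0n.
rewrite divr_ge0 ?ln_ge0 ?ler1n //=; apply: ler_pM; rewrite ?invr_ge0 ?ln_ge0 ?ler1n //.
  apply: (@le_trans _ _ (ln (2 ^ s.+1)%N%:R)).
    by rewrite ler_ln ?posrE ?ltr0n ?expn_gt0 // ler_nat ltnW.
  rewrite natrX lnXn ?ltr0n // -[leRHS]mulr1 mulr_natl -[leLHS]mulr_natl -[leRHS]mulr_natl.
  by rewrite ler_wpM2l //; have := @ln_le_sub1 R 2 (ltr0n _ 2); lra.
by rewrite lef_pV2 ?posrE ?ltr0n ?expn_gt0 // ler_nat.
Qed.

Lemma Tp_ge0 c s : 0 <= Tp c s.
Proof. by rewrite /Tp big_seq sumr_ge0 // => q /lnq_bounds/andP[]. Qed.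

Lemma sum_lnq_sqr_le c s : \sum_(q <- cls c s) lnq q ^+ 2 <= s.+1%:R / (2 ^ s)%N%:R * Tp c s.
Proof.
rewrite /Tp mulr_sumr big_seq [leRHS]big_seq; apply: ler_sum => q /lnq_bounds/andP[l0 l1].
by rewrite expr2 ler_wpM2r.
Qed.

Lemma Tp_le c s : Tp c s <= s.+1%:R.
Proof.
apply: (@le_trans _ _ (\sum_(q <- cls c s) s.+1%:R / (2 ^ s)%N%:R)).
  by rewrite /Tp big_seq [leRHS]big_seq; apply: ler_sum => q /lnq_bounds/andP[].
rewrite big_const_seq count_predT iter_addr_0 -[leLHS]mulr_natl mulrCA -[leRHS]mulr1 ler_wpM2l //.
rewrite ler_pdivrMr ?ltr0n ?expn_gt0 // mul1r ler_nat size_filter (leq_trans (count_size _ _)) //.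
by rewrite size_iota expnS mul2n -addnn addKn.
Qed.

Lemma cls_unitl c s q : (N <= 2 ^ s)%N -> q \in cls c s -> unitl P q.
Proof.
move=> Ns; rewrite mem_cls => /and3P[pq _ /andP[lo _]]; apply/allP => p.
rewrite mem_sprimes => /and3P[pp _ pN]; rewrite dvdn_prime2 //.
by rewrite neq_ltn (leq_trans pN) // (leq_trans Ns).
Qed.

Lemma cls_progression c s q H : ((2 ^ s.+1) %/ W < H)%N -> q \in cls c s ->
  exists2 m, (m < H)%N & q = (c %% W + W * m)%N.
Proof.
move=> hH; rewrite mem_cls => /and3P[_ /eqP qc /andP[_ hi]].
exists (q %/ W)%N; first by apply: leq_ltn_trans hH; rewrite leq_div2r // ltnW.
by rewrite -qc addnC mulnC -divn_eq.
Qed.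

Let uP : uniq P := uniq_sprimes W N.
Let pP : all prime P := prime_sprimes W N.
Let cWP : all (coprime W) P.
Proof. by apply/allP => p; rewrite mem_sprimes coprime_sym => /and3P[]. Qed.

(** [Nk_small] with [Q = Z^4] and [X = M = Z^2]; its condition [Q^2 <= H] is where [Z^8] comes from.
    The constant 96 is [24 * 4], because [H <= 4 * 2^s / W]. *)
Lemma piece_small c s Z (m0 : R) : (N <= 2 ^ s)%N -> (0 < Z)%N -> (W * Z ^ 8 <= 2 ^ s.+1)%N ->
  0 < m0 -> m0 <= ssum P (fun m => (\prod_(l <- m) l <= Z ^ 2)%N%:R / (\prod_(l <- m) l)%N%:R) ->
  ssum P (fun rho => (\prod_(l <- rho) l <= Z ^ 2)%N%:R *
    ((\prod_(l <- rho) l.-1)%N%:R * Nk rho (cls c s) lnq)) <= 96 * s.+1%:R * Tp c s / (W%:R * m0).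
Proof.
move=> Ns Z0 WZ m00 hm; set H := ((2 ^ s.+1) %/ W).+1.
have Wr : 0 < W%:R :> R by rewrite ltr0n.
have := @Nk_small R P (cls c s) lnq W (c %% W) H uP pP W0 cWP (filter_uniq _ (iota_uniq _ _))
  (fun q qs => cls_unitl Ns qs) (fun q qs => cls_progression (ltnSn _) qs) (Z ^ 4) (Z ^ 2) (Z ^ 2).
rewrite expn_gt0 Z0 -!expnD => /(_ isT) h.
have ZH : (Z ^ 8 <= H)%N by rewrite leqW // leq_divRL // mulnC.
have {h} := h ZH (leqnn _); set V := ssum P _; set M := ssum P _ => h.
have V0 : 0 <= V.
  apply: ssum_ge0 => rho sr; rewrite mulr_ge0 // mulr_ge0 // Nk_ge0 //.
    by apply/allP => l /(mem_subseq sr)/(allP pP).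
  by move=> q /(cls_unitl Ns)/allP U; apply/allP => l /(mem_subseq sr)/U.
rewrite ler_pdivlMr ?mulr_gt0 // [W%:R * m0]mulrC mulrA -ler_pdivlMr //.
apply: le_trans (ler_wpM2l V0 hm) (le_trans h _).
have Hle : H%:R <= 4 * (2 ^ s)%N%:R / W%:R :> R.
  rewrite ler_pdivlMr // -!natrM ler_nat /H mulSn.
  apply: (@leq_trans (2 ^ s.+1 + 2 ^ s.+1)); last by rewrite expnS -mulnDl.
  by rewrite leq_add ?leq_trunc_div // (leq_trans _ WZ) // leq_pmulr // expn_gt0 Z0.
have s0 : 0 < (2 ^ s)%N%:R :> R by rewrite ltr0n expn_gt0.
have T0 := Tp_ge0 c s.
apply: le_trans (_ : 24 * (4 * (2 ^ s)%N%:R / W%:R) * (s.+1%:R / (2 ^ s)%N%:R * Tp c s) <= _).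
  apply: ler_pM; [by rewrite mulr_ge0 | | by rewrite ler_wpM2l | exact: sum_lnq_sqr_le].
  by apply: sumr_ge0 => q _; exact: sqr_ge0.
rewrite le_eqVlt; apply/orP; left; apply/eqP.
move: (2 ^ s)%N%:R (Tp c s) (s.+1%:R) s0 => x T y x0.
by field; rewrite !gt_eqF.
Qed.

Lemma piece_large c s Z e : (N <= 2 ^ s)%N -> (0 < Z)%N ->
  ssum P (fun rho => (\prod_(l <- rho) l <= Z ^ e.+1)%N%:R *
    ((\prod_(l <- rho) l)%N%:R * Nk rho (cls c s) lnq)) <=
  24 * s.+1%:R ^+ 2 * (2 + (Z ^ (2 * e + 2))%N%:R / (2 ^ s)%N%:R).
Proof.
(* The second summand makes room for [Q^2] with [Q = Z^(e+1)], even when the block is shorter than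
   that. *)
move=> Ns Z0; set H := (2 ^ s.+1 + Z ^ (2 * e + 2))%N.
have hH : ((2 ^ s.+1) %/ W < H)%N.
  rewrite (leq_ltn_trans (leq_div _ _)) // -[ltnLHS]addn0 ltn_add2l expn_gt0 Z0 //.
have := @Nk_large R P (cls c s) lnq W (c %% W) H uP pP W0 cWP (filter_uniq _ (iota_uniq _ _))
  (fun q qs => cls_unitl Ns qs) (fun q qs => cls_progression hH qs) (Z ^ e.+1).
rewrite expn_gt0 Z0 -!expnD => /(_ isT) h.
have ZH : (Z ^ (e.+1 + e.+1) <= H)%N.
  by rewrite (_ : (e.+1 + e.+1 = 2 * e + 2)%N) ?leq_addl // mul2n -addnn addnS addSn addn2.
apply: le_trans (h ZH) _.
have s0 : 0 < (2 ^ s)%N%:R :> R by rewrite ltr0n expn_gt0.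
have sq : \sum_(q <- cls c s) lnq q ^+ 2 <= s.+1%:R ^+ 2 / (2 ^ s)%N%:R.
  apply: le_trans (sum_lnq_sqr_le c s) _; rewrite expr2 mulrAC -mulrA.
  by rewrite -[leRHS]mulrA ler_wpM2l // ler_wpM2r ?invr_ge0 // Tp_le.
apply: le_trans (ler_wpM2l _ sq) _; first by rewrite mulr_ge0.
rewrite /H natrD expnS natrM.
rewrite le_eqVlt; apply/orP; left; apply/eqP.
move: (2 ^ s)%N%:R (s.+1%:R) (Z ^ _)%N%:R s0 => x y z x0.
by field; rewrite gt_eqF.
Qed.

(** The level of distribution: the inequality amounts to [2 e <= 1107], so moduli below [Z^554] are
    just admissible when [q q' >= Z^1115]. *)
Lemma exponents_le e : (2 <= e < 554)%N -> ((2 * e + 2) * 2 + 4 <= 2 * e + 1115)%N.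
Proof.
case/andP=> _ e1; have : (2 * e <= 2 * 553)%N by rewrite leq_mul2l.
move: (2 * e)%N => a h; rewrite mulnDl muln2 -addnn -!addnA leq_add2l.
exact: leq_trans (leq_add h (leqnn _)) _.
Qed.

(** After multiplication by [Z^4] each of the four terms under the root is at most a constant times
    [Z^(2e)]: the constant one by [e >= 2], the mixed ones by the bounds [Z^60], the last one by
    [exponents_le]. A factor [1/Z] survives after paying [Z] for the colours. *)
Lemma power_saving (Z A B X : R) e : 1 <= Z -> (2 <= e < 554)%N -> Z ^+ 60 <= A -> Z ^+ 60 <= B ->
  Z ^+ 1115 <= A * B -> X = Z ^+ (2 * e + 2) ->
  Z / Z ^+ e * Num.sqrt ((2 + X / A) * (2 + X / B)) <= 3 / Z.
Proof.
move=> Z1 /andP[e2 eE] ZA ZB ZAB XE.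
have Z0 : 0 < Z by apply: lt_le_trans Z1.
have A0 : 0 < A by apply: lt_le_trans ZA; rewrite exprn_gt0.
have B0 : 0 < B by apply: lt_le_trans ZB; rewrite exprn_gt0.
have X0 : 0 <= X by rewrite XE exprn_ge0 // ltW.
have Ze : 0 < Z ^+ e by rewrite exprn_gt0.
have mono a b : (a <= b)%N -> Z ^+ a <= Z ^+ b by move=> ab; rewrite ler_weXn2l.
have key : (2 + X / A) * (2 + X / B) <= (3 * Z ^+ e / Z ^+ 2) ^+ 2.
  have Z4 : 0 < Z ^+ 4 by rewrite exprn_gt0.
  have -> : (3 * Z ^+ e / Z ^+ 2) ^+ 2 = 9 * Z ^+ (2 * e) / Z ^+ 4.
    by rewrite mulnC exprM; field; rewrite gt_eqF.
  rewrite ler_pdivlMr //.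
  have -> : (2 + X / A) * (2 + X / B) * Z ^+ 4 =
     4 * Z ^+ 4 + 2 * (X * Z ^+ 4 / A) + 2 * (X * Z ^+ 4 / B) + X ^+ 2 * Z ^+ 4 / (A * B).
    by field; rewrite !gt_eqF.
  have h1 : Z ^+ 4 <= Z ^+ (2 * e) by apply: mono; rewrite (leq_mul2l 2 2 e).
  have h2 Y : 0 < Y -> Z ^+ 60 <= Y -> X * Z ^+ 4 / Y <= Z ^+ (2 * e).
    move=> Y0 ZY; rewrite ler_pdivrMr // XE -exprD.
    apply: le_trans (ler_wpM2l _ ZY); last by rewrite exprn_ge0 // ltW.
    by rewrite -exprD mono // -addnA leq_add2l.
  have h3 : X ^+ 2 * Z ^+ 4 / (A * B) <= Z ^+ (2 * e).
    rewrite ler_pdivrMr ?mulr_gt0 // XE -exprM -exprD.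
    apply: le_trans (ler_wpM2l _ ZAB); last by rewrite exprn_ge0 // ltW.
    by rewrite -exprD mono // exponents_le // e2.
  by have := h2 A A0 ZA; have := h2 B B0 ZB; lra.
have r0 : 0 <= 3 * Z ^+ e / Z ^+ 2 by rewrite divr_ge0 ?mulr_ge0 ?exprn_ge0 // ltW.
apply: (@le_trans _ _ (Z / Z ^+ e * (3 * Z ^+ e / Z ^+ 2))).
  rewrite ler_wpM2l //; first by rewrite divr_ge0 ?exprn_ge0 // ltW.
  by rewrite -[leRHS]ger0_norm // -sqrtr_sqr; apply: ler_wsqrtr.
by rewrite le_eqVlt; apply/orP; left; apply/eqP; field; rewrite !gt_eqF.
Qed.

Section Pair.
Variables (h : 'I_8 -> nat) (i : 'I_8) (b : ('I_8 -> nat) -> R) (t Z : nat).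
Hypotheses (ZE : Z = (2 ^ t)%N) (t0 : (0 < t)%N) (w60 : (60 <= w)%N) (w1 : (1134 <= w)%N) (w1134 : (1134 ^ 554 <= w)%N)
  (sepP : forall p, p \in P -> hsep h p) (ab : anti b) (sb : supp i (Z ^ 277) 1 b)
  (NZ : (N <= Z ^ 60)%N) (WZ : (W * Z ^ 8 <= Z ^ 60)%N) (hZ : (h i <= Z)%N).
Variable m0 : R.
Hypotheses (m00 : 0 < m0)
  (hm0 : m0 <= ssum P (fun m => (\prod_(l <- m) l <= Z ^ 2)%N%:R / (\prod_(l <- m) l)%N%:R)).

Let MB := \prod_(p <- P) (1 + 500 / p%:R ^+ 2) * Cs P (dup i b).

Lemma pair_bound c1 c2 s1 s2 : (60 * t <= s1 < 1299 * t)%N -> (60 * t <= s2 < 1299 * t)%N ->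
  (1115 * t <= s1 + s2)%N ->
  `|\sum_(q <- cls c1 s1) \sum_(q' <- cls c2 s2) lnq q * lnq q' * Lam P b (hcol h (q * q' - h i)) ^+ 2
    - Tp c1 s1 * Tp c2 s2 * Bil (mu_unit R i) P b b| <=
  MB * (1134 / w%:R * Num.sqrt (96 * s1.+1%:R * Tp c1 s1 / (W%:R * m0) * (96 * s2.+1%:R * Tp c2 s2 / (W%:R * m0)))
        + 554 * (24 * (1299 * t)%N%:R ^+ 2 * 3 / Z%:R)).
Proof.
move=> /andP[s1lo s1hi] /andP[s2lo s2hi] slo.
have Z1 : (1 < Z)%N by rewrite ZE -(expn0 2) ltn_exp2l.
have Z0 : (0 < Z)%N by apply: ltnW.
have Zs k s : (k * t <= s)%N -> (Z ^ k <= 2 ^ s)%N by move=> ks; rewrite ZE -expnM mulnC leq_exp2l.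
have N1 : (N <= 2 ^ s1)%N by apply: leq_trans NZ (Zs _ _ s1lo).
have N2 : (N <= 2 ^ s2)%N by apply: leq_trans NZ (Zs _ _ s2lo).
have WZ1 : (W * Z ^ 8 <= 2 ^ s1.+1)%N.
  by apply: leq_trans WZ (leq_trans (Zs _ _ s1lo) _); rewrite leq_exp2l.
have WZ2 : (W * Z ^ 8 <= 2 ^ s2.+1)%N.
  by apply: leq_trans WZ (leq_trans (Zs _ _ s2lo) _); rewrite leq_exp2l.
have w1r : 0 < w%:R :> R by rewrite ltr0n.
have P60 : all (leq 60) P.
  by apply/allP => p /(sprimes_gt Hw) wp; apply: leq_trans w60 (ltnW wp).
have h1134 : 1134 <= w%:R :> R by rewrite ler_nat.
have DZ : (Z ^ 277 * Z ^ 277 <= Z ^ 554)%N by rewrite -expnD.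
have hS q q' : q \in cls c1 s1 -> q' \in cls c2 s2 -> (h i <= q * q')%N.
  rewrite !mem_cls => /and3P[pq _ /andP[lo _]] /and3P[pq' _ _].
  apply: leq_trans hZ (leq_trans _ (leq_pmulr _ (prime_gt0 pq'))); apply: leq_trans lo.
  by rewrite ZE leq_exp2l // (leq_trans _ s1lo) // leq_pmull.
have K8 : #|'I_8| == 8%N by rewrite card_ord.
have dl0 : 0 <= 1134 / w%:R :> R by rewrite divr_ge0.
have hd rho : subseq rho P -> rho != [::] ->
    1134 ^+ size rho <= 1134 / w%:R * (\prod_(l <- rho) l.-1)%N%:R :> R.
  by move=> sr rn; apply: (factor_small w0 Hw) h1134 sr rn.
have hZc rho : subseq rho P -> (\prod_(l <- rho) l < Z ^ 277 * Z ^ 277)%N -> 1134 ^+ size rho <= Z%:R :> R.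
  move=> sr; rewrite -expnD => rD; rewrite -natrX ler_nat.
  exact: (factor_pow Hw _ Z1 w1134 sr rD).
have U1 e : (2 <= e < 554)%N -> _ := fun _ => piece_large c1 e N1 Z0.
have U2 e : (2 <= e < 554)%N -> _ := fun _ => piece_large c2 e N2 Z0.
have PB := piece_bound K8 uP pP P60 sepP ab sb (fun q qs => cls_unitl N1 qs) (fun q qs => cls_unitl N2 qs)
  hS Z1 DZ dl0 hd hZc (piece_small c1 N1 Z0 WZ1 m00 hm0) (piece_small c2 N2 Z0 WZ2 m00 hm0) U1 U2.
apply: (le_trans PB) => {PB U1 U2}; rewrite -/MB.
have MB0 : 0 <= MB.
  rewrite mulr_ge0 //; last first.
    by apply: Cs_ge0 => f; rewrite /dup; case: ab => b0 _; rewrite mulr_ge0.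
  by apply: prodr_ge0 => p _; rewrite addr_ge0 // divr_ge0 // exprn_ge0.
apply: ler_wpM2l => //; rewrite lerD2l.
set Y := 24 * (1299 * t)%N%:R ^+ 2 * 3 / Z%:R.
have Y0 : 0 <= Y by rewrite divr_ge0 ?mulr_ge0 ?exprn_ge0.
apply: (@le_trans _ _ (\sum_(2 <= e < 554) Y)); last first.
  by rewrite sumr_const_nat -[leLHS]mulr_natl ler_wpM2r // ler_nat.
apply: ler_sum_nat => e he.
rewrite /Y; set x := s1.+1%:R; set y := s2.+1%:R; set T := (1299 * t)%N%:R.
have x0 : 0 <= x by []. have y0 : 0 <= y by []. have T0 : 0 <= T :> R by [].
have xT : x <= T :> R by rewrite ler_nat.
have yT : y <= T :> R by rewrite ler_nat.
have ps : Z%:R / Z%:R ^+ e * Num.sqrt ((2 + Z%:R ^+ (2 * e + 2) / (2 ^ s1)%N%:R)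
     * (2 + Z%:R ^+ (2 * e + 2) / (2 ^ s2)%N%:R)) <= 3 / Z%:R :> R.
  apply: power_saving => //; rewrite ?ler1n -?natrX -?natrM ?ler_nat ?Zs //.
  by rewrite -expnD Zs.
rewrite !natrX in ps *.
set u := 2 + _ / 2 ^+ s1 in ps *; set v := 2 + _ / 2 ^+ s2 in ps *.
have u0 : 0 <= u by rewrite addr_ge0 // divr_ge0 ?exprn_ge0.
have v0 : 0 <= v by rewrite addr_ge0 // divr_ge0 ?exprn_ge0.
have -> : 24 * x ^+ 2 * u * (24 * y ^+ 2 * v) = (24 * (x * y)) ^+ 2 * (u * v) by ring.
rewrite sqrtrM ?sqr_ge0 // sqrtr_sqr ger0_norm ?mulr_ge0 //.
rewrite mulrCA -[leRHS]mulrA; apply: ler_pM; rewrite ?mulr_ge0 ?sqrtr_ge0 ?invr_ge0 ?exprn_ge0 //.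
by rewrite ler_wpM2l // expr2 ler_pM.
Qed.

End Pair.
End Pieces.

(* Wraps hypotheses mentioning huge numerals, which [done] would evaluate. *)
Variant hidden (A : Prop) : Prop := Hide of A.
Lemma unhide A : hidden A -> A. Proof. by case. Qed.

Lemma half_le (F : realFieldType) (e : F) : e <= 2^-1 -> 2^-1 <= 1 - e.
Proof. by move=> *; lra. Qed.

Lemma double_le (F : realFieldType) (e : F) : e <= 1 -> 60 * (1 + e) <= 120.
Proof. lra. Qed.

(** Numerically [96 * 1299 * 4 = 498816], rounded up to [500 * 1000]; this determines [C0]. *)
Lemma window_le (F : realFieldType) (s t l : F) : 0 <= l -> s <= 1299 * t -> 2^-1 * t <= l ->
  96 * s <= 500 * 1000 * 2^-1 * l.
Proof. lra. Qed.

(** * The two moments and the contradiction *)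

Section Totals.
Variable R : realType.

Definition offset (j : 'I_8) : nat := nth 0%N [:: 0; 2; 6; 8; 12; 18; 20; 26]%N j.

Lemma offset_le j : (offset j <= 26)%N.
Proof. by case: j => -[|[|[|[|[|[|[|[|[]]]]]]]]]. Qed.

Lemma offset_inj j k : offset j = offset k -> j = k.
Proof.
move=> E; apply: val_inj; move: E; case: j k => [j jp] [k kp]; rewrite /offset /=.
by move: j k jp kp; do 8?[case=> //=]; do 8?[case=> //=].
Qed.

Lemma hsep_offset p : (26 < p)%N -> hsep offset p.
Proof.
move=> p26 j k; rewrite !modn_small; first exact: offset_inj.
  exact: leq_ltn_trans (offset_le k) p26.
exact: leq_ltn_trans (offset_le j) p26.
Qed.

Variables (w W t Z : nat) (eps l phi b lo hi c8 c9 C0 : R) (P : seq nat) (y : ('I_8 -> nat) -> R).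
Hypotheses (w60 : (60 <= w)%N) (w1134 : (1134 <= w)%N)
  (wpow : hidden (1134 ^ 554 <= w)%N)
  (W0 : (0 < W)%N) (Hw : forall p, prime p -> coprime p W -> (w < p)%N) (t0 : (0 < t)%N)
  (ZE : hidden (Z = (2 ^ t)%N)) (lE : hidden (l = ln Z%:R)) (phiE : hidden (phi = (totient W)%:R))
  (bE : hidden (b = phi / W%:R * l)) (PE : hidden (P = sprimes W (Z ^ 60))) (yE : hidden (y = wt R Z 60 270 (K := 'I_8)))
  (loE : hidden (lo = (1 - eps) * b)) (hiE : hidden (hi = (1 + eps) * b))
  (c8E : hidden (c8 = (nat_of_bin count8)%:R)) (c9E : hidden (c9 = (nat_of_bin count9)%:R))
  (C0E : hidden (C0 = 500 * 1000)) (e0 : 0 < eps) (e1 : eps <= 2^-1)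
  (mass : forall k, (k < 60)%N -> lo <= Us P (bin R Z 60 k) <= hi)
  (WZ : hidden ((W * Z ^ 8 <= Z ^ 60)%N)) (hZ : (26 <= Z)%N).

Let w0 : (0 < w)%N. Proof. exact: leq_trans w60. Qed.
Let Z1 : (1 < Z)%N. Proof. by rewrite (unhide ZE) -(expn0 2) ltn_exp2l. Qed.
Let Z0 : (0 < Z)%N. Proof. exact: (ltnW Z1). Qed.

Lemma ell_bounds : 2^-1 * t%:R <= l <= t%:R.
Proof.
have l2 : (2^-1 <= ln 2 :> R) && (ln 2 <= 1 :> R).
  have := @ln_natS_ge R 1 isT; rewrite ln1 subr0.
  by have := @ln_le_sub1 R 2 (ltr0n _ 2) => h1 h2; apply/andP; split; lra.
rewrite (unhide lE) (unhide ZE) natrX lnXn ?ltr0n // -[ln 2 *+ t]mulr_natr; case/andP: l2 => h1 h2.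
by rewrite ler_wpM2r // andTb -[leRHS]mul1r ler_wpM2r.
Qed.

Let l0 : 0 < l.
Proof.
case/andP: ell_bounds => h _; apply: lt_le_trans h.
by rewrite mulr_gt0 ?invr_gt0 ?ltr0n.
Qed.
Let phi0 : 0 < phi. Proof. by rewrite (unhide phiE) ltr0n totient_gt0. Qed.
Let Wr : 0 < W%:R :> R. Proof. by rewrite ltr0n. Qed.
Let b0 : 0 < b. Proof. by rewrite (unhide bE) mulr_gt0 ?divr_gt0. Qed.
Let eps1 : eps <= 1. Proof. by apply: le_trans e1 _; rewrite invf_le1 ?ltr0n // ler1n. Qed.
Let lo0 : 0 <= lo. Proof. by rewrite (unhide loE) mulr_ge0 ?(ltW b0) // subr_ge0. Qed.
Let c9_ge0 : 0 <= c9. Proof. rewrite (unhide c9E); exact: ler0n. Qed.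
Let K8 : #|'I_8| = 8%N. Proof. exact: card_ord. Qed.
Let anti_y : anti y. Proof. by rewrite (unhide yE); exact: anti_wt. Qed.

Let P60 : all (leq 60) P.
Proof. by rewrite (unhide PE); apply/allP => p /(sprimes_gt Hw) wp; apply: leq_trans w60 (ltnW wp). Qed.
Let P1 : all (leq 1) P.
Proof. by apply/allP => p /(allP P60); apply: leq_trans. Qed.
Let sepP p : p \in P -> hsep offset p.
Proof. by move=> /(allP P60) p60; apply: hsep_offset; apply: leq_trans p60. Qed.
Lemma Cs_y_le : Cs P y <= c8 * hi ^+ 8.
Proof.
apply: le_trans (Cs_le_Isum P _) _; first by case: anti_y.
rewrite (unhide c8E) -(count8E R K8) -[in X in _ ^+ X]K8.
by rewrite (unhide yE); apply: Isum_wt_le => // k k60; case/andP: (mass k60).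
Qed.

Section Colour.
Variable i : 'I_8.
Let C9 := Cs P (dup i y).
Let MB := \prod_(p <- P) (1 + 500 / p%:R ^+ 2) * C9.

Let C9_ge0 : 0 <= C9.
Proof. by apply: Cs_ge0 => f; rewrite /dup; case: anti_y => y0 _; rewrite mulr_ge0. Qed.

(** [1000 <= w] keeps the Euler product below 2, and [hi <= 2 * b] turns the 60 levels of each of
    the nine coordinates into 120. *)
Lemma MB_le (B : R) : hidden (B = 1000) -> B <= w%:R -> MB <= 2 * (120 * b) ^+ 9.
Proof.
move=> BE w1000; have w1 : 0 < w%:R :> R by rewrite ltr0n.
have wC : 500 <= w%:R :> R by apply: le_trans w1000; rewrite (unhide BE) ler_nat.
have [_ [h1 h2]] := @prod_sprimes_bounds R w W (Z ^ 60) w0 Hw 500 (ler0n _ 500) wC.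
rewrite -(unhide PE) in h1 h2.
have hw : 500 / w%:R <= 2^-1 :> R.
  by rewrite ler_pdivrMr //; move: (unhide BE) w1000; lra.
have h3 : \prod_(p <- P) (1 + 500 / p%:R ^+ 2) <= 2 :> R.
  have : 0 <= \prod_(p <- P) (1 + 500 / p%:R ^+ 2) :> R by apply: le_trans h2.
  by move: h1; move: (\prod_(p <- P) _) => X; nra.
apply: ler_pM => //; first by apply: le_trans h2.
apply: le_trans (Cs_le_Isum P _) _.
  by move=> f; rewrite /dup; case: anti_y => y0 _; rewrite mulr_ge0.
have h4 : Isum P (dup i y) <= (60%:R * hi) ^+ #|'I_8|.+1.
  by rewrite (unhide yE); apply: Isum_dup_le => // k k60; case/andP: (mass k60).
apply: le_trans h4 _; rewrite K8.
have hi0 : 0 <= hi by rewrite (unhide hiE) mulr_ge0 ?(ltW b0) // addr_ge0 // ltW.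
apply: lerXn2r; rewrite ?nnegrE ?mulr_ge0 ?(ltW b0) //.
rewrite (unhide hiE) mulrA ler_wpM2r ?(ltW b0) //.
exact: double_le.
Qed.

(** [1012 = 512 + 500]: the loss from [Isum] to [Cs] on nine coordinates, with [512 = 2^9], and the
    loss of [Bil_unit_ge]. *)
Lemma Bil_ge (B : R) : hidden (B = 1012) -> B <= eps * w%:R ->
  (1 - eps) * (c9 * lo ^+ 9) <= Bil (mu_unit R i) P y y.
Proof.
move=> BE wbig; have w1 : 0 < w%:R :> R by rewrite ltr0n.
have w1012 : B <= w%:R by apply: le_trans wbig _; rewrite -[leRHS]mul1r ler_wpM2r.
have hI : c9 * lo ^+ 9 <= Isum P (dup i y).
  have -> : 9%N = #|'I_8|.+1 by rewrite K8.
  rewrite (unhide c9E) -(count9E R i K8) (unhide yE).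
  apply: Isum_dup_ge => // k k60; by case/andP: (mass k60).
have h512 : \prod_(p <- P) (1 + 2 ^+ #|{: option 'I_8}| / p%:R ^+ 2) =
    \prod_(p <- P) (1 + 512 / p%:R ^+ 2) :> R.
  by apply: eq_bigr => p _; rewrite card_option K8 -natrX.
have := Isum_le_Cs (anti_dup i anti_y) P1; rewrite h512 => hC.
have wC2 : 512 <= w%:R :> R by apply: le_trans w1012; rewrite (unhide BE) ler_nat.
have wC1 : 500 <= w%:R :> R by apply: le_trans w1012; rewrite (unhide BE) ler_nat.
have [_ [g1 g2]] := @prod_sprimes_bounds R w W (Z ^ 60) w0 Hw 512 (ler0n _ 512)
  wC2.
have [g3 _] := @prod_sprimes_bounds R w W (Z ^ 60) w0 Hw 500 (ler0n _ 500)
  wC1.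
have K8b : #|'I_8| == 8%N by rewrite K8.
have hB := Bil_unit_ge i K8b anti_y P60.
have q1 : 512 / w%:R + 500 / w%:R <= eps.
  by rewrite -mulrDl ler_pdivrMr // -natrD (_ : (512 + 500)%N%:R = B) // (unhide BE).
have q1' : 512 / w%:R <= 1 :> R by rewrite (le_trans _ (le_trans q1 eps1)) // lerDl divr_ge0.
have q1'' : 500 / w%:R <= 1 :> R by rewrite (le_trans _ (le_trans q1 eps1)) // lerDr divr_ge0.
have q2 : 0 <= 512 / w%:R :> R by rewrite divr_ge0.
have q3 : 0 <= 500 / w%:R :> R by rewrite divr_ge0.
apply: le_trans hB; rewrite -/C9 -?(unhide PE) in hC g1 g2 g3 *.
have I0 : 0 <= Isum P (dup i y) by apply: le_trans hI; rewrite mulr_ge0 ?exprn_ge0.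
have s1 : (1 - 512 / w%:R) * Isum P (dup i y) <= C9.
  apply: (@le_trans _ _ ((1 - 512 / w%:R) * (\prod_(p <- P) (1 + 512 / p%:R ^+ 2) * C9))).
    by rewrite ler_wpM2l // subr_ge0.
  by rewrite mulrA -[leRHS]mul1r ler_wpM2r // mulrC.
apply: (@le_trans _ _ ((1 - 500 / w%:R) * C9)); last by rewrite ler_wpM2r.
apply: (@le_trans _ _ ((1 - 500 / w%:R) * ((1 - 512 / w%:R) * Isum P (dup i y)))); last first.
  by rewrite ler_wpM2l // subr_ge0.
rewrite mulrA; apply: ler_pM; rewrite ?subr_ge0 ?mulr_ge0 ?exprn_ge0 //.
by move: (512 / w%:R) (500 / w%:R) q1 q2 q3 => u v q1 q2 q3; nra.
Qed.

Definition Tint a c : R := \sum_(Z ^ a <= q < Z ^ a.+1 | prime q && (q == c %[mod W])) lnq R q.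

Lemma Tint_sum a c : Tint a c = \sum_(a * t <= s < a * t + t) Tp R W c s.
Proof.
rewrite /Tint (unhide ZE) -!expnM mulnS mulnC addnC big_mkcond /= mulnC sum_dyadic.
by apply: eq_bigr => s _; rewrite /Tp big_filter [RHS]big_mkcond.
Qed.

Let dl : R := 1134 / w%:R.
Let f q q' : R := Lam P y (hcol offset (q * q' - offset i)) ^+ 2.
Let Y : R := 554 * (24 * (1299 * t)%N%:R ^+ 2 * 3 / Z%:R).

(** Sums [pair_bound] over the [t^2] pairs of binary blocks. A single block may contain few primes,
    so the square root of the masses is bounded by their product plus [1 / phi^2]; only after
    summation is [t^2 / phi^2] absorbed, being at most 16 times the product of the two [Tint]. Hence
    [33 = 1 + 2 * 16]. *)
Lemma pair_total a a' c c' : (60 <= a)%N -> (60 <= a')%N -> (a < 1299)%N -> (a' < 1299)%N -> (1115 <= a + a')%N ->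
  2^-1 * (l / phi) <= Tint a c -> 2^-1 * (l / phi) <= Tint a' c' ->
  Y <= dl * C0 / phi ^+ 2 ->
  Tint a c * Tint a' c' * (Bil (mu_unit R i) P y y - 33 * C0 * dl * MB) <=
  \sum_(Z ^ a <= q < Z ^ a.+1 | prime q && (q == c %[mod W]))
    \sum_(Z ^ a' <= q' < Z ^ a'.+1 | prime q' && (q' == c' %[mod W])) lnq R q * lnq R q' * f q q'.
Proof.
move=> a60 a60' ah ah' aa' T1lo T2lo hY.
have w1 : 0 < w%:R :> R by rewrite ltr0n.
have MB0 : 0 <= MB.
  by rewrite mulr_ge0 //; apply: prodr_ge0 => p _; rewrite addr_ge0 // divr_ge0 // exprn_ge0.
have dl0 : 0 <= dl by rewrite divr_ge0.
have split2 k d (G : nat -> R) : \sum_(Z ^ k <= q < Z ^ k.+1 | prime q && (q == d %[mod W])) G q =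
    \sum_(k * t <= s < k * t + t) \sum_(q <- cls W d s) G q.
  rewrite (unhide ZE) -!expnM mulnS mulnC addnC big_mkcond /= mulnC sum_dyadic.
  by apply: eq_bigr => s _; rewrite big_filter [RHS]big_mkcond.
rewrite split2.
under eq_bigr => s _ do under eq_bigr => q _ do rewrite split2.
under eq_bigr => s _ do rewrite exchange_big /=.
(* [277 = 270 + 7]: one power of [Z] of rounding for each colour other than [i]. *)
have sb : supp i (Z ^ 277) 1 y.
  move=> g; rewrite (unhide yE) => yg; rewrite mul1n; have := @wt_prod_lt R Z 60 270 Z1 _ i g _ yg.
  by rewrite K8; apply.
pose m0 : R := 2^-1 * b.
have m00 : 0 < m0 by rewrite mulr_gt0 ?invr_gt0 ?ltr0n.
have sepP' : forall p, p \in sprimes W (Z ^ 60) -> hsep offset p by rewrite -(unhide PE).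
have hm0' : m0 <= ssum P (fun m => (\prod_(k <- m) k <= Z ^ 2)%N%:R / (\prod_(k <- m) k)%N%:R).
  have /andP[h _] := mass (isT : 0 < 60)%N.
  apply: (@le_trans _ _ lo).
    rewrite /m0 (unhide loE) ler_wpM2r ?(ltW b0) //.
    exact: half_le.
  apply: le_trans h _; apply: le_ssum => rho _; rewrite ler_wpM2r ?invr_ge0 // ler_nat.
  case: (boolP (_ && _)) => // /andP[_ /eqP lg0].
  have : (trunc_log Z (\prod_(k <- rho) k) < 1)%N by rewrite lg0.
  move=> h'; have := trunc_log_ltn (\prod_(k <- rho) k) Z1; rewrite lg0 => h''.
  by rewrite (leq_trans (ltnW h'')) // leq_exp2l.
have hm0 := hm0'; rewrite (unhide PE) in hm0.
have hsZ : (offset i <= Z)%N by apply: leq_trans (offset_le i) hZ.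
have range k s : (60 <= k)%N -> (k < 1299)%N -> (k * t <= s < k * t + t)%N -> (60 * t <= s < 1299 * t)%N.
  move=> k60 k1299 /andP[s1 s2]; rewrite (leq_trans _ s1) ?leq_mul2r ?k60 ?orbT //=.
  by apply: leq_trans s2 _; rewrite addnC -mulSn leq_mul2r k1299 orbT.
have Wm : W%:R * m0 = 2^-1 * (phi * l) by rewrite /m0 (unhide bE); field; rewrite gt_eqF.
have est s1 s2 : (a * t <= s1 < a * t + t)%N -> (a' * t <= s2 < a' * t + t)%N ->
   Tp R W c s1 * Tp R W c' s2 * Bil (mu_unit R i) P y y
     - MB * (dl * C0 * (Tp R W c s1 * Tp R W c' s2 + phi^-1 ^+ 2) + Y) <=
   \sum_(q <- cls W c s1) \sum_(q' <- cls W c' s2) lnq R q * lnq R q' * f q q'.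
  move=> h1 h2.
  have r1 := range _ _ a60 ah h1; have r2 := range _ _ a60' ah' h2.
  have r3 : (1115 * t <= s1 + s2)%N.
    case/andP: h1 => h1 _; case/andP: h2 => h2 _; apply: leq_trans (leq_add h1 h2).
    by rewrite -mulnDl leq_mul2r aa' orbT.
  have := @pair_bound R w W (Z ^ 60) w0 W0 Hw offset i y t Z (unhide ZE) t0 w60 w1134 (unhide wpow) sepP' anti_y sb
    (leqnn _) (unhide WZ) hsZ m0 m00 hm0 c c' s1 s2 r1 r2 r3.
  rewrite -(unhide PE) -/MB -/Y -/dl ler_norml => /andP[+ _]; rewrite lerBrDr => hle.
  apply: (le_trans _ hle); rewrite [leRHS]addrC lerD2l lerN2 ler_wpM2l // lerD2r -[dl * C0 * _]mulrA ler_wpM2l //.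
  have C00 : 0 <= C0 by rewrite (unhide C0E) mulr_ge0.
  have T1 := Tp_ge0 R W c s1; have T2 := Tp_ge0 R W c' s2.
  set x := Tp R W c s1 in T1 *; set z := Tp R W c' s2 in T2 *.
  have f0 : 0 <= phi^-1 by rewrite invr_ge0 ltW.
  have bd s u : (s < 1299 * t)%N -> 0 <= u -> 96 * s.+1%:R * u / (W%:R * m0) <= C0 * phi^-1 * u.
    move=> hs u0; rewrite Wm mulrAC ler_wpM2r // ler_pdivrMr; last by rewrite !mulr_gt0 ?invr_gt0 ?ltr0n.
    have -> : C0 * phi^-1 * (2^-1 * (phi * l)) = C0 * 2^-1 * l by field; rewrite gt_eqF.
    have hs' : s.+1%:R <= 1299 * t%:R :> R by rewrite -natrM ler_nat.
    case/andP: ell_bounds => hl _; rewrite (unhide C0E).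
    exact: window_le (ltW l0) hs' hl.
  apply: (@le_trans _ _ (Num.sqrt ((C0 * (x * z + phi^-1 ^+ 2)) ^+ 2))); last first.
    by rewrite sqrtr_sqr ger0_norm // mulr_ge0 // addr_ge0 ?exprn_ge0 // mulr_ge0.
  apply: ler_wsqrtr; apply: (@le_trans _ _ ((C0 * phi^-1 * x) * (C0 * phi^-1 * z))).
    have nn s u : 0 <= u -> 0 <= 96 * s.+1%:R * u / (W%:R * m0).
      move=> u0; apply: divr_ge0; last exact: mulr_ge0 (ler0n _ _) (ltW m00).
      by apply: mulr_ge0 u0; apply: mulr_ge0; exact: ler0n.
    by apply: ler_pM; rewrite ?nn ?bd //; [case/andP: r1 | case/andP: r2].
  rewrite exprMn.
  have -> : C0 * phi^-1 * x * (C0 * phi^-1 * z) = C0 ^+ 2 * (x * z * phi^-1 ^+ 2) by ring.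
  rewrite ler_wpM2l ?exprn_ge0 //.
  have xz : 0 <= x * z by rewrite mulr_ge0.
  have p2 : 0 <= phi^-1 ^+ 2 by rewrite exprn_ge0.
  by move: (x * z) (phi^-1 ^+ 2) xz p2 => u v u0 v0; nra.
have tot : \sum_(a * t <= s1 < a * t + t) \sum_(a' * t <= s2 < a' * t + t)
   (Tp R W c s1 * Tp R W c' s2 * Bil (mu_unit R i) P y y
     - MB * (dl * C0 * (Tp R W c s1 * Tp R W c' s2 + phi^-1 ^+ 2) + Y)) <=
   \sum_(a * t <= s1 < a * t + t) \sum_(a' * t <= s2 < a' * t + t)
     \sum_(q <- cls W c s1) \sum_(q' <- cls W c' s2) lnq R q * lnq R q' * f q q'.
  by apply: ler_sum_nat => s1 h1; apply: ler_sum_nat => s2 h2; exact: est.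
apply: le_trans tot.
have cst n (X : R) : X * t%:R = \sum_(n <= s < n + t) X by rewrite sumr_const_nat addKn mulr_natr.
have -> : \sum_(a * t <= s1 < a * t + t) \sum_(a' * t <= s2 < a' * t + t)
   (Tp R W c s1 * Tp R W c' s2 * Bil (mu_unit R i) P y y
     - MB * (dl * C0 * (Tp R W c s1 * Tp R W c' s2 + phi^-1 ^+ 2) + Y)) =
   Tint a c * Tint a' c' * (Bil (mu_unit R i) P y y - MB * (dl * C0))
    - MB * (dl * C0 / phi ^+ 2 + Y) * t%:R ^+ 2.
  transitivity (\sum_(a * t <= s1 < a * t + t) (Tp R W c s1 * Tint a' c' * (Bil (mu_unit R i) P y y - MB * (dl * C0))
      - MB * (dl * C0 / phi ^+ 2 + Y) * t%:R)).
    apply: eq_bigr => s1 _; rewrite [in RHS]Tint_sum mulr_sumr mulr_suml.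
    rewrite (cst (a' * t)%N (MB * (dl * C0 / phi ^+ 2 + Y))) -sumrB.
    by apply: eq_bigr => s2 _; rewrite -exprVn; ring.
  rewrite [in RHS]Tint_sum [t%:R ^+ 2]expr2 [_ * (t%:R * t%:R)]mulrA.
  by rewrite (cst (a * t)%N (MB * (dl * C0 / phi ^+ 2 + Y) * t%:R)) !mulr_suml -sumrB.
move: T1lo T2lo; set x := Tint a c; set z := Tint a' c' => T1lo T2lo.
have lp : 0 <= l / phi by rewrite divr_ge0 ?ltW.
have tl : 2^-1 * (t%:R / phi) <= l / phi.
  by rewrite mulrA ler_wpM2r ?invr_ge0 ?(ltW phi0) //; case/andP: ell_bounds.
have tp0 : 0 <= t%:R / phi by rewrite divr_ge0 ?(ltW phi0).
have xz : (t%:R / phi) ^+ 2 <= 16 * (x * z).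
  have u : 4^-1 * (t%:R / phi) <= x by apply: le_trans T1lo; lra.
  have v : 4^-1 * (t%:R / phi) <= z by apply: le_trans T2lo; lra.
  have r0 : 0 <= 4^-1 * (t%:R / phi) by rewrite mulr_ge0 ?invr_ge0.
  by have := ler_pM r0 r0 u v; rewrite expr2; lra.
have D0 : 0 <= dl * C0 by rewrite mulr_ge0 // (unhide C0E) mulr_ge0.
have g1 : (dl * C0 / phi ^+ 2 + Y) * t%:R ^+ 2 <= 32 * (dl * C0) * (x * z).
  apply: (@le_trans _ _ (2 * (dl * C0) * (t%:R / phi) ^+ 2)).
    rewrite [(t%:R / phi) ^+ 2]exprMn exprVn.
    have -> : 2 * (dl * C0) * (t%:R ^+ 2 / phi ^+ 2) = (2 * (dl * C0 / phi ^+ 2)) * t%:R ^+ 2 by ring.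
    by rewrite ler_wpM2r ?exprn_ge0 //; lra.
  by have := ler_wpM2l D0 xz; lra.
by have := ler_wpM2l MB0 g1; lra.
Qed.

End Colour.
End Totals.

(** * Disjointness of the colours and the total mass *)

Section Detection.
Variable R : realType.

Lemma sum_subseq_le (I : eqType) (s1 s2 : seq I) (F : I -> R) : uniq s1 -> {subset s1 <= s2} ->
  (forall x, 0 <= F x) -> \sum_(x <- s1) F x <= \sum_(x <- s2) F x.
Proof.
move=> + + F0; elim: s1 s2 => [|x s1 IH] s2 /=; first by rewrite big_nil sumr_ge0.
case/andP=> xs us sub; have xs2 : x \in s2 by apply: sub; exact: mem_head.
rewrite big_cons [leRHS](big_rem x xs2) /= lerD2l.
apply: IH => // z zs; have zx : z != x by apply: contraNneq xs => <-.
by have := sub z; rewrite inE zs orbT (perm_mem (perm_to_rem xs2)) inE (negbTE zx); apply.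
Qed.

Definition semiprime (m : nat) : Prop :=
  exists p q : nat, [/\ prime p, prime q, (p < q)%N & m = (p * q)%N].

Lemma semiprime_factor p q r s : prime p -> prime q -> (p < q)%N -> prime r -> prime s -> (r < s)%N ->
  (p * q = r * s)%N -> (p, q) = (r, s).
Proof.
move=> pp pq ltpq pr ps ltrs E; have p0 := prime_gt0 pp.
have : (p %| r * s)%N by rewrite -E dvdn_mulr.
rewrite Euclid_dvdM // !dvdn_prime2 // => /orP[/eqP pE|/eqP pE]; subst p.
  by move/eqP: E; rewrite eqn_pmul2l // => /eqP ->.
move/eqP: E; rewrite mulnC eqn_pmul2r // => /eqP qE; subst q.
by move: (ltn_trans ltpq ltrs); rewrite ltnn.
Qed.

Section Inject.
Variables (Z W N0 nu : nat) (G : nat -> R).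
Hypotheses (Z26 : (26 <= Z)%N) (G0 : forall n, 0 <= G n) (N0Z : hidden (N0 <= Z ^ 1114)%N)
  (iso : forall n i j, (N0 <= n)%N -> semiprime (n + offset i) -> semiprime (n + offset j) -> i = j).
Notation lg := (trunc_log Z).

Definition inner (i : 'I_8) (q : nat) : seq nat :=
  [seq q' <- index_iota (Z ^ lowb (lg q)) (Z ^ (1293 - lg q)) |
    prime q' && (q * q' == nu + offset i %[mod W])].
Definition outer : seq nat := [seq q <- index_iota (Z ^ 60) (Z ^ 646) | prime q].

Lemma pow_window (a l u q q' : nat) : (1 < Z)%N -> (a < l)%N -> (1115 <= a + l)%N -> (u <= 1293 - a)%N -> (a <= 1293)%N ->
  (Z ^ a <= q < Z ^ a.+1)%N -> (Z ^ l <= q' < Z ^ u)%N ->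
  [/\ (q < q')%N, (Z ^ 1115 <= q * q')%N & (q * q' < Z ^ 1294)%N].
Proof.
move=> Z1 al bl ua a1 /andP[q1 q2] /andP[q3 q4]; split.
- by apply: leq_trans q2 (leq_trans _ q3); rewrite leq_exp2l.
- by apply: leq_trans (leq_mul q1 q3); rewrite -expnD leq_exp2l.
- apply: leq_trans (_ : (q.+1 * q'.+1 <= _)%N); last first.
    by apply: leq_trans (leq_mul q2 q4) _; rewrite -expnD leq_exp2l // addSn ltnS
      (leq_trans (leq_add (leqnn a) ua)) ?subnKC.
  by rewrite mulSn addSn ltnS (leq_trans _ (leq_addl _ _)) // leq_mul2l leqnSn orbT.
Qed.

(** Subtracting a shift costs at most one level, which is why [n] starts at [Z^1114] and [q q'] at
    [Z^1115]. *)
Lemma offset_window m h : (h <= 26)%N -> (Z ^ 1115 <= m)%N -> (Z ^ 1114 <= m - h)%N.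
Proof.
move=> h26 hm; rewrite leq_subRL; last first.
  apply: leq_trans h26 (leq_trans Z26 (leq_trans _ hm)).
  by rewrite -[leqLHS]expn1 leq_pexp2l // (leq_trans _ Z26).
apply: leq_trans hm; rewrite expnS; apply: leq_trans (_ : 26 * Z ^ 1114 <= _)%N; last by rewrite leq_mul2r Z26 orbT.
apply: leq_trans (leq_add h26 (leqnn _)) _; rewrite (mulSn 25) addnC leq_add2l.
have g : (26 <= Z ^ 1114)%N.
  by apply: leq_trans Z26 _; rewrite -[leqLHS]expn1 leq_pexp2l // (leq_trans _ Z26).
by apply: leq_trans g _; rewrite leq_pmull.
Qed.

Lemma inner_outerP i q q' : q \in outer -> q' \in inner i q ->
  [/\ prime q, prime q', (q < q')%N & [/\ (offset i <= q * q')%N, (Z ^ 1114 <= q * q' - offset i)%N,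
     (q * q' < Z ^ 1294)%N & (q * q' - offset i == nu %[mod W])%N]].
Proof.
have Z1 : (1 < Z)%N by apply: leq_trans Z26.
rewrite mem_filter mem_index_iota => /and3P[pq q1 q2].
rewrite mem_filter mem_index_iota => /andP[/andP[pq' qc] q'b].
have qb := trunc_log_bounds Z1 (prime_gt0 pq).
set a := lg q in qb q'b.
have a646 : (a < 646)%N by case/andP: qb => qb _; have := leq_ltn_trans qb q2; rewrite ltn_exp2l.
have b1 : (a < lowb a)%N by rewrite leq_maxl.
have b2 : (1115 <= a + lowb a)%N by rewrite -leq_subLR leq_maxr.
have a1293 : (a <= 1293)%N by apply: leq_trans (ltnW a646) _.
have [h1 h2 h3] := pow_window Z1 b1 b2 (leqnn _) a1293 qb q'b.
have h4 : (offset i <= q * q')%N.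
  apply: leq_trans (offset_le i) (leq_trans Z26 (leq_trans _ h2)).
  by rewrite -[leqLHS]expn1 leq_pexp2l // ltnW.
do 2?split => //; first exact: offset_window (offset_le i) h2.
by rewrite -(eqn_modDr (offset i)) subnK.
Qed.

(** The map from [(i, q, q')] to [q q' - h_i] is injective: two preimages of one [n] make [n + h_i]
    and [n + h_j] semiprime, so [iso] gives [i = j], and then the factorisation is unique. *)
Lemma sum_pairs_le :
  \sum_(i : 'I_8) \sum_(q <- outer) \sum_(q' <- inner i q) G (q * q' - offset i) <=
  \sum_(Z ^ 1114 <= n < Z ^ 1294 | (n == nu %[mod W])%N) G n.
Proof.
pose T1 := [seq (i, q) | i <- enum 'I_8, q <- outer].
pose T := [seq (x, q') | x <- T1, q' <- inner x.1 x.2].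
pose tau (x : ('I_8 * nat) * nat) := (x.1.2 * x.2 - offset x.1.1)%N.
have E : \sum_(i : 'I_8) \sum_(q <- outer) \sum_(q' <- inner i q) G (q * q' - offset i) =
    \sum_(x <- T) G (tau x).
  rewrite /T big_allpairs_dep /= /T1 big_allpairs /= big_enum /=.
  by apply: eq_bigr => i _; apply: eq_bigr => q _.
have memT x : x \in T -> x.1.2 \in outer /\ x.2 \in inner x.1.1 x.1.2.
  case/allpairsPdep=> y [z [/allpairsP[[i q] [/= _ qo ->]] zi ->]]; by split.
have uT1 : uniq T1 by apply: allpairs_uniq; rewrite ?enum_uniq ?filter_uniq ?iota_uniq // => -[? ?] [? ?].
have uT : uniq T.
  apply: allpairs_uniq_dep => // [x _|]; first by rewrite filter_uniq ?iota_uniq.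
  by move=> [x1 y1] [x2 y2] _ _ /= [-> ->].
rewrite E -(big_map tau xpredT) -[leRHS]big_filter; apply: sum_subseq_le => //.
  rewrite map_inj_in_uniq // => x y xT yT; rewrite /tau.
  case: x xT => [[i q] q'] /memT /= [qo qi]; case: y yT => [[j r] r'] /memT /= [ro ri].
  have [pq pq' lq [h1 h2 h3 h4]] := inner_outerP qo qi.
  have [pr pr' lr [g1 g2 g3 g4]] := inner_outerP ro ri.
  move=> En; have ij : i = j.
    apply: (iso (n := q * q' - offset i)); first exact: leq_trans (unhide N0Z) h2.
      by rewrite subnK //; exists q, q'.
    by rewrite En subnK //; exists r, r'.
  subst j; have : (q * q' = r * r')%N by rewrite -(subnK h1) -(subnK g1) En.
  by move/(semiprime_factor pq pq' lq pr pr' lr) => [-> ->].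
move=> n /mapP[[[i q] q'] /memT /= [qo qi] ->].
have [_ _ _ [h1 h2 h3 h4]] := inner_outerP qo qi.
by rewrite mem_filter h4 mem_index_iota h2 /= (leq_ltn_trans (leq_subr _ _) h3).
Qed.

End Inject.

(** [Lam_class_sum] with weight [1/n], whose sum over a class modulo [s] is [(1294 - 1114) ln Z / s]
    up to [Z^-1114]. The error is multiplied by the square of [absum P y], at most [Z^556 * C]. *)
Lemma sieve_sum_le (w W Z nu : nat) (l C : R) (P : seq nat) (y : ('I_8 -> nat) -> R) :
  (60 <= w)%N -> (0 < W)%N -> (forall p, prime p -> coprime p W -> (w < p)%N) -> (1 < Z)%N ->
  hidden (l = ln Z%:R) -> hidden (P = sprimes W (Z ^ 60)) ->
  hidden (y = wt R Z 60 270 (K := 'I_8)) -> Cs P y <= C ->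
  \sum_(Z ^ 1114 <= n < Z ^ 1294 | (n == nu %[mod W])%N) n%:R^-1 * Lam P y (hcol offset n) ^+ 2 <=
  180 * l / W%:R * C + (Z ^ 1114)%N%:R^-1 * ((Z ^ 278)%N%:R ^+ 2 * C) ^+ 2.
Proof.
move=> w60 W0 Hw Z1 [lE] [PE] [yE] hC.
have Z0 : (0 < Z)%N by apply: ltnW.
have pP : all prime P by rewrite PE prime_sprimes.
have P60 p : p \in P -> (60 <= p)%N by rewrite PE => /(sprimes_gt Hw) wp; apply: leq_trans w60 (ltnW wp).
have y0 f : 0 <= y f by rewrite yE; case: (anti_wt R Z 60 270 'I_8).
have C1 : 0 <= Cs P y by apply: Cs_ge0.
have cs s a : (0 < s)%N -> `|\sum_(n <- index_iota (Z ^ 1114) (Z ^ 1294) | (n == a %[mod s])%N) n%:R^-1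
    - 180 * l / s%:R| <= (Z ^ 1114)%N%:R^-1 :> R.
  move=> s0; have h : (Z ^ 1114 <= Z ^ 1294)%N by rewrite leq_exp2l.
  have A0 : (0 < Z ^ 1114)%N by rewrite expn_gt0 Z0.
  have -> : 180 * l = ln (Z ^ 1294)%N%:R - ln (Z ^ 1114)%N%:R.
    rewrite !natrX !lnXn ?ltr0n // -lE -mulrnBr // [RHS](_ : _ = l *+ 180) //.
    by rewrite mulr_natl.
  exact: harmonic_progression.
have cop : all (coprime W) P.
  by rewrite PE; apply/allP => p; rewrite mem_sprimes coprime_sym => /and3P[].
have sep p : p \in P -> hsep offset p by move=> /P60 p60; apply: hsep_offset; apply: leq_trans p60.
have good s p : p \in P -> (0 < s)%N -> (0 < s * p)%N.
  by move=> /P60 p60 s0; rewrite muln_gt0 s0 (leq_trans _ p60).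
have uP : uniq P by rewrite PE uniq_sprimes.
have := @Lam_class_sum R _ offset _ _ _ _ (fun s => (0 < s)%N) cs P y y W nu uP pP cop sep W0 (fun p s pp s0 => good s p pp s0).
rewrite ler_norml => /andP[_]; rewrite lerBlDr => h.
have h2 : 180 * l / W%:R * Bil (mu_all R (K := 'I_8)) P y y <= 180 * l / W%:R * C.
  have l0 : 0 <= l by rewrite lE ln_ge0 // ler1n.
  apply: ler_wpM2l; first by apply: divr_ge0; [apply: mulr_ge0 | apply: ler0n].
  apply: le_trans hC; have -> : Cs P y = Cs P (fun f => y f ^+ 2).
    by congr Cs; apply/boolp.funext => f; rewrite yE wt_sqr.
  apply: Bil_all_le; apply/allP => p /P60 p60; first exact: leq_trans p60.
  by rewrite card_ord (leq_trans _ p60).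
have h3 : absum P y <= (Z ^ 278)%N%:R ^+ 2 * C.
  have := @absum_le_Cs R 'I_8 P y 1 (Z ^ 278) isT.
  rewrite expr1n mul1r => hh; apply: le_trans (hh _ _ _) _ => //.
  - by apply/allP => p /P60 p60; apply: leq_trans p60.
  - move=> f; rewrite yE => /(wt_prod_le Z1); by rewrite card_ord mul1n.
  - by rewrite ler_wpM2l // exprn_ge0.
have h4 : 0 <= absum P y.
  apply: le_trans (_ : 0 <= 0) _ => //.
  exact: absum_ge0.
have h5 : (Z ^ 1114)%N%:R^-1 * (absum P y * absum P y) <= (Z ^ 1114)%N%:R^-1 * ((Z ^ 278)%N%:R ^+ 2 * C) ^+ 2.
  by rewrite expr2; apply: ler_wpM2l; [rewrite invr_ge0 | apply: ler_pM].
have := le_trans h (lerD h5 h2); rewrite [leRHS]addrC; apply: le_trans.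
by apply: ler_sum => n _; rewrite expr2.
Qed.

End Detection.

(** * The lower bound from products of two primes *)

Section Decomposition.
Variable R : realType.

Lemma sum_powers (Z : nat) (F : nat -> R) (a b : nat) : (0 < Z)%N ->
  \sum_(Z ^ a <= q < Z ^ b) F q = \sum_(a <= s < b) \sum_(Z ^ s <= q < Z ^ s.+1) F q.
Proof.
move=> Z0; have mono m n : (m <= n)%N -> (Z ^ m <= Z ^ n)%N by move=> ?; rewrite leq_pexp2l.
have [ba|/ltnW ab] := leqP b a; first by rewrite !big_geq // mono.
rewrite -(subnKC ab); elim: (b - a)%N => [|n IH]; first by rewrite addn0 !big_geq.
by rewrite addnS big_nat_recr ?leq_addr //= -IH -big_cat_nat //= mono ?leq_addr.
Qed.

Lemma sum_classes_le (W : nat) (s : seq nat) (F : nat -> R) : (0 < W)%N -> (forall q, 0 <= F q) ->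
  \sum_(c < W | coprime c W) \sum_(q <- s | prime q && (q == c %[mod W])) F q <= \sum_(q <- s | prime q) F q.
Proof.
move=> W0 F0; rewrite (exchange_big_dep prime) /=; last by move=> c q _ /andP[].
apply: ler_sum => q pq; pose c0 := Ordinal (ltn_pmod q W0).
rewrite big_mkcond (bigD1 c0) //= big1 => [|c cc0].
  by rewrite addr0; case: ifP.
case: ifP => // /and3P[_ _ /eqP E]; case/eqP: cc0.
by apply: val_inj; rewrite /= E modn_small.
Qed.

Lemma sum_coprime_const (W : nat) (X : R) : \sum_(c < W | coprime c W) X = (totient W)%:R * X.
Proof.
rewrite totient_count_coprime big_mkord natr_sum mulr_suml big_mkcond /=.
by apply: eq_bigr => c _; rewrite coprime_sym; case: coprime; rewrite ?mul1r ?mul0r.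
Qed.

Lemma lnq_le (Z a q : nat) (l : R) : (0 < Z)%N -> l = ln Z%:R -> prime q -> (q < Z ^ a.+1)%N ->
  0 <= lnq R q <= a.+1%:R * l / q%:R.
Proof.
move=> Z0 lE pq qZ; have q0 := prime_gt0 pq.
rewrite divr_ge0 ?ln_ge0 ?ler1n //= ler_wpM2r ?invr_ge0 //.
apply: (@le_trans _ _ (ln (Z ^ a.+1)%N%:R)).
  by rewrite ler_ln ?posrE ?ltr0n ?expn_gt0 ?Z0 // ler_nat ltnW.
by rewrite natrX lnXn ?ltr0n // -lE mulr_natl.
Qed.

Lemma lnq_prod_le (Z a b q q' h : nat) (l : R) : (0 < Z)%N -> l = ln Z%:R -> 0 < l ->
  prime q -> prime q' -> (q < Z ^ a.+1)%N -> (q' < Z ^ b.+1)%N -> (h < q * q')%N ->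
  (a.+1%:R * b.+1%:R)^-1 * (lnq R q * lnq R q') <= l ^+ 2 * (q * q' - h)%N%:R^-1.
Proof.
move=> Z0 lE l0 pq pq' qZ qZ' hq; have q0 := prime_gt0 pq; have q0' := prime_gt0 pq'.
have /andP[u0 u1] := lnq_le Z0 lE pq qZ; have /andP[v0 v1] := lnq_le Z0 lE pq' qZ'.
have ab : 0 < a.+1%:R * b.+1%:R :> R by rewrite mulr_gt0.
rewrite ler_pdivrMl //; apply: le_trans (ler_pM u0 v0 u1 v1) _.
have -> : a.+1%:R * l / q%:R * (b.+1%:R * l / q'%:R) = a.+1%:R * b.+1%:R * (l ^+ 2 * (q * q')%N%:R^-1) :> R.
  by rewrite natrM; field; rewrite !pnatr_eq0 -!lt0n q0 q0'.
rewrite ler_wpM2l ?(ltW ab) // ler_wpM2l ?exprn_ge0 ?(ltW l0) //.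
by rewrite lef_pV2 ?posrE ?ltr0n ?subn_gt0 ?muln_gt0 ?q0 // ler_nat leq_subr.
Qed.

Section Lower.
Variables (Z W nu : nat) (l : R) (P : seq nat) (y : ('I_8 -> nat) -> R) (i : 'I_8).
Hypotheses (Z26 : (26 <= Z)%N) (W1 : (1 < W)%N) (lE : hidden (l = ln Z%:R)) (l0 : 0 < l).
Notation lg := (trunc_log Z).
Let Z1 : (1 < Z)%N. Proof. exact: leq_trans Z26. Qed.
Let Z0 : (0 < Z)%N. Proof. exact: (ltnW Z1). Qed.
Let f q q' : R := Lam P y (hcol offset (q * q' - offset i)) ^+ 2.
Let G (n : nat) : R := n%:R^-1 * Lam P y (hcol offset n) ^+ 2.
Let f0 q q' : 0 <= f q q'. Proof. exact: sqr_ge0. Qed.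
Let G0 n : 0 <= G n. Proof. by rewrite mulr_ge0 ?invr_ge0 ?sqr_ge0. Qed.

(** The class of [(nu + h_i) / c] modulo [W]: the Chinese remainder theorem provides a multiple of
    [c] congruent to [nu + h_i], which is then divided by [c]. *)
Definition cofactor_class c := (chinese W c (nu + offset i) 0 %/ c %% W)%N.
Definition pair_sum a b c c' : R :=
  \sum_(Z ^ a <= q < Z ^ a.+1 | prime q && (q == c %[mod W]))
    \sum_(Z ^ b <= q' < Z ^ b.+1 | prime q' && (q' == c' %[mod W])) lnq R q * lnq R q' * f q q'.

Lemma cofactor_classP c : coprime c W -> (c * cofactor_class c = nu + offset i %[mod W])%N.
Proof.
move=> cW; have Wc : coprime W c by rewrite coprime_sym.
rewrite modnMmr mulnC divnK ?chinese_modl //.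
have := chinese_modr Wc (nu + offset i) 0; rewrite mod0n => /eqP //.
Qed.

Lemma coprime_cofactor_class c : coprime (nu + offset i) W -> coprime c W -> coprime (cofactor_class c) W.
Proof.
move=> nW cW; have : coprime (c * cofactor_class c) W.
  by rewrite -coprime_modl cofactor_classP // coprime_modl.
by rewrite coprimeMl => /andP[].
Qed.

Lemma inner_ge a c q : (60 <= a)%N -> coprime c W -> prime q -> (q == c %[mod W])%N -> (Z ^ a <= q < Z ^ a.+1)%N ->
  \sum_(lowb a <= b < 1293 - a) (a.+1%:R * b.+1%:R)^-1 *
    \sum_(Z ^ b <= q' < Z ^ b.+1 | prime q' && (q' == cofactor_class c %[mod W])) lnq R q * lnq R q' * f q q'
  <= l ^+ 2 * \sum_(q' <- inner Z W nu i q) G (q * q' - offset i).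
Proof.
move=> a60 cW pq qc qa; have lgq : lg q = a by apply: trunc_log_eq.
have qZ : (26 <= q)%N.
  case/andP: qa => qa _; apply: leq_trans Z26 (leq_trans _ qa).
  by rewrite -[leqLHS]expn1 leq_pexp2l // (leq_trans _ a60).
rewrite /inner lgq big_filter [X in _ <= _ * X]big_mkcond /= sum_powers // mulr_sumr.
apply: ler_sum => b _.
rewrite !mulr_sumr big_mkcond /=; apply: ler_sum_nat => q' /andP[_ q'b].
case: ifP => [/andP[pq' qc']|_]; last by case: ifP; rewrite ?mulr0 // => _; rewrite mulr_ge0 ?exprn_ge0 ?(ltW l0).
have -> : prime q' && (q * q' == nu + offset i %[mod W])%N.
  rewrite pq' /= -(eqP (introT eqP (cofactor_classP cW))) -modnMm (eqP qc) (eqP qc') modnMm //.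
rewrite /G /f [X in X <= _]mulrA [X in _ <= X]mulrA; apply: ler_wpM2r; first exact: sqr_ge0.
apply: (lnq_prod_le Z0 (unhide lE) l0) => //; first by case/andP: qa.
apply: leq_ltn_trans (offset_le i) _; apply: leq_trans (_ : q * 2 <= _)%N; last first.
  by rewrite leq_mul2l prime_gt1 ?orbT.
by rewrite muln2 -addnn; apply: leq_trans (leq_add qZ qZ).
Qed.

(** The class [c] of [q] runs over the units modulo [W] and determines that of [q'], hence one
    totient factor. The factors [1 / ((a + 1) (b + 1))] from replacing [1 / (q q' - h_i)] by
    logarithmic weights collect into [harm_sum]. *)
Lemma outer_ge (X : R) :
  (forall a b c, (60 <= a < 646)%N -> (lowb a <= b < 1293 - a)%N -> coprime c W -> X <= pair_sum a b c (cofactor_class c)) ->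
  harm_sum R * (totient W)%:R * X <=
  l ^+ 2 * \sum_(q <- outer Z) \sum_(q' <- inner Z W nu i q) G (q * q' - offset i).
Proof.
move=> HX; rewrite /outer big_filter big_mkcond /= sum_powers // mulr_sumr.
rewrite /harm_sum -mulrA mulr_suml; apply: ler_sum_nat => a ha; rewrite -big_mkcond /=.
have W0 : (0 < W)%N by apply: ltnW.
apply: (@le_trans _ _ (\sum_(lowb a <= b < 1293 - a) \sum_(c < W | coprime c W)
   (a.+1%:R * b.+1%:R)^-1 * pair_sum a b c (cofactor_class c))).
  rewrite mulr_suml; apply: ler_sum_nat => b hb.
  rewrite -sum_coprime_const mulr_sumr; apply: ler_sum => c cW.
  by apply: ler_wpM2l; [rewrite invr_ge0 mulr_ge0 | apply: HX].
rewrite exchange_big /= mulr_sumr.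
have L0 q : 0 <= l ^+ 2 * \sum_(q' <- inner Z W nu i q) G (q * q' - offset i).
  by rewrite mulr_ge0 ?exprn_ge0 ?(ltW l0) // sumr_ge0.
apply: le_trans (sum_classes_le _ W0 L0).
apply: ler_sum => c cW; rewrite /pair_sum.
under eq_bigr do rewrite mulr_sumr.
rewrite exchange_big /= big_nat_cond [leRHS]big_nat_cond; apply: ler_sum => q /andP[qa /andP[pq qc]].
by apply: inner_ge => //; case/andP: ha.
Qed.

End Lower.
End Decomposition.

(** Bernoulli's inequality reduces the powers of [1 - e] and [1 + e] to the factors [1 - 13 e] and
    [1 - 9 e]; with [e <= 1/1000] these cannot use up the margin of 21 to 20. *)
Lemma final_numeric (F : realFieldType) (e x h : F) : 0 < h -> 21 * 180 * x <= 160 * h ->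
  0 < e -> 1000 * e <= 1 -> 8 * h * ((1 - e) ^+ 2 * ((1 - e) ^+ 10 - e)) <= 180 * x * (1 + e) ^+ 9 -> False.
Proof.
move=> h0 hx e0 e1 hle.
have d0 : 0 <= 1 - e by lra.
have d1 : 1 - e <= 1 by lra.
have bern (n : nat) (z : F) : 0 <= z -> z <= 1 -> 1 - n%:R * (1 - z) <= z ^+ n.
  move=> z0 z1; elim: n => [|n IH]; first by rewrite expr0 mul0r subr0.
  have := ler_wpM2l z0 IH; rewrite exprS -natr1; have : 0 <= n%:R * (1 - z) ^+ 2 :> F by rewrite mulr_ge0 ?sqr_ge0.
  by rewrite expr2; move: (z ^+ n) (n%:R : F) => u v; lra.
have A1 : 1 - 13 * e <= (1 - e) ^+ 2 * ((1 - e) ^+ 10 - e).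
  rewrite mulrBr -exprD; have := bern 12 _ d0 d1.
  have : (1 - e) ^+ 2 * e <= 1 * e by rewrite ler_wpM2r ?(ltW e0) // exprn_ile1.
  by rewrite [(2 + 10)%N]/=; move: ((1 - e) ^+ 12) ((1 - e) ^+ 2 * e) => u v; lra.
have B1 : (1 + e) ^+ 9 * (1 - 9 * e) <= 1.
  have := bern 9 _ d0 d1 => hb.
  have B0 : 0 <= (1 + e) ^+ 9 by rewrite exprn_ge0 // addr_ge0 // ltW.
  have hb' : 1 - 9 * e <= (1 - e) ^+ 9 by move: hb; move: ((1 - e) ^+ 9) => u; lra.
  apply: le_trans (ler_wpM2l B0 hb') _; rewrite -exprMn exprn_ile1 //; nra.
move: A1 B1 hle; set A := (1 - e) ^+ 2 * ((1 - e) ^+ 10 - e); set B := (1 + e) ^+ 9 => A1 B1 hle.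
have B0 : 0 <= B by rewrite exprn_ge0 // addr_ge0 // ltW.
clearbody A B; have s1 : 160 * h * (21 * A) <= 160 * h * (20 * B).
  by have t1 := ler_wpM2r B0 hx; lra.
have {s1} s1 : 21 * A <= 20 * B by move: s1; rewrite ler_pM2l // mulr_gt0.
have s2 : 21 * (1 - 13 * e) * (1 - 9 * e) <= 20.
  have nine : 0 <= 1 - 9 * e by lra.
  have := ler_wpM2r nine (_ : 21 * (1 - 13 * e) <= 20 * B); move=> /(_ _)/le_trans; apply; last by lra.
  by lra.
by nra.
Qed.

Lemma nat_of_bin_neq0 n : n <> BinNums.N0 -> (0 < nat_of_bin n)%N.
Proof. by case: n => // p _; exact: nat_of_bin_gt0. Qed.

(** * Assembling the contradiction *)

Section Contradiction.
Variable R : realType.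
Variables (w W t Z nu N0 : nat) (eps l phi b lo hi c8 c9 C0 B1 B2 : R) (P : seq nat) (y : ('I_8 -> nat) -> R).
Hypotheses (w60 : (60 <= w)%N) (w1134 : (1134 <= w)%N)
  (wpow : hidden (1134 ^ 554 <= w)%N)
  (W1 : (1 < W)%N) (Hw : forall p, prime p -> coprime p W -> (w < p)%N) (t0 : (0 < t)%N)
  (ZE : hidden (Z = (2 ^ t)%N)) (lE : hidden (l = ln Z%:R)) (phiE : hidden (phi = (totient W)%:R))
  (bE : hidden (b = phi / W%:R * l)) (PE : hidden (P = sprimes W (Z ^ 60)))
  (yE : hidden (y = wt R Z 60 270 (K := 'I_8)))
  (loE : hidden (lo = (1 - eps) * b)) (hiE : hidden (hi = (1 + eps) * b))
  (c8E : hidden (c8 = (nat_of_bin count8)%:R)) (c9E : hidden (c9 = (nat_of_bin count9)%:R))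
  (C0E : hidden (C0 = 500 * 1000)) (e0 : 0 < eps) (e1 : eps <= 2^-1)
  (mass : forall k, (k < 60)%N -> lo <= Us P (bin R Z 60 k) <= hi)
  (WZ : hidden (W * Z ^ 8 <= Z ^ 60)%N) (hZ : (26 <= Z)%N)
  (nuW : forall i, coprime (nu + offset i) W) (N0Z : hidden (N0 <= Z ^ 1114)%N)
  (iso : forall n i j, (N0 <= n)%N -> semiprime (n + offset i) -> semiprime (n + offset j) -> i = j)
  (tint : forall a c, (60 <= a)%N -> coprime c W -> (1 - eps) * (l / phi) <= Tint R W Z a c)
  (hY : 554 * (24 * (1299 * t)%N%:R ^+ 2 * 3 / Z%:R) <= 1134 / w%:R * C0 / phi ^+ 2)
  (B1E : hidden (B1 = 1000)) (hB1 : B1 <= w%:R) (B2E : hidden (B2 = 1012)) (hB2 : B2 <= eps * w%:R)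
  (hbig : 33 * C0 * 1134 * (2 * 120 ^+ 9) <= eps * w%:R) (c9_ge1 : 1 <= c9)
  (hlast : Z%:R ^- 2 * (c8 * hi ^+ 8) <= eps * (180 * l / W%:R)).

Let W0 : (0 < W)%N. Proof. exact: ltnW. Qed.
Let Z1 : (1 < Z)%N. Proof. exact: leq_trans hZ. Qed.
Let phi0 : 0 < phi. Proof. by rewrite (unhide phiE) ltr0n totient_gt0. Qed.
Let Wr : 0 < W%:R :> R. Proof. by rewrite ltr0n. Qed.
Let l0 : 0 < l. Proof. by rewrite (unhide lE) ln_gt0 // ltr1n. Qed.
Let b0 : 0 < b. Proof. by rewrite (unhide bE) mulr_gt0 ?divr_gt0. Qed.
Let eps1 : 0 <= 1 - eps.
Proof. by rewrite subr_ge0; apply: le_trans e1 _; rewrite invf_le1 ?ltr0n // ler1n. Qed.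

Let E := c9 * b ^+ 9 * ((1 - eps) ^+ 10 - eps).

(** The exponent 10 is one factor [1 - eps] from [Bil_ge] and nine from [lo^9]; the remaining
    [- eps] pays for the equidistribution error, which is small because [eps * w] is large. *)
Lemma main_term_ge i : E <= Bil (mu_unit R i) P y y -
  33 * C0 * (1134 / w%:R) * (\prod_(p <- P) (1 + 500 / p%:R ^+ 2) * Cs P (dup i y)).
Proof.
have hBil := Bil_ge w60 W0 Hw t0 ZE lE phiE bE PE yE loE c9E e1 mass i B2E hB2.
have hMB := MB_le w60 W0 Hw t0 ZE lE phiE bE PE yE hiE e0 e1 mass i B1E hB1.
set MB := (\prod_(p <- P) _ * _) in hMB *.
have w1 : 0 < w%:R :> R by rewrite ltr0n (leq_trans _ w60).
have C00 : 0 <= C0 by rewrite (unhide C0E) mulr_ge0 ?ler0n.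
have k0 : 0 <= 33 * C0 * (1134 / w%:R) by rewrite !mulr_ge0 ?invr_ge0 ?ler0n.
have hm : 33 * C0 * (1134 / w%:R) * MB <= eps * (c9 * b ^+ 9).
  apply: le_trans (ler_wpM2l k0 hMB) _.
  have b9 : 0 <= b ^+ 9 by rewrite exprn_ge0 // ltW.
  have -> : 33 * C0 * (1134 / w%:R) * (2 * (120 * b) ^+ 9) = (33 * C0 * 1134 * (2 * 120 ^+ 9)) / w%:R * b ^+ 9.
    by rewrite exprMn; move: (120 ^+ 9 : R) (b ^+ 9) => u v; field; rewrite gt_eqF.
  apply: (@le_trans _ _ (eps * b ^+ 9)); first by rewrite ler_wpM2r // ler_pdivrMr.
  by rewrite ler_wpM2l ?(ltW e0) // -[leLHS]mul1r ler_wpM2r.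
apply: le_trans (lerB hBil hm); rewrite (unhide loE) /E.
by rewrite exprMn [(1 - eps) ^+ 10]exprS; move: ((1 - eps) ^+ 9) (b ^+ 9) => u v; rewrite le_eqVlt; apply/orP; left; apply/eqP; ring.
Qed.

Lemma second_moment_le : \sum_(Z ^ 1114 <= n < Z ^ 1294 | (n == nu %[mod W])%N) n%:R^-1 * Lam P y (hcol offset n) ^+ 2 <=
  (1 + eps) * (180 * l / W%:R) * (c8 * hi ^+ 8).
Proof.
have hC := Cs_y_le t0 ZE yE c8E mass.
apply: le_trans (sieve_sum_le nu w60 W0 Hw Z1 lE PE yE hC) _.
have hl := hlast; set C := c8 * hi ^+ 8 in hl *; have Zr : 0 < Z%:R :> R by rewrite ltr0n (ltnW Z1).
have C00 : 0 <= C.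
  rewrite mulr_ge0 //; first by rewrite (unhide c8E) ler0n.
  by rewrite exprn_ge0 // (unhide hiE) mulr_ge0 ?(ltW b0) // addr_ge0 // ltW.
(* [4 * 278 = 1112], two levels below 1114: the start of the range of [n] is tied to the size of the
   support. *)
have -> : (Z ^ 1114)%N%:R^-1 * ((Z ^ 278)%N%:R ^+ 2 * C) ^+ 2 = Z%:R ^- 2 * C * C.
  rewrite !natrX (_ : 1114 = 278 * 2 * 2 + 2)%N // exprD !exprM.
  by move: (Z%:R ^+ 278 : R) (exprn_gt0 278 Zr) => u u0; field; rewrite !gt_eqF.
by have := ler_wpM2r C00 hl; lra.
Qed.

Lemma pieces_ge (X : R) : X = ((1 - eps) * (l / phi)) ^+ 2 * E -> 0 <= E ->
  8 * (harm_sum R * phi * X) <= l ^+ 2 * ((1 + eps) * (180 * l / W%:R) * (c8 * hi ^+ 8)).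
Proof.
move=> XE E0; have l2 : 0 <= l ^+ 2 by rewrite exprn_ge0 // ltW.
apply: le_trans (ler_wpM2l l2 second_moment_le).
have G0 n : 0 <= n%:R^-1 * Lam P y (hcol offset n) ^+ 2 :> R by rewrite mulr_ge0 ?invr_ge0 ?ler0n ?sqr_ge0.
apply: le_trans (ler_wpM2l l2 (sum_pairs_le W nu hZ G0 N0Z iso)).
rewrite mulr_sumr; have -> : 8 * (harm_sum R * phi * X) = \sum_(i < 8) harm_sum R * phi * X.
  by rewrite sumr_const card_ord mulr_natl.
apply: ler_sum => i _; rewrite (unhide phiE).
apply: (outer_ge hZ W1 lE l0) => a a' c /andP[a60 a646] /andP[a'lo a'hi] cW.
have a'a : (a < a')%N by apply: leq_trans a'lo; exact: leq_maxl.
have aa' : (1115 <= a + a')%N.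
  by rewrite -leq_subLR; apply: leq_trans a'lo; exact: leq_maxr.
have a1 : (a < 1299)%N by apply: leq_trans a646 _.
have a'1 : (a' < 1299)%N by apply: leq_trans a'hi (leq_trans (leq_subr _ _) _).
have a'60 : (60 <= a')%N by apply: leq_trans a60 (ltnW a'a).
have c'W := coprime_cofactor_class (nuW i) cW.
have T1 := tint a60 cW; have T2 := tint a'60 c'W.
have lp : 0 <= l / phi by rewrite divr_ge0 ?ltW.
have half (T : R) : (1 - eps) * (l / phi) <= T -> 2^-1 * (l / phi) <= T.
  by apply: le_trans; apply: ler_wpM2r => //; exact: half_le.
have := pair_total w60 w1134 wpow W0 Hw t0 ZE lE phiE bE PE yE loE C0E e1 mass WZ hZ i
  a60 a'60 a1 a'1 aa' (half _ T1) (half _ T2) hY.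
apply: le_trans; have Tp : 0 <= (1 - eps) * (l / phi) by rewrite mulr_ge0.
rewrite XE expr2; apply: ler_pM => //; [by rewrite mulr_ge0 | by apply: ler_pM | exact: main_term_ge].
Qed.

Lemma sieve_contradiction : 1000 * eps <= 1 -> False.
Proof.
move=> e1000.
have c8_gt0 : 0 < c8.
  by rewrite (unhide c8E) ltr0n; apply: nat_of_bin_neq0; vm_compute.
have num : 21 * 180 * c8 <= 160 * harm_sum R * c9.
  by rewrite (unhide c8E) (unhide c9E); exact: numeric_ratio.
have Hc9 : 0 < harm_sum R * c9.
  by have : 0 < 160 * (harm_sum R * c9); [apply: lt_le_trans (_ : _ <= _); last (by rewrite mulrA; exact: num); rewrite !mulr_gt0 ?ltr0n | rewrite pmulr_rgt0 ?ltr0n].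
have D0 : 0 <= (1 - eps) ^+ 10 - eps.
  have : 1 - 10%:R * (1 - (1 - eps)) <= (1 - eps) ^+ 10.
    by apply: bernoulli; rewrite eps1 lerBlDr lerDl ltW.
  by move: ((1 - eps) ^+ 10) => u; lra.
have E0 : 0 <= E by rewrite mulr_ge0 // mulr_ge0 ?exprn_ge0 ?(ltW b0) // (le_trans _ c9_ge1).
have := pieces_ge erefl E0; rewrite (unhide hiE) => hfin.
apply: (@final_numeric R eps c8 (harm_sum R * c9) Hc9) => //; first by rewrite mulrA.
have u0 : 0 < l ^+ 2 * (l / W%:R) * b ^+ 8 by rewrite !mulr_gt0 ?exprn_gt0 ?invr_gt0.
rewrite -(ler_pM2l u0); move: hfin; rewrite /E.
have -> : b ^+ 9 = phi * (l / W%:R) * b ^+ 8 by rewrite exprS {1}(unhide bE); ring.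
rewrite [((1 + eps) * b) ^+ 8]exprMn [(1 + eps) ^+ 9]exprS.
move: ((1 - eps) ^+ 10) ((1 + eps) ^+ 8) (b ^+ 8) (harm_sum R) => u v z h.
set LL := (X in X <= _ -> _); set RR := (X in _ <= X -> _).
have -> : LL = l ^+ 2 * (l / W%:R) * z * (8 * (h * c9) * ((1 - eps) ^+ 2 * (u - eps))).
  by rewrite /LL; field; rewrite !gt_eqF.
have -> : RR = l ^+ 2 * (l / W%:R) * z * (180 * c8 * ((1 + eps) * v)) by rewrite /RR; ring.
by [].
Qed.

End Contradiction.

(** Admissibility of the octuple. For [p > 28] the residue 1 works because [1 + h_j <= 27]; the
    smaller primes are checked by computation. *)
Lemma admissible_residue p : prime p -> exists r, forall j, ~~ (p %| r + offset j)%N.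
Proof.
move=> pp; have [p28|p28] := leqP p 28; last first.
  exists 1%N => j; apply/negP => /(dvdn_leq (ltn0Sn _)).
  by rewrite leqNgt (leq_trans _ p28) // !ltnS (leq_trans (offset_le j)).
have chk : all (fun p => has (fun r => all (fun h => ~~ (p %| r + h)%N) [:: 0; 2; 6; 8; 12; 18; 20; 26]%N) (iota 0 p))
    [seq p <- iota 0 29 | prime p] by vm_compute.
have /(allP chk)/hasP[r _ /allP hr] : p \in [seq p <- iota 0 29 | prime p] by rewrite mem_filter pp mem_iota.
by exists r => j; apply: hr; apply: mem_nth; case: j.
Qed.

Lemma coprime_big p (s : seq nat) : all (coprime p) s -> coprime p (\prod_(q <- s) q).
Proof.
elim: s => [|q s IH] /=; first by rewrite big_nil coprimen1.
by case/andP=> pq ps; rewrite big_cons coprimeMr pq IH.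
Qed.

Lemma shifted_coprime (s : seq nat) : uniq s -> all prime s ->
  exists nu, forall j, coprime (nu + offset j) (\prod_(p <- s) p).
Proof.
elim: s => [|p s IH] /=; first by exists 0%N => j; rewrite big_nil coprimen1.
case/andP=> ps us /andP[pp sp]; have [nu hnu] := IH us sp; have [r hr] := admissible_residue pp.
have cM : coprime p (\prod_(q <- s) q).
  apply: coprime_big; apply/allP => q qs; have pq := allP sp q qs; rewrite prime_coprime // dvdn_prime2 //.
  by apply: contraNneq ps => ->.
exists (chinese p (\prod_(q <- s) q) r nu) => j; rewrite big_cons coprimeMr; apply/andP; split.
  by rewrite coprime_sym prime_coprime // /dvdn -modnDml chinese_modl // modnDml; exact: hr.
by rewrite -coprime_modl -modnDml chinese_modr // modnDml coprime_modl.
Qed.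

(** [W] is the product of the primes up to [w], and [nu] glues admissible residues modulo these
    primes. *)
Lemma pick_modulus w : (2 <= w)%N -> exists W nu,
  [/\ (1 < W)%N, forall p, prime p -> coprime p W -> (w < p)%N & forall j, coprime (nu + offset j) W].
Proof.
move=> w2; pose s := [seq p <- iota 0 w.+1 | prime p].
have us : uniq s by rewrite filter_uniq ?iota_uniq.
have sp : all prime s by apply/allP => p; rewrite mem_filter => /andP[].
have [nu hnu] := shifted_coprime us sp; exists (\prod_(p <- s) p)%N, nu.
have hw p : prime p -> coprime p (\prod_(q <- s) q) -> (w < p)%N.
  move=> pp; apply: contraTT; rewrite -leqNgt => pw; rewrite prime_coprime // negbK.
  have ps : p \in s by rewrite mem_filter pp mem_iota.
  by rewrite (big_rem p ps) /= dvdn_mulr.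
split=> //; have W0 : (0 < \prod_(p <- s) p)%N.
  by rewrite big_seq prodn_cond_gt0 // => p /(allP sp)/prime_gt0.
rewrite ltn_neqAle W0 andbT; apply/eqP => E1.
by have := hw 2%N isT; rewrite -E1 coprimen1 => /(_ isT); rewrite ltnNge w2.
Qed.

Section Choices.
Variable R : realType.

Lemma nat_above (A B : nat) (X : R) : exists w, [/\ (A <= w)%N, (B <= w)%N & X <= w%:R].
Proof.
exists (A + (B + Num.Def.archi_bound `|X|))%N; split; rewrite ?leq_addr //.
  by rewrite addnCA leq_addr.
apply: le_trans (ler_norm X) (le_trans (ltW (archi_boundP (normr_ge0 X))) _).
by rewrite ler_nat addnA leq_addl.
Qed.

Lemma power_dominates (A B : R) : 0 <= B ->
  exists t, [/\ (2 <= t)%N, A <= t%:R & B * t%:R ^+ 8 <= (2 ^ t)%N%:R].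
Proof.
move=> B0; have [s [_ s1 hs]] := nat_above 0 1 (`|A| + B * 9 ^+ 8).
have sr : 0 <= s%:R :> R by exact: ler0n.
have K0 : 0 <= B * 9 ^+ 8 by rewrite mulr_ge0 ?exprn_ge0 ?ler0n.
(* Then [2^t = (2^s)^9 >= s^9], and one of the nine factors [s] absorbs [B * 9^8]. *)
exists (9 * s)%N; split.
- by apply: leq_trans (_ : 2 * 1 <= _)%N => //; rewrite leq_mul.
- apply: le_trans (ler_norm A) (le_trans _ (_ : s%:R <= _)); last by rewrite ler_nat leq_pmull.
  by apply: le_trans hs; rewrite lerDl.
rewrite natrM exprMn mulrA [(9 * s)%N]mulnC expnM natrX.
apply: (@le_trans _ _ (s%:R ^+ 9)).
  rewrite [leRHS]exprS ler_wpM2r ?exprn_ge0 //; apply: le_trans hs; by rewrite lerDr normr_ge0.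
by apply: lerXn2r; rewrite ?nnegrE ?ler0n // ler_nat ltnW // ltn_expl.
Qed.

(** A difference of two Mertens sums. The finitely many classes modulo [W] give one constant for all
    [c]; the [- 1] pays for upper ends of the form [Z^(a+1) - 1]. *)
Lemma Tint_lower (W : nat) : (0 < W)%N -> exists2 C : R, 0 <= C &
  forall Z a c, (1 < Z)%N -> (0 < a)%N -> coprime c W ->
    (ln Z%:R - 1) / (totient W)%:R - C <= Tint R W Z a c.
Proof.
move=> W0; set phi := (totient W)%:R; have phi0 : 0 < phi :> R by rewrite ltr0n totient_gt0.
pose S c N := \sum_(1 <= p < N | prime p && (p == c %[mod W])) ln p%:R / p%:R : R.
have ex c : exists C : R, coprime c W -> forall N, `|S c N.+1 - ln N%:R / phi| <= C.
  case: (boolP (coprime c W)) => cW; last by exists 0.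
  by have [C hC] := mertens_progression R W0 cW; exists C => _ N; exact: hC.
have [Cf hCf] := boolp.choice ex.
have T0 : 0 <= \sum_(c < W) `|Cf c| by apply: sumr_ge0.
exists (2 * \sum_(c < W) `|Cf c|); first by rewrite mulr_ge0 ?ler0n.
move=> Z a c Z1 a0 cW; have Z0 := ltnW Z1.
have c0W : coprime (c %% W) W by rewrite coprime_modl.
have bd N : `|S c N.+1 - ln N%:R / phi| <= \sum_(c < W) `|Cf c|.
  have -> : S c N.+1 = S (c %% W)%N N.+1 by apply: eq_bigl => p; rewrite modn_mod.
  apply: le_trans (hCf _ c0W N) _; apply: le_trans (ler_norm _) _.
  by rewrite (bigD1 (Ordinal (ltn_pmod c W0))) //= lerDl sumr_ge0.
have Za : (1 < Z ^ a)%N by rewrite -(expn0 Z) ltn_exp2l.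
have Zb : (1 < Z ^ a.+1)%N by rewrite -(expn0 Z) ltn_exp2l.
have TE : Tint R W Z a c = S c (Z ^ a.+1)%N - S c (Z ^ a)%N.
  apply/eqP; rewrite eq_sym subr_eq addrC; apply/eqP.
  rewrite /S (@big_cat_nat _ _ _ (Z ^ a)) //=; first exact: ltnW.
  by rewrite leq_exp2l.
have := bd (Z ^ a.+1).-1%N; have := bd (Z ^ a).-1%N; rewrite !prednK ?(ltnW Za) ?(ltnW Zb) //.
have x0 : 0 < (Z ^ a.+1).-1%:R :> R by rewrite ltr0n -ltnS prednK // ltnW.
have y0 : 0 < (Z ^ a).-1%:R :> R by rewrite ltr0n -ltnS prednK // ltnW.
have l1 : ln (Z ^ a).-1%:R <= ln (Z ^ a)%N%:R :> R.
  have z0 : 0 < (Z ^ a)%N%:R :> R by rewrite ltr0n ltnW.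
  by rewrite ler_ln ?posrE // ler_nat leq_pred.
have l2 : ln (Z ^ a.+1)%N%:R - ln (Z ^ a.+1).-1%:R <= 1 :> R.
  apply: le_trans (ln_ratio_le x0 _) _; first by rewrite ltr0n ltnW.
  rewrite ler_pdivrMr // mul1r lerBlDr -natrD ler_nat.
  by rewrite -[leqLHS]prednK ?(ltnW Zb) // -addn1 leq_add2l -ltnS prednK // ltnW.
have l3 : ln (Z ^ a.+1)%N%:R - ln (Z ^ a)%N%:R = ln Z%:R :> R.
  by rewrite expnS natrM lnM ?posrE ?ltr0n ?expn_gt0 ?Z0 // addrK.
have key : (ln Z%:R - 1) / phi <= ln (Z ^ a.+1).-1%:R / phi - ln (Z ^ a).-1%:R / phi.
  by rewrite -mulrBl ler_wpM2r ?invr_ge0 ?(ltW phi0) //; lra.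
rewrite TE !ler_norml; move: key (S c _) (S c _) => key u v /andP[_ h1] /andP[h2 _].
move: h1 h2 key; move: (_ / phi) (_ / phi) (_ / phi) => p1 p2 p3 h1 h2 key.
by lra.
Qed.

Lemma mass_bounds (e b W w U : R) : 0 < e -> e <= 2^-1 -> 0 < b -> 0 <= W -> 0 < w -> 4 <= e * w -> 4 * W <= e * b ->
  b - W - (b + W) / w <= U <= b + W -> (1 - e) * b <= U <= (1 + e) * b.
Proof.
move=> e0 e1 b0 W0 w0 ew Wb /andP[h1 h2].
have eb : e * b <= b by rewrite -[leRHS]mul1r ler_wpM2r ?(ltW b0) //; lra.
have hw : (b + W) / w <= 2^-1 * (e * b).
  rewrite ler_pdivrMr //; have : (2^-1 * b) * 4 <= (2^-1 * b) * (e * w) by rewrite ler_wpM2l // mulr_ge0 ?invr_ge0 ?ler0n ?(ltW b0).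
  have -> : 2^-1 * b * (e * w) = 2^-1 * (e * b) * w by ring.
  by lra.
by apply/andP; split; lra.
Qed.

(** Both errors are at most the eighth power of [t] over a power of [Z], with constants depending on
    [w] and [W], so a single growth condition on [Z] settles them. *)
Lemma error_bounds (t Z l e b W phi c8 Q K : R) : 2 <= t -> 0 < W -> 0 < phi -> 0 <= c8 -> 0 < e -> e <= 2^-1 ->
  2^-1 * t <= l -> l <= t -> b = phi / W * l -> 0 < Q -> 1 <= Z -> 0 <= K ->
  (K / Q + c8 * (2 * (phi / W)) ^+ 8 * W / (180 * e)) * t ^+ 8 <= Z ->
  K * t ^+ 2 / Z <= Q /\ Z ^- 2 * (c8 * ((1 + e) * b) ^+ 8) <= e * (180 * l / W).
Proof.
move=> t2 W0 phi0 c80 e0 e1 tl lt bE Q0 Z1 K0 hZ.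
have Z0 : 0 < Z by apply: lt_le_trans Z1.
have t0 : 0 <= t by lra.
have a0 : 0 <= K / Q by rewrite divr_ge0 // ltW.
have pw : 0 <= phi / W by rewrite divr_ge0 ?ltW.
have k0 : 0 <= c8 * (2 * (phi / W)) ^+ 8 by rewrite mulr_ge0 // exprn_ge0 // mulr_ge0 ?ler0n.
have d0 : 0 < 180 * e by rewrite mulr_gt0 ?ltr0n.
have b0 : 0 <= c8 * (2 * (phi / W)) ^+ 8 * W / (180 * e) by rewrite divr_ge0 ?(ltW d0) // mulr_ge0 // ltW.
have t8 : 0 <= t ^+ 8 by rewrite exprn_ge0.
have hA : K / Q * t ^+ 8 <= Z by apply: le_trans hZ; rewrite ler_wpM2r // lerDl.
have hB : c8 * (2 * (phi / W)) ^+ 8 * W / (180 * e) * t ^+ 8 <= Z by apply: le_trans hZ; rewrite ler_wpM2r // lerDr.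
split.
  rewrite ler_pdivrMr //; have t28 : t ^+ 2 <= t ^+ 8 by rewrite ler_weXn2l //; lra.
  apply: le_trans (ler_wpM2l K0 t28) _; move: hA; rewrite mulrAC ler_pdivrMr //.
  by rewrite [Z * Q]mulrC.
have l1 : 1 <= l by lra.
have l0 : 0 <= l by lra.
have e1' : e <= 1 by apply: le_trans e1 _; rewrite invf_le1 ?ltr0n // ler1n.
have hb : (1 + e) * b <= 2 * (phi / W) * t.
  rewrite bE -[2 * _ * t]mulrA; apply: ler_pM; [lra | by rewrite mulr_ge0 | lra | by rewrite ler_wpM2l].
have hb0 : 0 <= (1 + e) * b.
  by rewrite bE; apply: mulr_ge0; [apply: addr_ge0 => //; exact: ltW | exact: mulr_ge0].
have h8 : c8 * ((1 + e) * b) ^+ 8 <= c8 * (2 * (phi / W)) ^+ 8 * t ^+ 8.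
  rewrite -[leRHS]mulrA -exprMn; apply: ler_wpM2l => //; apply: lerXn2r => //.
  by rewrite nnegrE; exact: le_trans hb0 hb.
rewrite mulrC ler_pdivrMr ?exprn_gt0 //; apply: (le_trans h8).
have hB' : c8 * (2 * (phi / W)) ^+ 8 * t ^+ 8 <= Z * (180 * e) / W.
  by rewrite ler_pdivlMr //; move: hB; rewrite mulrAC ler_pdivrMr //; rewrite mulrAC.
apply: (le_trans hB').
have -> : e * (180 * l / W) * Z ^+ 2 = Z * (180 * e) / W * (l * Z) by ring.
rewrite -[leLHS]mulr1 ler_wpM2l //; first by rewrite divr_ge0 ?mulr_ge0 ?ler0n ?(ltW Z0) ?(ltW e0) ?(ltW W0).
by rewrite -[leLHS]mulr1 ler_pM.
Qed.

End Choices.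

Section Pairs.
Variable R : realType.

(** By contradiction. The parameters are fixed in the order [e], [w], then [W] and [nu], then [t],
    each depending only on earlier ones: [e * w] must beat absolute constants, [t] must beat
    everything depending on [W]. Large constants enter only through [hidden] equations. *)
Lemma close_semiprimes (N0 : nat) : exists n i j,
  [/\ (N0 <= n)%N, i <> j, semiprime (n + offset i) & semiprime (n + offset j)].
Proof.
apply: boolp.contrapT => H.
have iso n i j : (N0 <= n)%N -> semiprime (n + offset i) -> semiprime (n + offset j) -> i = j.
  by move=> hn si sj; apply: boolp.contrapT => ij; apply: H; exists n, i, j; split.
have {H} [K KE] : exists K : R, hidden (K = 33 * (500 * 1000) * 1134 * (2 * 120 ^+ 9)) by exists (33 * (500 * 1000) * 1134 * (2 * 120 ^+ 9)); split.
have [C0 C0E] : exists C0 : R, hidden (C0 = 500 * 1000) by exists (500 * 1000); split.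
have [B1 B1E] : exists B1 : R, hidden (B1 = 1000) by exists 1000; split.
have [B2 B2E] : exists B2 : R, hidden (B2 = 1012) by exists 1012; split.
have [c8 c8E] : exists c8 : R, hidden (c8 = (nat_of_bin count8)%:R) by exists (nat_of_bin count8)%:R; split.
have [c9 c9E] : exists c9 : R, hidden (c9 = (nat_of_bin count9)%:R) by exists (nat_of_bin count9)%:R; split.
have c8_ge0 : 0 <= c8 by rewrite (unhide c8E) ler0n.
have c9_ge1 : 1 <= c9 by rewrite (unhide c9E) (ler_nat R 1); apply: nat_of_bin_neq0; vm_compute.
have [e [e0 e1 e1000]] : exists e : R, [/\ 0 < e, e <= 2^-1 & 1000 * e <= 1].
  exists 1000%:R^-1; split; first by rewrite invr_gt0 ltr0n.
    by rewrite lef_pV2 ?posrE ?ltr0n // ler_nat.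
  by rewrite divff // pnatr_eq0.
have K0 : 0 <= K by rewrite (unhide KE) !mulr_ge0 ?exprn_ge0 ?ler0n.
have B20 : 0 <= B2 by rewrite (unhide B2E) ler0n.
have [w [wlo w1134 hwX]] := nat_above (1134 ^ 554) 1134 ((B2 + K + 4) / e).
move: wlo => /Hide wpow; have w60 : (60 <= w)%N by apply: leq_trans w1134.
have w0 : 0 < w%:R :> R by rewrite ltr0n (leq_trans _ w60).
have ew : B2 + K + 4 <= e * w%:R by move: hwX; rewrite ler_pdivrMr // mulrC.
have hB2 : B2 <= e * w%:R by apply: le_trans ew; rewrite -addrA lerDl addr_ge0 ?ler0n.
have hK : K <= e * w%:R by apply: le_trans ew; rewrite addrAC lerDr addr_ge0 ?ler0n.
have h4 : 4 <= e * w%:R by apply: le_trans ew; rewrite lerDr addr_ge0.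
have ewle : e * w%:R <= w%:R.
  rewrite -[leRHS]mul1r ler_wpM2r ?(ltW w0) //; apply: le_trans e1 _.
  by rewrite invf_le1 ?ltr0n // ler1n.
have hB1 : B1 <= w%:R.
  apply: le_trans ewle; apply: le_trans hB2.
  by rewrite (unhide B1E) (unhide B2E) ler_nat.
have w2 : (2 <= w)%N by apply: leq_trans w60.
have [W [nu [W1 Hw nuW]]] := pick_modulus w2; have W0 : (0 < W)%N by apply: ltnW.
have Wr : 0 < W%:R :> R by rewrite ltr0n.
have [phi phiE] : exists phi : R, hidden (phi = (totient W)%:R) by exists (totient W)%:R; split.
have phi1 : 1 <= phi by rewrite (unhide phiE) (ler_nat R 1) totient_gt0.
have phi0 : 0 < phi by apply: lt_le_trans phi1.
have [C Cge0 hC] := Tint_lower R W0.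
have [Q QE] : exists Q : R, hidden (Q = 1134 / w%:R * C0 / phi ^+ 2) by exists (1134 / w%:R * C0 / phi ^+ 2); split.
have C00 : 0 < C0 by rewrite (unhide C0E) mulr_gt0 ?ltr0n.
have Q0 : 0 < Q.
  rewrite (unhide QE); apply: divr_gt0; last exact: exprn_gt0.
  by apply: mulr_gt0 => //; apply: divr_gt0 => //; exact: ltr0n.
have [K1 K1E] : exists K1 : R, hidden (K1 = 554 * (24 * 1299 ^+ 2 * 3)) by exists (554 * (24 * 1299 ^+ 2 * 3)); split.
have K10 : 0 <= K1 by rewrite (unhide K1E) !mulr_ge0 ?exprn_ge0 ?ler0n.
set Bc := K1 / Q + c8 * (2 * (phi / W%:R)) ^+ 8 * W%:R / (180 * e).
have Bc0 : 0 <= Bc.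
  apply: addr_ge0; first by rewrite divr_ge0 // ltW.
  apply: divr_ge0; last by apply: mulr_ge0; [exact: ler0n | exact: ltW].
  apply: mulr_ge0; last exact: ltW.
  apply: mulr_ge0 => //; apply: exprn_ge0; apply: mulr_ge0; first exact: ler0n.
  by apply: divr_ge0; exact: ltW.
set A1 := 8 * W%:R ^+ 2 / e; set A2 := 2 * (1 + C * phi) / e.
have A10 : 0 <= A1 by rewrite divr_ge0 ?(ltW e0) // mulr_ge0 ?exprn_ge0 ?ler0n.
have A20 : 0 <= A2 by rewrite divr_ge0 ?(ltW e0) // mulr_ge0 ?ler0n // addr_ge0 // mulr_ge0 // ltW.
have [t [t2 hA hB]] := power_dominates (26%:R + N0%:R + W%:R + A1 + A2) Bc0.
have tN : (26 + N0 + W <= t)%N.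
  rewrite -(ler_nat R) !natrD; apply: le_trans hA; rewrite -[leRHS]addrA lerDl; exact: addr_ge0.
have tA1 : A1 <= t%:R.
  by apply: le_trans hA; rewrite addrAC lerDr !addr_ge0 ?ler0n.
have tA2 : A2 <= t%:R by apply: le_trans hA; rewrite lerDr !addr_ge0 ?ler0n.
have [Z ZE] : exists Z, hidden (Z = (2 ^ t)%N) by exists (2 ^ t)%N; split.
rewrite -(unhide ZE) in hB.
have tZ : (t <= Z)%N by rewrite (unhide ZE) ltnW // ltn_expl.
have hZ : (26 <= Z)%N by apply: leq_trans tZ; apply: leq_trans tN; rewrite -addnA leq_addr.
have N0Z : (N0 <= Z)%N.
  by apply: leq_trans tZ; apply: leq_trans tN; rewrite addnAC leq_addl.
have WZ : (W <= Z)%N by apply: leq_trans tZ; apply: leq_trans tN; rewrite leq_addl.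
have Z0 : (0 < Z)%N by apply: leq_trans hZ.
have Z1 : (1 < Z)%N by apply: leq_trans hZ.
have N0Z' : hidden (N0 <= Z ^ 1114)%N.
  split; apply: leq_trans N0Z _; rewrite -[leqLHS]expn1; exact: leq_pexp2l.
have WZ' : hidden (W * Z ^ 8 <= Z ^ 60)%N.
  split; apply: (@leq_trans (Z * Z ^ 8)%N); first by rewrite leq_mul2r WZ orbT.
  by rewrite -expnS leq_pexp2l.
have [l lE] : exists l : R, hidden (l = ln Z%:R) by exists (ln Z%:R); split.
have /andP[tl lt] := ell_bounds ZE lE.
have [b bE] : exists b : R, hidden (b = phi / W%:R * l) by exists (phi / W%:R * l); split.
have t2r : 2 <= t%:R :> R by rewrite ler_nat.
have t0 : (0 < t)%N by apply: leq_trans t2.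
have l0 : 0 < l by apply: lt_le_trans tl; rewrite mulr_gt0 ?invr_gt0 ?ltr0n.
have b0 : 0 < b by rewrite (unhide bE) mulr_gt0 ?divr_gt0.
have Wb : 4 * W%:R <= e * b.
  have : 2^-1 * t%:R / W%:R <= b.
    rewrite (unhide bE) [leRHS]mulrAC; apply: ler_wpM2r; first by rewrite invr_ge0 ltW.
    have tt0 : 0 <= 2^-1 * t%:R :> R by rewrite mulr_ge0 ?invr_ge0 ?ler0n.
    by rewrite -[leLHS]mul1r; exact: ler_pM.
  move/(ler_wpM2l (ltW e0)); apply: le_trans.
  have : 8 * W%:R ^+ 2 <= t%:R * e by move: tA1; rewrite /A1 ler_pdivrMr.
  move=> h8; rewrite [leRHS]mulrA ler_pdivlMr //; move: h8; rewrite expr2.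
  by move: (W%:R : R) (t%:R : R) => x z h8; lra.
have Zr1 : 1 <= Z%:R :> R by rewrite ler1n.
have [hY hlast] := error_bounds t2r Wr phi0 c8_ge0 e0 e1 tl lt (unhide bE) Q0 Zr1 K10 hB.
have mass k : (k < 60)%N -> (1 - e) * b <= Us (sprimes W (Z ^ 60)) (bin R Z 60 k) <= (1 + e) * b.
  move=> k60; apply: (mass_bounds e0 e1 b0 (ltW Wr) w0 h4 Wb).
  apply: (Us_bin_bounds _ (leq_trans _ w60) W0 Hw Z1 k60) => //.
  by rewrite (unhide bE) (unhide phiE) (unhide lE).
have tint a c : (60 <= a)%N -> coprime c W -> (1 - e) * (l / phi) <= Tint R W Z a c.
  move=> a60 cW; apply: le_trans (hC Z a c Z1 (leq_trans _ a60) cW) => //.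
  rewrite -(unhide lE) -(unhide phiE) lerBrDr.
  have hA2 : 2 * (1 + C * phi) <= t%:R * e by move: tA2; rewrite /A2 ler_pdivrMr.
  rewrite ler_pdivlMr // mulrDl -mulrA divfK ?gt_eqF //.
  have : e * (2^-1 * t%:R) <= e * l by rewrite ler_wpM2l ?(ltW e0).
  by lra.
have hY' : 554 * (24 * (1299 * t)%N%:R ^+ 2 * 3 / Z%:R) <= 1134 / w%:R * C0 / phi ^+ 2.
  rewrite -(unhide QE); apply: le_trans hY; rewrite (unhide K1E) natrM exprMn.
  rewrite le_eqVlt; apply/orP; left; apply/eqP.
  by move: (1299%:R : R) (t%:R : R) (Z%:R^-1 : R) => ? ? ?; ring.
have hbig : 33 * C0 * 1134 * (2 * 120 ^+ 9) <= e * w%:R.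
  by apply: le_trans hK; rewrite (unhide C0E) (unhide KE).
exact: (sieve_contradiction w60 w1134 wpow W1 Hw t0 ZE lE phiE bE (Hide (erefl _)) (Hide (erefl _))
  (Hide (erefl _)) (Hide (erefl _)) c8E c9E C0E e0 e1 mass WZ' hZ nuW N0Z' iso tint hY'
  B1E hB1 B2E hB2 hbig c9_ge1 hlast e1000).
Qed.

End Pairs.

Require Import Defs.
From HB Require Import structures.
From mathcomp Require Import all_boot all_order all_algebra.
From mathcomp Require Import all_classical all_reals all_analysis.
Import Order.TTheory GRing.Theory Num.Theory.
Local Open Scope ring_scope.

(** * From close pairs to the limit inferior *)

Lemma limn_einf_le (R : realType) (u : nat -> \bar R) (c : \bar R) :
  (forall N, exists2 n, (N <= n)%N & (u n <= c)%E) -> (limn_einf u <= c)%E.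
Proof.
move=> H; rewrite limn_einf_lim; apply: lime_le; first exact: is_cvg_einfs.
apply: nearW => N; have [n Nn un] := H N.
by apply: le_trans un; apply: ereal_inf_lbound; exists n.
Qed.

Lemma enumeration_mono (q : nat -> nat) (m n : nat) : (forall n, (q n < q n.+1)%N) -> (q m < q n)%N = (m < n)%N.
Proof.
move=> qS; have mono : {homo q : i j / (i < j)%N} by apply: homo_ltn qS; exact: ltn_trans.
by apply: leqW_mono; exact: leq_mono.
Qed.

(** The pair itself need not be consecutive; the successor of [n + h] in the enumeration is still at
    most [n + k]. *)
Lemma gap_of_close_pair (q : nat -> nat) (N n h k : nat) :
  enumerates_two_distinct_primes q -> (q N <= n)%N -> (h < k)%N -> (k <= 26)%N ->
  two_distinct_primes (n + h) -> two_distinct_primes (n + k) ->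
  exists2 m, (N <= m)%N & (q m.+1 <= q m + 26)%N.
Proof.
move=> [qS qE] Nn hk k26 /qE[a ha] /qE[b hb].
have mono a b := @enumeration_mono q a b qS.
exists a; first by rewrite leqNgt -mono // ha -leqNgt (leq_trans Nn) ?leq_addr.
have ab : (a < b)%N by rewrite -mono // ha hb ltn_add2l.
apply: (@leq_trans (q b)); first by rewrite leqNgt mono // -leqNgt.
by rewrite ha hb -addnA leq_add2l (leq_trans k26) ?leq_addl.
Qed.

Theorem theorem3 (R : realType) (q : nat -> nat) :
  enumerates_two_distinct_primes q ->
  (limn_einf (fun n : nat => ((q n.+1)%:R - (q n)%:R : R)%:E) <= 26%:E)%E.
Proof.
move=> hq; apply: limn_einf_le => N.
have [n [i [j [Nn ij si sj]]]] := close_semiprimes R (q N).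
have [m Nm gap] : exists2 m, (N <= m)%N & (q m.+1 <= q m + 26)%N.
  have [lt_ij|lt_ji|/offset_inj //] := ltngtP (offset i) (offset j).
    exact: gap_of_close_pair hq Nn lt_ij (offset_le j) si sj.
  exact: gap_of_close_pair hq Nn lt_ji (offset_le i) sj si.
exists m => //; rewrite lee_fin lerBlDr addrC.
by rewrite -natrD ler_nat.
Qed.
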